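(* Let $n\ge 2$, let $\Omega\subset\mathbb{R}^n$ be a bounded connected open set whose boundary $\Gamma=\partial\Omega$ is a smooth $(n-1)$-dimensional manifold, and let $\varphi\in VMO(\Gamma;\mathbb{R}^n)$. Let $f\in VMO_\varphi(\Omega;\mathbb{R}^n)\cap W^{1,n-1}(\Omega;\mathbb{R}^n)$ with $\partial_n f\in L^\infty(\Omega;\mathbb{R}^n)$, where $\partial_n$ is the weak partial derivative in the $n$-th coordinate. Let $g:\mathbb{R}^n\to\mathbb{R}$ be a smooth function whose support is compact, connected and contained in $\mathbb{R}^n\setminus\overline{\mathrm{essR}(\varphi)}$. Then for every $p\in\operatorname{supp} g$, $$\int_\Omega g(f(x))\,\det\nabla f(x)\,dx=\deg(f,\Omega,p)\int_{\mathbb{R}^n}g(z)\,dz,$$ where $\deg(f,\Omega,p)$ is the $VMO$ degree.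
   Context: Notation: $\lambda_n$ is Lebesgue measure on $\mathbb{R}^n$, $⨍$-type averages are written $\frac{1}{\lambda_n(A)}\int_A$, and $\bar f_\epsilon(x)=\frac{1}{\lambda_n(B_\epsilon(x))}\int_{B_\epsilon(x)}f(y)\,dy$. BMO and VMO: for an open set $O$ and $f\in L^1_{loc}(O)$ (vector valued), $\|f\|_{BMO(O)}=\sup\frac{1}{\lambda_n(B_\epsilon(x))}\int_{B_\epsilon(x)}|f(y)-\bar f_\epsilon(x)|\,dy$, the supremum over $x\in O$ and $0<\epsilon<\operatorname{dist}(x,\partial O)$. $BMO(O)$ is the set of $f$ with finite seminorm, and $VMO(O)$ is the closure of $C(\overline O)$ in the BMO seminorm. On the compact manifold $\Gamma$, $BMO(\Gamma)$ and $VMO(\Gamma)$ are defined in the same way, using small metric balls of $\Gamma$ and surface measure, $VMO(\Gamma)$ being the closure of $C(\Gamma)$. $VMO_0(\Omega)$: the set of $f\in VMO(\Omega)$ such that for any ball $B\supset\Omega$, the function equal to $f$ on $\Omega$ and $0$ on $B\setminus\Omega$ is in $VMO(B)$. $VMO_\varphi(\Omega)$: let $T$ be a tubular neighborhood of $\Gamma$ on which the nearest-point projection $P:T\to\Gamma$ is uniquely defined and Lipschitz, and such that the reflection $2P(x)-x$ of each $x\in T\setminus\overline\Omega$ lies in $\Omega$. For $\varphi\in VMO(\Gamma)$ set $\bar\varphi=\varphi\circ P$ on $T$. Let $\psi:\Omega\to\mathbb{R}$ be smooth with $\psi=0$ outside $T$ and $\psi=1$ on an open $U\subset\Omega$ that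 is a neighborhood of $\Gamma$ in $\Omega$ with $\Gamma\subset\overline U\subset T$, and set $\tilde\varphi=\psi\bar\varphi$. Then $f\in VMO_\varphi(\Omega)$ means $f\in VMO(\Omega)$ and $f-\tilde\varphi\in VMO_0(\Omega)$. Essential range: $\mathrm{essR}(\varphi)$ is the set of points $y$ such that $\varphi^{-1}(S)$ has positive measure for every open $S\ni y$. VMO degree: a neighborhood of $\Gamma$ in $\Omega$ is an open $N\subset\Omega$ containing $\{x\in\Omega:\operatorname{dist}(x,\Gamma)<s\}$ for some $s>0$; put $D_N=\{B_\epsilon(x)\subset N:\epsilon=\operatorname{dist}(x,\Gamma)\}$. Let $f\in VMO(\Omega;\mathbb{R}^n)$ and $p\in\mathbb{R}^n$ be such that there are $d_0>0$ and a neighborhood $N$ of $\Gamma$ in $\Omega$ with $\frac{1}{\lambda_n(B)}\int_B|f(y)-p|\,dy>d_0$ for all $B\in D_N$ (this holds whenever $f\in VMO_\varphi(\Omega)$ and $p\notin\overline{\mathrm{essR}(\varphi)}$). Then $\deg(f,\Omega,p)=\lim_{\epsilon\to0}\deg(\bar f_\epsilon,\Omega_\epsilon,p)$, where $\Omega_\epsilon=\{x\in\Omega:\operatorname{dist}(x,\Gamma)>\epsilon\}$ and the degree on the right is the Brouwer degree of the continuous map $\bar f_\epsilon$ on $\overline{\Omega_\epsilon}$; the limit exists. *)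

(* Defs.v *)
From HB Require Import structures.
From mathcomp Require Import all_boot all_order all_algebra.
From mathcomp Require Import all_classical all_reals all_analysis.

Set Implicit Arguments.
Unset Strict Implicit.
Unset Printing Implicit Defensive.

Import Order.TTheory GRing.Theory Num.Theory.
Import numFieldNormedType.Exports.

Local Open Scope classical_set_scope.
Local Open Scope ring_scope.

Section euclidean.
Context {R : realType} {n : nat}.
Implicit Types (x y : 'rV[R]_n) (A O N : set 'rV[R]_n).

(* The library norm on 'rV[R]_n is the sup norm; it induces the same topology,
   but balls, distances and oscillations below are Euclidean. *)
Definition enorm x : R := Num.sqrt (\sum_(i < n) x 0 i ^+ 2).

Definition eball x (r : R) : set 'rV[R]_n := [set y | enorm (y - x) < r].

(* [set_dist x set0 = +oo]. *)
Definition set_dist x A : \bar R := ereal_inf [set (enorm (x - y))%:E | y in A].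

(* [ediam set0 = -oo]. *)
Definition ediam A : \bar R :=
  ereal_sup [set (enorm (p.1 - p.2))%:E | p in A `*` A].

Definition bnd A : set 'rV[R]_n := closure A `\` interior A.

Definition bnd_nbhs O N : Prop :=
  [/\ open N, N `<=` O &
    exists2 s : R, 0 < s &
      [set x | O x /\ (set_dist x (bnd O) < s%:E)%E] `<=` N].

End euclidean.

(* A copy of [T] in which every set is measurable, so that the library's
   [mu_ext] ranges over the coverings by arbitrary sequences of sets. *)
Definition discr (T : Type) : Type := T.

Section discr.
Variable T : pointedType.
HB.instance Definition _ := Pointed.on (discr T).
HB.instance Definition _ :=
  @isMeasurable.Build default_measure_display (discr T)
    discrete_measurable discrete_measurable0
    discrete_measurableC discrete_measurableU.
End discr.

Section lebesgue.
Variables (R : realType) (n : nat).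

Definition cbox (a b : 'rV[R]_n) : set 'rV[R]_n :=
  [set x | forall i, a 0 i <= x 0 i <= b 0 i].

(* [+oo] on the nonempty sets that are not closed boxes, so that only coverings
   by boxes count in [leb_outer]. *)
Definition box_vol (E : set (discr 'rV[R]_n)) : \bar R :=
  if E == set0 then 0%E else
  ereal_inf [set (\prod_(i < n) (ab.2 0 i - ab.1 0 i))%:E | ab in
    [set ab : 'rV[R]_n * 'rV[R]_n |
      (forall i, ab.1 0 i <= ab.2 0 i) /\ E = cbox ab.1 ab.2]].

Lemma box_vol0 : box_vol set0 = 0%E.
Proof. by rewrite /box_vol eqxx. Qed.

Lemma box_vol_ge0 E : (0 <= box_vol E)%E.
Proof.
rewrite /box_vol; case: ifP => // _; apply: le_ereal_inf_tmp => _ [ab [h _] <-].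
by rewrite lee_fin prodr_ge0 // => i _; rewrite subr_ge0.
Qed.

Definition leb_outer : set 'rV[R]_n -> \bar R := mu_ext box_vol.

HB.instance Definition _ := isOuterMeasure.Build R 'rV[R]_n leb_outer
  (mu_ext0 box_vol0 box_vol_ge0) (mu_ext_ge0 box_vol_ge0)
  (@le_mu_ext _ _ _ box_vol) (mu_ext_sigma_subadditive box_vol_ge0).

Definition lebesgue_outer : {outer_measure set 'rV[R]_n -> \bar R} := leb_outer.

(* The Caratheodory measurable sets of [lebesgue_outer] are the Lebesgue
   measurable sets. *)
Definition leb : {measure set (caratheodory_type lebesgue_outer) -> \bar R} :=
  (lebesgue_outer : set (caratheodory_type lebesgue_outer) -> \bar R).

End lebesgue.

Section hausdorff.
Variables (R : realType) (n k : nat).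

Definition unit_ball_vol : R := fine (leb R k (eball 0 1)).

Definition hausdorff_gauge (delta : R) (E : set (discr 'rV[R]_n)) : \bar R :=
  if E == set0 then 0%E else
  if (ediam E <= delta%:E)%E
  then (unit_ball_vol * (fine (ediam E) / 2) ^+ k)%:E else +oo%E.

Lemma hausdorff_gauge0 delta : hausdorff_gauge delta set0 = 0%E.
Proof. by rewrite /hausdorff_gauge eqxx. Qed.

Lemma hausdorff_gauge_ge0 delta E : (0 <= hausdorff_gauge delta E)%E.
Proof.
rewrite /hausdorff_gauge; case: ifPn => // /set0P[x Ex]; case: ifP => // _.
rewrite lee_fin mulr_ge0 ?fine_ge0 ?exprn_ge0 ?divr_ge0 ?fine_ge0 //.
apply: le_trans (_ : (enorm (x - x))%:E <= _)%E.
  by rewrite lee_fin sqrtr_ge0.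
by apply: ereal_sup_ubound; exists (x, x).
Qed.

Definition haus_outer (A : set 'rV[R]_n) : \bar R :=
  ereal_sup [set mu_ext (hausdorff_gauge delta) A | delta in [set d | 0 < d]].

Lemma haus_outer_ge0 A : (0 <= haus_outer A)%E.
Proof.
apply: le_trans (mu_ext_ge0 (@hausdorff_gauge_ge0 1) A) _.
by apply: ereal_sup_ubound; exists 1 => //=.
Qed.

Lemma haus_outer0 : haus_outer set0 = 0%E.
Proof.
apply/eqP; rewrite eq_le haus_outer_ge0 andbT.
apply: ge_ereal_sup => _ [d _ <-].
by rewrite (mu_ext0 (hausdorff_gauge0 d) (@hausdorff_gauge_ge0 d)).
Qed.

Lemma le_haus_outer : {homo haus_outer : A B / A `<=` B >-> (A <= B)%E}.
Proof.
move=> A B AB; apply: ge_ereal_sup => _ [d d0 <-].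
apply: le_trans (le_mu_ext (hausdorff_gauge d) AB) _.
by apply: ereal_sup_ubound; exists d.
Qed.

Lemma haus_outer_sigma_subadditive : sigma_subadditive haus_outer.
Proof.
move=> F; apply: ge_ereal_sup => _ [d d0 <-].
apply: le_trans (mu_ext_sigma_subadditive (@hausdorff_gauge_ge0 d) F) _.
apply: lee_nneseries => [i _|i _]; last by apply: ereal_sup_ubound; exists d.
by move=> ?; exact: mu_ext_ge0 (@hausdorff_gauge_ge0 d) _.
Qed.

HB.instance Definition _ := isOuterMeasure.Build R 'rV[R]_n haus_outer
  haus_outer0 haus_outer_ge0 le_haus_outer haus_outer_sigma_subadditive.

Definition hausdorff_outer : {outer_measure set 'rV[R]_n -> \bar R} :=
  haus_outer.

(* k-dimensional Hausdorff measure, normalized so as to be the surface measure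
   on k-dimensional submanifolds. *)
Definition haus : {measure set (caratheodory_type hausdorff_outer) -> \bar R} :=
  (hausdorff_outer : set (caratheodory_type hausdorff_outer) -> \bar R).

End hausdorff.

Section oscillation.
Context {R : realType} {d : measure_display} {T : measurableType d} {m : nat}.
Variable mu : {measure set T -> \bar R}.
Implicit Types (B : set T) (f : T -> 'rV[R]_m).

Definition mean B f : 'rV[R]_m :=
  \row_(i < m) ((fine (mu B))^-1 * (\int[mu]_(y in B) (f y 0 i))%R).

Definition mean_dist B f (p : 'rV[R]_m) : \bar R :=
  (((fine (mu B))^-1)%:E * \int[mu]_(y in B) (enorm (f y - p))%:E)%E.

Definition osc_sup (balls : set (set T)) f : \bar R :=
  ereal_sup [set mean_dist B f (mean B f) | B in balls].

End oscillation.

Section smooth.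
Context {R : realType} {n : nat}.

Definition partial (V : normedModType R) (i : 'I_n) (f : 'rV[R]_n -> V) :
  'rV[R]_n -> V := fun x => 'D_(delta_mx 0 i) f x.

(* C^oo on the open set [U]: every iterated partial derivative is
   differentiable, hence continuous, on [U]. *)
Definition smooth_on (V : normedModType R) (U : set 'rV[R]_n)
    (f : 'rV[R]_n -> V) : Prop :=
  forall (s : seq 'I_n) x, U x -> differentiable (foldr (@partial V) f s) x.

Definition supp (g : 'rV[R]_n -> R) : set 'rV[R]_n :=
  closure [set x | g x != 0].

Definition test_fun (O : set 'rV[R]_n) (eta : 'rV[R]_n -> R) : Prop :=
  [/\ smooth_on setT eta, compact (supp eta) & supp eta `<=` O].

(* Embedded smooth (n-1)-dimensional submanifold of R^n: locally, a
   diffeomorphism straightens [G] to the hyperplane where the last coordinate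
   vanishes. *)
Definition smooth_hypersurface (G : set 'rV[R]_n) : Prop :=
  forall x, G x -> exists U V : set 'rV[R]_n,
    exists Phi Psi : 'rV[R]_n -> 'rV[R]_n,
    [/\ [/\ open U, open V & U x],
        smooth_on U Phi /\ smooth_on V Psi,
        (forall y, U y -> V (Phi y) /\ Psi (Phi y) = y),
        (forall z, V z -> U (Psi z) /\ Phi (Psi z) = z) &
        forall y, U y ->
          (G y <-> forall i : 'I_n, i.+1 = n -> Phi y 0 i = 0)].

End smooth.

Section sobolev.
Context {R : realType} {n : nat}.
Implicit Types (O : set 'rV[R]_n) (u v : 'rV[R]_n -> R).

Definition loc_integrable O u : Prop :=
  forall K : set 'rV[R]_n, compact K -> K `<=` O ->
    (leb R n).-integrable K (EFin \o u).

Definition Lp_on O (q : \bar R) u : Prop :=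
  (patch (fun=> 0) O u : caratheodory_type (lebesgue_outer R n) -> R)
    \in Lfun (leb R n) q.

Definition weak_partial O (i : 'I_n) u v : Prop :=
  [/\ loc_integrable O u, loc_integrable O v &
    forall eta, test_fun O eta ->
      (\int[leb R n]_(x in O) (u x * partial i eta x))%R =
      - (\int[leb R n]_(x in O) (v x * eta x))%R].

Definition sobolev1 (m : nat) O (q : \bar R)
    (f : 'rV[R]_n -> 'rV[R]_m) : Prop :=
  forall k : 'I_m, Lp_on O q (fun x => f x 0 k) /\
    forall i : 'I_n, exists2 v, weak_partial O i (fun x => f x 0 k) v &
                                Lp_on O q v.

Definition weak_gradient (m : nat) O (f : 'rV[R]_n -> 'rV[R]_m)
    (Df : 'rV[R]_n -> 'M[R]_(m, n)) : Prop :=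
  forall (k : 'I_m) (i : 'I_n),
    weak_partial O i (fun x => f x 0 k) (fun x => Df x k i).

End sobolev.

Section vmo.
Context {R : realType} {n m : nat}.
Implicit Types (O : set 'rV[R]_n) (f : 'rV[R]_n -> 'rV[R]_m).

Definition inner_balls O : set (set 'rV[R]_n) :=
  [set B | exists x eps, [/\ O x, 0 < eps,
     (eps%:E < set_dist x (bnd O))%E & B = eball x eps]].

Definition bmo_norm O f : \bar R := osc_sup (leb R n) (inner_balls O) f.

Definition BMO O f : Prop :=
  (forall k, loc_integrable O (fun x => f x 0 k)) /\ (bmo_norm O f < +oo)%E.

Definition VMO O f : Prop :=
  BMO O f /\ forall e : R, 0 < e -> exists2 h : 'rV[R]_n -> 'rV[R]_m,
    {within closure O, continuous h} &
    (bmo_norm O (fun x => (f x - h x)%R) < e%:E)%E.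

Definition VMO0 O f : Prop :=
  VMO O f /\ forall c r, O `<=` eball c r ->
    VMO (eball c r) (patch (fun=> 0) O f).

End vmo.

Section vmo_boundary.
Context {R : realType} {n m : nat}.
Variable G : set 'rV[R]_n.
Implicit Types (f : 'rV[R]_n -> 'rV[R]_m).

Notation sigma := (haus R n n.-1).

Definition curve_in (x y : 'rV[R]_n) (c : R -> 'rV[R]_n) : Prop :=
  [/\ forall t, derivable c t 1, continuous (derive1 c),
      forall t, 0 <= t <= 1 -> G (c t), c 0 = x & c 1 = y].

Definition curve_length (c : R -> 'rV[R]_n) : R :=
  (\int[lebesgue_measure]_(t in `[0%R, 1%R]) (enorm (derive1 c t)))%R.

(* The Riemannian distance of [G], [+oo] between distinct components. *)
Definition geodist (x y : 'rV[R]_n) : \bar R :=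
  ereal_inf [set (curve_length c)%:E | c in curve_in x y].

Definition surface_balls (r : R) : set (set 'rV[R]_n) :=
  [set B | exists x eps, [/\ G x, 0 < eps, eps < r &
     B = [set y | G y /\ (geodist x y < eps%:E)%E]]].

Definition bmo_norm_surface (r : R) f : \bar R :=
  osc_sup sigma (surface_balls r) f.

(* The radii of the balls are bounded by some [r > 0]; on a compact smooth
   hypersurface the choice of [r] is immaterial. *)
Definition VMO_surface f : Prop :=
  (forall k, sigma.-integrable G (fun x => (f x 0 k)%:E)) /\
  exists2 r : R, 0 < r & (bmo_norm_surface r f < +oo)%E /\
    forall e : R, 0 < e -> exists2 h : 'rV[R]_n -> 'rV[R]_m,
      {within G, continuous h} &
      (bmo_norm_surface r (fun x => (f x - h x)%R) < e%:E)%E.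

Definition essR f : set 'rV[R]_m :=
  [set y | forall S : set 'rV[R]_m, open S -> S y ->
     (0 < sigma (G `&` f @^-1` S))%E].

End vmo_boundary.

Section vmo_trace.
Context {R : realType} {n m : nat}.
Variable O : set 'rV[R]_n.

Definition tubular_nbhs (T : set 'rV[R]_n) (P : 'rV[R]_n -> 'rV[R]_n) : Prop :=
  [/\ open T, bnd O `<=` T,
      (forall x, T x -> bnd O (P x) /\
         forall y, bnd O y -> y <> P x -> enorm (x - P x) < enorm (x - y)),
      [lipschitz P x | x in T] &
      forall x, T x -> ~ closure O x -> O (2 *: P x - x)].

Definition trace_cutoff (T : set 'rV[R]_n) (psi : 'rV[R]_n -> R) : Prop :=
  [/\ smooth_on O psi, (forall x, O x -> ~ T x -> psi x = 0) &
    exists U : set 'rV[R]_n,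
      [/\ bnd_nbhs O U, bnd O `<=` closure U, closure U `<=` T &
          forall x, U x -> psi x = 1]].

(* [P] is arbitrary outside the tubular neighborhood; there [psi] vanishes. *)
Definition VMO_trace (P : 'rV[R]_n -> 'rV[R]_n) (psi : 'rV[R]_n -> R)
    (phi f : 'rV[R]_n -> 'rV[R]_m) : Prop :=
  VMO O f /\ VMO0 O (fun x => f x - psi x *: phi (P x)).

End vmo_trace.

Section degree.
Context {R : realType} {n : nat}.

(* Brouwer degree at [p] of [h], continuous on the closure of the bounded open
   set [V] with [p] not in [h @` bnd V]: the signed number of preimages of [p]
   under a smooth [k] uniformly closer to [h] than the distance from [p] to
   [h @` bnd V], and for which [p] is a regular value; it does not depend on
   [k]. *)
Definition brouwer_degree (V : set 'rV[R]_n) (h : 'rV[R]_n -> 'rV[R]_n)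
    (p : 'rV[R]_n) : int :=
  xget 0 [set d : int | exists k : 'rV[R]_n -> 'rV[R]_n,
    [/\ smooth_on setT k,
        (forall x, closure V x ->
           ((enorm (k x - h x))%:E < set_dist p (h @` bnd V))%E),
        (forall x, V x -> k x = p -> \det ('J k x) != 0) &
        d = \sum_(x \in V `&` k @^-1` [set p]) sgz (\det ('J k x))]].

Definition shrink (O : set 'rV[R]_n) (eps : R) : set 'rV[R]_n :=
  [set x | O x /\ (eps%:E < set_dist x (bnd O))%E].

(* A limit of integers, hence an eventual value; junk if there is no limit. *)
Definition vmo_degree (f : 'rV[R]_n -> 'rV[R]_n) (O : set 'rV[R]_n)
    (p : 'rV[R]_n) : R :=
  lim (((brouwer_degree (shrink O eps)
           (fun x => mean (leb R n) (eball x eps) f) p)%:~R : R)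
         @[eps --> 0^'+]).

End degree.

(* Main.v *)
From HB Require Import structures.
Require Import Defs.
From mathcomp Require Import all_boot all_order all_algebra fingroup perm.
From mathcomp Require Import all_classical all_reals all_analysis.
From mathcomp Require Import measurable_realfun ess_sup_inf.
From mathcomp Require Import ring lra.
Set Implicit Arguments.
Unset Strict Implicit.
Unset Printing Implicit Defensive.
Import Order.TTheory GRing.Theory Num.Theory.
Import numFieldNormedType.Exports.
Local Open Scope classical_set_scope.
Local Open Scope ring_scope.

(** The degree of the smooth map k_e = (1_Omega f) * kappa_e, with kappa_e a
    product bump supported in a cube of side comparable to e, is computed by
    integrating a pullback: on the set Omega_e of points at distance > e from
    Gamma, the null Lagrangian property of Jacobian determinants makes the
    integral of (g o k) det Dk invariant under homotopies that keep the boundary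
    away from supp g, and Sard's theorem with a regular value identifies it with
    deg(k, Omega_e, p) times the integral of g.

    Vanishing mean oscillation makes k_e uniformly close to the mean of f over
    B_e(x). On the boundary of Omega_e this mean stays away from supp g: the zero
    extension of f - psi (phi o P) has small oscillation on balls of which a
    fixed portion lies outside Omega (Omega lies locally on one side of Gamma),
    so f is close in mean to phi o P, and phi o P avoids a neighborhood of supp g
    almost everywhere, because P^-1 maps sets that are null for the surface
    measure to Lebesgue null sets. Hence deg(f_e, Omega_e, p) times the integral
    of g equals the integral of (g o k_e) det Dk_e over Omega_e.

    As e tends to 0 this tends to the integral of g(f) det Df: Dk_e is the
    mollification of Df, and by Jensen's inequality |det Dk_e| is dominated by
    the mollification of the integrable sum of the |d_i f_m|^(n-1), since the
    last column of Df is bounded. *)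

(** * Lebesgue measure and integral *)

(** Homotopy invariance is not proved for [g] directly, since that would call for a primitive
    (n-1)-form. It is proved for [kern s], a product of one-variable bumps with explicit primitives:
    composing each coordinate with its primitive turns [kern s] (u) det Du into a Jacobian
    determinant, and maps are exchanged one coordinate at a time. Averaging translated kernels over
    supp g then recovers [g]; connectedness of supp g makes all translates contribute equally. VMO
    controls oscillation only on balls of radius less than the distance to the boundary, while the
    degree uses radius equal to it. Hence the limits over slightly smaller balls, and the kernel
    scale e / (2 (n + 1)), whose cube sits well inside B_e(x). That Omega lies on one side of Gamma
    is not a local fact: near a point, Omega could touch Gamma from both sides. This is excluded by
    a function with values 1 and -1 on a box containing Gamma that changes sign exactly across
    Gamma; it is glued from small boxes, and a connected Omega sees only one of its values. *)

Section lebesgue_basics.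
Context {R : realType} {n : nat}.
Implicit Types (a b x y : 'rV[R]_n) (A : set 'rV[R]_n).

Lemma cbox_sub a b a' b' : (forall i, a 0 i <= b 0 i) ->
  cbox a b `<=` cbox a' b' ->
  (forall i, a' 0 i <= a 0 i) /\ (forall i, b 0 i <= b' 0 i).
Proof.
move=> ab s.
have /s Ha : cbox a b a by move=> i; rewrite lexx ab.
have /s Hb : cbox a b b by move=> i; rewrite lexx ab.
by split=> i; [have /andP[] := Ha i|have /andP[] := Hb i].
Qed.

Lemma box_vol_cbox a b : (forall i, a 0 i <= b 0 i) ->
  box_vol (cbox a b) = (\prod_(i < n) (b 0 i - a 0 i))%:E.
Proof.
move=> ab; rewrite /box_vol; case: ifPn => [/eqP e0|_].
  have : cbox a b a by move=> i; rewrite lexx ab.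
  by rewrite e0.
rewrite (_ : [set _ | _ in _] = [set (\prod_(i < n) (b 0 i - a 0 i))%:E]).
  exact: ereal_inf1.
apply/seteqP; split=> [_ [[a' b'] /= [ab' e] <-]|_ ->]; last by exists (a, b).
have [|h1 h2] := @cbox_sub a b a' b' ab; first by rewrite -e.
have [|h3 h4] := @cbox_sub a' b' a b ab'; first by rewrite -e.
by congr EFin; apply: eq_bigr => i _; congr (_ - _); apply/le_anti;
  rewrite ?h1 ?h2 ?h3 ?h4.
Qed.

Lemma integral_itv1 (c d : R) : c <= d ->
  (\int[lebesgue_measure]_t ((\1_`[c, d] t : R)%:E) = (d - c)%:E)%E.
Proof.
move=> cd; rewrite integral_indic//.
rewrite [X in X = _](_ : _ = lebesgue_measure `[c, d]%classic); last by rewrite setIT.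
rewrite lebesgue_measure_itv/= lte_fin.
case: ltP => // dc; have -> : c = d by apply/le_anti; rewrite cd dc.
by rewrite subrr.
Qed.

(* The coordinates of a nonnegative countable domination between products of
   interval indicators are integrated one at a time. *)
Lemma box_cover_le a b (a' b' : nat -> 'rV[R]_n) (c : nat -> R) :
  (forall i, a 0 i <= b 0 i) -> (forall k i, a' k 0 i <= b' k 0 i) ->
  (forall k, 0 <= c k) ->
  (forall x, cbox a b x -> exists2 k, c k = 1 & cbox (a' k) (b' k) x) ->
  ((\prod_(i < n) (b 0 i - a 0 i))%:E <=
   \sum_(k <oo) (c k * \prod_(i < n) (b' k 0 i - a' k 0 i))%:E)%E.
Proof.
move=> ab ab' c0 cov.
(* The factors after [m] integrations: below [m] the indicator has become an edge length, and only
   the remaining coordinates still depend on [x]. *)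
pose h (u v : 'rV[R]_n) (m : nat) (x : 'rV[R]_n) (i : 'I_n) : R :=
  if (i < m)%N then v 0 i - u 0 i else \1_`[u 0 i, v 0 i] (x 0 i).
have h0 (u v : 'rV[R]_n) m x i : (forall i, u 0 i <= v 0 i) -> 0 <= h u v m x i.
  by move=> uv; rewrite /h; case: ifP => // _; rewrite subr_ge0.
suff H m x : (m <= n)%N -> ((\prod_(i < n) h a b m x i)%:E <=
    \sum_(k <oo) (c k * \prod_(i < n) h (a' k) (b' k) m x i)%:E)%E.
  have := H n 0 (leqnn _).
  rewrite (eq_bigr (fun i => b 0 i - a 0 i)); last first.
    by move=> i _; rewrite /h ltn_ord.
  move/le_trans; apply; apply: lee_nneseries => k _.
    by rewrite lee_fin mulr_ge0// prodr_ge0// => i _; exact: h0.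
  rewrite lee_fin ler_wpM2l// ler_prod// => i _.
  by rewrite h0//= /h ltn_ord. 
elim: m x => [|m IH] x mn.
  have [Hx|Hx] := pselect (cbox a b x); last first.
    have [i Hi] : exists i, ~ (a 0 i <= x 0 i <= b 0 i) by apply/existsNP.
    have e0 : h a b 0%N x i = 0.
      by rewrite /h ltn0 indicE memNset//= in_itv.
    rewrite (bigD1 i)//= e0 mul0r.
    apply: nneseries_ge0 => k _ _; rewrite lee_fin mulr_ge0// prodr_ge0//.
  have [k ck Hk] := cov _ Hx.
  apply: (@le_trans _ _ (\sum_(k0 < k.+1) (c k0 * \prod_(i < n) h (a' k0) (b' k0) 0%N x i)%:E)%E).
    rewrite big_ord_recr/=.
    rewrite [X in (X <= _)%E](_ : _ = 0 + 1%:E)%E; last first.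
      rewrite add0e; congr EFin; apply: big1 => i _; rewrite /h ltn0 indicE mem_set//=.
      by rewrite in_itv/=; exact: Hx.
    apply: leeD.
      apply: sume_ge0 => j _; rewrite lee_fin mulr_ge0// prodr_ge0//.
    rewrite ck mul1r lee_fin big1// => i _; rewrite /h ltn0 indicE mem_set//=.
    by rewrite in_itv/=; exact: Hk.
  rewrite -(big_mkord xpredT (fun k0 => (c k0 * \prod_(i < n) h (a' k0) (b' k0) 0%N x i)%:E)).
  apply: nneseries_lim_ge => j _ _; rewrite lee_fin mulr_ge0// prodr_ge0//.
pose im := Ordinal mn.
pose X t : 'rV[R]_n := \row_i (if i == im then t else x 0 i).
have hX (u v : 'rV[R]_n) t : \prod_(i < n) h u v m (X t) i =
    (\prod_(i < n | i != im) h u v m.+1 x i) * \1_`[u 0 im, v 0 im] t.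
  rewrite (bigD1 im)//= mulrC {2}/h ltnn mxE eqxx; congr (_ * _).
  apply: eq_bigr => i; rewrite -val_eqE/= => im'.
  by rewrite /h mxE -val_eqE/= (negbTE im') [in RHS]ltnS [in RHS]leq_eqVlt (negbTE im').
have hS (u v : 'rV[R]_n) : \prod_(i < n) h u v m.+1 x i =
    (\prod_(i < n | i != im) h u v m.+1 x i) * (v 0 im - u 0 im).
  by rewrite (bigD1 im)//= mulrC {2}/h ltnS leqnn.
have p0 (u v : 'rV[R]_n) : (forall i, u 0 i <= v 0 i) -> 0 <= \prod_(i < n | i != im) h u v m.+1 x i.
  by move=> uv; rewrite prodr_ge0// => j _; exact: h0.
have mi (u v : R) : measurable_fun [set: measurableTypeR R] (fun t : measurableTypeR R => (\1_`[u, v] t : R)%:E).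
  by apply/measurable_EFinP; exact: measurable_indic.
have key : (\int[lebesgue_measure]_t ((\prod_(i < n) h a b m (X t) i)%:E) <=
   \int[lebesgue_measure]_t (\sum_(k <oo)
     (c k * \prod_(i < n) h (a' k) (b' k) m (X t) i)%:E))%E.
  apply: ge0_le_integral => //.
  - by move=> t _; rewrite lee_fin prodr_ge0// => i _; exact: h0.
  - under eq_fun do rewrite hX EFinM.
    exact: measurable_funeM.
  - apply: ge0_emeasurable_sum => [k t _ _|k _].
      by rewrite lee_fin mulr_ge0// prodr_ge0// => i _; exact: h0.
    under eq_fun do rewrite hX EFinM EFinM.
    by apply: measurable_funeM; exact: measurable_funeM.
  - by move=> t _; apply: IH; exact: ltnW.
move: key; rewrite integral_nneseries//; first last.
- by move=> k t _; rewrite lee_fin mulr_ge0// prodr_ge0// => i _; exact: h0.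
- move=> k; under eq_fun do rewrite hX EFinM EFinM.
  by apply: measurable_funeM; exact: measurable_funeM.
rewrite hS EFinM -(integral_itv1 (ab im)).
under eq_integral do rewrite hX EFinM.
rewrite ge0_integralZl_EFin//; last exact: p0.
move/le_trans; apply; apply: lee_nneseries => k _.
  move=> _; apply: integral_ge0 => t _; rewrite lee_fin mulr_ge0// prodr_ge0// => i _.
  exact: h0.
under eq_integral do rewrite hX mulrA EFinM.
rewrite ge0_integralZl_EFin//; last by rewrite mulr_ge0// p0.
by rewrite integral_itv1// -EFinM hS mulrA.
Qed.

(** The factor [c], which is 0 exactly for the empty set, lets the empty members of a covering be
    handled by the same formula as the boxes. *)
Lemma box_vol_box (E : set 'rV[R]_n) : (box_vol E < +oo)%E ->
  exists (a b : 'rV[R]_n) (c : R), [/\ (forall i, a 0 i <= b 0 i), c = (E != set0)%:R,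
   E = [set x | c = 1 /\ cbox a b x] &
   box_vol E = (c * \prod_(i < n) (b 0 i - a 0 i))%:E].
Proof.
have [->|E0] := eqVneq E set0.
  rewrite box_vol0 => _; exists 0, 0, 0; split => //.
    by apply/seteqP; split=> // x [/esym/eqP]; rewrite oner_eq0.
  by rewrite mul0r.
move=> Eoo; suff [a [b [ab e]]] : exists a b, (forall i, a 0 i <= b 0 i) /\ E = cbox a b.
  exists a, b, 1; split => //; last by rewrite e box_vol_cbox// mul1r.
  by rewrite e; apply/seteqP; split=> [x ?|x []].
apply: contrapT => H; move: Eoo; rewrite /box_vol (negbTE E0).
rewrite (_ : [set _ | _ in _] = set0) ?ereal_inf0 ?ltxx//.
apply/seteqP; split=> // x [[a b] /= [ab e] _]; apply: H.
by exists a, b.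
Qed.

Lemma box_vol_cover_le a b (F : nat -> set 'rV[R]_n) :
  (forall i, a 0 i <= b 0 i) -> cbox a b `<=` \bigcup_k F k ->
  ((\prod_(i < n) (b 0 i - a 0 i))%:E <= \sum_(k <oo) box_vol (F k))%E.
Proof.
move=> ab cov; have [[k Hk]|H] := pselect (exists k, box_vol (F k) = +oo%E).
  rewrite (eseries_pinfty _ _ Hk) ?leey// => m _.
  by rewrite -ltNye (lt_le_trans _ (box_vol_ge0 _)).
have /choice[a' /choice[b' /choice[c Hc]]] : forall k, exists a' b' (c : R),
   [/\ (forall i, a' 0 i <= b' 0 i), c = (F k != set0)%:R,
   F k = [set x | c = 1 /\ cbox a' b' x] &
   box_vol (F k) = (c * \prod_(i < n) (b' 0 i - a' 0 i))%:E].
  move=> k; apply: box_vol_box; rewrite ltey; apply/eqP => e.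
  by apply: H; exists k.
rewrite (eq_eseriesr (g := fun k => (c k * \prod_(i < n) (b' k 0 i - a' k 0 i))%:E)); last first.
  by move=> k _; have [] := Hc k.
apply: box_cover_le => //.
- by move=> k; have [] := Hc k.
- by move=> k; have [_ -> _ _] := Hc k; rewrite ler0n.
- move=> x /cov[k _ Fx]; exists k; move: Fx; have [_ _ e _] := Hc k; rewrite e.
    by move=> [].
  by move=> [].
Qed.

Lemma leb_outer_cbox a b : (forall i, a 0 i <= b 0 i) ->
  leb_outer (cbox a b) = (\prod_(i < n) (b 0 i - a 0 i))%:E.
Proof.
move=> ab; apply/eqP; rewrite eq_le; apply/andP; split.
  apply: le_trans (_ : \sum_(k <oo) box_vol ((fun k => if k == 0%N then cbox a b else set0) k) <= _)%E.
    apply: ereal_inf_lbound => /=.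
    exists (fun k => if k == 0%N then cbox a b else set0) => //.
    by split=> // x Hx; exists 0%N.
  rewrite nneseries_recl//; last by move=> k _; exact: box_vol_ge0.
  rewrite eqxx box_vol_cbox// eseries0 ?adde0//.
  by move=> [|k]//= _ _; rewrite box_vol0.
apply: le_ereal_inf_tmp => _ [F [_ cov] <-]; exact: box_vol_cover_le.
Qed.

End lebesgue_basics.

(** * Measurable sets, and the affine maps that preserve boxes *)

Section lebesgue_measurable.
Context {R : realType} {n : nat}.
Implicit Types (a b x y c : 'rV[R]_n) (A : set 'rV[R]_n).
Notation M := (caratheodory_type (lebesgue_outer R n)).

Definition upd x (i : 'I_n) (t : R) : 'rV[R]_n :=
  \row_j (if j == i then t else x 0 j).

Lemma updE x i t j : upd x i t 0 j = if j == i then t else x 0 j.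
Proof. by rewrite mxE. Qed.

(** A coordinate hyperplane cuts a box into two boxes whose volumes add up. Summed over a covering,
    this is the Caratheodory criterion for half-spaces. *)
Lemma box_vol_split (E : set 'rV[R]_n) (i : 'I_n) (c : R)
    (H := [set x : 'rV[R]_n | (x 0 i <= c)%R]) :
  (leb_outer (E `&` H) + leb_outer (E `&` ~` H) <= box_vol E)%E.
Proof.
have [->|Eoo] := eqVneq (box_vol E) +oo%E; first by rewrite leey.
have /box_vol_box[a [b [k [ab kE EE ->]]]] : (box_vol E < +oo)%E by rewrite ltey.
have [E0|E0] := eqVneq E set0.
  by rewrite E0 !set0I !outer_measure0 adde0 lee_fin kE E0 eqxx mul0r.
have k1 : k = 1 by rewrite kE E0.
(* The level is clamped to the edge in direction [i], so that both pieces lie in genuine, possibly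
   degenerate, boxes. *)
pose c' := Num.max (a 0 i) (Num.min c (b 0 i)).
have /andP[ac cb] : a 0 i <= c' <= b 0 i.
  by rewrite /c' le_max lexx/= ge_max ab/= ge_min lexx orbT.
have h1 : E `&` H `<=` cbox a (upd b i c').
  move=> x; rewrite EE => -[[_ Hx] /= xc] j; rewrite updE.
  case: eqVneq => [->|_]; last exact: Hx.
  have /andP[ax xb] := Hx i; rewrite ax/= /c' le_max le_min xc xb.
  by rewrite orbT.
have h2 : E `&` ~` H `<=` cbox (upd a i c') b.
  move=> x; rewrite EE => -[[_ Hx] /= /negP]; rewrite -ltNge => cx j; rewrite updE.
  case: eqVneq => [->|_]; last exact: Hx.
  have /andP[ax xb] := Hx i; rewrite xb andbT /c' ge_max ax/= ge_min.
  by rewrite (ltW cx).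
have p1 : leb_outer (cbox a (upd b i c')) = ((\prod_(j < n | j != i) (b 0 j - a 0 j)) * (c' - a 0 i))%:E.
  rewrite leb_outer_cbox; last first.
    by move=> j; rewrite updE; case: eqVneq => [->|_]; [exact: ac|exact: ab].
  rewrite (bigD1 i)//= updE eqxx mulrC; congr ((_ * _)%:E).
  by apply: eq_bigr => j /negbTE ji; rewrite updE ji.
have p2 : leb_outer (cbox (upd a i c') b) = ((\prod_(j < n | j != i) (b 0 j - a 0 j)) * (b 0 i - c'))%:E.
  rewrite leb_outer_cbox; last first.
    by move=> j; rewrite updE; case: eqVneq => [->|_]; [exact: cb|exact: ab].
  rewrite (bigD1 i)//= updE eqxx mulrC; congr ((_ * _)%:E).
  by apply: eq_bigr => j /negbTE ji; rewrite updE ji.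
apply: le_trans (leeD (le_outer_measure (lebesgue_outer R n) _ _ h1)
  (le_outer_measure (lebesgue_outer R n) _ _ h2)) _.
rewrite [X in (X + _ <= _)%E]p1 [X in (_ + X <= _)%E]p2 -EFinD lee_fin k1 mul1r.
rewrite [leRHS](bigD1 i)//= [leRHS]mulrC -mulrDr.
by rewrite le_eqVlt; apply/orP; left; apply/eqP; congr (_ * _); ring.
Qed.

Lemma measurable_halfspace (i : 'I_n) (c : R) :
  measurable ([set x : M | (x : 'rV[R]_n) 0 i <= c] : set M).
Proof.
apply: le_caratheodory_measurable => X.
apply: le_ereal_inf_tmp => _ [F [_ cov] <-].
set H : set 'rV[R]_n := [set x | _].
apply: (@le_trans _ _ (\sum_(k <oo) (leb_outer (F k `&` H) + leb_outer (F k `&` ~` H))))%E; last first.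
  apply: lee_nneseries => k _; last exact: box_vol_split.
  by move=> _; rewrite adde_ge0// outer_measure_ge0.
rewrite nneseriesD; first last.
- by move=> k _ _; exact: (outer_measure_ge0 (lebesgue_outer R n)).
- by move=> k _ _; exact: (outer_measure_ge0 (lebesgue_outer R n)).
apply: leeD.
  apply: le_trans (outer_measure_sigma_subadditive (lebesgue_outer R n) _).
  apply: le_outer_measure => x [/cov[k _ Fx] Hx]; by exists k.
apply: le_trans (outer_measure_sigma_subadditive (lebesgue_outer R n) _).
apply: le_outer_measure => x [/cov[k _ Fx] Hx]; by exists k.
Qed.

Lemma measurable_coord (i : 'I_n) :
  measurable_fun [set: M] (fun x : M => (x : 'rV[R]_n) 0 i).
Proof.
apply: (measurability (@RGenOInfty.G R)); first exact: RGenOInfty.measurableE.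
move=> _ [_ [c ->] <-]; rewrite setTI.
rewrite (_ : _ @^-1` _ = ~` [set x : M | (x : 'rV[R]_n) 0 i <= c]).
  by apply: measurableC; exact: measurable_halfspace.
by apply/seteqP; split => x /=; rewrite in_itv/= andbT ltNge => /negP.
Qed.

Lemma measurable_cbox a b : measurable (cbox a b : set M).
Proof.
rewrite (_ : cbox a b = \bigcap_(i in [set: 'I_n])
   ((fun x : M => (x : 'rV[R]_n) 0 i) @^-1` `[a 0 i, b 0 i]%classic)).
  apply: fin_bigcap_measurable => // i _.
  rewrite -[X in measurable X]setTI; apply: measurable_coord => //.
by apply/seteqP; split => [x Hx i _|x Hx i] /=;
  [rewrite in_itv/=; exact: Hx|have := Hx i I; rewrite /= in_itv/=].
Qed.

(** Corners are rational to make the index set countable; the boxes that leave [A] are replaced by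
    the empty set. *)
Lemma open_bigcup_cbox A : open A ->
  exists F : 'rV[rat]_n * 'rV[rat]_n -> set 'rV[R]_n, A = \bigcup_q F q /\
    forall q, F q = set0 \/ exists a b, F q = cbox a b.
Proof.
move=> oA.
pose q (r : 'rV[rat]_n) : 'rV[R]_n := map_mx ratr r.
pose F (ab : 'rV[rat]_n * 'rV[rat]_n) : set 'rV[R]_n :=
  if `[< cbox (q ab.1) (q ab.2) `<=` A >] then cbox (q ab.1) (q ab.2) else set0.
exists F; split; last first.
  by move=> ab; rewrite /F; case: ifP => _; [right; exists (q ab.1), (q ab.2)|left].
apply/seteqP; split => [x Ax|x [ab _]]; last first.
  by rewrite /F; case: asboolP => // + Hx; apply.
have /nbhs_ballP[e /= e0 He] : nbhs x A by apply: open_nbhs_nbhs; split.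
have /choice[a Ha] (i : 'I_n) : exists r : rat, ratr r \in `](x 0 i - e), x 0 i[.
  by apply: rat_in_itvoo; rewrite ltrBlDr ltrDl.
have /choice[b Hb] (i : 'I_n) : exists r : rat, ratr r \in `]x 0 i, (x 0 i + e)[.
  by apply: rat_in_itvoo; rewrite ltrDl.
exists (\row_i a i, \row_i b i) => //; rewrite /F /=.
have sA : cbox (q (\row_i a i)) (q (\row_i b i)) `<=` A.
  move=> y Hy; apply: He; split => // i j; have := Hy j; rewrite !mxE (ord1 i).
  have := Ha j; have := Hb j; rewrite !in_itv/= => /andP[h1 h2] /andP[h3 h4] /andP[h5 h6].
  rewrite /ball/= ltr_norml; apply/andP; split; [lra|lra].
case: asboolP => // _ i; rewrite !mxE.
have := Ha i; have := Hb i; rewrite !in_itv/= => /andP[h1 h2] /andP[h3 h4].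
by rewrite !ltW.
Qed.

Lemma open_lmeasurable A : open A -> measurable (A : set M).
Proof.
move=> /open_bigcup_cbox[F [-> HF]].
apply: countable_bigcupT_measurable => [|q]; first exact: countableP.
by have [->|[a [b ->]]] := HF q => //; exact: measurable_cbox.
Qed.

Lemma closed_lmeasurable A : closed A -> measurable (A : set M).
Proof.
by move=> cA; rewrite -(setCK A); apply: measurableC; apply: open_lmeasurable;
  rewrite openC.
Qed.

(** Real-valued integration over the whole space; an integral over a subset is written with an
    indicator factor. *)
Definition lmeas (f : 'rV[R]_n -> R) := measurable_fun [set: M] (f : M -> R).
Definition lintble (f : 'rV[R]_n -> R) :=
  (leb R n).-integrable [set: M] (fun x : M => (f x)%:E).
Definition lint (f : 'rV[R]_n -> R) : R :=
  (\int[leb R n]_(x in [set: M]) (f x))%R.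

Lemma continuous_lmeas (f : 'rV[R]_n -> R) : continuous f -> lmeas f.
Proof.
move=> cf; apply: (measurability (@RGenOpens.G R)); first exact: RGenOpens.measurableE.
move=> _ [_ [a [b ->]] <-]; rewrite setTI; apply: open_lmeasurable.
by move/continuousP: cf; apply; exact: interval_open.
Qed.

(** Signed coordinate permutations followed by a translation: they map boxes to boxes of the same
    volume. Translations and reflections are the cases used for convolutions; the general case
    computes the degree of signed permutation matrices. *)
Definition sperm (pi : 'S_n) (s : 'I_n -> bool) c x : 'rV[R]_n :=
  \row_i ((-1) ^+ s i * x 0 (pi i) + c 0 i).

Definition sperm_inv (pi : 'S_n) (s : 'I_n -> bool) c : 'rV[R]_n -> 'rV[R]_n :=
  sperm (perm_inv pi) (s \o perm_inv pi)
    (\row_j - ((-1) ^+ s (perm_inv pi j) * c 0 (perm_inv pi j))).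

Lemma sperm_invK pi s c : cancel (sperm_inv pi s c) (sperm pi s c).
Proof.
move=> x; apply/rowP => j; rewrite !mxE /= permK mulrDr mulrA -signr_addb addbb.
by rewrite mul1r mulrN mulrA -signr_addb addbb mul1r subrK.
Qed.

Lemma sperm_cbox pi s c a b : (forall i, a 0 i <= b 0 i) ->
  exists a' b', [/\ (forall i, a' 0 i <= b' 0 i),
    sperm pi s c @^-1` cbox a b = cbox a' b' &
    \prod_(i < n) (b' 0 i - a' 0 i) = \prod_(i < n) (b 0 i - a 0 i)].
Proof.
move=> ab; pose r := perm_inv pi.
exists (\row_j (if s (r j) then c 0 (r j) - b 0 (r j) else a 0 (r j) - c 0 (r j))).
exists (\row_j (if s (r j) then c 0 (r j) - a 0 (r j) else b 0 (r j) - c 0 (r j))).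
split.
- by move=> j; rewrite !mxE; have := ab (r j); case: ifP => _; lra.
- apply/seteqP; split => x Hx.
    move=> j; have := Hx (r j); rewrite !mxE permKV.
    by case: (s (r j)) => /andP[h1 h2]; apply/andP; split; rewrite ?expr0 ?expr1 in h1 h2; lra.
  move=> i; have := Hx (pi i); rewrite !mxE /r permK.
  by case: (s i) => /andP[h1 h2]; apply/andP; split; rewrite ?expr0 ?expr1; lra.
- rewrite [RHS](reindex_inj (@perm_inj _ r)); apply: eq_bigr => j _; rewrite !mxE.
  by case: ifP => _; lra.
Qed.

Lemma leb_outer_sperm pi s c A :
  leb_outer (sperm pi s c @^-1` A) = leb_outer A.
Proof.
have le pi' s' c' A' : (leb_outer (sperm pi' s' c' @^-1` A') <= leb_outer A')%E.
  apply: le_ereal_inf_tmp => _ [F [_ cov] <-].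
  apply: (@le_trans _ _ (\sum_(k <oo) box_vol ((sperm pi' s' c') @^-1` F k))%E).
    apply: ereal_inf_lbound; exists (fun k => sperm pi' s' c' @^-1` F k) => //.
    by split => // x /cov[k _ Fx]; exists k.
  apply: lee_nneseries => k _; first by move=> _; exact: box_vol_ge0.
  have [->|Eoo] := eqVneq (box_vol (F k)) +oo%E; first by rewrite leey.
  have [F0|F0] := eqVneq (F k) set0.
    by rewrite F0 preimage_set0.
  have /box_vol_box[a [b [m [ab mE EE _]]]] : (box_vol (F k) < +oo)%E by rewrite ltey.
  have {}EE : F k = cbox a b.
    by rewrite EE mE F0; apply/seteqP; split => [x []|x].
  have [a' [b' [ab' e1 e2]]] := sperm_cbox pi' s' c' ab.
  by rewrite EE e1 !box_vol_cbox// e2.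
apply/eqP; rewrite eq_le le/=.
rewrite -[X in (leb_outer X <= _)%E](_ : sperm_inv pi s c @^-1` (sperm pi s c @^-1` A) = _).
  exact: le.
by apply/seteqP; split => x /=; rewrite sperm_invK.
Qed.

(** The Caratheodory condition is transported by a bijection that preserves the outer measure of
    every set. *)
Lemma measurable_sperm pi s c : measurable_fun [set: M] (sperm pi s c : M -> M).
Proof.
move=> _ Y mY; rewrite setTI.
have {}mY : (lebesgue_outer R n).-caratheodory Y by exact: mY.
suff : (lebesgue_outer R n).-caratheodory (sperm pi s c @^-1` Y) by [].
move=> X.
pose S := sperm_inv pi s c.
have e Z : leb_outer Z = leb_outer (S @^-1` Z) by rewrite /S leb_outer_sperm.
rewrite /= /lebesgue_outer /= (e X) (e (X `&` _)) (e (X `&` ~` _)).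
have := mY (S @^-1` X); rewrite /lebesgue_outer /= => ->.
have eY Z : S @^-1` (X `&` sperm pi s c @^-1` Z) = S @^-1` X `&` Z.
  by apply/seteqP; split => x /= [h1]; rewrite /S sperm_invK.
by rewrite eY -(eY (~` Y)).
Qed.

Lemma ge0_integral_sperm pi s c (f : 'rV[R]_n -> \bar R) :
  measurable_fun [set: M] (f : M -> \bar R) -> (forall x, (0 <= f x)%E) ->
  (\int[leb R n]_(x in [set: M]) f (sperm pi s c x) = \int[leb R n]_(x in [set: M]) f x)%E.
Proof.
move=> mf f0.
transitivity (\int[pushforward (leb R n) (sperm pi s c : M -> M)]_(x in [set: M]) f x)%E.
  by rewrite (ge0_integral_pushforward (measurable_sperm pi s c)).
congr integral; apply/funext => A; exact: leb_outer_sperm.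
Qed.

Lemma leb_sigma_finite : sigma_finite [set: M] (leb R n).
Proof.
exists (fun k => cbox (const_mx (- k%:R)) (const_mx k%:R)).
  apply/seteqP; split => // x _.
  pose m := \max_(i < n) Num.truncn (`|(x : 'rV[R]_n) 0%R i|).
  exists m.+1 => // i; rewrite !mxE -ler_norml.
  apply: le_trans (ltW (truncnS_gt _)) _.
  by rewrite ler_nat ltnS; exact: leq_bigmax.
move=> k; split; first exact: measurable_cbox.
rewrite [X in (X < _)%E](leb_outer_cbox _) ?ltry// => i.
by rewrite !mxE; apply: (@le_trans _ _ 0); rewrite ?oppr_le0 ler0n.
Qed.

Definition leb_sfin : {sigma_finite_measure set M -> \bar R} :=
  HB.pack (leb R n : set M -> \bar R) (Measure.class (leb R n))
  (@Measure_isSigmaFinite.Build _ _ _ (leb R n) leb_sigma_finite).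

End lebesgue_measurable.

(** * Integration calculus: null sets, dominated convergence, invariance, Fubini *)

Section lint_theory.
Context {R : realType} {n : nat}.
Implicit Types (x y c : 'rV[R]_n) (A N : set 'rV[R]_n) (f g h : 'rV[R]_n -> R).
Notation M := (caratheodory_type (lebesgue_outer R n)).
Notation leb_outer := (@leb_outer R n).

Lemma lmeasB f g : lmeas f -> lmeas g -> lmeas (fun x => f x - g x).
Proof. exact: measurable_funB. Qed.

Lemma lmeasM f g : lmeas f -> lmeas g -> lmeas (fun x => f x * g x).
Proof. exact: measurable_funM. Qed.

Lemma lmeas_cst (k : R) : lmeas (fun _ : 'rV[R]_n => k).
Proof. exact: measurable_cst. Qed.

Lemma lmeasZ (k : R) f : lmeas f -> lmeas (fun x => k * f x).
Proof. by apply: lmeasM; exact: lmeas_cst. Qed.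

Lemma lmeas_norm f : lmeas f -> lmeas (fun x => `|f x|).
Proof. by move=> mf; apply: measurableT_comp. Qed.

Lemma lmeas_indic A : measurable (A : set M) -> lmeas (\1_A).
Proof. by move=> mA; exact: measurable_indic. Qed.

(** The preimage under [u] of an open interval is a countable union of boxes, and the preimage of a
    box under [F] is a finite intersection of coordinate conditions. *)
Lemma lmeas_comp_row m (u : 'rV[R]_m -> R) (F : 'rV[R]_n -> 'rV[R]_m) :
  continuous u -> (forall i, lmeas (fun x => F x 0 i)) -> lmeas (fun x => u (F x)).
Proof.
move=> cu mF; apply: (measurability (@RGenOpens.G R)); first exact: RGenOpens.measurableE.
move=> _ [_ [a [b ->]] <-]; rewrite setTI.
have /open_bigcup_cbox[G [Ge HG]] : open (u @^-1` `]a, b[%classic).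
  by move/continuousP: cu; apply; exact: interval_open.
rewrite (_ : _ @^-1` _ = \bigcup_q (F @^-1` G q)); last first.
  by rewrite -preimage_bigcup -Ge.
apply: countable_bigcupT_measurable => [|q]; first exact: countableP.
have [->|[a' [b' ->]]] := HG q; first by rewrite preimage_set0.
rewrite (_ : F @^-1` _ = \bigcap_(i in [set: 'I_m])
   ((fun x : M => F x 0 i) @^-1` `[a' 0 i, b' 0 i]%classic)).
  apply: fin_bigcap_measurable => // i _.
  rewrite -[X in measurable X]setTI; apply: mF => //.
by apply/seteqP; split => [x Hx i _|x Hx i] /=;
  [rewrite in_itv/=; exact: Hx|have := Hx i I; rewrite /= in_itv/=].
Qed.

Lemma lmeasE f : lmeas f -> measurable_fun [set: M] (fun x : M => (f x)%:E).
Proof. by move=> mf; exact: ((measurable_EFinP _ _).2 mf). Qed.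

Lemma lintble_meas f : lintble f -> lmeas f.
Proof. by move=> /integrableP[/measurable_EFinP]. Qed.

Lemma lintbleD f g : lintble f -> lintble g -> lintble (fun x => f x + g x).
Proof. by move=> if_ ig; exact: (integrableD measurableT if_ ig). Qed.

Lemma lintbleB f g : lintble f -> lintble g -> lintble (fun x => f x - g x).
Proof. by move=> if_ ig; exact: (integrableB measurableT if_ ig). Qed.

Lemma lintbleZ (k : R) f : lintble f -> lintble (fun x => k * f x).
Proof. by move=> if_; exact: (integrableZl measurableT k if_). Qed.

Lemma lintble0 : lintble (fun _ : 'rV[R]_n => 0 : R).
Proof. exact: integrable0. Qed.

Lemma lintble_norm f : lintble f -> lintble (fun x => `|f x|).
Proof. by move=> ?; apply: integrable_norm. Qed.

Lemma lintble_sum (I : Type) (s : seq I) (F : I -> 'rV[R]_n -> R) :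
  (forall i, lintble (F i)) -> lintble (fun x => \sum_(i <- s) F i x).
Proof.
move=> iF; elim: s => [|i s IH].
  by under [X in lintble X]funext do rewrite big_nil; exact: lintble0.
by under [X in lintble X]funext do rewrite big_cons; exact: lintbleD.
Qed.

Lemma le_lintble f g : lmeas f -> (forall x, `|f x| <= g x) -> lintble g -> lintble f.
Proof.
move=> mf fg ig; have mf' := (measurable_EFinP _ _).2 mf.
apply: (le_integrable measurableT mf' _ ig).
by move=> x _; rewrite /= lee_fin (le_trans (fg x))// ler_norm.
Qed.

Lemma lintD f g : lintble f -> lintble g -> lint (fun x => f x + g x) = lint f + lint g.
Proof. by move=> ? ?; apply: RintegralD. Qed.

Lemma lintB f g : lintble f -> lintble g -> lint (fun x => f x - g x) = lint f - lint g.
Proof. by move=> ? ?; apply: RintegralB. Qed.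

Lemma lintZ (k : R) f : lintble f -> lint (fun x => k * f x) = k * lint f.
Proof. by move=> ?; apply: RintegralZl. Qed.

Lemma lint0 : lint (fun _ : 'rV[R]_n => 0 : R) = 0.
Proof. by rewrite /lint Rintegral_cst// mul0r. Qed.

Lemma lint_sum (I : Type) (s : seq I) (F : I -> 'rV[R]_n -> R) :
  (forall i, lintble (F i)) ->
  lint (fun x => \sum_(i <- s) F i x) = \sum_(i <- s) lint (F i).
Proof.
move=> iF; elim: s => [|i s IH].
  by rewrite big_nil -[RHS]lint0; congr lint; apply/funext => x; rewrite big_nil.
rewrite big_cons -IH -lintD//; last exact: lintble_sum.
by congr lint; apply/funext => x; rewrite big_cons.
Qed.

Lemma le_lint f g : lintble f -> lintble g -> (forall x, f x <= g x) -> lint f <= lint g.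
Proof. by move=> ? ? fg; apply: le_Rintegral. Qed.

Lemma lint_ge0 f : (forall x, 0 <= f x) -> 0 <= lint f.
Proof. by move=> f0; apply: Rintegral_ge0. Qed.

Lemma le_norm_lint f : lintble f -> `|lint f| <= lint (fun x => `|f x|).
Proof. by move=> ?; apply: le_normr_Rintegral. Qed.

Lemma lintE f : lintble f -> (lint f)%:E = (\int[leb R n]_(x in [set: M]) (f x)%:E)%E.
Proof. by move=> iF; rewrite fineK//; exact: integrable_fin_num. Qed.

Lemma norm_lint_le f g : lmeas f -> (forall x, `|f x| <= g x) -> lintble g ->
  `|lint f| <= lint g.
Proof.
move=> mf fg ig; have if_ := le_lintble mf fg ig.
by apply: le_trans (le_norm_lint if_) _; apply: le_lint => //; exact: lintble_norm.
Qed.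

Definition null A := leb_outer A = 0%E.

Lemma nullS A N : A `<=` N -> null N -> null A.
Proof.
move=> AN N0; apply/eqP; rewrite eq_le (outer_measure_ge0 (lebesgue_outer R n)) andbT.
by rewrite -N0; exact: (le_outer_measure (lebesgue_outer R n)).
Qed.

Lemma null_bigcup (F : nat -> set 'rV[R]_n) : (forall k, null (F k)) ->
  null (\bigcup_k F k).
Proof.
move=> F0; apply/eqP; rewrite eq_le (outer_measure_ge0 (lebesgue_outer R n)) andbT.
apply: le_trans (outer_measure_sigma_subadditive (lebesgue_outer R n) F) _.
by rewrite eseries0// => k _ _; exact: F0.
Qed.

Lemma null0 : null set0. Proof. exact: outer_measure0. Qed.

Lemma nullU A N : null A -> null N -> null (A `|` N).
Proof.
move=> A0 N0; rewrite -bigcup2E; apply: null_bigcup => -[|[|k]] //=; exact: null0.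
Qed.

Lemma null_measurable A : null A -> measurable (A : set M).
Proof.
move=> A0; suff : (lebesgue_outer R n).-caratheodory A by [].
apply: le_caratheodory_measurable => X.
have X0 : null (X `&` A) by apply: nullS A0; exact: subIsetr.
rewrite [X in (X + _)%E]X0 add0e; apply: le_outer_measure; exact: subIsetl.
Qed.

Lemma null_ae_eq N (f g : 'rV[R]_n -> R) : null N -> (forall x, ~ N x -> f x = g x) ->
  ae_eq (leb R n) [set: M] (fun x : M => (f x)%:E) (fun x : M => (g x)%:E).
Proof.
move=> N0 fg; exists N; split; [exact: null_measurable|exact: N0|].
by move=> x /=; apply: contra_notP => Nx _; rewrite fg.
Qed.

Lemma ae_lmeas N f g : null N -> (forall x, ~ N x -> f x = g x) -> lmeas f -> lmeas g.
Proof.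
move=> N0 fg mf _ Y mY; rewrite setTI.
pose Z := f @^-1` Y : set 'rV[R]_n.
have e : g @^-1` Y = (Z `\` N) `|` (g @^-1` Y `&` N).
  apply/seteqP; split => x.
    have [Nx|Nx] := pselect (N x); first by right.
    by move=> Yx; left; split => //; rewrite /Z /= fg.
  by move=> [[Zx /fg]|[]//] /= <-.
have mN := null_measurable N0.
have mN' : measurable ((g @^-1` Y `&` N) : set M).
  by apply: null_measurable; apply: nullS N0; exact: subIsetr.
have mZ : measurable (Z : set M) by rewrite -[X in measurable X]setTI; exact: mf.
have mg : measurable (g @^-1` Y : set M).
  by rewrite e; apply: measurableU => //; exact: measurableD.
exact: mg.
Qed.

Lemma ae_lintble N f g : null N -> (forall x, ~ N x -> f x = g x) ->
  lintble f -> lintble g.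
Proof.
move=> N0 fg if_; have mg := ae_lmeas N0 fg (lintble_meas if_).
have fg' x : ~ N x -> `|f x| = `|g x| by move=> /fg ->.
apply/integrableP; split; first exact: lmeasE.
have e : (\int[leb R n]_(x in [set: M]) `|(f x)%:E| = \int[leb R n]_(x in [set: M]) `|(g x)%:E|)%E.
  exact: (@ae_eq_integral _ M R (leb R n) [set: M] (fun x => `|g x|%:E) (fun x => `|f x|%:E)
    measurableT (lmeasE (lmeas_norm (lintble_meas if_))) (lmeasE (lmeas_norm mg)) (null_ae_eq N0 fg')).
by rewrite -e; move/integrableP : if_ => [].
Qed.

Lemma ae_lint N f g : null N -> (forall x, ~ N x -> f x = g x) ->
  lmeas f -> lint f = lint g.
Proof.
move=> N0 fg mf; have mg := ae_lmeas N0 fg mf.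
congr fine.
exact: (@ae_eq_integral _ M R (leb R n) [set: M] (EFin \o g) (EFin \o f) measurableT (lmeasE mf) (lmeasE mg) (null_ae_eq N0 fg)).
Qed.

Lemma dominated_lint N (F : nat -> 'rV[R]_n -> R) f g : null N ->
  (forall k, lmeas (F k)) -> lintble g ->
  (forall k x, ~ N x -> `|F k x| <= g x) ->
  (forall x, ~ N x -> F k x @[k --> \oo] --> f x) ->
  [/\ lintble f, forall k, lintble (F k) & lint (F k) @[k --> \oo] --> lint f].
Proof.
move=> N0 mF ig Fg Ff.
(* Cutting off on [N] makes the convergence hold everywhere, which yields the measurability of the
   limit. *)
pose F' k x := F k x * \1_(~` N) x; pose f' x := f x * \1_(~` N) x.
have F'0 k x : ~ N x -> F' k x = F k x by move=> Nx; rewrite /F' indicE mem_set// mulr1.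
have f'0 x : ~ N x -> f' x = f x by move=> Nx; rewrite /f' indicE mem_set// mulr1.
have mF' k : lmeas (F' k) by apply: ae_lmeas N0 _ (mF k) => x /F'0.
have Ff' x : F' k x @[k --> \oo] --> f' x.
  have [Nx|Nx] := pselect (N x).
    rewrite /f' indicE memNset ?mulr0; last by [].
    under eq_fun do rewrite /F' indicE memNset ?mulr0//.
    exact: cvg_cst.
  by rewrite f'0//; under eq_fun do rewrite F'0//; exact: Ff.
have mf' : lmeas f'.
  exact: (@measurable_fun_cvg _ M R [set: M] F' f' mF' (fun x _ => Ff' x)).
have Fg' k x : `|F' k x| <= `|g x|.
  have [Nx|Nx] := pselect (N x).
    by rewrite /F' indicE memNset ?mulr0 ?normr0.
  by rewrite F'0// (le_trans (Fg _ _ Nx))// ler_norm.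
have iF' k : lintble (F' k).
  by apply: le_lintble (mF' k) _ (lintble_norm ig) => x; exact: Fg'.
have c' x : (F' k x)%:E @[k --> \oo] --> (f' x)%:E.
  by apply: cvg_EFin; [near=> k|exact: Ff'].
have [i1 _ i3] := @dominated_convergence _ M _ (leb R n) [set: M] measurableT
  (fun k x => (F' k x)%:E) (fun x => (f' x)%:E) (fun x => `|g x|%:E)
  (fun k => lmeasE (mF' k)) (lmeasE mf')
  (aeW (leb R n) (fun (x : M) _ => c' x)) (lintble_norm ig)
  (aeW (leb R n) (fun (x : M) k _ => Fg' k x)).
split.
- exact: ae_lintble N0 f'0 i1.
- by move=> k; exact: ae_lintble N0 (F'0 k) (iF' k).
- rewrite -(ae_lint N0 f'0 mf').
  rewrite (_ : (fun k => lint (F k)) = fine \o (fun k => (\int[leb R n]_(x in [set: M]) (F' k x)%:E)%E)).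
    by apply: fine_cvg; rewrite (lintE i1).
  by apply/funext => k; rewrite -(ae_lint N0 (F'0 k) (mF' k)).
Unshelve. all: by end_near. Qed.

Lemma lint_sperm pi s c f : lintble f ->
  lintble (fun x => f (sperm pi s c x)) /\ lint (fun x => f (sperm pi s c x)) = lint f.
Proof.
move=> if_; have mf := lintble_meas if_.
have m (h : 'rV[R]_n -> R) : lmeas h -> lmeas (fun x => h (sperm pi s c x)).
  move=> mh; exact: (@measurableT_comp _ _ _ M M R h _ _ mh (measurable_sperm pi s c)).
have H (h : 'rV[R]_n -> R) : (forall x, 0 <= h x) -> lintble h ->
    lintble (fun x => h (sperm pi s c x)) /\ lint (fun x => h (sperm pi s c x)) = lint h.
  move=> h0 ih.
  have e : (\int[leb R n]_(x in [set: M]) (h (sperm pi s c x))%:E =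
            \int[leb R n]_(x in [set: M]) (h x)%:E)%E.
    apply: (ge0_integral_sperm pi s c (f := fun x => (h x)%:E)); first exact: lmeasE (lintble_meas ih).
    by move=> x; rewrite lee_fin.
  split; last by congr fine.
  apply/integrableP; split; first exact: lmeasE (m _ (lintble_meas ih)).
  rewrite (_ : (fun x => _) = (fun x : M => (h (sperm pi s c x))%:E)); last first.
    by apply/funext => x; rewrite /= ger0_norm.
  by rewrite e -lintE// ltry.
have i1 := lintbleD (lintble_norm if_) if_; have i2 := lintbleB (lintble_norm if_) if_.
have [|j1 e1] := H _ _ i1; first by move=> x; have := ler_norm (- f x); rewrite normrN; lra.
have [|j2 e2] := H _ _ i2; first by move=> x; rewrite subr_ge0 ler_norm.
have e (y : 'rV[R]_n) : f y = 2^-1 * ((`|f y| + f y) - (`|f y| - f y)) by lra.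
split.
  under [X in lintble X]funext do rewrite e.
  by apply: lintbleZ; apply: lintbleB.
transitivity (lint (fun x => 2^-1 * ((`|f (sperm pi s c x)| + f (sperm pi s c x)) - (`|f (sperm pi s c x)| - f (sperm pi s c x))))).
  by congr lint; apply/funext => x; exact: e.
rewrite lintZ; last exact: lintbleB.
rewrite lintB// e1 e2 -lintB// -lintZ; last exact: lintbleB.
by congr lint; apply/funext => x; rewrite -e.
Qed.

Lemma lint_translate c f : lintble f ->
  lintble (fun x => f (x + c)) /\ lint (fun x => f (x + c)) = lint f.
Proof.
move=> if_; have [] := lint_sperm 1%g (fun=> false) c if_.
rewrite (_ : (fun x => _) = (fun x => f (x + c)))//; apply/funext => x.
by congr f; apply/rowP => i; rewrite !mxE expr0 mul1r perm1.
Qed.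

Lemma lint_reflect c f : lintble f ->
  lintble (fun x => f (c - x)) /\ lint (fun x => f (c - x)) = lint f.
Proof.
move=> if_; have [] := lint_sperm 1%g (fun=> true) c if_.
rewrite (_ : (fun x => _) = (fun x => f (c - x)))//; apply/funext => x.
by congr f; apply/rowP => i; rewrite !mxE expr1 mulN1r perm1 addrC.
Qed.

Lemma lintble_indic A : measurable (A : set M) -> (leb_outer A < +oo)%E -> lintble (\1_A).
Proof.
move=> mA Aoo; apply/integrableP; split; first exact: lmeasE (lmeas_indic mA).
rewrite (_ : (fun x => _) = (fun x : M => ((\1_A x)%:E : \bar R))); last first.
  by apply/funext => x; rewrite /= ger0_norm.
by rewrite integral_indic// setIT.
Qed.

Lemma lint_indic A : measurable (A : set M) -> lint (\1_A) = fine (leb_outer A).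
Proof. by move=> mA; congr fine; rewrite integral_indic// setIT. Qed.

Lemma lintble_bounded f a b (C : R) : lmeas f -> (forall x, `|f x| <= C) ->
  (forall x, ~ cbox a b x -> f x = 0) -> lintble f.
Proof.
move=> mf fC f0.
apply: (le_lintble mf (g := fun x => C * \1_(cbox a b) x)) => [x|].
  have [xb|xb] := pselect (cbox a b x); first by rewrite indicE mem_set// mulr1.
  by rewrite f0// normr0 indicE memNset// mulr0.
apply: lintbleZ; apply: lintble_indic; first exact: measurable_cbox.
have [ab|/existsNP[i ab]] := pselect (forall i, a 0 i <= b 0 i).
  by rewrite leb_outer_cbox// ltry.
rewrite (_ : cbox a b = set0) ?outer_measure0//.
apply/seteqP; split => // x /(_ i) /andP[h1 h2]; apply: ab; exact: le_trans h1 h2.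
Qed.

Lemma lint0_ae f : (forall x, 0 <= f x) -> lintble f -> lint f = 0 -> null [set x | f x != 0].
Proof.
move=> f0 if_ f00.
have : (\int[leb R n]_(x in [set: M]) `|(f x)%:E| = 0)%E.
  rewrite -[RHS]/(0%:E) -f00 lintE//; apply: eq_integral => x _.
  by rewrite /= ger0_norm.
move/(ae_eq_integral_abs (leb R n) measurableT (lmeasE (lintble_meas if_))).1.
move=> [N [mN N0 sN]]; apply: nullS N0 => x /= fx; apply: sN => /= H.
by have := H I => -[] /eqP; rewrite (negbTE fx).
Qed.

Lemma norm_addr_bnd (a : R) : 0 <= `|a| + a <= 2 * `|a|.
Proof.
have h1 := ler_norm (- a); have h2 := ler_norm a; rewrite normrN in h1.
by apply/andP; split; lra.
Qed.

Lemma norm_subr_bnd (a : R) : 0 <= `|a| - a <= 2 * `|a|.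
Proof. by have := norm_addr_bnd (- a); rewrite normrN. Qed.

(** The two integrands are twice the positive and the negative part; signed Fubini is reduced to
    Tonelli through them. *)
Lemma lint_posneg f : lintble f ->
  lint f = 2^-1 * (lint (fun y => `|f y| + f y) - lint (fun y => `|f y| - f y)).
Proof.
move=> jf; have jn := lintble_norm jf.
have e : f = (fun y => 2^-1 * ((`|f y| + f y) - (`|f y| - f y))).
  by apply/funext => y; lra.
rewrite {1}e lintZ; last by apply: lintbleB; [exact: lintbleD|exact: lintbleB].
by rewrite lintB; [|exact: lintbleD|exact: lintbleB].
Qed.

Definition jmeas (F : 'rV[R]_n -> 'rV[R]_n -> R) :=
  measurable_fun [set: M * M] (fun p : M * M => F p.1 p.2).

Lemma jmeas_fst f : lmeas f -> jmeas (fun x _ => f x).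
Proof.
move=> mf; exact: (@measurableT_comp _ _ _ (M * M)%type M R f _ fst mf measurable_fst).
Qed.

Lemma jmeas_snd f : lmeas f -> jmeas (fun _ y => f y).
Proof.
move=> mf; exact: (@measurableT_comp _ _ _ (M * M)%type M R f _ snd mf measurable_snd).
Qed.

Lemma jmeasM F G : jmeas F -> jmeas G -> jmeas (fun x y => F x y * G x y).
Proof. by move=> mF mG; exact: (measurable_funM mF mG). Qed.

Lemma jmeasD F G : jmeas F -> jmeas G -> jmeas (fun x y => F x y + G x y).
Proof. by move=> mF mG; exact: (measurable_funD mF mG). Qed.

Lemma jmeasB F G : jmeas F -> jmeas G -> jmeas (fun x y => F x y - G x y).
Proof. by move=> mF mG; exact: (measurable_funB mF mG). Qed.

Lemma jmeas_comp (u : R -> R) F : continuous u -> jmeas F -> jmeas (fun x y => u (F x y)).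
Proof.
move=> cu mF.
exact: (@measurableT_comp _ _ _ (M * M)%type R R u _ _ (continuous_measurable_fun cu) mF).
Qed.

Lemma jmeas_norm F : jmeas F -> jmeas (fun x y => `|F x y|).
Proof. by apply: jmeas_comp; exact: norm_continuous. Qed.

Lemma jmeas_prod (I : Type) (s : seq I) (F : I -> 'rV[R]_n -> 'rV[R]_n -> R) :
  (forall i, jmeas (F i)) -> jmeas (fun x y => \prod_(i <- s) F i x y).
Proof.
move=> mF; elim: s => [|i s IH].
  rewrite (_ : (fun x y => _) = fun _ _ => 1); last first.
    by apply/funext => x; apply/funext => y; rewrite big_nil.
  by apply: jmeas_fst; exact: lmeas_cst.
rewrite (_ : (fun x y => _) = fun x y => F i x y * \prod_(j <- s) F j x y).
  exact: jmeasM.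
by apply/funext => x; apply/funext => y; rewrite big_cons.
Qed.

(** Every section is assumed integrable, not just almost every one, so that [lint] of a section
    never truncates an infinite integral. *)
Lemma lint_tonelli (F : 'rV[R]_n -> 'rV[R]_n -> R) : jmeas F -> (forall x y, 0 <= F x y) ->
  (forall x, lintble (F x)) -> (forall y, lintble (F ^~ y)) ->
  lintble (fun x => lint (F x)) ->
  lintble (fun y => lint (F ^~ y)) /\
  lint (fun x => lint (F x)) = lint (fun y => lint (F ^~ y)).
Proof.
move=> mF F0 i1 i2 i3.
pose G (p : M * M) : \bar R := (F p.1 p.2)%:E.
have mG : measurable_fun [set: M * M] G by exact: ((measurable_EFinP _ _).2 mF).
have G0 p : (0 <= G p)%E by rewrite lee_fin.
have e : (\int[leb R n]_(x in [set: M]) \int[leb R n]_(y in [set: M]) G (x, y) =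
   \int[leb R n]_(y in [set: M]) \int[leb R n]_(x in [set: M]) G (x, y))%E.
  exact: (@fubini_tonelli _ _ M M R (leb_sfin (R := R) (n := n)) (leb_sfin (R := R) (n := n)) G mG G0).
have mg : measurable_fun [set: M] (fun y : M => \int[leb R n]_(x in [set: M]) G (x, y))%E.
  exact: (@measurable_fun_fubini_tonelli_G _ _ M M R (leb_sfin (R := R) (n := n)) G mG G0).
have e1 : (fun x : M => \int[leb R n]_(y in [set: M]) G (x, y))%E = (fun x : M => (lint (F x))%:E).
  by apply/funext => x; rewrite lintE.
have e2 : (fun y : M => \int[leb R n]_(x in [set: M]) G (x, y))%E = (fun y : M => (lint (F ^~ y))%:E).
  by apply/funext => y; rewrite lintE.
rewrite e1 e2 in e; rewrite e2 in mg.
have j : lintble (fun y => lint (F ^~ y)).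
  apply/integrableP; split; first exact: mg.
  rewrite (_ : (fun x => _) = (fun x : M => (lint (F ^~ x))%:E)); last first.
    by apply/funext => x; rewrite /= ger0_norm// lint_ge0.
  by rewrite -e -lintE// ltry.
split; first exact: j.
by apply: EFin_inj; rewrite (lintE i3) (lintE j).
Qed.

Lemma lmeas_lint (F : 'rV[R]_n -> 'rV[R]_n -> R) : jmeas F -> (forall x y, 0 <= F x y) ->
  (forall x, lintble (F x)) -> lmeas (fun x => lint (F x)).
Proof.
move=> mF F0 iF.
pose G (p : M * M) : \bar R := (F p.1 p.2)%:E.
have mG : measurable_fun [set: M * M] G by exact: ((measurable_EFinP _ _).2 mF).
have G0 p : (0 <= G p)%E by rewrite lee_fin.
apply: ((measurable_EFinP _ _).1 _).
have mg : measurable_fun [set: M] (fun x : M => \int[leb R n]_(y in [set: M]) G (x, y))%E.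
  exact: (@measurable_fun_fubini_tonelli_F _ _ M M R (leb_sfin (R := R) (n := n)) G mG G0).
have e1 : (fun x : M => \int[leb R n]_(y in [set: M]) G (x, y))%E = (fun x : M => (lint (F x))%:E).
  by apply/funext => x; rewrite lintE.
by rewrite e1 in mg; exact: mg.
Qed.

Lemma lint_fubini (F : 'rV[R]_n -> 'rV[R]_n -> R) : jmeas F ->
  (forall x, lintble (F x)) -> (forall y, lintble (F ^~ y)) ->
  lintble (fun x => lint (fun y => `|F x y|)) ->
  [/\ lintble (fun x => lint (F x)), lintble (fun y => lint (F ^~ y)) &
  lint (fun x => lint (F x)) = lint (fun y => lint (F ^~ y))].
Proof.
move=> mF i1 i2 i3.
have H G : jmeas G -> (forall x y, 0 <= G x y) -> (forall x y, G x y <= 2 * `|F x y|) ->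
  [/\ lintble (fun x => lint (G x)), lintble (fun y => lint (G ^~ y)) &
  lint (fun x => lint (G x)) = lint (fun y => lint (G ^~ y))].
  move=> mG G0 GF.
  have mGx x : lmeas (G x) by exact: (@measurable_fun_pair2 _ _ _ M M R _ x mG).
  have mGy y : lmeas (G ^~ y) by exact: (@measurable_fun_pair1 _ _ _ M M R _ y mG).
  have ix x : lintble (G x).
    apply: le_lintble (mGx x) _ (lintbleZ 2 (lintble_norm (i1 x))) => y.
    by rewrite ger0_norm.
  have iy y : lintble (G ^~ y).
    apply: le_lintble (mGy y) _ (lintbleZ 2 (lintble_norm (i2 y))) => x.
    by rewrite ger0_norm.
  have il : lintble (fun x => lint (G x)).
    apply: (le_lintble (g := fun x => 2 * lint (fun y => `|F x y|))) (lintbleZ 2 i3).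
      exact: lmeas_lint.
    move=> x; rewrite ger0_norm ?lint_ge0// -lintZ; last exact: lintble_norm.
    by apply: le_lint => //; apply: lintbleZ; exact: lintble_norm.
  by have [] := lint_tonelli mG G0 ix iy il.
have mN := jmeas_norm mF.
have [|x y|x y|a1 a2 a3] := H (fun x y => `|F x y| + F x y).
- exact: jmeasD.
- by case/andP: (norm_addr_bnd (F x y)).
- by case/andP: (norm_addr_bnd (F x y)).
have [|x y|x y|b1 b2 b3] := H (fun x y => `|F x y| - F x y).
- exact: jmeasB.
- by case/andP: (norm_subr_bnd (F x y)).
- by case/andP: (norm_subr_bnd (F x y)).
have E1 : (fun x => lint (F x)) = (fun x => 2^-1 *
    (lint (fun y => `|F x y| + F x y) - lint (fun y => `|F x y| - F x y))).
  by apply/funext => x; exact: lint_posneg.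
have E2 : (fun y => lint (F ^~ y)) = (fun y => 2^-1 *
    (lint (fun x => `|F x y| + F x y) - lint (fun x => `|F x y| - F x y))).
  by apply/funext => y; exact: lint_posneg.
have i4 := lintbleB a1 b1; have i5 := lintbleB a2 b2.
rewrite E1 E2; split; [exact: (lintbleZ _ i4)|exact: (lintbleZ _ i5)|].
by rewrite (lintZ _ i4) (lintZ _ i5) (lintB a1 b1) (lintB a2 b2) a3 b3.
Qed.

Lemma lint_fubini_dom (F : 'rV[R]_n -> 'rV[R]_n -> R) (h : 'rV[R]_n -> R) : jmeas F ->
  (forall x, lintble (F x)) -> (forall y, lintble (F ^~ y)) ->
  (forall x, lint (fun y => `|F x y|) <= h x) -> lintble h ->
  [/\ lintble (fun x => lint (F x)), lintble (fun y => lint (F ^~ y)) &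
  lint (fun x => lint (F x)) = lint (fun y => lint (F ^~ y))].
Proof.
move=> mF i1 i2 Fh ih; apply: lint_fubini => //; apply: le_lintble _ _ ih.
  by apply: lmeas_lint => [|//|x]; [exact: jmeas_norm|exact: lintble_norm].
by move=> x; rewrite ger0_norm// lint_ge0.
Qed.

End lint_theory.

#[global] Opaque lint.

Section quadratic_criterion.
Context {R : realType}.

(** Serves to differentiate [flat] at 0, where no single formula holds on both sides. *)
Lemma is_derive_quad (V W : normedModType R) (f : V -> W) (x v : V) (c : W) (C : R) :
  (forall h : R, `|h| <= 1 -> `|f (x + h *: v) - f x - h *: c| <= C * h ^+ 2) ->
  is_derive x v f c.
Proof.
move=> H.
have L : h^-1 *: (f (h *: v + x) - f x) @[h --> 0^'] --> c.
  apply/cvgrPdist_le => e e0; near=> h.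
  have h0 : h != 0 by near: h; exact: nbhs_dnbhs_neq.
  have h1 : `|h| <= 1 by near: h; exact: dnbhs0_le.
  have he : `|h| <= e / (`|C| + 1).
    by near: h; apply: dnbhs0_le; rewrite divr_gt0// ltr_wpDl.
  have -> : c - h^-1 *: (f (h *: v + x) - f x) = h^-1 *: (h *: c - (f (h *: v + x) - f x)).
    by rewrite [in RHS]scalerBr scalerA mulVf// scale1r.
  have hp : 0 < `|h| by rewrite normr_gt0.
  rewrite normrZ normfV ler_pdivrMl// distrC [h *: v + x]addrC; apply: le_trans (H _ h1) _.
  rewrite -real_normK ?num_real// expr2 mulrCA ler_pM2l//.
  have C1 : 0 < `|C| + 1 by rewrite ltr_wpDl.
  rewrite ler_pdivlMr// in he.
  by apply: le_trans he; rewrite mulrC ler_wpM2l// (le_trans (ler_norm _))// lerDl.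
by split; [apply/cvg_ex; exists c|exact: cvg_lim].
Unshelve. all: by end_near. Qed.

End quadratic_criterion.

(** * Bump functions and differential calculus *)

Section smooth_line.
Context {R : realType}.
Implicit Types (u v : R -> R) (k j m : nat) (t : R).

Fixpoint diffn k u : Prop :=
  if k is k'.+1 then (forall t, derivable u t 1) /\ diffn k' ((derive1 u)) else continuous u.

Lemma diffn_continuous k u : diffn k u -> continuous u.
Proof.
by case: k => // k [du _] t; apply/differentiable_continuous/derivable1_diffP.
Qed.

Lemma diffnS k u : diffn k.+1 u -> diffn k u.
Proof.
elim: k u => [u|k IH u [du]]; first exact: diffn_continuous.
by move=> /IH h; split.
Qed.

Lemma diffn_cst k (c : R) : diffn k (fun=> c).
Proof.
elim: k c => [c t|k IH c]; first exact: cvg_cst.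
split; first by move=> t; exact: derivable_cst.
rewrite (_ : derive1 _ = fun=> 0)//; apply/funext => t.
by rewrite derive1E derive_cst.
Qed.

Lemma diffn_id k : diffn k (fun t => t).
Proof.
case: k => [|k]; first by move=> t; exact: cvg_id.
split; first by move=> t; exact: derivable_id.
rewrite (_ : derive1 _ = fun=> (1 : R)); first exact: diffn_cst.
by apply/funext => t; rewrite derive1E derive_id.
Qed.

Lemma diffnD k u v : diffn k u -> diffn k v -> diffn k (fun t => u t + v t).
Proof.
elim: k u v => [u v cu cv t|k IH u v [du hu] [dv hv]].
  by apply: cvgD; [exact: cu|exact: cv].
split; first by move=> t; exact: derivableD.
rewrite (_ : derive1 _ = fun t => (derive1 u) t + (derive1 v) t); first exact: IH.
by apply/funext => t; rewrite !derive1E deriveD.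
Qed.

Lemma diffnM k u v : diffn k u -> diffn k v -> diffn k (fun t => u t * v t).
Proof.
elim: k u v => [u v cu cv t|k IH u v hu hv].
  by apply: cvgM; [exact: cu|exact: cv].
have [du hu'] := hu; have [dv hv'] := hv.
split; first by move=> t; exact: derivableM.
rewrite (_ : derive1 _ = fun t => u t * (derive1 v) t + v t * (derive1 u) t).
  by apply: diffnD; apply: IH => //; exact: diffnS.
by apply/funext => t; rewrite !derive1E deriveM.
Qed.

Lemma diffn_comp k u v : diffn k u -> diffn k v -> diffn k (fun t => u (v t)).
Proof.
elim: k u v => [u v cu cv t|k IH u v hu hv].
  by apply: continuous_comp; [exact: cv|exact: cu].
have [du hu'] := hu; have [dv hv'] := hv.
have duv t : is_derive t 1 (fun t => u (v t)) ((derive1 u) (v t) * (derive1 v) t).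
  by apply: is_derive1_comp; rewrite derive1E; apply: DeriveDef.
split; first by move=> t; exact: ex_derive.
rewrite (_ : derive1 _ = fun t => (derive1 u) (v t) * (derive1 v) t).
  by apply: diffnM => //; apply: (IH ((derive1 u)) v) => //; exact: diffnS.
by apply/funext => t; rewrite derive1E derive_val.
Qed.

(* [flat 0] is the classical smooth function vanishing on the negative axis;
   the family is stable under derivation. *)
Definition flat k t : R := if 0 < t then t^-1 ^+ k * expR (- t^-1) else 0.

Lemma flat_ge0 k t : 0 <= flat k t.
Proof.
by rewrite /flat; case: ifPn => // t0; rewrite mulr_ge0 ?expR_ge0// exprn_ge0// invr_ge0 ltW.
Qed.

Lemma flat_gt0 k t : 0 < t -> 0 < flat k t.
Proof. by move=> t0; rewrite /flat t0 mulr_gt0 ?expR_gt0// exprn_gt0// invr_gt0. Qed.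

Lemma flat_le0 k t : t <= 0 -> flat k t = 0.
Proof. by rewrite /flat leNgt => /negbTE ->. Qed.

(** With y = 1/t, exp y is the (k+2)-th power of exp (y/(k+2)), which is at least y/(k+2); so exp
    (-y) is at most ((k+2) t)^(k+2), and dividing by t^k leaves t^2. *)
Lemma flat_bound k : exists2 C : R, 0 <= C & forall t, flat k t <= C * t ^+ 2.
Proof.
exists (k.+2%:R ^+ k.+2) => [|t]; first by rewrite exprn_ge0.
have [t0|t0] := ltP 0 t; last first.
  by rewrite flat_le0// mulr_ge0 ?sqr_ge0 ?exprn_ge0.
rewrite /flat t0 expRN.
have y0 : 0 < t^-1 by rewrite invr_gt0.
have h : (k.+2%:R * t) ^- k.+2 <= expR t^-1.
  rewrite (_ : expR t^-1 = expR (t^-1 / k.+2%:R) ^+ k.+2); last first.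
    by rewrite -expRM_natl mulrC mulfVK// pnatr_eq0.
  rewrite -exprVn invfM mulrC lerXn2r ?nnegrE ?expR_ge0//.
    by rewrite mulr_ge0// ?invr_ge0// ltW.
  by apply: le_trans (expR_ge1Dx _); rewrite lerDr.
have Kt : 0 < (k.+2%:R * t) ^+ k.+2 by rewrite exprn_gt0// mulr_gt0.
have h2 : (expR t^-1)^-1 <= (k.+2%:R * t) ^+ k.+2.
  by rewrite -[leRHS]invrK lef_pV2// ?posrE ?expR_gt0 ?invr_gt0.
apply: le_trans (ler_wpM2l _ h2) _; first by rewrite exprn_ge0// ltW.
rewrite exprMn mulrCA -addn2 [t ^+ (k + 2)]exprD [t^-1 ^+ k * _]mulrA -exprMn mulVf ?gt_eqF//.
by rewrite expr1n mul1r.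
Qed.

Lemma is_derive_flat k t : is_derive t 1 (flat k) (flat k.+2 t - k%:R * flat k.+1 t).
Proof.
have [t0|t0|t0] := ltgtP t 0.
- rewrite !flat_le0 ?ltW// mulr0 subr0.
  have := is_derive_cst (0 : R) t 1; apply: near_eq_is_derive.
  near=> s; rewrite flat_le0//; apply/ltW; near: s; exact: lt_nbhsl.
- apply: (near_eq_is_derive (f := fun s : R => s^-1 ^+ k * expR (- s^-1))).
    near=> s; rewrite /flat ifT//; near: s; exact: lt_nbhsr.
  have t00 : t != 0 by rewrite gt_eqF.
  have dV : is_derive t 1 (fun s : R => s^-1) (- t^-1 ^+ 2).
    apply: DeriveDef; first by apply: derivableV => //; exact: derivable_id.
    by rewrite (@deriveV _ _ (fun s => s))// derive_id scaler1 exprVn.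
  have dE : is_derive t 1 (fun s => expR (- s^-1)) (t^-1 ^+ 2 * expR (- t^-1)).
    have dN : is_derive t 1 (fun s : R => - s^-1) (t^-1 ^+ 2).
      by rewrite -[t^-1 ^+ 2]opprK; exact: (is_deriveN dV).
    by rewrite mulrC; exact: is_derive1_comp.
  have eF : ((fun s : R => s^-1) ^+ k * (fun s : R => expR (- s^-1)))%R = (fun s => s^-1 ^+ k * expR (- s^-1)).
    by apply/funext => s; rewrite exprfctE.
  have := is_deriveM (is_deriveX k dV) dE; rewrite eF => H; apply: is_derive_eq H _.
  rewrite exprfctE /flat t0 /GRing.scale/=.
  by case: k {eF} => [|k] /=; rewrite ?mul0r ?expr0 ?mulr0 ?mul1r ?subr0 ?addr0// !exprS; ring.
- rewrite t0 !flat_le0// mulr0 subr0.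
  have [C C0 hC] := flat_bound k; apply: (is_derive_quad (C := C)) => h _.
  by rewrite add0r (flat_le0 k (lexx 0)) scaler0 !subr0 ger0_norm ?flat_ge0// /GRing.scale/= mulr1.
Unshelve. all: by end_near. Qed.

Lemma diffn_flat j k : diffn k (flat j).
Proof.
elim: k j => [|k IH] j.
  move=> t; apply/differentiable_continuous/derivable1_diffP.
  by have [] := is_derive_flat j t.
split; first by move=> t; have [] := is_derive_flat j t.
rewrite (_ : derive1 _ = fun t => flat j.+2 t + (- j%:R) * flat j.+1 t).
  by apply: diffnD => //; apply: diffnM => //; exact: diffn_cst.
apply/funext => t; rewrite derive1E mulNr.
by have [_ ->] := is_derive_flat j t.
Qed.

(** Nesting [flat 0] in itself gives a smooth step that rises from -1/e to 0 and is constant outside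
    [0, 1]; [bump] is its derivative in closed form. A bump with an explicit primitive is what makes
    pullbacks of product kernels into Jacobian determinants. *)
Definition smooth_step t : R := - flat 0 (1 - expR 1 * flat 0 t).
Definition bump t : R := expR 1 * flat 2 (1 - expR 1 * flat 0 t) * flat 2 t.

Lemma flat0_ge1 t : 1 <= t -> 1 <= expR 1 * flat 0 t.
Proof.
move=> t1; have t0 : 0 < t by apply: lt_le_trans t1.
rewrite /flat t0 expr0 mul1r -expRD -{1}expR0 ler_expR subr_ge0.
by rewrite invf_le1.
Qed.

Lemma diffn_bump k : diffn k bump.
Proof.
apply: diffnM; last exact: diffn_flat.
apply: diffnM; first exact: diffn_cst.
apply: (diffn_comp (u := flat 2)); first exact: diffn_flat.
apply: (diffnD (u := fun=> 1) (v := fun t => - (expR 1 * flat 0 t))); first exact: diffn_cst.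
rewrite (_ : (fun t => _) = fun t => (- expR 1) * flat 0 t); last by apply/funext => t; rewrite mulNr.
by apply: diffnM; [exact: diffn_cst|exact: diffn_flat].
Qed.

Lemma is_derive_smooth_step t : is_derive t 1 smooth_step (bump t).
Proof.
have h1 : is_derive t 1 (fun t => 1 - expR 1 * flat 0 t) (- (expR 1 * flat 2 t)).
  have d0 := is_derive_flat 0 t; rewrite mul0r subr0 in d0.
  have := is_deriveB (is_derive_cst (1 : R) t 1) (is_deriveZ (expR 1) d0).
  by rewrite sub0r.
rewrite (_ : bump t = - (flat 2 (1 - expR 1 * flat 0 t) * - (expR 1 * flat 2 t))).
  apply: is_deriveN; apply: is_derive1_comp.
  by have := is_derive_flat 0 (1 - expR 1 * flat 0 t); rewrite mul0r subr0.
by rewrite /bump; ring.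
Qed.

Lemma bump_ge0 t : 0 <= bump t.
Proof. by rewrite !mulr_ge0 ?flat_ge0 ?expR_ge0. Qed.

Lemma bump_gt0 t : 0 < t -> t < 1 -> 0 < bump t.
Proof.
move=> t0 t1; rewrite !mulr_gt0 ?flat_gt0 ?expR_gt0//.
rewrite subr_gt0 /flat t0 expr0 mul1r -expRD -[X in _ < X]expR0 ltr_expR subr_lt0.
by rewrite invf_gt1.
Qed.

Lemma bump_out t : t <= 0 \/ 1 <= t -> bump t = 0.
Proof.
move=> [t0|t1]; first by rewrite /bump (flat_le0 2 t0) mulr0.
by rewrite /bump (flat_le0 2 (t := 1 - _)) ?mulr0 ?mul0r// subr_le0 flat0_ge1.
Qed.

Lemma smooth_step_le0 t : t <= 0 -> smooth_step t = smooth_step 0.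
Proof. by move=> t0; rewrite /smooth_step (flat_le0 0 t0) (flat_le0 0 (lexx 0)). Qed.

Lemma smooth_step_ge1 t : 1 <= t -> smooth_step t = 0.
Proof. by move=> t1; rewrite /smooth_step flat_le0 ?oppr0// subr_le0 flat0_ge1. Qed.

End smooth_line.

(** * C^1 and C^2 functions of several variables, symmetry of second derivatives *)

Section calculus_rows.
Context {R : realType} {n : nat}.
Implicit Types (f g : 'rV[R]_n -> R) (x y v : 'rV[R]_n) (i j : 'I_n).

Lemma norm_row_le x (c : R) : 0 <= c -> (forall i, `|x 0 i| <= c) -> `|x| <= c.
Proof.
move=> c0 H; rewrite [leLHS]/Num.norm /= mx_normrE; apply/bigmax_leP; split => // -[a i] _ /=.
by rewrite (ord1 a).
Qed.

Lemma coord_le_norm x i : `|x 0 i| <= `|x|.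
Proof.
by rewrite [leRHS]/Num.norm /= mx_normrE; apply/bigmax_geP; right => /=; exists (0, i).
Qed.

Lemma continuous_addf f g : continuous f -> continuous g -> continuous (fun x => f x + g x).
Proof. by move=> cf cg x; exact: (continuousD (cf x) (cg x)). Qed.

Lemma continuous_mulf f g : continuous f -> continuous g -> continuous (fun x => f x * g x).
Proof. by move=> cf cg x; exact: (continuousM (cf x) (cg x)). Qed.

Lemma continuous_compf (u : R -> R) f : continuous u -> continuous f -> continuous (fun x => u (f x)).
Proof. by move=> cu cf x; exact: (continuous_comp (cf x) (cu (f x))). Qed.

Lemma continuous_cstf (c : R) : continuous (fun _ : 'rV[R]_n => c).
Proof. exact: cst_continuous. Qed.

Definition C1 f := (forall x, differentiable f x) /\ forall i, continuous (partial i f).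
Definition C2 f := (forall x, differentiable f x) /\ forall i, C1 (partial i f).

Lemma C1_continuous f : C1 f -> continuous f.
Proof. by move=> [df _] x; exact: differentiable_continuous. Qed.

Lemma C2_C1 f : C2 f -> C1 f.
Proof. by move=> [df d2]; split => // i; exact: C1_continuous. Qed.

Lemma partialE f x i : differentiable f x -> partial i f x = 'd f x (delta_mx 0 i).
Proof. by move=> df; rewrite /partial deriveE. Qed.

Lemma is_derive_partial f x i : differentiable f x ->
  is_derive x (delta_mx 0 i) f (partial i f x).
Proof. by move=> df; apply: DeriveDef => //; exact: diff_derivable. Qed.

Lemma partial_cst (c : R) i x : partial i (fun=> c) x = 0.
Proof. exact: derive_cst. Qed.

Lemma partialD f g i x : differentiable f x -> differentiable g x ->
  partial i (fun y => f y + g y) x = partial i f x + partial i g x.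
Proof.
move=> df dg; have := is_deriveD (is_derive_partial i df) (is_derive_partial i dg).
by move=> [_ <-].
Qed.

Lemma partialM f g i x : differentiable f x -> differentiable g x ->
  partial i (fun y => f y * g y) x = partial i f x * g x + f x * partial i g x.
Proof.
move=> df dg; have := is_deriveM (is_derive_partial i df) (is_derive_partial i dg).
by move=> [_]; rewrite /partial => ->; rewrite addrC mulrC.
Qed.

Lemma partial_comp (u : R -> R) f i x : derivable u (f x) 1 -> differentiable f x ->
  differentiable (fun y => u (f y)) x /\
  partial i (fun y => u (f y)) x = derive1 u (f x) * partial i f x.
Proof.
move=> /[dup] du /derivable1_diffP du' df.
have d : differentiable (fun y => u (f y)) x by exact: differentiable_comp.
split => //; rewrite partialE// [X in X _ = _](diff_comp df du')/= partialE//.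
by rewrite deriv1E//= mulrC.
Qed.

Lemma C1_cst (c : R) : C1 (fun=> c).
Proof.
split; first by move=> x; exact: differentiable_cst.
move=> i; rewrite (_ : partial i _ = fun=> 0); first exact: continuous_cstf.
by apply/funext => x; exact: partial_cst.
Qed.

Lemma C1D f g : C1 f -> C1 g -> C1 (fun x => f x + g x).
Proof.
move=> [df cf] [dg cg]; split; first by move=> x; exact: differentiableD.
move=> i; rewrite (_ : partial i _ = fun x => partial i f x + partial i g x).
  exact: continuous_addf.
by apply/funext => x; exact: partialD.
Qed.

Lemma C1M f g : C1 f -> C1 g -> C1 (fun x => f x * g x).
Proof.
move=> hf hg; have [df cf] := hf; have [dg cg] := hg.
split; first by move=> x; exact: differentiableM.
move=> i; rewrite (_ : partial i _ = fun x => partial i f x * g x + f x * partial i g x).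
  by apply: continuous_addf; apply: continuous_mulf => //; exact: C1_continuous.
by apply/funext => x; exact: partialM.
Qed.

Lemma C1_comp (u : R -> R) f : diffn 1 u -> C1 f -> C1 (fun x => u (f x)).
Proof.
move=> [du cu] hf; have [df cf] := hf.
split; first by move=> x; apply: differentiable_comp => //; exact/derivable1_diffP.
move=> i; rewrite (_ : partial i _ = fun x => derive1 u (f x) * partial i f x).
  by apply: continuous_mulf => //; apply: continuous_compf => //; exact: C1_continuous.
by apply/funext => x; have [] := partial_comp i (du (f x)) (df x).
Qed.

Lemma C1_prod (I : Type) (s : seq I) (F : I -> 'rV[R]_n -> R) :
  (forall k, C1 (F k)) -> C1 (fun x => \prod_(k <- s) F k x).
Proof.
move=> hF; elim: s => [|k s IH].
  by rewrite (_ : (fun x => _) = fun=> 1); [exact: C1_cst|apply/funext => x; rewrite big_nil].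
rewrite (_ : (fun x => _) = fun x => F k x * \prod_(l <- s) F l x); first exact: C1M.
by apply/funext => x; rewrite big_cons.
Qed.

Lemma C2_cst (c : R) : C2 (fun=> c).
Proof.
split; first by move=> x; exact: differentiable_cst.
move=> i; rewrite (_ : partial i _ = fun=> 0); first exact: C1_cst.
by apply/funext => x; exact: partial_cst.
Qed.

Lemma C2D f g : C2 f -> C2 g -> C2 (fun x => f x + g x).
Proof.
move=> [df cf] [dg cg]; split; first by move=> x; exact: differentiableD.
move=> i; rewrite (_ : partial i _ = fun x => partial i f x + partial i g x); first exact: C1D.
by apply/funext => x; exact: partialD.
Qed.

Lemma C2M f g : C2 f -> C2 g -> C2 (fun x => f x * g x).
Proof.
move=> hf hg; have [df cf] := hf; have [dg cg] := hg.
split; first by move=> x; exact: differentiableM.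
move=> i; rewrite (_ : partial i _ = fun x => partial i f x * g x + f x * partial i g x).
  by apply: C1D; apply: C1M => //; exact: C2_C1.
by apply/funext => x; exact: partialM.
Qed.

Lemma C2Z (c : R) f : C2 f -> C2 (fun x => c * f x).
Proof. by apply: C2M; exact: C2_cst. Qed.

Lemma C2B f g : C2 f -> C2 g -> C2 (fun x => f x - g x).
Proof.
move=> hf hg; rewrite (_ : (fun x => _) = fun x => f x + (-1) * g x).
  exact: (C2D hf (C2Z (-1) hg)).
by apply/funext => x; rewrite mulN1r.
Qed.

Lemma C2_comp (u : R -> R) f : diffn 2 u -> C2 f -> C2 (fun x => u (f x)).
Proof.
move=> [du cu] hf; have [df cf] := hf.
split; first by move=> x; apply: differentiable_comp => //; exact/derivable1_diffP.
move=> i; rewrite (_ : partial i _ = fun x => derive1 u (f x) * partial i f x).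
  by apply: C1M => //; apply: C1_comp => //; exact: C2_C1.
by apply/funext => x; have [] := partial_comp i (du (f x)) (df x).
Qed.

Lemma smooth_C2 f : smooth_on setT f -> C2 f.
Proof.
move=> sf; have dd s x : differentiable (foldr (@partial R n R) f s) x by exact: sf.
split; first exact: (dd [::]).
move=> i; split; first exact: (dd [:: i]).
by move=> j x; apply: differentiable_continuous; exact: (dd [:: j; i]).
Qed.

Lemma is_derive_line f x v (t : R) : differentiable f (x + t *: v) ->
  is_derive t 1 (fun s : R => f (x + s *: v)) ('D_v f (x + t *: v)).
Proof.
move=> df.
have e : (fun h : R => h^-1 *: (((fun s : R => f (x + s *: v)) \o shift t) (h *: 1) - f (x + t *: v))) =
  (fun h : R => h^-1 *: ((f \o shift (x + t *: v)) (h *: v) - f (x + t *: v))).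
  by apply/funext => h /=; congr (_ *: (f _ - _)); rewrite addrCA -scalerDl [_ *: 1]mulr1.
apply: DeriveDef.
  have := diff_derivable (v := v) df; by rewrite /derivable e.
by rewrite /derive e.
Qed.

Lemma mvt_line f x v (t : R) : (forall y, differentiable f y) -> 0 <= t ->
  exists2 s : R, 0 <= s <= t & f (x + t *: v) - f x = t * 'D_v f (x + s *: v).
Proof.
move=> df t0.
have [||s sI e] := @MVT_segment R (fun s : R => f (x + s *: v)) (fun s => 'D_v f (x + s *: v)) 0 t t0.
- by move=> s _; exact: is_derive_line.
- apply/continuous_subspaceT => s; apply/differentiable_continuous/derivable1_diffP.
  by have [] := is_derive_line (df (x + s *: v)).
exists s; first by rewrite in_itv/= in sI.
by rewrite scale0r addr0 subr0 in e; rewrite e mulrC.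
Qed.

Lemma normrv_delta i : `|delta_mx 0 i : 'rV[R]_n| <= 1.
Proof.
apply: norm_row_le => // k; by rewrite mxE; case: (_ && _); rewrite ?normr1 ?normr0.
Qed.

Lemma partial_shift f (w : 'rV[R]_n) i x :
  partial i (fun y => f (y + w)) x = partial i f (x + w).
Proof.
have e : (fun h : R => h^-1 *: (((fun y => f (y + w)) \o shift x) (h *: delta_mx 0 i) - f (x + w))) =
  (fun h : R => h^-1 *: ((f \o shift (x + w)) (h *: delta_mx 0 i) - f (x + w))).
  by apply/funext => h /=; rewrite addrA.
by rewrite /partial /derive e.
Qed.

Lemma differentiable_shift f (w : 'rV[R]_n) x :
  differentiable f (x + w) -> differentiable (fun y => f (y + w)) x.
Proof. by move=> df; apply: differentiable_comp. Qed.

Lemma schwarz_aux (D u v w a b e k : R) : 0 < k ->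
  `|D - v - u + w - k * a| <= k * e -> `|D - u - v + w - k * b| <= k * e ->
  `|a - b| <= 2 * e.
Proof.
move=> k0; have -> : D - v - u + w = D - u - v + w by ring.
move: (D - u - v + w) => E A B.
rewrite -(ler_pM2l k0) -{1}(gtr0_norm k0) -normrM mulrBr.
apply: le_trans (ler_distD E _ _) _; rewrite [`|k * a - E|]distrC.
by apply: le_trans (lerD A B) _; rewrite mulrCA mulr_natl mulr2n.
Qed.

(** The second difference over a square of side h does not depend on the order of the two
    directions; two applications of the mean value theorem write it as h^2 times either mixed
    derivative at a nearby point. *)
Lemma schwarz f i j : C2 f -> partial i (partial j f) = partial j (partial i f).
Proof.
move=> [df cf]; apply/funext => x.
suff H e : 0 < e -> `|partial i (partial j f) x - partial j (partial i f) x| <= 2 * e.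
  apply/eqP; rewrite -subr_eq0 -normr_le0; apply/ler_addgt0Pr => e e0.
  by rewrite add0r; have := H (e / 2) (divr_gt0 e0 (ltr0Sn _ _)); rewrite mulrC divfK.
move=> e0.
have key a b : exists2 d : R, 0 < d & forall h : R, 0 < h -> h < d ->
    `|(f (x + h *: delta_mx 0 a + h *: delta_mx 0 b) - f (x + h *: delta_mx 0 a)
      - f (x + h *: delta_mx 0 b) + f x) - h ^+ 2 * partial b (partial a f) x| <= h ^+ 2 * e.
  have /cvgrPdist_le/(_ _ e0)/nbhs_ballP[d /= d0 Hd] := (cf a).2 b x.
  exists (d / 2); first by rewrite divr_gt0.
  move=> h h0 hd.
  pose g y := f (y + h *: delta_mx 0 b) - f y.
  have dg y : differentiable g y.
    by apply: differentiableB => //; exact: differentiable_shift.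
  have [s /andP[s0 sh] es] := mvt_line x (delta_mx 0 a) dg (ltW h0).
  have Dg y : 'D_(delta_mx 0 a) g y = partial a f (y + h *: delta_mx 0 b) - partial a f y.
    have := is_deriveB (is_derive_partial a (differentiable_shift (df (y + h *: delta_mx 0 b)))) (is_derive_partial a (df y)).
    by move=> [_ ->]; rewrite partial_shift.
  have [s' /andP[s'0 s'h] es'] := mvt_line (x + s *: delta_mx 0 a) (delta_mx 0 b) (cf a).1 (ltW h0).
  rewrite (_ : f _ - _ - _ + _ = h ^+ 2 * partial b (partial a f) (x + s *: delta_mx 0 a + s' *: delta_mx 0 b)).
    rewrite -mulrBr normrM ger0_norm ?sqr_ge0// ler_wpM2l ?sqr_ge0// distrC.
    apply: Hd; rewrite -ball_normE /ball_/= distrC -[x + _ + _]addrA [x + (_ + _)]addrC addrK.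
    apply: le_lt_trans (_ : h + h < d); last by rewrite -mulr2n -mulr_natl mulrC -ltr_pdivlMr.
    apply: le_trans (ler_normD _ _) _; rewrite !normrZ !ger0_norm//.
    by apply: lerD; (apply: le_trans (_ : _ * 1 <= _); [apply: ler_wpM2l => //; exact: normrv_delta|by rewrite mulr1]).
  transitivity (g (x + h *: delta_mx 0 a) - g x); first by rewrite /g; ring.
  by rewrite es Dg es' expr2 -mulrA.
have [d1 d10 H1] := key i j; have [d2 d20 H2] := key j i.
pose h := Num.min d1 d2 / 2.
have m0 : 0 < Num.min d1 d2 by rewrite lt_min d10.
have h0 : 0 < h by rewrite divr_gt0.
have hd : h < Num.min d1 d2 by rewrite /h ltr_pdivrMr// ltr_pMr// ltrDl.
rewrite lt_min in hd; case/andP: hd => hd1 hd2.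
have := H1 _ h0 hd1; have := H2 _ h0 hd2.
rewrite [x + h *: delta_mx 0 j + _]addrAC.
by move=> A B; apply: schwarz_aux A B; rewrite exprn_gt0.
Qed.

End calculus_rows.

(** * Criteria for differentiability *)

Section differentiable_criteria.
Context {R : realType} {V W : normedModType R}.

Lemma differentiable_eps (f : V -> W) (x : V) (df : {linear V -> W}) : continuous df ->
  (forall e : R, 0 < e -> \forall h \near (0 : V), `|f (h + x) - f x - df h| <= e * `|h|) ->
  differentiable f x /\ 'd f x = df :> (V -> W).
Proof.
move=> cdf H.
have e : f \o shift x = cst (f x) + df +o_ (0 : V) id.
  apply/eqaddoP => e e0; apply: filterS (H e e0) => h.
  by rewrite opprD addrA.
have dE := diff_unique cdf e.
by split => //; apply/diff_locallyP; rewrite dE.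
Qed.

Lemma near_eq_differentiable (f g : V -> W) (x : V) :
  (\near x, f x = g x) -> differentiable f x -> differentiable g x.
Proof.
move=> fg df; have [_ /eqaddoP H] := (diff_locallyP _ _).1 df.
have [] := @differentiable_eps g x ('d f x) (diff_continuous df) _ => //.
move=> e e0.
have c : (h + x) @[h --> (0 : V)] --> x.
  by rewrite -[X in _ --> X]add0r; apply: cvgD; [exact: cvg_id|exact: cvg_cst].
have fg' : \forall h \near (0 : V), f (h + x) = g (h + x) by exact: c fg.
apply: filterS2 fg' (H e e0) => h /= e1.
by rewrite -e1 -(nbhs_singleton fg) opprD addrA.
Qed.

End differentiable_criteria.

(** * Boxes, compactness and bounds for continuous functions *)

Section compactness.
Context {R : realType} {n : nat}.
Implicit Types (f : 'rV[R]_n -> R) (x y a b : 'rV[R]_n) (V K : set 'rV[R]_n).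

Lemma closed_cbox a b : closed (cbox a b).
Proof.
rewrite (_ : cbox a b = \bigcap_(i in [set: 'I_n]) ((fun x : 'rV[R]_n => x 0 i) @^-1` `[a 0 i, b 0 i]%classic)).
  apply: closed_bigI => i _; apply: closed_comp; last exact: itv_closed.
  by move=> x _; exact: coord_continuous.
by apply/seteqP; split => [x Hx i _|x Hx i] /=;
  [rewrite in_itv/=; exact: Hx|have := Hx i I; rewrite /= in_itv/=].
Qed.

Lemma cbox_bounded V : bounded_set V -> exists2 C : R, 0 < C & V `<=` cbox (const_mx (- C)) (const_mx C).
Proof.
move=> [M [_ HM]]; exists (`|M| + 1); first by rewrite ltr_wpDl.
move=> x Vx i; rewrite !mxE -ler_norml; apply: le_trans (coord_le_norm _ _) _.
by apply: HM => //; rewrite (le_lt_trans (ler_norm _))// ltrDl.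
Qed.

Lemma bounded_cbox a b : bounded_set (cbox a b).
Proof.
exists (`|a| + `|b|); split; first exact: num_real.
move=> M HM x Hx; apply: norm_row_le => [|i].
  by apply: le_trans (ltW HM); rewrite addr_ge0.
have /andP[h1 h2] := Hx i; apply: le_trans (ltW HM).
have := coord_le_norm a i; have := coord_le_norm b i; rewrite !ler_norml.
by move=> /andP[h3 h4] /andP[h5 h6]; have := normr_ge0 a; have := normr_ge0 b => h7 h8; apply/andP; split; lra.
Qed.

Lemma compact_cbox a b : compact (cbox a b).
Proof. by apply: bounded_closed_compact; [exact: bounded_cbox|exact: closed_cbox]. Qed.

Lemma compact_closure V : bounded_set V -> compact (closure V).
Proof.
move=> /cbox_bounded[C C0 VC]; apply: (subclosed_compact _ (@compact_cbox (const_mx (- C)) (const_mx C))).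
  exact: closed_closure.
by rewrite ((closure_id _).1 (@closed_cbox (const_mx (- C)) (const_mx C))); exact: closureS VC.
Qed.

Lemma compact_cbox_sub K : compact K -> exists2 C : R, 0 < C & K `<=` cbox (const_mx (- C)) (const_mx C).
Proof. by move=> /compact_bounded/cbox_bounded. Qed.

Lemma compact_fun_bound f K : compact K -> continuous f ->
  exists2 C : R, 0 < C & forall x, K x -> `|f x| <= C.
Proof.
move=> cK cf; have : compact (f @` K) by apply: continuous_compact => //; exact: continuous_subspaceT.
move=> /compact_bounded[M [_ HM]]; exists (`|M| + 1); first by rewrite ltr_wpDl.
move=> x Kx; apply: (HM (`|M| + 1)); last by exists x.
by rewrite (le_lt_trans (ler_norm _))// ltrDl.
Qed.

Lemma lintble_compact f V K : open V -> compact K -> K `<=` V -> continuous f ->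
  (forall x, V x -> ~ K x -> f x = 0) -> lintble (fun x => \1_V x * f x).
Proof.
move=> oV cK KV cf f0.
have [C _ KC] := compact_cbox_sub cK; have [D D0 fD] := compact_fun_bound cK cf.
apply: (lintble_bounded (a := const_mx (- C)) (b := const_mx C) (C := D)).
- by apply: lmeasM; [exact/lmeas_indic/open_lmeasurable|exact: continuous_lmeas].
- move=> x; rewrite indicE; case: (pselect (V x)) => Vx; last by rewrite memNset// mul0r normr0 ltW.
  rewrite mem_set// mul1r; case: (pselect (K x)) => Kx; first exact: fD.
  by rewrite f0// normr0 ltW.
- move=> x xC; rewrite indicE; case: (pselect (V x)) => Vx; last by rewrite memNset// mul0r.
  by rewrite f0 ?mulr0// => /KC.
Qed.

End compactness.

(** * Integrals of pullbacks and the Brouwer degree *)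

Section null_lagrangian.
Context {R : realType} {n : nat}.
Implicit Types (f : 'rV[R]_n -> R) (x y a b : 'rV[R]_n) (V K : set 'rV[R]_n).
Implicit Types (U : 'I_n -> 'rV[R]_n -> R) (i j l m : 'I_n).

Lemma invS_cvg_dnbhs : (k.+1%:R^-1 : R) @[k --> \oo] --> (0 : R)^'.
Proof.
move=> A [e /= e0 HA]; have [k _ Hk] := near_infty_natSinv_lt (PosNum e0).
exists k => // m km; apply: HA => /=; last by rewrite invr_neq0 ?pnatr_eq0.
by rewrite sub0r normrN ger0_norm ?invr_ge0//; exact: Hk.
Qed.

(* Translation invariance of the measure makes the integral of every
   difference quotient vanish. *)
Lemma lint_partial0 f i a b (C : R) : (forall x, differentiable f x) ->
  (forall x, `|partial i f x| <= C) -> (forall x, ~ cbox a b x -> f x = 0) ->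
  lintble (partial i f) /\ lint (partial i f) = 0.
Proof.
move=> df fC f0.
have cf : continuous f by move=> x; exact: differentiable_continuous.
have C0 : 0 <= C by apply: le_trans (fC 0).
have lf : lintble f.
  have [D D0 fD] := compact_fun_bound (@compact_cbox R n a b) cf.
  apply: (lintble_bounded (a := a) (b := b) (C := D)) => //; first exact: continuous_lmeas.
  move=> x; case: (pselect (cbox a b x)) => xb; first exact: fD.
  by rewrite f0// normr0 ltW.
pose h (k : nat) : R := k.+1%:R^-1.
have h0 k : 0 < h k by rewrite invr_gt0.
have h1 k : h k <= 1 by rewrite invf_le1// ler1n.
pose F k x := (h k)^-1 * (f (x + h k *: delta_mx 0 i) - f x).
have lF k : lintble (F k) /\ lint (F k) = 0.
  have [l1 l2] := lint_translate (h k *: delta_mx 0 i) lf.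
  split; first by apply: lintbleZ; exact: lintbleB.
  by rewrite lintZ ?lintB ?l2 ?subrr ?mulr0//; exact: lintbleB.
pose a' := a - const_mx 1 : 'rV[R]_n; pose b' := b + const_mx 1 : 'rV[R]_n.
have iC : lintble (fun x => C * \1_(cbox a' b') x).
  apply: lintbleZ; apply: (lintble_bounded (a := a') (b := b') (C := 1)).
  - exact/lmeas_indic/measurable_cbox.
  - by move=> x; rewrite indicE; case: (_ \in _); rewrite ?normr1 ?normr0.
  - by move=> x xb; rewrite indicE memNset.
have FC k x : ~ set0 x -> `|F k x| <= C * \1_(cbox a' b') x.
  move=> _; case: (pselect (cbox a' b' x)) => xb.
    rewrite indicE mem_set// mulr1.
    have [s _ e] := mvt_line x (delta_mx 0 i) df (ltW (h0 k)).
    by rewrite /F e mulKf ?gt_eqF//; exact: fC.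
  rewrite /F !f0 ?subr0 ?mulr0 ?normr0 ?mulr_ge0//.
  - by move=> H; apply: xb => l; have /andP[u v] := H l; rewrite !mxE; apply/andP; split; lra.
  - move=> H; apply: xb => l; have := H l; rewrite !mxE eqxx /=.
    by have := h1 k; have := h0 k; case: (l == i) => /= p q /andP[u v]; apply/andP; split; lra.
have Fl x : ~ set0 x -> F k x @[k --> \oo] --> partial i f x.
  move=> _; have /cvg_ex[D HD] := diff_derivable (v := delta_mx 0 i) (df x).
  have -> : partial i f x = D by rewrite /partial /derive; exact: cvg_lim HD.
  have := cvg_comp _ _ invS_cvg_dnbhs HD; apply: cvg_trans.
  rewrite (_ : _ \o _ = F ^~ x)//; apply/funext => k /=.
  by rewrite /F /h [x + _]addrC.
have mF k : lmeas (F k) by apply: lintble_meas; have [] := lF k.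
have [l1 _ l3] := dominated_lint (N := set0) (F := F) (f := partial i f) null0 mF iC FC Fl.
split => //; rewrite -(cvg_lim _ l3)//.
under eq_fun do rewrite (lF _).2.
exact: lim_cst.
Qed.

Lemma partial_prod (I : eqType) (r : seq I) (F : I -> 'rV[R]_n -> R) i x : uniq r ->
  (forall k, differentiable (F k) x) ->
  differentiable (fun y => \prod_(k <- r) F k y) x /\
  partial i (fun y => \prod_(k <- r) F k y) x =
  \sum_(l <- r) partial i (F l) x * \prod_(k <- r | k != l) F k x.
Proof.
move=> + dF; elim: r => [_|c r IH /= /andP[cr ur]].
  rewrite (_ : (fun y => _) = fun=> 1); last by apply/funext => y; rewrite big_nil.
  by rewrite big_nil partial_cst; split => //; exact: differentiable_cst.
have [d e] := IH ur.
rewrite (_ : (fun y => _) = fun y => F c y * \prod_(k <- r) F k y); last first.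
  by apply/funext => y; rewrite big_cons.
split; first exact: differentiableM.
rewrite partialM// e big_cons big_cons eqxx /=; congr (_ * _ + _).
  rewrite big_seq [RHS]big_seq_cond; apply: eq_bigl => k.
  by case: (boolP (k \in r)) => //= kr; apply/esym; apply: contraNneq cr => <-.
rewrite mulr_sumr [LHS]big_seq [RHS]big_seq; apply: eq_bigr => l lr.
rewrite big_cons ifT; last by apply: contraNneq cr => ->.
by rewrite mulrCA.
Qed.

Definition jac U x : 'M[R]_n := \matrix_(m, i) partial i (U m) x.

(** Divergence form of the determinant. Expanding the derivative of the product produces extra terms
    with second derivatives; they cancel in pairs under exchange of the values of the permutation at
    [j] and [l], which flips the sign and, second derivatives being symmetric, nothing else. *)
Lemma det_jac_div U j x : (forall m, C2 (U m)) ->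
  \det (jac U x) = \sum_(s : 'S_n) (-1) ^+ s *
    partial (s j) (fun y => U j y * \prod_(m | m != j) partial (s m) (U m) y) x.
Proof.
move=> cU.
pose r := [seq m <- index_enum 'I_n | m != j].
have ur : uniq r by rewrite filter_uniq// index_enum_uniq.
pose T l (s : 'S_n) := (-1) ^+ s * (U j x * (partial (s j) (partial (s l) (U l)) x *
  \prod_(m | (m != j) && (m != l)) partial (s m) (U m) x)).
have step (s : 'S_n) : (-1) ^+ s * partial (s j) (fun y => U j y * \prod_(m | m != j) partial (s m) (U m) y) x =
   (-1) ^+ s * (\prod_m partial (s m) (U m) x) + \sum_(l | l != j) T l s.
  have [d e] := @partial_prod _ r (fun m => partial (s m) (U m)) (s j) x ur
    (fun m => ((cU m).2 (s m)).1 x).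
  have eq1 : (fun y => \prod_(m | m != j) partial (s m) (U m) y) =
             (fun y => \prod_(m <- r) partial (s m) (U m) y).
    by apply/funext => y; rewrite big_filter.
  rewrite (_ : (fun y => U j y * _) = (fun y => U j y * (\prod_(m <- r) partial (s m) (U m) y))); last first.
    by apply/funext => y; rewrite big_filter.
  rewrite partialM//; last exact: (cU j).1.
  rewrite mulrDr e; congr (_ + _).
    by rewrite [in RHS](bigD1 j)//= big_filter.
  rewrite /T -!mulr_sumr big_filter; congr (_ * (_ * _)).
  by apply: eq_bigr => l lj; rewrite big_filter_cond.
rewrite (eq_bigr _ (fun s _ => step s)) big_split/= exchange_big/= [X in _ = _ + X]big1 ?addr0.
  by apply: eq_bigr => s _; congr (_ * _); apply: eq_bigr => m _; rewrite mxE.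
move=> l lj; suff H : \sum_(s : 'S_n) T l s = - \sum_(s : 'S_n) T l s.
  by move/eqP: H; rewrite -subr_eq0 opprK -mulr2n mulrn_eq0 => /eqP.
rewrite {1}(reindex_inj (mulgI (tperm j l))) -sumrN; apply: eq_bigr => s _.
rewrite /T odd_permM odd_tperm eq_sym lj /= signrN !permM tpermL tpermR mulNr.
rewrite (eq_bigr (fun m => partial (s m) (U m) x)); last first.
  by move=> m /andP[mj ml]; rewrite permM tpermD// eq_sym.
by rewrite (schwarz _ _ (cU l)).
Qed.

(** The determinant is a sum of derivatives of fields that vanish on [V] outside [K], through the
    factor [U j] or through a factor of some other row; each such derivative has integral 0. *)
Lemma null_lagrangian V K U j : open V -> compact K -> K `<=` V ->
  (forall m, C2 (U m)) ->
  (forall x, V x -> ~ K x -> U j x = 0 \/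
     exists2 m, m != j & forall i, partial i (U m) x = 0) ->
  lint (fun x => \1_V x * \det (jac U x)) = 0.
Proof.
move=> oV cK KV cU H.
have [C C0 KC] := compact_cbox_sub cK.
pose Y (s : 'S_n) y := U j y * \prod_(m | m != j) partial (s m) (U m) y.
have cY s : C1 (Y s).
  apply: C1M; first exact/C2_C1.
  rewrite (_ : (fun x => _) = fun y => \prod_(m <- [seq m <- index_enum 'I_n | m != j]) partial (s m) (U m) y).
    by apply: C1_prod => m; exact: (cU m).2.
  by apply/funext => x; rewrite big_filter.
have Y0 s x : V x -> ~ K x -> Y s x = 0.
  move=> Vx Kx; have [e|[m mj e]] := H x Vx Kx; first by rewrite /Y e mul0r.
  by rewrite /Y (bigD1 m)//= e mul0r mulr0.
(* The extension by zero stays differentiable across the boundary of [V], because [Y s] already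
   vanishes on [V] outside [K]. *)
pose X s x := \1_V x * Y s x.
have XV s x : V x -> \near x, X s x = Y s x.
  move=> Vx; near=> y; rewrite /X indicE mem_set ?mul1r//.
  by near: y; apply: open_nbhs_nbhs; split.
have XK s x : ~ V x -> \near x, X s x = 0.
  move=> Vx; have Kx : ~ K x by move=> /KV.
  near=> y; have Ky : ~ K y.
    near: y; apply: open_nbhs_nbhs; split => //; rewrite openC.
    by apply: compact_closed => //; exact: norm_hausdorff.
  rewrite /X indicE; case: (pselect (V y)) => Vy; last by rewrite memNset// mul0r.
  by rewrite Y0// mulr0.
have dX s x : differentiable (X s) x /\ forall i, partial i (X s) x = \1_V x * partial i (Y s) x.
  case: (pselect (V x)) => Vx.
    have e : \near x, Y s x = X s x by apply: filterS (XV s x Vx) => y ->.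
    split; first by apply: (near_eq_differentiable e); exact: (cY s).1.
    by move=> i; rewrite /partial -(near_eq_derive _ e) indicE mem_set// mul1r.
  have e : \near x, 0 = X s x by apply: filterS (XK s x Vx) => y ->.
  split; first by apply: (near_eq_differentiable e); exact: differentiable_cst.
  by move=> i; rewrite /partial -(near_eq_derive _ e) indicE memNset// mul0r derive_cst.
have [D D0 HD] : exists2 D, 0 < D & forall (s : 'S_n) i x, K x -> `|partial i (Y s) x| <= D.
  have /choice[D HD] (p : 'S_n * 'I_n) : exists D, 0 < D /\ forall x, K x -> `|partial p.2 (Y p.1) x| <= D.
    by have [D D0 HD] := compact_fun_bound cK ((cY p.1).2 p.2); exists D.
  exists (1 + \sum_p D p).
    by rewrite ltr_pwDl// sumr_ge0// => p _; rewrite ltW// (HD p).1.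
  move=> s i x Kx; apply: le_trans ((HD (s, i)).2 x Kx) _.
  rewrite (bigD1 (s, i))//= addrCA lerDl addr_ge0// sumr_ge0// => p _.
  by rewrite ltW// (HD p).1.
have lX (s : 'S_n) : lintble (partial (s j) (X s)) /\ lint (partial (s j) (X s)) = 0.
  apply: (lint_partial0 (a := const_mx (- C)) (b := const_mx C) (C := D)).
  - by move=> x; exact: (dX s x).1.
  - move=> x; rewrite (dX s x).2 indicE; case: (pselect (V x)) => Vx; last first.
      by rewrite memNset// mul0r normr0 ltW.
    rewrite mem_set// mul1r; case: (pselect (K x)) => Kx; first exact: HD.
    have e : \near x, 0 = Y s x.
      near=> y; rewrite Y0//; near: y; apply: open_nbhs_nbhs; split => //.
      by rewrite openC; apply: compact_closed => //; exact: norm_hausdorff.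
    by rewrite /partial -(near_eq_derive _ e) derive_cst normr0 ltW.
  - move=> x xC; rewrite /X indicE; case: (pselect (V x)) => Vx; last by rewrite memNset// mul0r.
    by rewrite Y0 ?mulr0// => /KC.
rewrite (_ : (fun x => _) = fun x => \sum_(s : 'S_n) (-1) ^+ s * partial (s j) (X s) x).
  rewrite lint_sum; last by move=> s; apply: lintbleZ; exact: (lX s).1.
  by rewrite big1// => s _; rewrite lintZ ?(lX s).2 ?mulr0//; exact: (lX s).1.
apply/funext => x; rewrite (det_jac_div j)// mulr_sumr; apply: eq_bigr => s _.
by rewrite (dX s x).2 mulrCA.
Unshelve. all: by end_near. Qed.

End null_lagrangian.

(** * Homotopy invariance of pullbacks of product kernels *)

Section homotopy.
Context {R : realType} {n : nat}.
Implicit Types (x y a b : 'rV[R]_n) (V K : set 'rV[R]_n) (s t : R).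
Implicit Types (u v : 'I_n -> 'rV[R]_n -> R) (i j l m : 'I_n).

Definition rowf u x : 'rV[R]_n := \row_m u m x.

(* [pull V g u] is the integral over [V] of the pullback by [u] of the n-form
   with density [g]. *)
Definition pull V (g : 'rV[R]_n -> R) u : R :=
  lint (fun x => \1_V x * (g (rowf u x) * \det (jac u x))).

(** An unnormalized kernel living on the cube [0, s]^n. It is a product of one-variable functions,
    so its pullback can be integrated coordinate by coordinate. *)
Definition kern s y : R := \prod_(m < n) bump (y 0 m / s).

Lemma continuous_rowf u : (forall m, continuous (u m)) -> continuous (rowf u).
Proof.
move=> cu x A /nbhs_ballP[e /= e0 HA].
have H m : nbhs x [set y : 'rV[R]_n | `|u m x - u m y| < e / 2].
  by have /cvgrPdist_lt/(_ (e / 2)) := cu m x; apply; rewrite divr_gt0.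
have : nbhs x [set y : 'rV[R]_n | forall m, `|u m x - u m y| < e / 2].
  exact: filter_forall H.
apply: filterS => y Hy; apply: HA; rewrite -ball_normE /ball_/=.
apply: (@le_lt_trans _ _ (e / 2)); last by rewrite ltr_pdivrMr// ltr_pMr// ltrDl.
apply: norm_row_le; first by rewrite divr_ge0// ltW.
by move=> m; rewrite !mxE; exact: ltW.
Qed.

Lemma continuous_det (F : 'rV[R]_n -> 'M[R]_n) :
  (forall i j, continuous (fun x => F x i j)) -> continuous (fun x => \det (F x)).
Proof.
move=> cF; rewrite /determinant.
have cp (s : 'S_n) : continuous (fun x => (-1) ^+ s * \prod_i F x i (s i)).
  apply: continuous_mulf; first exact: continuous_cstf.
  elim: (index_enum _) => [|i r IH].
    by under [X in continuous X]funext do rewrite big_nil; exact: continuous_cstf.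
  by under [X in continuous X]funext do rewrite big_cons; exact: continuous_mulf.
elim: (index_enum _) => [|i r IH].
  by under [X in continuous X]funext do rewrite big_nil; exact: continuous_cstf.
by under [X in continuous X]funext do rewrite big_cons; exact: continuous_addf.
Qed.

Lemma continuous_jac u : (forall m, C1 (u m)) -> continuous (fun x => \det (jac u x)).
Proof.
move=> cu; apply: continuous_det => m i.
by under [X in continuous X]funext do rewrite mxE; exact: (cu m).2.
Qed.

Lemma continuous_kern s : continuous (kern s).
Proof.
rewrite /kern; elim: (index_enum _) => [|i r IH].
  by under [X in continuous X]funext do rewrite big_nil; exact: continuous_cstf.
under [X in continuous X]funext do rewrite big_cons; apply: continuous_mulf => //.
apply: continuous_compf; first exact: (diffn_continuous (diffn_bump 0)).
by apply: continuous_mulf; [exact: coord_continuous|exact: continuous_cstf].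
Qed.

Lemma bump_scale_out s t : 0 < s -> s <= `|t| -> bump (t / s) = 0.
Proof.
move=> s0; rewrite ler_normr => /orP[h|h]; apply: bump_out.
  by right; rewrite ler_pdivlMr// mul1r.
by left; rewrite ler_pdivrMr// mul0r -oppr_ge0 (le_trans (ltW s0)).
Qed.

Lemma kern_out s y : 0 < s -> (exists m, s <= `|y 0 m|) -> kern s y = 0.
Proof. by move=> s0 [m h]; rewrite /kern (bigD1 m)//= bump_scale_out// mul0r. Qed.

Lemma lintble_pull V K (g : 'rV[R]_n -> R) u : open V -> compact K -> K `<=` V ->
  continuous g -> (forall m, C1 (u m)) ->
  (forall x, V x -> ~ K x -> g (rowf u x) = 0) ->
  lintble (fun x => \1_V x * (g (rowf u x) * \det (jac u x))).
Proof.
move=> oV cK KV cg cu g0; apply: lintble_compact cK KV _ _ => //.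
  apply: continuous_mulf; last exact: continuous_jac.
  move=> x; apply: continuous_comp; last exact: cg.
  by apply: continuous_rowf => m; exact: C1_continuous.
by move=> x Vx Kx; rewrite g0 ?mul0r.
Qed.

(** The map [u] followed in each coordinate by a primitive of t |-> [bump] (t / s). *)
Definition stepf s u : 'I_n -> 'rV[R]_n -> R := fun m x => s * smooth_step (u m x / s).

Lemma diffn_step s k : diffn k (fun t => s * smooth_step (t / s)).
Proof.
apply: diffnM; first exact: diffn_cst.
apply: (diffn_comp (u := smooth_step)); last by apply: diffnM; [exact: diffn_id|exact: diffn_cst].
case: k => [|k].
  move=> t; apply/differentiable_continuous/derivable1_diffP.
  by have [] := is_derive_smooth_step t.
split; first by move=> t; have [] := is_derive_smooth_step t.
rewrite (_ : derive1 _ = bump); first exact: diffn_bump.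
by apply/funext => t; rewrite derive1E; have [_ ->] := is_derive_smooth_step t.
Qed.

Lemma C2_stepf s u m : C2 (u m) -> C2 (stepf s u m).
Proof. by move=> cu; exact: (C2_comp (diffn_step s 2) cu). Qed.

Lemma derive_step s t : 0 < s -> derive1 (fun t => s * smooth_step (t / s)) t = bump (t / s).
Proof.
move=> s0; rewrite derive1E.
have d1 : is_derive t 1 (fun t : R => t / s) s^-1.
  have := is_deriveZ s^-1 (is_derive_id t (1 : R)).
  rewrite (_ : s^-1 \*: id = fun t : R => t / s); last by apply/funext => r; rewrite /= mulrC.
  by rewrite /GRing.scale/= mulr1.
have d2 := @is_derive1_comp R smooth_step (fun t => t / s) t _ _ (is_derive_smooth_step (t / s)) d1.
have := is_deriveZ s d2.
rewrite /GRing.scale/= mulrCA mulfV ?gt_eqF// mulr1.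
by case=> _ <-.
Qed.

Lemma partial_stepf s u m i x : 0 < s -> differentiable (u m) x ->
  partial i (stepf s u m) x = bump (u m x / s) * partial i (u m) x.
Proof.
move=> s0 du; have [ds _] := diffn_step s 1.
by have [_] := partial_comp i (ds (u m x)) du; rewrite derive_step.
Qed.

Lemma jacE u x m i : jac u x m i = partial i (u m) x.
Proof. by rewrite mxE. Qed.

(** The chain rule multiplies row m by the m-th factor of the kernel. So the pullback of [kern s] is
    itself a Jacobian determinant, to which the null Lagrangian property applies. *)
Lemma det_jac_stepf s u x : 0 < s -> (forall m, differentiable (u m) x) ->
  \det (jac (stepf s u) x) = kern s (rowf u x) * \det (jac u x).
Proof.
move=> s0 du.
rewrite (_ : jac _ _ = diag_mx (\row_m bump (u m x / s)) *m jac u x).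
  rewrite det_mulmx det_diag /kern; congr (_ * _).
  by apply: eq_bigr => m _; rewrite !mxE.
by apply/matrixP => m i; rewrite mul_diag_mx !mxE partial_stepf.
Qed.

(** Determinants are linear in row [j], so the difference of the two integrands is the Jacobian of a
    map whose [j]-th coordinate is the difference of two steps. Outside [K] either another
    coordinate is beyond [s], where its step is constant, or both [j]-th coordinates are beyond [s]
    on the same side, where the two steps agree. *)
Lemma pull_one_coord V K s u v j : open V -> compact K -> K `<=` V -> 0 < s ->
  (forall m, C2 (u m)) -> (forall m, C2 (v m)) ->
  (forall m, m != j -> u m = v m) ->
  (forall x, V x -> ~ K x -> (exists2 m, m != j & s <= `|u m x|) \/
     (s <= u j x /\ s <= v j x) \/ (u j x <= - s /\ v j x <= - s)) ->
  pull V (kern s) u = pull V (kern s) v.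
Proof.
move=> oV cK KV s0 cu cv uv H.
have lu : lintble (fun x => \1_V x * (kern s (rowf u x) * \det (jac u x))).
  apply: lintble_pull cK KV _ _ _ => //; first exact: continuous_kern.
    by move=> m; exact: C2_C1.
  move=> x Vx Kx; apply: kern_out => //; have [[m mj h]|[[h _]|[h _]]] := H x Vx Kx.
  - by exists m; rewrite mxE.
  - by exists j; rewrite mxE (le_trans h)// ler_norm.
  - by exists j; rewrite mxE -normrN (le_trans _ (ler_norm _))// lerNr.
have lv : lintble (fun x => \1_V x * (kern s (rowf v x) * \det (jac v x))).
  apply: lintble_pull cK KV _ _ _ => //; first exact: continuous_kern.
    by move=> m; exact: C2_C1.
  move=> x Vx Kx; apply: kern_out => //; have [[m mj h]|[[_ h]|[_ h]]] := H x Vx Kx.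
  - by exists m; rewrite mxE -uv.
  - by exists j; rewrite mxE (le_trans h)// ler_norm.
  - by exists j; rewrite mxE -normrN (le_trans _ (ler_norm _))// lerNr.
apply/eqP; rewrite -subr_eq0 -(lintB lu lv).
pose W m x := if m == j then stepf s u j x - stepf s v j x else stepf s u m x.
have cW m : C2 (W m).
  rewrite /W; case: (m == j); last exact: C2_stepf.
  by apply: C2B; exact: C2_stepf.
have W0 x : V x -> ~ K x -> W j x = 0 \/ exists2 m, m != j & forall i, partial i (W m) x = 0.
  move=> Vx Kx; have [[m mj h]|H'] := H x Vx Kx.
    right; exists m => // i; rewrite /W (negbTE mj).
    by rewrite (partial_stepf _ s0 ((cu m).1 x)) bump_scale_out// mul0r.
  left; rewrite /W eqxx /stepf; case: H' => -[h1 h2].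
    by rewrite !smooth_step_ge1 ?subrr// ler_pdivlMr// mul1r.
  rewrite !(smooth_step_le0 (t := _ / s)) ?subrr// ler_pdivrMr// mul0r.
    by rewrite (le_trans h2)// oppr_le0 ltW.
  by rewrite (le_trans h1)// oppr_le0 ltW.
rewrite -(null_lagrangian oV cK KV cW W0); apply/eqP; congr lint; apply/funext => x.
rewrite -mulrBr; congr (_ * _).
rewrite -!det_jac_stepf//; last 2 first.
- by move=> m; exact: (cv m).1.
- by move=> m; exact: (cu m).1.
have du m : differentiable (stepf s u m) x by exact: (C2_stepf s (cu m)).1.
have dv m : differentiable (stepf s v m) x by exact: (C2_stepf s (cv m)).1.
have Wj : W j = fun y => stepf s u j y - stepf s v j y.
  by apply/funext => y; rewrite /W eqxx.
have Wm m : m != j -> W m = stepf s u m.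
  by move=> /negbTE mj; apply/funext => y; rewrite /W mj.
rewrite [RHS](determinant_multilinear (B := jac (stepf s u) x) (C := jac (stepf s v) x) (i0 := j) (b := 1) (c := -1)).
- by rewrite mul1r mulN1r.
- apply/rowP => i; rewrite [LHS]mxE jacE Wj scale1r scaleN1r.
  rewrite [RHS]mxE [X in _ = X + _]mxE jacE [X in _ = _ + X]mxE [X in _ = _ - X]mxE jacE.
  have := is_deriveB (is_derive_partial i (du j)) (is_derive_partial i (dv j)).
  by move=> [_ <-].
- apply/matrixP => m i; rewrite [LHS]mxE [RHS]mxE !jacE Wm//.
  by rewrite eq_sym neq_lift.
- apply/matrixP => m i; rewrite [LHS]mxE [RHS]mxE !jacE Wm; last by rewrite eq_sym neq_lift.
  by rewrite /stepf uv// eq_sym neq_lift.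
Qed.

Lemma far_close (a b s : R) : 0 < s -> 2 * s < `|a| -> `|a - b| <= s ->
  [/\ s <= `|a|, s <= `|b| & (s <= a /\ s <= b) \/ (a <= - s /\ b <= - s)].
Proof.
move=> s0; rewrite ltr_normr !ler_normr ler_norml => /orP[h|h] /andP[h1 h2].
  by split; [apply/orP; left; lra|apply/orP; left; lra|left; split; lra].
by split; [apply/orP; right; lra|apply/orP; right; lra|right; split; lra].
Qed.

(** Where a coordinate of [u] exceeds 2 s in absolute value, that of [v] has the same sign and both
    exceed s; hence every mixture of coordinates of [u] and [v] stays admissible while they are
    exchanged one by one. *)
Lemma pull_close V s u v : open V -> bounded_set V -> 0 < s ->
  (forall m, C2 (u m)) -> (forall m, C2 (v m)) ->
  (forall x, closure V x -> forall m, `|u m x - v m x| <= s) ->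
  (forall x, bnd V x -> exists m, 2 * s < `|u m x|) ->
  pull V (kern s) u = pull V (kern s) v.
Proof.
move=> oV bV s0 cu cv uv H.
pose K := closure V `&` [set x | forall m, `|u m x| <= 2 * s].
have cK : compact K.
  apply: compact_closedI; first exact: compact_closure.
  rewrite (_ : [set x | _] = \bigcap_(m in [set: 'I_n]) (fun x => `|u m x|) @^-1` [set r | r <= 2 * s]).
    apply: closed_bigI => m _; apply: closed_comp; last exact: closed_le.
    move=> x _; apply: (@continuous_compf _ _ (fun r => `|r|)); first exact: norm_continuous.
    exact: C1_continuous (C2_C1 (cu m)).
  by apply/seteqP; split => [x Hx m _|x Hx m]; [exact: Hx|exact: (Hx m I)].
have KV : K `<=` V.
  move=> x [cx Hx]; apply: contrapT => Vx.
  have [|m] := H x; first by split => // /interior_subset.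
  by rewrite ltNge Hx.
(* The first [p] coordinates are already those of [v]. *)
pose w (p : nat) m := if (m < p)%N then v m else u m.
have cw p m : C2 (w p m) by rewrite /w; case: ifP.
have w0 : w 0%N = u by apply/funext => m; rewrite /w ltn0.
have wn : w n = v by apply/funext => m; rewrite /w ltn_ord.
have stepE p (pn : (p < n)%N) : pull V (kern s) (w p.+1) = pull V (kern s) (w p).
  apply/esym; pose j := Ordinal pn.
  have wj : w p j = u j by rewrite /w ltnn.
  have wj' : w p.+1 j = v j by rewrite /w ltnSn.
  apply: (pull_one_coord (j := j) oV cK KV s0 (cw p) (cw p.+1)).
    by move=> m; rewrite -val_eqE/= => mj; rewrite /w ltnS [(m <= p)%N]leq_eqVlt (negbTE mj).
  move=> x Vx Kx.
  have [m Hm] : exists m, 2 * s < `|u m x|.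
    apply: contrapT => /forallNP H'; apply: Kx; split; first exact: subset_closure.
    by move=> m; rewrite leNgt; apply/negP; exact: H'.
  have [h1 h2 h3] := far_close s0 Hm (uv x (subset_closure Vx) m).
  case: (eqVneq m j) => [mj|mj]; last by left; exists m; rewrite // /w; case: ifP.
  by right; rewrite wj wj' -mj.
suff E p : (p <= n)%N -> pull V (kern s) (w p) = pull V (kern s) u by rewrite -wn E.
elim: p => [|p IH] pn; first by rewrite w0.
by rewrite (stepE _ pn); exact: IH (ltnW pn).
Qed.

(** The linear homotopy is cut into finitely many steps, each of which moves every coordinate by at
    most [s] on the closure, as [pull_close] asks. *)
Lemma pull_homotopy V s u v : open V -> bounded_set V -> 0 < s ->
  (forall m, C2 (u m)) -> (forall m, C2 (v m)) ->
  (forall x t, bnd V x -> 0 <= t <= 1 -> exists m, 2 * s < `|(1 - t) * u m x + t * v m x|) ->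
  pull V (kern s) u = pull V (kern s) v.
Proof.
move=> oV bV s0 cu cv H.
have /choice[D HD] : forall m, exists D, 0 < D /\ forall x, closure V x -> `|u m x - v m x| <= D.
  move=> m; have [D D0 HD] := compact_fun_bound (compact_closure bV)
    (C1_continuous (C2_C1 (C2B (cu m) (cv m)))).
  by exists D.
pose E := 1 + \sum_m D m.
have E0 : 0 < E by rewrite ltr_pwDl// sumr_ge0// => m _; rewrite ltW// (HD m).1.
have HE m x : closure V x -> `|u m x - v m x| <= E.
  move=> Vx; apply: le_trans ((HD m).2 x Vx) _.
  rewrite /E (bigD1 m)//= addrCA lerDl addr_ge0// sumr_ge0// => p _.
  by rewrite ltW// (HD p).1.
pose N := (Num.truncn (E / s)).+1.
have N0 : 0 < N%:R :> R by rewrite ltr0n.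
have ENs : E / N%:R <= s.
  by rewrite ler_pdivrMr// mulrC -ler_pdivrMr//; exact/ltW/truncnS_gt.
pose w (p : nat) m x := (1 - p%:R / N%:R) * u m x + (p%:R / N%:R) * v m x.
have cw p m : C2 (w p m) by apply: C2D; exact: C2Z.
have w0 : w 0%N = u.
  by apply/funext => m; apply/funext => x; rewrite /w mul0r subr0 mul1r mul0r addr0.
have wN : w N = v.
  by apply/funext => m; apply/funext => x; rewrite /w divff ?gt_eqF// subrr mul0r add0r mul1r.
have diffw p m x : `|w p m x - w p.+1 m x| = `|u m x - v m x| / N%:R.
  rewrite (_ : _ - _ = (u m x - v m x) / N%:R).
    by rewrite normrM normfV [`|N%:R|]gtr0_norm.
  by rewrite /w -[p.+1]addn1 natrD; field; rewrite gt_eqF.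
have stepE p (pN : (p < N)%N) : pull V (kern s) (w p.+1) = pull V (kern s) (w p).
  apply/esym; apply: (pull_close oV bV s0 (cw p) (cw p.+1)).
    move=> x Vx m; rewrite diffw; apply: le_trans ENs.
    by rewrite ler_pM2r ?invr_gt0// HE.
  move=> x Vx; apply: (H x (p%:R / N%:R) Vx); apply/andP; split; first by rewrite divr_ge0.
  by rewrite ler_pdivrMr// mul1r ler_nat ltnW.
suff F p : (p <= N)%N -> pull V (kern s) (w p) = pull V (kern s) u by rewrite -wN F.
elim: p => [|p IH] pN; first by rewrite w0.
by rewrite (stepE _ pN); exact: IH (ltnW pN).
Qed.

End homotopy.

(** * Local degree of invertible linear maps *)

Section linear_degree.
Context {R : realType} {n : nat}.
Implicit Types (x y a b : 'rV[R]_n) (V K : set 'rV[R]_n) (s t r : R) (A B : 'M[R]_n).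
Implicit Types (u v : 'I_n -> 'rV[R]_n -> R) (i j l m : 'I_n).

(** On the compact product of the boundary with [0, 1], a homotopy without zeros is bounded away
    from 0; this gives the margin for all small kernels at once. *)
Lemma pull_homotopy_ex V u v : open V -> bounded_set V ->
  (forall m, C2 (u m)) -> (forall m, C2 (v m)) ->
  (forall x t, bnd V x -> 0 <= t <= 1 -> exists m, (1 - t) * u m x + t * v m x != 0) ->
  exists2 s0 : R, 0 < s0 & forall s, 0 < s -> s < s0 ->
    pull V (kern s) u = pull V (kern s) v.
Proof.
move=> oV bV cu cv H.
pose F (p : 'rV[R]_n * R) m : R := (1 - p.2) * u m p.1 + p.2 * v m p.1.
pose f p := \sum_m `|F p m|.
have cF m : continuous (F ^~ m).
  move=> p; have c1 : {for p, continuous (fun q : 'rV[R]_n * R => u m q.1)}.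
    by apply: (@continuous_comp _ _ _ fst (u m)); [exact: cvg_fst|exact: C1_continuous (C2_C1 (cu m)) _].
  have c2 : {for p, continuous (fun q : 'rV[R]_n * R => v m q.1)}.
    by apply: (@continuous_comp _ _ _ fst (v m)); [exact: cvg_fst|exact: C1_continuous (C2_C1 (cv m)) _].
  have c3 : {for p, continuous (fun q : 'rV[R]_n * R => q.2)} by exact: cvg_snd.
  have c4 : {for p, continuous (fun q : 'rV[R]_n * R => 1 - q.2)}.
    by apply: continuousB => //; exact: cst_continuous.
  exact: continuousD (continuousM c4 c1) (continuousM c3 c2).
have cf : continuous f.
  rewrite /f; elim: (index_enum _) => [|m r IH].
    by under [X in continuous X]funext do rewrite big_nil; exact: cst_continuous.
  under [X in continuous X]funext do rewrite big_cons.
  move=> p; have cm : {for p, continuous (fun q => `|F q m|)}.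
    exact: (continuous_comp (cF m p) (@norm_continuous _ _ _)).
  exact: continuousD cm (IH p).
have cbV : compact (bnd V).
  apply: subclosed_compact (compact_closure bV) _; last by move=> x [].
  rewrite /bnd ((interior_id V).1 oV) setDE.
  by apply: closedI; [exact: closed_closure|rewrite closedC].
have [B0|/set0P[x0 Bx0]] := eqVneq (bnd V) set0.
  exists 1; first exact: ltr01.
  by move=> s s0 _; apply: (pull_homotopy oV bV s0 cu cv) => x t; rewrite B0.
have K0 : (bnd V `*` (`[0, 1]%classic : set R)) !=set0.
  by exists (x0, 0 : R); split => //=; rewrite in_itv/= lexx ler01.
have [[xm tm] /set_mem[/= Bm tI] cmin] := compact_EVT_min K0
  (compact_setX cbV (@segment_compact R 0 1)) (continuous_subspaceT cf).
rewrite in_itv/= in tI.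
have c0 : 0 < f (xm, tm).
  have [m Hm] := H _ _ Bm tI; rewrite /f (bigD1 m)//= ltr_pwDl ?normr_gt0//.
  by rewrite sumr_ge0.
(* If every coordinate were at most 2 s in absolute value, their sum would be at most 2 n s, which
   is below the minimum of [f]. *)
exists (f (xm, tm) / (2 * n.+1%:R)); first by rewrite divr_gt0// mulr_gt0.
move=> s s0 ss; apply: (pull_homotopy oV bV s0 cu cv) => x t Bx tI'.
apply: contrapT => /forallNP Hm.
have : f (xm, tm) <= f (x, t) by apply: cmin; rewrite inE; split => //=; rewrite in_itv/=.
apply/negP; rewrite -ltNge; apply: le_lt_trans (_ : \sum_(m < n) 2 * s < _).
  by apply: ler_sum => m _; rewrite leNgt; apply/negP; exact: Hm.
rewrite sumr_const card_ord -[X in X < _]mulr_natr.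
rewrite ltr_pdivlMr ?mulr_gt0// in ss; apply: le_lt_trans ss.
have -> : s * (2 * n.+1%:R) = 2 * s * n.+1%:R by ring.
by apply: ler_wpM2l; [rewrite mulr_ge0// ltW|rewrite ler_nat].
Qed.

Definition linf A a : 'I_n -> 'rV[R]_n -> R := fun m x => \sum_i A m i * (x 0 i - a 0 i).

Lemma partial_coord i j x : partial j (fun x : 'rV[R]_n => x 0 i) x = (i == j)%:R.
Proof.
rewrite /partial /derive.
have -> : (fun h : R => h^-1 *: (((fun x : 'rV[R]_n => x 0 i) \o shift x) (h *: delta_mx 0 j) - x 0 i)) =
   (fun h : R => h^-1 * h * (i == j)%:R).
  by apply/funext => h /=; rewrite /GRing.scale/= !mxE eqxx/= addrK mulrA.
apply: cvg_lim => //; apply: (@cvg_trans _ ((fun=> (i == j)%:R) @ (0 : R)^')).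
  apply: near_eq_cvg; near=> h; rewrite mulVf ?mul1r//.
  by near: h; exact: nbhs_dnbhs_neq.
exact: cvg_cst.
Unshelve. all: by end_near. Qed.

Lemma C2_coord i : C2 (fun x : 'rV[R]_n => x 0 i).
Proof.
split; first by move=> x; exact: differentiable_coord.
move=> j; rewrite (_ : partial j _ = fun=> ((i == j)%:R : R)); first exact: C1_cst.
by apply/funext => x; exact: partial_coord.
Qed.

Lemma C2_sum (I : Type) (r : seq I) (F : I -> 'rV[R]_n -> R) :
  (forall k, C2 (F k)) -> C2 (fun x => \sum_(k <- r) F k x).
Proof.
move=> cF; elim: r => [|k r IH].
  by under [X in C2 X]funext do rewrite big_nil; exact: C2_cst.
by under [X in C2 X]funext do rewrite big_cons; exact: (C2D (cF k) IH).
Qed.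

Lemma partial_sum (I : Type) (r : seq I) (F : I -> 'rV[R]_n -> R) i x :
  (forall k, C2 (F k)) ->
  partial i (fun x => \sum_(k <- r) F k x) x = \sum_(k <- r) partial i (F k) x.
Proof.
move=> cF; elim: r => [|k r IH].
  by rewrite big_nil; under [X in partial _ X]funext do rewrite big_nil; exact: partial_cst.
rewrite big_cons -IH; under [X in partial _ X]funext do rewrite big_cons.
by apply: partialD; [exact: (cF k).1|exact: (C2_sum r cF).1].
Qed.

Lemma C2_linf A a m : C2 (linf A a m).
Proof.
apply: C2_sum => i; apply: C2Z; apply: C2B; [exact: C2_coord|exact: C2_cst].
Qed.

Lemma jac_linf A a x : jac (linf A a) x = A.
Proof.
apply/matrixP => m j; rewrite jacE /linf partial_sum; last first.
  by move=> i; apply: C2Z; apply: C2B; [exact: C2_coord|exact: C2_cst].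
rewrite (bigD1 j)//= big1 ?addr0 => [|i ij].
  rewrite partialM; [|exact: differentiable_cst|exact: (C2B (C2_coord j) (C2_cst _)).1].
  rewrite partial_cst mul0r add0r partialD; [|exact: differentiable_coord|exact: differentiable_cst].
  by rewrite partial_cst addr0 partial_coord eqxx mulr1.
rewrite partialM; [|exact: differentiable_cst|exact: (C2B (C2_coord i) (C2_cst _)).1].
rewrite partial_cst mul0r add0r partialD; [|exact: differentiable_coord|exact: differentiable_cst].
by rewrite partial_cst addr0 partial_coord (negbTE ij) mulr0.
Qed.

Lemma linf_mulmx A a x : (forall m, linf A a m x = 0) -> A *m (x - a)^T = 0.
Proof.
move=> H; apply/matrixP => m k; rewrite (ord1 k) [RHS]mxE -[RHS](H m) mxE.
by apply: eq_bigr => i _; rewrite !mxE.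
Qed.

Lemma linf_neq0 A a x : A \in unitmx -> x != a -> exists m, linf A a m x != 0.
Proof.
move=> uA xa; apply: contrapT => /forallNP H.
have /linf_mulmx e : forall m, linf A a m x = 0.
  by move=> m; apply/eqP; apply: contrapT => /negP; exact: H.
move/(congr1 (mulmx (invmx A))): e; rewrite mulKmx// mulmx0 => /(congr1 trmx).
by rewrite trmxK trmx0 => /eqP; rewrite subr_eq0 (negbTE xa).
Qed.

(** The local degree at [a] of x |-> A (x - a) is the sign of its determinant, as seen by all small
    kernels. *)
Definition good V a A := exists2 s0 : R, 0 < s0 & forall s, 0 < s -> s < s0 ->
  pull V (kern s) (linf A a) = Num.sg (\det A) * lint (@kern R n s).

Lemma good_path V a A B : open V -> bounded_set V -> V a ->
  Num.sg (\det A) = Num.sg (\det B) ->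
  (forall t, 0 <= t <= 1 -> (1 - t) *: A + t *: B \in unitmx) ->
  good V a B -> good V a A.
Proof.
move=> oV bV Va sAB uAB [s1 s10 H1].
have [||x t Bx tI|s2 s20 H2] := @pull_homotopy_ex V (linf A a) (linf B a) oV bV.
- exact: C2_linf.
- exact: C2_linf.
- have xa : x != a.
    by apply/eqP => xa; case: Bx => _; apply; rewrite xa; rewrite ((interior_id V).1 oV).
  have [m Hm] := linf_neq0 (uAB t tI) xa; exists m.
  apply: contra_neq Hm => <-; rewrite /linf !mulr_sumr -big_split /=.
  by apply: eq_bigr => i _; rewrite !mxE mulrDl !mulrA.
exists (Num.min s1 s2); first by rewrite lt_min s10.
move=> s s0; rewrite lt_min => /andP[h1 h2].
by rewrite (H2 _ s0 h2) (H1 _ s0 h1) sAB.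
Qed.

Definition sgmx (pi : 'S_n) (e : 'I_n -> bool) : 'M[R]_n :=
  perm_mx pi *m diag_mx (\row_i (-1) ^+ e i).

Lemma sgmxE pi e m i : sgmx pi e m i = if i == pi m then (-1) ^+ e i else 0.
Proof.
rewrite /sgmx mul_mx_diag !mxE eq_sym; case: eqP => _; by rewrite ?mul1r ?mul0r.
Qed.

Lemma lintble_continuous (f : 'rV[R]_n -> R) a b : continuous f ->
  (forall x, ~ cbox a b x -> f x = 0) -> lintble f.
Proof.
move=> cf f0; have := @lintble_compact R n f setT (cbox a b) openT (@compact_cbox R n a b) (fun _ _ => I) cf (fun x _ => f0 x).
by under [X in lintble X -> _]funext do rewrite indicT mul1r.
Qed.

Lemma lintble_kern s : 0 < s -> lintble (@kern R n s).
Proof.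
move=> s0; apply: (@lintble_continuous _ (const_mx (- s)) (const_mx s)).
  exact: continuous_kern.
move=> x /existsNP[i Hi]; apply: kern_out => //; exists i; rewrite leNgt; apply/negP => h.
by apply: Hi; rewrite !mxE -ler_norml ltW.
Qed.

(** The only case that is integrated explicitly: signed permutations preserve the measure, and for
    small [s] the preimage of the cube of the kernel lies in [V]. *)
Lemma good_sgmx V a pi e : open V -> V a -> good V a (sgmx pi e).
Proof.
move=> oV Va.
have /nbhs_ballP[r /= r0 Hr] : nbhs a V by apply: open_nbhs_nbhs; split.
exists r => // s s0 sr.
have dE : \det (sgmx pi e) = Num.sg (\det (sgmx pi e)).
  have d2 : \det (sgmx pi e) ^+ 2 = 1.
    rewrite /sgmx det_mulmx det_perm det_diag exprMn sqrr_sign mul1r -prodrXl big1// => i _.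
    by rewrite mxE sqrr_sign.
  by have /eqP := d2; rewrite sqrf_eq1 => /orP[] /eqP ->; rewrite ?sgrN1 ?sgr1.
pose c : 'rV[R]_n := \row_m - ((-1) ^+ e (pi m) * a 0 (pi m)).
have E x : rowf (linf (sgmx pi e) a) x = sperm pi (e \o pi) c x.
  apply/rowP => m; rewrite !mxE /linf (bigD1 (pi m))//= big1 ?addr0 => [|i ipi].
    by rewrite sgmxE eqxx mulrBr.
  by rewrite sgmxE (negbTE ipi) mul0r.
have ik := lintble_kern s0; have [ik' <-] := lint_sperm pi (e \o pi) c ik.
rewrite -dE -(lintZ _ ik'); congr lint; apply/funext => x.
rewrite E jac_linf indicE; case: (pselect (V x)) => Vx.
  by rewrite mem_set// mul1r mulrC.
rewrite memNset// mul0r kern_out ?mulr0//.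
apply: contrapT => /forallNP H; apply: Vx; apply: Hr; rewrite -ball_normE /ball_/=.
apply: le_lt_trans sr; apply: norm_row_le; first exact: ltW.
move=> i; have /negP := H (perm_inv pi i); rewrite -ltNge => /ltW.
by rewrite !mxE /= permKV -mulrBr normrM normrX normrN1 expr1n mul1r distrC.
Qed.

Lemma sgr_prod (F : 'I_n -> R) : Num.sg (\prod_i F i) = \prod_i Num.sg (F i).
Proof. exact: (big_morph Num.sg (@sgrM R) (@sgr1 R)). Qed.

Lemma det_upper (U : 'M[R]_n) : (forall i j, (j < i)%N -> U i j = 0) -> \det U = \prod_i U i i.
Proof.
move=> H; rewrite -det_tr det_trig; first by apply: eq_bigr => i _; rewrite mxE.
by apply/is_trig_mxP => i j ij; rewrite mxE H.
Qed.

Lemma lincE A B t i j : ((1 - t) *: A + t *: B) i j = (1 - t) * A i j + t * B i j.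
Proof. by rewrite !mxE. Qed.

(** With D the diagonal of U and S the matrix of its signs, straight segments of invertible matrices
    join P L U to P L D, to P D, to P S, which is a signed permutation. Triangularity keeps the
    determinant nonzero along each of them. *)
Lemma good_lu V a (pi : 'S_n) (L U : 'M[R]_n) : open V -> bounded_set V -> V a ->
  (forall i j, (i <= j)%N -> L i j = (i == j)%:R) ->
  (forall i j, (j < i)%N -> U i j = 0) -> (forall i, U i i != 0) ->
  good V a (perm_mx pi *m L *m U).
Proof.
move=> oV bV Va lL uU U0.
pose D := diag_mx (\row_i U i i) : 'M[R]_n.
pose S := diag_mx (\row_i Num.sg (U i i)) : 'M[R]_n.
have dU : \det U = \prod_i U i i by exact: det_upper.
have dD : \det D = \prod_i U i i by rewrite det_diag; apply: eq_bigr => i _; rewrite mxE.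
have dS : \det S = \prod_i Num.sg (U i i) by rewrite det_diag; apply: eq_bigr => i _; rewrite mxE.
have dL t : \det ((1 - t) *: L + t *: 1%:M) = 1.
  rewrite det_trig; last first.
    apply/is_trig_mxP => i j ij; have ij' : (i == j) = false by rewrite -val_eqE; exact: ltn_eqF.
    by rewrite lincE (lL _ _ (ltnW ij)) mxE ij' !mulr0 addr0.
  by rewrite big1// => i _; rewrite lincE (lL _ _ (leqnn i)) mxE eqxx !mulr1 subrK.
have dL1 : \det L = 1 by have := dL 0; rewrite subr0 scale1r scale0r addr0.
have pne : \prod_i U i i != 0 by apply/prodf_neq0 => i _.
have up : (perm_mx pi : 'M[R]_n) \in unitmx by exact: unitmx_perm.
have uL t : ((1 - t) *: L + t *: 1%:M) \in unitmx by rewrite unitmxE dL unitr1.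
have uL1 : L \in unitmx by rewrite unitmxE dL1 unitr1.
have uD : D \in unitmx by rewrite unitmxE dD unitfE.
have gS : good V a (perm_mx pi *m S).
  rewrite (_ : S = diag_mx (\row_i (-1) ^+ (U i i < 0)%R)); first exact: good_sgmx.
  by congr diag_mx; apply/rowP => i; rewrite !mxE; rewrite -[LHS]/(Num.sg (U i i)) /Num.sg (negbTE (U0 i)); case: ifP.
have gD : good V a (perm_mx pi *m D).
  apply: good_path gS => //.
    rewrite !det_mulmx !sgrM dD dS !sgr_prod; congr (_ * _).
    by apply: eq_bigr => i _; rewrite sgr_id.
  move=> t /andP[t0 t1]; rewrite !scalemxAr -mulmxDr unitmx_mul up/=.
  rewrite (_ : _ + _ = diag_mx (\row_i ((1 - t) * U i i + t * Num.sg (U i i)))); last first.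
    by apply/matrixP => i j; rewrite !mxE; case: (i == j); rewrite ?mulr1n ?mulr0n ?mulr0 ?addr0.
  rewrite unitmxE det_diag unitfE; apply/prodf_neq0 => i _; rewrite mxE.
  rewrite {1}[U i i]numEsg mulrCA [t * _]mulrC -mulrDr mulf_neq0 ?sgr_eq0// gt_eqF//.
  have u0 : 0 < `|U i i| by rewrite normr_gt0.
  have [->|t1'] := eqVneq t 1; first by rewrite subrr mul0r add0r.
  by rewrite ltr_wpDr// mulr_gt0// subr_gt0 lt_neqAle t1'.
have gLD : good V a (perm_mx pi *m L *m D).
  apply: good_path gD => //; first by rewrite !det_mulmx dL1 mulr1.
  move=> t _; rewrite (_ : _ + _ = perm_mx pi *m ((1 - t) *: L + t *: 1%:M) *m D).
    by rewrite !unitmx_mul up uL uD.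
  by rewrite mulmxDr mulmxDl -!scalemxAr -!scalemxAl mulmx1.
apply: good_path gLD => //; first by rewrite !det_mulmx dD dU.
move=> t _; rewrite !scalemxAr -mulmxDr !unitmx_mul up uL1/= unitmxE.
rewrite det_upper => [|i j ij].
  rewrite unitfE; apply/prodf_neq0 => i _; rewrite lincE !mxE eqxx mulr1n -mulrDl subrK mul1r.
  exact: U0.
have ij' : (i == j) = false by rewrite -val_eqE; exact: gtn_eqF.
by rewrite lincE uU// !mxE ij' mulr0n !mulr0 addr0.
Qed.

End linear_degree.

(** Every invertible matrix has an LUP decomposition; it is available in positive dimension, so
    dimension 0 is treated apart. *)
Lemma good_unit (R : realType) (n : nat) (V : set 'rV[R]_n) (a : 'rV[R]_n) (A : 'M[R]_n) :
  open V -> bounded_set V -> V a -> A \in unitmx -> good V a A.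
Proof.
case: n V a A => [|n] V a A oV bV Va uA.
  by rewrite [A](_ : _ = sgmx 1%g (fun=> false)); [exact: good_sgmx|apply/matrixP => -[]].
have := cormen_lup_correct A; have := cormen_lup_perm A.
have := @cormen_lup_lower _ n A; have := @cormen_lup_upper _ n A; have := cormen_lup_detL A.
case: cormen_lup => [[P L] U] /= dL uU lL /is_perm_mxP[sg ->] e.
have eA : A = perm_mx (perm_inv sg) *m L *m U.
  rewrite -mulmxA -[L *m U]e mulmxA -[perm_mx _ *m perm_mx _]perm_mxM.
  by rewrite (_ : (perm_inv sg * sg)%g = 1%g) ?perm_mx1 ?mul1mx//; exact: mulVg.
rewrite eA; apply: good_lu => // i.
have : \det A != 0 by rewrite -unitfE -unitmxE.
rewrite eA !det_mulmx (det_upper uU) => /eqP H; apply/eqP => Ui; apply: H.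
by rewrite [X in _ * X](bigD1 i)//= Ui mul0r mulr0.
Qed.

(** * Local degree at a regular zero *)

Section regular_zeros.
Context {R : realType} {n : nat}.
Implicit Types (x y a b : 'rV[R]_n) (V K : set 'rV[R]_n) (s t r : R) (A B : 'M[R]_n).
Implicit Types (u v : 'I_n -> 'rV[R]_n -> R) (i j l m : 'I_n).

Lemma diffE_row (f : 'rV[R]_n -> R) a (h : 'rV[R]_n) : differentiable f a ->
  'd f a h = \sum_i partial i f a * h 0 i.
Proof.
move=> df; rewrite {1}[h]row_sum_delta linear_sum; apply: eq_bigr => i _.
by rewrite linearZ/= -partialE// mulrC.
Qed.

Lemma diff_approx (f : 'rV[R]_n -> R) a (e : R) : differentiable f a -> 0 < e ->
  exists2 r, 0 < r & forall x, `|x - a| < r ->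
   `|f x - f a - \sum_i partial i f a * (x - a) 0 i| <= e * `|x - a|.
Proof.
move=> df e0; have [_ /eqaddoP /(_ _ e0)/nbhs_ballP[r /= r0 H]] := (diff_locallyP _ _).1 df.
exists r => // x xr; have := H (x - a); rewrite -ball_normE /ball_/= sub0r normrN => /(_ xr).
by rewrite -[X in `|X| <= _]/(f (x - a + a) - (f a + 'd f a (x - a))) subrK opprD addrA diffE_row.
Qed.

(** At a zero x of the homotopy between u and its linearization A (x - a), the latter is bounded by
    the linearization error, at most e |x - a|. As |x - a| is at most C times |A (x - a)|, the
    choice e = 1 / (2 C) forces x = a. *)
Lemma local_nonzero u a : (forall m, differentiable (u m) a) -> (forall m, u m a = 0) ->
  jac u a \in unitmx ->
  exists2 r, 0 < r & forall x t, `|x - a| < r -> x != a -> 0 <= t <= 1 ->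
    exists m, (1 - t) * u m x + t * linf (jac u a) a m x != 0.
Proof.
move=> du u0 uA; set A := jac u a.
pose C := 1 + \sum_i \sum_m `|invmx A i m|.
have C0 : 0 < C by rewrite ltr_pwDl// sumr_ge0// => i _; rewrite sumr_ge0.
pose e := (2 * C)^-1.
have e0 : 0 < e by rewrite invr_gt0 mulr_gt0.
have /choice[rr Hr] m : exists r, 0 < r /\ forall x, `|x - a| < r ->
   `|u m x - linf A a m x| <= e * `|x - a|.
  have [r r0 H] := diff_approx (du m) e0; exists r; split => // x xr; have := H x xr.
  rewrite u0 subr0 (_ : \sum_i _ = linf A a m x)//.
  by apply: eq_bigr => i _; rewrite /A jacE !mxE.
pose r := \big[Num.min/1]_m rr m.
have r0 : 0 < r by rewrite /r; elim/big_ind: _ => // [x y x0 y0|m _]; [rewrite lt_min x0|exact: (Hr m).1].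
have rm m : r <= rr m by rewrite /r; exact: bigmin_le.
exists r => // x t xr xa /andP[t0 t1]; apply: contrapT => /forallNP H.
have z m : linf A a m x = (1 - t) * (linf A a m x - u m x).
  have /negP := H m; rewrite negbK => /eqP h.
  by apply/eqP; rewrite -subr_eq0 -h; apply/eqP; ring.
have zb m : `|linf A a m x| <= e * `|x - a|.
  rewrite z normrM; apply: le_trans (_ : 1 * (e * `|x - a|) <= _); last by rewrite mul1r.
  apply: ler_pM => //; first by rewrite ger0_norm ?subr_ge0// gerBl.
  by rewrite distrC; apply: (Hr m).2; exact: lt_le_trans xr (rm m).
have xa0 : 0 < `|x - a| by rewrite normr_gt0 subr_eq0.
suff : `|x - a| <= C * (e * `|x - a|).
  rewrite mulrA /e invfM mulrCA mulfV ?gt_eqF// mulr1 leNgt gtr_pMl// invf_lt1//.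
  by rewrite ltrDl ltr01.
apply: norm_row_le => [|i]; first by rewrite !mulr_ge0// ltW.
have -> : (x - a) 0 i = \sum_m invmx A i m * linf A a m x.
  have : (x - a)^T = invmx A *m (A *m (x - a)^T) by rewrite mulKmx.
  move/matrixP => /(_ i 0); rewrite [LHS]mxE => ->; rewrite mxE.
  by apply: eq_bigr => m _; congr (_ * _); rewrite mxE; apply: eq_bigr => k _; rewrite !mxE.
apply: le_trans (ler_norm_sum _ _ _) _.
apply: le_trans (_ : (\sum_m `|invmx A i m|) * (e * `|x - a|) <= _).
  by rewrite mulr_suml; apply: ler_sum => m _; rewrite normrM ler_wpM2l.
rewrite ler_wpM2r ?mulr_ge0 ?ltW// /C [X in _ < _ + X](bigD1 i)//= addrCA ltrDl.
by rewrite ltr_pwDl// sumr_ge0// => j _; rewrite sumr_ge0.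
Qed.

Lemma bounded_ball a r : bounded_set (ball a r).
Proof.
exists (`|a| + r); split; first exact: num_real.
move=> M HM x; rewrite -ball_normE /ball_/= => xr; apply: le_trans (ltW HM).
rewrite -[x](subrK a) addrC; apply: le_trans (ler_normD _ _) _.
by rewrite lerD2l distrC ltW.
Qed.

Lemma local_degree u a : (forall m, C2 (u m)) -> (forall m, u m a = 0) ->
  jac u a \in unitmx ->
  exists2 r0, 0 < r0 &
    (forall x, `|x - a| < r0 -> x != a -> exists m, u m x != 0) /\
    forall r, 0 < r -> r < r0 -> exists2 s0 : R, 0 < s0 & forall s, 0 < s -> s < s0 ->
    pull (ball a r) (kern s) u = Num.sg (\det (jac u a)) * lint (@kern R n s).
Proof.
move=> cu u0 uA.
have [r1 r10 H] := local_nonzero (fun m => (cu m).1 a) u0 uA.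
(* A boundary point of the ball of radius [r] is only known to be within 2 r of the center. *)
exists (r1 / 2); first by rewrite divr_gt0.
have r12 : r1 / 2 < r1 by rewrite ltr_pdivrMr// ltr_pMr// ltrDl.
split.
  move=> x xr xa; have [||m] := H x 0 _ xa; first exact: lt_trans xr r12.
    by rewrite lexx ler01.
  by rewrite subr0 mul1r mul0r addr0 => Hm; exists m.
move=> r r0 rr1.
have oB : open (ball a r) by exact: ball_open.
have aB : ball a r a by exact: ballxx.
have [s1 s10 H1] := good_unit oB (@bounded_ball a r) aB uA.
have [||x t Bx tI|s2 s20 H2] := @pull_homotopy_ex R n (ball a r) u (linf (jac u a) a) oB (@bounded_ball a r).
- exact: cu.
- by move=> m; exact: C2_linf.
- apply: H => //.
    case: Bx => /(_ _ (nbhsx_ballx x _ r0))[y []]; rewrite -ball_normE /ball_/= => h1 h2 _.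
    rewrite -(subrK y x) -addrA; apply: le_lt_trans (ler_normD _ _) _.
    rewrite ltr_pdivlMr// in rr1; apply: lt_trans rr1.
    by rewrite mulr_natr mulr2n ltrD// distrC.
  by apply/eqP => xa; case: Bx => _; apply; rewrite xa ((interior_id _).1 oB).
exists (Num.min s1 s2); first by rewrite lt_min s10.
move=> s s0; rewrite lt_min => /andP[h1 h2].
by rewrite (H2 _ s0 h2) (H1 _ s0 h1).
Qed.

End regular_zeros.

(** * From local degrees to the integral of a general density *)

Section degree_formula.
Context {R : realType} {n : nat}.
Implicit Types (x y a b : 'rV[R]_n) (V K : set 'rV[R]_n) (s t r : R) (f g : 'rV[R]_n -> R).
Implicit Types (u v : 'I_n -> 'rV[R]_n -> R) (i j l m : 'I_n).

(** A common threshold for finitely many conditions; it follows each compactness argument below. *)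
Lemma seq_small (T : eqType) (Z : seq T) (Q : T -> R -> Prop) :
  (forall z, z \in Z -> exists2 r0, 0 < r0 & forall r, 0 < r -> r < r0 -> Q z r) ->
  exists2 r0, 0 < r0 & forall z, z \in Z -> forall r, 0 < r -> r < r0 -> Q z r.
Proof.
elim: Z => [_|z Z IH H]; first by exists 1.
have [r1 r10 H1] := H z (mem_head _ _).
have [|r2 r20 H2] := IH; first by move=> w wZ; apply: H; rewrite inE wZ orbT.
exists (Num.min r1 r2); first by rewrite lt_min r10.
move=> w; rewrite inE => /orP[/eqP ->|wZ] r r0; rewrite lt_min => /andP[h1 h2].
  exact: H1.
exact: H2.
Qed.

Lemma compact_zeros V u : bounded_set V -> (forall m, continuous (u m)) ->
  compact (closure V `&` [set x | forall m, u m x = 0]).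
Proof.
move=> bV cu; apply: compact_closedI; first exact: compact_closure.
rewrite (_ : [set x | _] = \bigcap_(m in [set: 'I_n]) u m @^-1` [set 0]).
  apply: closed_bigI => m _; apply: closed_comp; last exact: closed_eq.
  by move=> x _; exact: cu.
by apply/seteqP; split => [x Hx m _|x Hx m]; [exact: Hx|exact: (Hx m I)].
Qed.

(** Regular zeros are isolated, and the set of zeros in the closure is compact. *)
Lemma finite_zeros V u : bounded_set V -> (forall m, C2 (u m)) ->
  (forall x, closure V x -> (forall m, u m x = 0) -> jac u x \in unitmx) ->
  exists2 Z : seq 'rV[R]_n, uniq Z &
    forall x, (x \in Z) <-> closure V x /\ forall m, u m x = 0.
Proof.
move=> bV cu H; pose Z := closure V `&` [set x | forall m, u m x = 0].
have cZ : compact Z by apply: compact_zeros => // m; exact: C1_continuous (C2_C1 (cu m)).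
have /choice[rho Hrho] (z : 'rV[R]_n) : exists r, 0 < r /\ (Z z -> forall x, `|x - z| < r -> Z x -> x = z).
  have [Zz|Zz] := pselect (Z z); last by exists 1.
  have [r0 r00 [Hr _]] := local_degree cu Zz.2 (H z Zz.1 Zz.2).
  exists r0; split => // _ x xr Zx; apply/eqP; apply: contrapT => /negP xz.
  by have [m] := Hr x xr xz; rewrite Zx.2 eqxx.
move: cZ; rewrite compact_cover => /(_ _ Z (fun z => ball z (rho z))).
case=> [z _|z Zz|D DZ ZD]; first exact: ball_open.
  by exists z => //; apply: ballxx; exact: (Hrho z).1.
exists [seq z <- finmap.enum_fset D | `[< Z z >]]; first by rewrite filter_uniq// finmap.fset_uniq.
move=> x; rewrite mem_filter; split => [/andP[/asboolP]//|Zx].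
apply/andP; split; first exact/asboolP.
have [z zD] := ZD _ Zx; rewrite -ball_normE /ball_/= distrC => xz.
have Zz : Z z by have := DZ z zD; rewrite inE.
by rewrite ((Hrho z).2 Zz x xz Zx).
Qed.

Lemma lintble_indic_cont V f : open V -> bounded_set V -> continuous f -> lintble (fun x => \1_V x * f x).
Proof.
move=> oV bV cf; have [C C0 VC] := cbox_bounded bV.
have [D D0 HD] := compact_fun_bound (@compact_cbox R n (const_mx (- C)) (const_mx C)) cf.
apply: (lintble_bounded (a := const_mx (- C)) (b := const_mx C) (C := D)).
- by apply: lmeasM; [exact/lmeas_indic/open_lmeasurable|exact: continuous_lmeas].
- move=> x; rewrite indicE; case: (pselect (V x)) => Vx; last by rewrite memNset// mul0r normr0 ltW.
  by rewrite mem_set// mul1r; apply: HD; exact: VC.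
- by move=> x xC; rewrite indicE memNset ?mul0r// => /VC.
Qed.

(** For small [s] the integrand lives in disjoint balls around the zeros, so the integral splits
    into local degrees. *)
Lemma pull_regular V u (Z : seq 'rV[R]_n) : open V -> bounded_set V ->
  (forall m, C2 (u m)) -> uniq Z ->
  (forall z, z \in Z -> [/\ V z, (forall m, u m z = 0) & jac u z \in unitmx]) ->
  (forall x, closure V x -> (forall m, u m x = 0) -> x \in Z) ->
  exists2 s0 : R, 0 < s0 & forall s, 0 < s -> s < s0 ->
    pull V (kern s) u = (\sum_(z <- Z) Num.sg (\det (jac u z))) * lint (@kern R n s).
Proof.
move=> oV bV cu uZ HZ ZH.
have cuc m : continuous (u m) by exact: C1_continuous (C2_C1 (cu m)).
have [r1 r10 H1] : exists2 r0, 0 < r0 & forall z, z \in Z -> forall r, 0 < r -> r < r0 ->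
  [/\ ball z r `<=` V, forall z', z' \in Z -> z' != z -> 2 * r < `|z - z'| &
    exists2 s0 : R, 0 < s0 & forall s, 0 < s -> s < s0 ->
    pull (ball z r) (kern s) u = Num.sg (\det (jac u z)) * lint (@kern R n s)].
  apply: seq_small => z zZ; have [Vz uz juz] := HZ z zZ.
  have [r0 r00 [_ Hr]] := local_degree cu uz juz.
  have /nbhs_ballP[r1 /= r10 Hr1] : nbhs z V by apply: open_nbhs_nbhs; split.
  have [r2 r20 Hr2] : exists2 r0, 0 < r0 & forall z', z' \in Z -> forall r, 0 < r -> r < r0 ->
     z' != z -> 2 * r < `|z - z'|.
    apply: seq_small => z' _; have [->|zz'] := eqVneq z' z; first by exists 1.
    exists (`|z - z'| / 2) => [|r r0' rr _]; first by rewrite divr_gt0// normr_gt0 subr_eq0 eq_sym.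
    by rewrite mulrC -ltr_pdivlMr.
  exists (Num.min r0 (Num.min r1 r2)); first by rewrite !lt_min r00 r10.
  move=> r rp; rewrite !lt_min => /and3P[h1 h2 h3]; split; last exact: Hr.
    by apply: subset_trans Hr1; apply: le_ball; exact: ltW.
  by move=> z' z'Z; exact: Hr2.
pose r := r1 / 2.
have r0 : 0 < r by rewrite divr_gt0.
have rr1 : r < r1 by rewrite ltr_pdivrMr// ltr_pMr// ltrDl.
have [s1 s10 Hs1] : exists2 s0 : R, 0 < s0 & forall z, z \in Z -> forall s, 0 < s -> s < s0 ->
    pull (ball z r) (kern s) u = Num.sg (\det (jac u z)) * lint (@kern R n s).
  by apply: seq_small => z zZ; have [_ _] := H1 z zZ r r0 rr1.
(* Away from the balls the map has no zero, and by compactness some coordinate exceeds a fixed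
   positive bound there. *)
pose W := [set x | forall z, z \in Z -> r <= `|x - z|].
pose f x := \sum_m `|u m x|.
have cf : continuous f.
  rewrite /f; elim: (index_enum _) => [|m q IH].
    by under [X in continuous X]funext do rewrite big_nil; exact: continuous_cstf.
  under [X in continuous X]funext do rewrite big_cons.
  by apply: continuous_addf => //; apply: continuous_compf => //; exact: norm_continuous.
have cW : compact (closure V `&` W).
  apply: compact_closedI; first exact: compact_closure.
  rewrite (_ : W = \bigcap_(z in [set` Z]) (fun x => `|x - z|) @^-1` [set t | r <= t]).
    apply: closed_bigI => z _; apply: closed_comp; last exact: closed_ge.
    move=> x _; apply: (@continuous_comp _ _ _ (fun x => x - z) (fun x => `|x|)).
      by apply: continuousB; [exact: cvg_id|exact: cst_continuous].
    exact: norm_continuous.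
  by apply/seteqP; split => [x Hx z zZ|x Hx z zZ]; exact: Hx.
have [s2 s20 Hs2] : exists2 s2, 0 < s2 & forall x, closure V x -> W x -> exists m, s2 < `|u m x|.
  have [W0|/set0P W0] := eqVneq (closure V `&` W) set0.
    by exists 1 => // x Vx Wx; have : (closure V `&` W) x by []; rewrite W0.
  have [c /set_mem[Vc Wc] cmin] := EVT_min_rV W0 cW (continuous_subspaceT cf).
  have fc : 0 < f c.
    rewrite lt_neqAle eq_sym; apply/andP; split; last by rewrite sumr_ge0.
    apply/eqP => /eqP; rewrite psumr_eq0 => [/allP fc0|m _]//.
    have /(ZH c Vc) cZ : forall m, u m c = 0.
      by move=> m; have /eqP/normr0_eq0 := fc0 m (mem_index_enum _).
    by have := Wc c cZ; rewrite subrr normr0 leNgt r0.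
  exists (f c / (n.+1%:R)); first by rewrite divr_gt0.
  move=> x Vx Wx; apply: contrapT => /forallNP Hm.
  have : f c <= f x by apply: cmin; rewrite inE.
  apply/negP; rewrite -ltNge; apply: le_lt_trans (_ : \sum_(m < n) f c / n.+1%:R < _).
    by apply: ler_sum => m _; rewrite leNgt; apply/negP; exact: Hm.
  rewrite sumr_const card_ord -[X in X < _]mulr_natr -mulrA gtr_pMr//.
  by rewrite mulrC ltr_pdivrMr// mul1r ltr_nat.
exists (Num.min s1 s2); first by rewrite lt_min s10.
move=> s s0; rewrite lt_min => /andP[ss1 ss2].
rewrite mulr_suml (eq_big_seq (fun z => pull (ball z r) (kern s) u)); last first.
  by move=> z zZ; rewrite (Hs1 z zZ).
have kW x : closure V x -> W x -> kern s (rowf u x) = 0.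
  move=> Vx Wx; have [m Hm] := Hs2 x Vx Wx; apply: kern_out => //; exists m; rewrite mxE.
  exact: ltW (lt_trans ss2 Hm).
pose h x := kern s (rowf u x) * \det (jac u x).
have ch : continuous h.
  apply: continuous_mulf; last by apply: continuous_jac => m; exact: C2_C1.
  move=> x; apply: continuous_comp; [exact: continuous_rowf|exact: continuous_kern].
have lz z : lintble (fun x => \1_(ball z r) x * h x).
  by apply: lintble_indic_cont ch; [exact: ball_open|exact: bounded_ball].
rewrite /pull -(lint_sum Z lz); congr lint; apply/funext => x; rewrite -/(h x).
case: (pselect (V x)) => Vx; last first.
  rewrite indicE memNset// mul0r big_seq big1// => z zZ.
  have [zV _ _] := H1 z zZ r r0 rr1.
  by rewrite indicE memNset ?mul0r// => /zV.
rewrite [in LHS]indicE mem_set// mul1r.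
case: (pselect (W x)) => Wx.
  rewrite /h kW ?mul0r; last exact: Wx.
    by rewrite big1// => z _; rewrite mulr0.
  exact: subset_closure.
have [z [zZ xz]] : exists z, z \in Z /\ `|x - z| < r.
  apply: contrapT => /forallNP H; apply: Wx => z zZ; rewrite leNgt; apply/negP => xz.
  exact: (H z).
rewrite (bigD1_seq z)//= indicE mem_set; last by rewrite -ball_normE /ball_/= distrC.
rewrite mul1r big_seq_cond big1 ?addr0// => z' /andP[z'Z z'z].
rewrite indicE memNset ?mul0r// -ball_normE /ball_/= => xz'.
have [_ /(_ _ z'Z z'z) + _] := H1 z zZ r r0 rr1; apply/negP; rewrite -leNgt.
rewrite -(subrK x z) -addrA; apply: le_trans (ler_normD _ _) _.
by rewrite mulr_natl mulr2n; apply: lerD; apply: ltW; rewrite distrC.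
Qed.

Lemma lipschitz_C1 f (L : R) : (forall x, differentiable f x) -> (forall i x, `|partial i f x| <= L) ->
  forall x y, `|f x - f y| <= n%:R * L * `|x - y|.
Proof.
move=> df fL x y; have [s _] := mvt_line y (x - y) df ler01.
rewrite scale1r mul1r [y + (x - y)]addrC subrK => ->; rewrite deriveE// diffE_row//.
apply: le_trans (ler_norm_sum _ _ _) _.
apply: le_trans (_ : \sum_(i < n) L * `|x - y| <= _).
  by apply: ler_sum => i _; rewrite normrM ler_pM//; exact: coord_le_norm.
by rewrite sumr_const card_ord -[leLHS]mulr_natl mulrA.
Qed.

Lemma partial_out f K i x : closed K -> (forall y, ~ K y -> f y = 0) -> ~ K x -> partial i f x = 0.
Proof.
move=> cK f0 Kx; have e : \near x, 0 = f x.
  by near=> y; rewrite f0//; near: y; apply: open_nbhs_nbhs; split => //; rewrite openC.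
by rewrite /partial -(near_eq_derive _ e) derive_cst.
Unshelve. all: by end_near. Qed.

Lemma lipschitz_compact f K : compact K -> C1 f -> (forall y, ~ K y -> f y = 0) ->
  exists2 L, 0 < L & forall x y, `|f x - f y| <= L * `|x - y|.
Proof.
move=> cK cf f0.
have /choice[D HD] i : exists D, 0 < D /\ forall x, K x -> `|partial i f x| <= D.
  by have [D D0 HD] := compact_fun_bound cK (cf.2 i); exists D.
pose E := 1 + \sum_i D i.
have E0 : 0 < E by rewrite ltr_pwDl// sumr_ge0// => i _; rewrite ltW// (HD i).1.
exists (n.+1%:R * E); first by rewrite mulr_gt0.
move=> x y; apply: le_trans (lipschitz_C1 (L := E) cf.1 _ x y) _.
  move=> i z; have [Kz|Kz] := pselect (K z).
    apply: le_trans ((HD i).2 z Kz) _; rewrite /E (bigD1 i)//= addrCA lerDl addr_ge0//.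
    by rewrite sumr_ge0// => k _; rewrite ltW// (HD k).1.
  by rewrite (partial_out _ _ f0 Kz) ?normr0 ?ltW//; apply: compact_closed => //; exact: norm_hausdorff.
by rewrite !ler_wpM2r ?(ltW E0)// ler_nat.
Qed.

Lemma kern_ge0 s y : 0 <= kern s y.
Proof. by rewrite prodr_ge0// => m _; exact: bump_ge0. Qed.

Lemma lint_kern_shift s z : 0 < s ->
  lintble (fun y => kern s (z - y)) /\ lint (fun y => kern s (z - y)) = lint (@kern R n s).
Proof. by move=> s0; exact: lint_reflect (lintble_kern s0). Qed.

Lemma kern_shift_out s z y : 0 < s -> s < `|z - y| -> kern s (z - y) = 0.
Proof.
move=> s0 h; apply: kern_out => //; apply: contrapT => /forallNP H.
move: h; apply/negP; rewrite -leNgt; apply: norm_row_le; first exact: ltW.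
by move=> i; rewrite leNgt; apply/negP => h; apply: (H i); exact: ltW.
Qed.

Definition transl u x : 'I_n -> 'rV[R]_n -> R := fun m y => u m y - x 0 m.

Lemma C2_transl u x m : C2 (u m) -> C2 (transl u x m).
Proof. by move=> cu; exact: (C2B cu (C2_cst _)). Qed.

Lemma jac_transl u x y : (forall m, C2 (u m)) -> jac (transl u x) y = jac u y.
Proof.
move=> cu; apply/matrixP => m i; rewrite !jacE /transl partialD; last exact: differentiable_cst.
  by rewrite partial_cst addr0.
exact: (cu m).1.
Qed.

Lemma rowf_transl u x y : rowf (transl u x) y = rowf u y - x.
Proof. by apply/rowP => m; rewrite !mxE. Qed.

(** The uniform radius makes the level set of [D] through [x0] both relatively open and relatively
    closed. *)
Lemma connected_locally_cst (S : set 'rV[R]_n) (D : 'rV[R]_n -> R) x0 r : connected S -> 0 < r ->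
  S x0 -> (forall x y, S x -> S y -> `|x - y| < r -> D x = D y) ->
  forall x, S x -> D x = D x0.
Proof.
move=> cS r0 Sx0 H; pose B := S `&` [set x | D x = D x0].
have -> // : S = B; last by move=> x [].
apply/esym; apply: cS; first by exists x0.
- exists (\bigcup_(y in B) ball y r); first by apply: bigcup_open => y _; exact: ball_open.
  apply/seteqP; split => [x [Sx Dx]|x [Sx [y [Sy Dy]]]].
    by split => //; exists x; [split|exact: ballxx].
  by rewrite -ball_normE /ball_/= => yx; split => //=; rewrite -Dy; apply: H => //; rewrite distrC.
- exists (~` (\bigcup_(y in S `\` B) ball y r)).
    by rewrite closedC; apply: bigcup_open => y _; exact: ball_open.
  apply/seteqP; split => [x [Sx Dx]|x [Sx nx]].
    split => // -[y [Sy nB]]; rewrite -ball_normE /ball_/= => yx; apply: nB; split => //=.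
    by rewrite -Dx; apply: H.
  by apply: contrapT => nB; apply: nx; exists x; [split|exact: ballxx].
Qed.

Lemma kern_bounded s : 0 < s -> exists2 M, 0 < M & forall y : 'rV[R]_n, `|kern s y| <= M.
Proof.
move=> sp; have [M M0 HM] := compact_fun_bound (@compact_cbox R n (const_mx (- s)) (const_mx s)) (@continuous_kern R n s).
exists M => // y; have [yb|/existsNP[i yb]] := pselect (cbox (const_mx (- s)) (const_mx s) y); first exact: HM.
rewrite kern_out ?normr0 ?ltW//; exists i; rewrite leNgt; apply/negP => h.
by apply: yb; rewrite !mxE -ler_norml ltW.
Qed.

Lemma lintble_kern_mul s z f E : 0 < s -> lmeas f -> (forall y, `|f y| <= E) ->
  lintble (fun y => f y * kern s (z - y)).
Proof.
move=> sp mf fE; have [ik _] := lint_kern_shift z sp.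
apply: (le_lintble (g := fun y => E * kern s (z - y))); last exact: lintbleZ _ ik.
  exact: lmeasM mf (lintble_meas ik).
by move=> y; rewrite normrM [`|kern _ _|]ger0_norm ?kern_ge0// ler_wpM2r ?kern_ge0.
Qed.

Lemma kern_mul_close s z f E L : 0 < s -> lmeas f -> (forall y, `|f y| <= E) -> 0 <= L ->
  (forall x y, `|f x - f y| <= L * `|x - y|) ->
  `|lint (fun y => f y * kern s (z - y)) - f z * lint (@kern R n s)| <= L * s * lint (@kern R n s).
Proof.
move=> sp mf fE L0 HL; have [ik ek] := lint_kern_shift z sp.
have ifk := lintble_kern_mul z sp mf fE.
have e c : c * lint (@kern R n s) = lint (fun y => c * kern s (z - y)) by rewrite -ek; exact: (esym (lintZ c ik)).
rewrite (e (f z)) (e (L * s)) -(lintB ifk (lintbleZ _ ik)).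
apply: norm_lint_le; last exact: lintbleZ _ ik.
  by apply: lmeasB; [exact: lintble_meas ifk|exact: lintble_meas (lintbleZ _ ik)].
move=> y; rewrite -mulrBl normrM [`|kern _ _|]ger0_norm ?kern_ge0//.
have [h|h] := leP `|z - y| s; last by rewrite kern_shift_out// !mulr0.
by rewrite ler_wpM2r ?kern_ge0//; apply: le_trans (HL _ _) _; rewrite distrC ler_wpM2l.
Qed.

Lemma pull_transl V s u y : (forall m, C2 (u m)) ->
  pull V (kern s) (transl u y) = lint (fun x => (\1_V x * \det (jac u x)) * kern s (rowf u x - y)).
Proof.
move=> cu; rewrite /pull; congr lint; apply/funext => x.
by rewrite rowf_transl (jac_transl _ _ cu) -mulrA [kern _ _ * _]mulrC.
Qed.

(** The pullback of the convolution of [g] with the kernel is the [g]-weighted integral of the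
    pullbacks of translated kernels. *)
Lemma pull_fubini V u g s E : open V -> bounded_set V -> (forall m, C2 (u m)) ->
  continuous g -> lintble g -> (forall y, `|g y| <= E) -> 0 < s ->
  let J x := \1_V x * \det (jac u x) in
  lintble (fun x => J x * lint (fun y => g y * kern s (rowf u x - y))) /\
  lint (fun x => J x * lint (fun y => g y * kern s (rowf u x - y))) =
  lint (fun y => g y * pull V (kern s) (transl u y)).
Proof.
move=> oV bV cu cg ig gE sp J.
have cJ : continuous (fun x => \det (jac u x)) by apply: continuous_jac => m; exact: C2_C1.
have iJ : lintble J by exact: lintble_indic_cont.
have mg := lintble_meas ig.
have E0 : 0 <= E by exact: le_trans (normr_ge0 _) (gE 0).
pose F x y := J x * (g y * kern s (rowf u x - y)).
have mk : jmeas (fun x y => kern s (rowf u x - y)).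
  apply: (@jmeas_prod _ _ _ _ (fun m x y => bump ((rowf u x - y) 0 m / s))) => m.
  apply: (jmeas_comp (u := fun t => bump (t / s)) (F := fun x y => (rowf u x - y) 0 m)).
    move=> t; apply: (continuous_comp (f := fun t => t / s)); last exact: (diffn_continuous (diffn_bump 0)).
    by apply: continuousM; [exact: cvg_id|exact: cst_continuous].
  rewrite (_ : (fun x y => _) = fun x y => u m x - y 0 m); last first.
    by apply/funext => x; apply/funext => y; rewrite !mxE.
  apply: jmeasB; [apply: jmeas_fst|apply: jmeas_snd]; apply: continuous_lmeas.
    exact: C1_continuous (C2_C1 (cu m)).
  exact: coord_continuous.
have mF : jmeas F by exact: jmeasM (jmeas_fst (lintble_meas iJ)) (jmeasM (jmeas_snd mg) mk).
have iF1 x : lintble (F x) by exact: lintbleZ _ (lintble_kern_mul _ sp mg gE).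
have [M M0 HM] := kern_bounded sp.
have mFy y : lmeas (F ^~ y).
  exact: (@measurable_fun_pair1 _ _ _ (caratheodory_type (lebesgue_outer R n)) (caratheodory_type (lebesgue_outer R n)) R _ y mF).
have iF2 y : lintble (F ^~ y).
  apply: (le_lintble (g := fun x => (E * M) * `|J x|)); first exact: mFy.
    by move=> x; rewrite /F normrM mulrC ler_wpM2r// normrM ler_pM.
  exact: lintbleZ _ (lintble_norm iJ).
have [|j1 j2 j3] := lint_fubini_dom mF iF1 iF2 (h := fun x => (E * lint (@kern R n s)) * `|J x|) _
     (lintbleZ _ (lintble_norm iJ)).
  move=> x; have [ik ek] := lint_kern_shift (rowf u x) sp.
  rewrite -ek -lintZ// mulrC -(lintZ _ (lintbleZ E ik)).
  apply: le_lint; [exact: lintble_norm|exact: lintbleZ _ (lintbleZ _ ik)|move=> y].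
  rewrite /F !normrM ler_wpM2l// [`|kern _ _|]ger0_norm ?kern_ge0// ler_wpM2r ?kern_ge0//.
have e1 x : lint (F x) = J x * lint (fun y => g y * kern s (rowf u x - y)).
  exact: (lintZ (J x) (lintble_kern_mul (rowf u x) sp mg gE)).
have e2 y : lint (F ^~ y) = g y * pull V (kern s) (transl u y).
  have iJk : lintble (fun x => J x * kern s (rowf u x - y)).
    apply: (le_lintble (g := fun x => M * `|J x|)); last exact: lintbleZ _ (lintble_norm iJ).
      apply: lmeasM; first exact: lintble_meas iJ.
      exact: (@measurable_fun_pair1 _ _ _ (caratheodory_type (lebesgue_outer R n)) (caratheodory_type (lebesgue_outer R n)) R _ y mk).
    by move=> x; rewrite normrM mulrC ler_wpM2r.
  rewrite (pull_transl V s y cu); apply: etrans (lintZ (g y) iJk).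
  by congr lint; apply/funext => x; rewrite /F mulrCA.
have E1 := funext e1; have E2 := funext e2.
by split; [rewrite -E1; exact: j1|rewrite -E1 -E2; exact: j3].
Qed.

Lemma eq_of_close (a b C s1 : R) : 0 < s1 -> 0 <= C ->
  (forall s, 0 < s -> s < s1 -> `|a - b| <= C * s) -> a = b.
Proof.
move=> s10 C0 H; apply/eqP; rewrite -subr_eq0 -normr_eq0 eq_le normr_ge0 andbT.
rewrite leNgt; apply/negP => h; set t := `|a - b| in H h.
have : t <= C * Num.min (s1 / 2) (t / (2 * (C + 1))).
  apply: H; first by rewrite lt_min !divr_gt0// mulr_gt0// ltr_wpDl.
  by rewrite gt_min ltr_pdivrMr// ltr_pMr// ltrDl ltr01.
apply/negP; rewrite -ltNge; apply: le_lt_trans (_ : C * (t / (2 * (C + 1))) < _).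
  by rewrite ler_wpM2l// ge_min lexx orbT.
by rewrite mulrCA gtr_pMr// ltr_pdivrMr ?mul1r; [lra|rewrite mulr_gt0// ltr_wpDl].
Qed.

(** Moving the base point by less than [s] is a perturbation allowed by [pull_close]; connectedness
    of [S] propagates the equality. *)
Lemma pull_kern_cst V u (S : set 'rV[R]_n) (c s : R) x0 : open V -> bounded_set V ->
  (forall m, C2 (u m)) -> connected S ->
  (forall x y, bnd V x -> S y -> exists m, c <= `|u m x - y 0 m|) ->
  S x0 -> 0 < s -> 3 * s < c -> forall y, S y ->
  pull V (kern s) (transl u y) = pull V (kern s) (transl u x0).
Proof.
move=> oV bV cu cS Hc Sx0 sp sc.
apply: (connected_locally_cst (D := fun y => pull V (kern s) (transl u y)) cS sp Sx0) => x y Sx Sy xy.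
apply: (pull_close oV bV sp); [move=> m|move=> m|move=> z _ m|move=> z Bz].
- exact: C2_transl.
- exact: C2_transl.
- rewrite (_ : _ - _ = - (x 0 m - y 0 m)); last by rewrite /transl; ring.
  rewrite normrN.
  by have := coord_le_norm (x - y) m; rewrite !mxE => /le_trans; apply; exact: ltW.
- have [m Hm] := Hc z x Bz Sx; exists m; apply: lt_le_trans Hm.
  by apply: lt_trans sc; rewrite ltr_pM2r// ltr_nat.
Qed.

Lemma lint_kern_gt0 s : 0 < s -> 0 < lint (@kern R n s).
Proof.
move=> sp; have ik := lintble_kern sp.
rewrite lt_neqAle lint_ge0 ?andbT; last by move=> y; exact: kern_ge0.
apply/eqP => k0; have N := lint0_ae (@kern_ge0 s) (ik n) (esym k0).
have : null (cbox (const_mx (s / 4) : 'rV[R]_n) (const_mx (s / 2))).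
  apply: nullS N => y yc /=; rewrite gt_eqF//; rewrite prodr_gt0// => m _.
  have := yc m; rewrite !mxE => /andP[h1 h2]; apply: bump_gt0.
    by rewrite divr_gt0//; apply: lt_le_trans h1; rewrite divr_gt0.
  by rewrite ltr_pdivrMr// mul1r; apply: le_lt_trans h2 _; lra.
have s42 : s / 4 <= s / 2 by lra.
rewrite /null leb_outer_cbox => [|i]; last by rewrite !mxE.
move=> [] /eqP; rewrite gt_eqF// prodr_gt0// => i _; rewrite !mxE; lra.
Qed.

(** Smearing [g] with the kernel of size [s] costs at most L s, by the Lipschitz bound on [g]. The
    smeared density has pullback integral exactly [d * lint g] times the mass of the kernel, since
    all its translates over [S] contribute [d]; then s tends to 0. *)
Lemma pull_degree V u (S : set 'rV[R]_n) g (c d s0 : R) x0 : open V -> bounded_set V ->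
  (forall m, C2 (u m)) -> C1 g -> compact S -> connected S -> (forall y, ~ S y -> g y = 0) ->
  0 < c -> (forall x y, bnd V x -> S y -> exists m, c <= `|u m x - y 0 m|) ->
  S x0 -> 0 < s0 -> (forall s, 0 < s -> s < s0 ->
    pull V (kern s) (transl u x0) = d * lint (@kern R n s)) ->
  pull V g u = d * lint g.
Proof.
move=> oV bV cu cg cS nS g0 c0 Hc Sx0 s00 Hs.
have cgc : continuous g by exact: C1_continuous.
have [L L0 HL] := lipschitz_compact cS cg g0.
have [E E0 HE] := compact_fun_bound cS cgc.
have gE y : `|g y| <= E.
  by have [Sy|Sy] := pselect (S y); [exact: HE|rewrite g0// normr0 ltW].
pose J x := \1_V x * \det (jac u x).
have cJ : continuous (fun x => \det (jac u x)) by apply: continuous_jac => m; exact: C2_C1.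
have iJ : lintble J by exact: lintble_indic_cont.
have ig : lintble g.
  have [C _ SC] := compact_cbox_sub cS.
  by apply: (lintble_continuous (a := const_mx (- C)) (b := const_mx C)) => // x xC; rewrite g0// => /SC.
have mg := lintble_meas ig.
have iJg : lintble (fun x => J x * g (rowf u x)).
  apply: (le_lintble (g := fun x => E * `|J x|)); last exact: lintbleZ _ (lintble_norm iJ).
    apply: lmeasM; first exact: lintble_meas.
    apply: continuous_lmeas => x; apply: continuous_comp; last exact: cgc.
    by apply: continuous_rowf => m; exact: C1_continuous (C2_C1 (cu m)).
  by move=> x; rewrite normrM mulrC ler_wpM2r.
have e : pull V g u = lint (fun x => J x * g (rowf u x)).
  by rewrite /pull; congr lint; apply/funext => x; rewrite /J -mulrA [g _ * _]mulrC.
have m0 : 0 < Num.min s0 (c / 3) by rewrite lt_min s00 divr_gt0.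
have l0 : 0 <= L * lint (fun x => `|J x|) by apply: mulr_ge0 (ltW L0) (lint_ge0 _).
apply/esym; apply: (eq_of_close m0 l0) => s sp; rewrite lt_min => /andP[ss0 sc].
have sc3 : 3 * s < c by rewrite mulrC -ltr_pdivlMr.
have kp := lint_kern_gt0 sp; set k := lint (@kern R n s) in kp.
have D y : S y -> pull V (kern s) (transl u y) = d * k.
  by move=> Sy; rewrite (pull_kern_cst oV bV cu nS Hc Sx0 sp sc3 Sy) (Hs s sp ss0).
have [iF eF] := pull_fubini oV bV cu cgc ig gE sp.
have eg : lint (fun y => g y * pull V (kern s) (transl u y)) = d * lint g * k.
  rewrite mulrAC -(lintZ _ ig); congr lint; apply/funext => y.
  by have [Sy|Sy] := pselect (S y); [rewrite D// mulrC|rewrite g0// mul0r mulr0].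
rewrite -(ler_pM2r kp) -[X in _ * X <= _](gtr0_norm kp) -normrM mulrBl -eg -eF e.
rewrite [_ * k]mulrC -(lintZ _ iJg) -(lintB iF (lintbleZ _ iJg)).
have -> : L * lint (fun x => `|J x|) * s * k = lint (fun x => (L * s * k) * `|J x|).
  by apply/esym; apply: etrans (lintZ _ (lintble_norm iJ)) _; ring.
apply: norm_lint_le; [exact: lmeasB (lintble_meas iF) (lintble_meas (lintbleZ k iJg))| |
  exact: lintbleZ _ (lintble_norm iJ)].
move=> x; rewrite -/(J x) mulrCA -mulrBr normrM mulrC ler_wpM2r// [k * _]mulrC.
exact: (kern_mul_close (rowf u x) sp mg gE (ltW L0) HL).
Qed.

End degree_formula.

(** * Sard's theorem and the degree formula *)

Section sard.
Context {R : realType} {n : nat}.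
Implicit Types (x y z w a b : 'rV[R]_n) (V K : set 'rV[R]_n) (s t r C L D d e : R) (f : 'rV[R]_n -> R).
Implicit Types (u : 'I_n -> 'rV[R]_n -> R) (i j l m : 'I_n).

Lemma leb_outer_sum (I : Type) (q : seq I) (F : I -> set 'rV[R]_n) c :
  (forall k, (leb_outer (F k) <= c%:E)%E) ->
  (leb_outer (\big[setU/set0]_(k <- q) F k) <= ((size q)%:R * c)%:E)%E.
Proof.
move=> Fc; elim: q => [|k q IH].
  by rewrite big_nil mul0r (outer_measure0 (lebesgue_outer R n)).
rewrite big_cons -bigcup2E.
have := outer_measure_subadditive (lebesgue_outer R n) (bigcup2 (F k) (\big[setU/set0]_(j <- q) F j)) 2.
rewrite bigcup2E !big_ord_recl !big_ord0 setU0 adde0 => /le_trans; apply.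
by rewrite /= -natr1 mulrDl mul1r addrC EFinD; exact: leeD.
Qed.

Lemma closed_half f C : continuous f -> closed [set y | `|f y| <= C].
Proof.
move=> cf; apply: (@closed_comp _ _ (fun y => `|f y|) [set t | t <= C]); last exact: closed_le.
by move=> y _; apply: (continuous_comp (cf y)); exact: norm_continuous.
Qed.

Lemma lip_coord_continuous (w : 'rV[R]_n) : continuous (fun y : 'rV[R]_n => \sum_j w 0 j * y 0 j).
Proof.
elim: (index_enum _) => [|m q IH].
  by under [X in continuous X]funext do rewrite big_nil; exact: continuous_cstf.
under [X in continuous X]funext do rewrite big_cons.
apply: continuous_addf => //; apply: continuous_mulf; [exact: continuous_cstf|exact: coord_continuous].
Qed.

(** A cube around [z] intersected with a thin layer normal to [w]; the image of a small cube that
    contains a critical point lies in such a set. *)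
Definition slab z w s t : set 'rV[R]_n :=
  [set y | (forall j, `|y 0 j - z 0 j| <= s) /\ `|\sum_j w 0 j * (y 0 j - z 0 j)| <= t].

Lemma slab_shift z w s t y : slab z w s t y = slab 0 w s t (y - z).
Proof.
rewrite /slab/=; congr (_ /\ _); first by apply: eq_forall => j; rewrite !mxE subr0.
by congr (is_true (`|_| <= _)); apply: eq_bigr => j _; rewrite !mxE subr0.
Qed.

Lemma closed_slab0 w s t : closed (slab 0 w s t).
Proof.
rewrite (_ : slab _ _ _ _ = (\bigcap_(j in [set: 'I_n]) [set y | `|y 0 j| <= s]) `&`
   [set y | `|\sum_j w 0 j * y 0 j| <= t]).
  apply: closedI; last exact/closed_half/lip_coord_continuous.
  by apply: closed_bigI => j _; apply: closed_half; exact: coord_continuous.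
have e y : \sum_j w 0 j * (y 0 j - (0 : 'rV[R]_n) 0 j) = \sum_j w 0 j * y 0 j.
  by apply: eq_bigr => j _; rewrite mxE subr0.
apply/seteqP; split => [y [h1 h2]|y [h1 h2]]; split.
- by move=> j _ /=; have := h1 j; rewrite mxE subr0.
- by rewrite /= -e.
- by move=> j; rewrite mxE subr0; exact: (h1 j I).
- by rewrite e.
Qed.

Lemma cbox_norm s y : 0 <= s -> cbox (const_mx (- s)) (const_mx s) y <-> `|y| <= s.
Proof.
move=> s0; split => [H|H i].
  by apply: norm_row_le => // i; have := H i; rewrite !mxE -ler_norml.
by rewrite !mxE -ler_norml; exact: le_trans (coord_le_norm y i) H.
Qed.

(* Disjoint translates of the slab in the direction i fit in a box of twice its size. *)
Lemma leb_slab0 w i s t : w 0 i = 1 -> 0 < t -> 3 * t <= s ->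
  (leb_outer (slab 0 w s t) <= (6 * t / s * (4 * s) ^+ n)%:E)%E.
Proof.
move=> wi t0 ts; have s0 : 0 < s by apply: lt_le_trans ts; rewrite mulr_gt0.
pose S := slab 0 w s t.
pose B := cbox (const_mx (- (2 * s))) (const_mx (2 * s)) : set 'rV[R]_n.
have s20 : 0 <= 2 * s by rewrite mulr_ge0// ltW.
have lB : leb_outer B = ((4 * s) ^+ n)%:E.
  rewrite leb_outer_cbox => [|k]; last by rewrite !mxE; lra.
  congr (_%:E); rewrite (eq_bigr (fun=> 4 * s)) ?prodr_const ?card_ord// => k _.
  by rewrite !mxE; ring.
have SB : S `<=` B.
  move=> y [h _]; apply/cbox_norm => //; apply: norm_row_le => // j.
  by have := h j; rewrite mxE subr0 => /le_trans; apply; rewrite ler_peMl ?ler1n// ltW.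
have lSoo : (leb_outer S < +oo)%E.
  by apply: le_lt_trans (le_outer_measure (lebesgue_outer R n) _ _ SB) _; rewrite /= lB ltry.
have mS := closed_lmeasurable (@closed_slab0 w s t).
have iS := lintble_indic mS lSoo.
(* A shift by 3 t in direction [i] changes the functional [w] by 3 t, more than the thickness 2 t,
   so the translates are disjoint; [N] of them move the slab by at most [s]. *)
pose N := Num.truncn (s / (3 * t)).
have N1 : s / (3 * t) < N%:R + 1 by rewrite natr1; exact: truncnS_gt.
have x1 : 1 <= s / (3 * t) by rewrite ler_pdivlMr ?mul1r// mulr_gt0.
have N2 : N%:R <= s / (3 * t) by rewrite truncn_le // ltW// divr_gt0// mulr_gt0.
have N3 : 1 <= N%:R :> R by rewrite ler1n truncn_gt0.
pose c (k : nat) : 'rV[R]_n := (- (3 * t * k%:R)) *: delta_mx 0 i.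
pose F (k : 'I_N) (y : 'rV[R]_n) : R := \1_S (y + c k).
have iF k : lintble (F k) /\ lint (F k) = fine (leb_outer S).
  by rewrite -(lint_indic mS); exact: lint_translate (c k) _ iS.
have cy y k j : (y + c k) 0 j = y 0 j - 3 * t * k%:R * (j == i)%:R.
  by rewrite /c !mxE eqxx/= mulNr.
have cw y k : \sum_j w 0 j * (y + c k) 0 j = (\sum_j w 0 j * y 0 j) - 3 * t * k%:R.
  under eq_bigr do rewrite cy mulrBr; rewrite sumrB; congr (_ - _).
  rewrite (bigD1 i)//= eqxx wi big1 ?addr0 ?mul1r ?mulr1// => j /negbTE ->.
  by rewrite !mulr0.
have SE y : S y <-> (forall j, `|y 0 j| <= s) /\ `|\sum_j w 0 j * y 0 j| <= t.
  rewrite /S /slab/=.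
  have e : \sum_j w 0 j * (y 0 j - (0 : 'rV[R]_n) 0 j) = \sum_j w 0 j * y 0 j.
    by apply: eq_bigr => j _; rewrite mxE subr0.
  by rewrite e; split => -[h1 h2]; split => // j; have := h1 j; rewrite mxE subr0.
have Fle y : \sum_(k < N) F k y <= \1_B y.
  have [[k Sk]|nS] := pselect (exists k : 'I_N, S (y + c k)); last first.
    rewrite big1 ?indic_ge0 // => k _; rewrite /F indicE memNset// => Sk.
    by apply: nS; exists k.
  have [h1 h2] := (SE _).1 Sk.
  have By : B y.
    apply/cbox_norm => //; apply: norm_row_le => // j; have := h1 j; rewrite cy.
    have : 0 <= 3 * t * k%:R * (j == i)%:R <= s.
      rewrite !mulr_ge0 ?ler0n ?(ltW t0)//=; apply: le_trans (_ : 3 * t * k%:R <= _).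
        by rewrite ler_piMr ?mulr_ge0 ?ler0n ?(ltW t0)//; case: (j == i).
      rewrite mulrC -ler_pdivlMr ?mulr_gt0//; apply: le_trans N2.
      by rewrite ler_nat ltnW.
    move: (3 * t * _ * _) => q /andP[q0 qs]; rewrite !ler_norml => /andP[z1 z2]; apply/andP; split; lra.
  rewrite indicE mem_set// (bigD1 k)//= [F k y]indicE mem_set// big1 ?addr0// => l lk.
  rewrite /F indicE memNset// => /SE[_]; rewrite cw; rewrite cw in h2 => h3.
  have lk1 : 1 <= `|(k%:R : R) - l%:R|.
    have [kl|kl] := leqP k l.
      rewrite distrC -natrB// normr_nat ler1n subn_gt0 ltn_neqAle kl andbT.
      by apply: contra lk => /eqP h; apply/eqP/val_inj.
    by rewrite -natrB ?(ltnW kl)// normr_nat ler1n subn_gt0.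
  move: lk1; apply/negP; rewrite -ltNge -(ltr_pM2l (_ : 0 < 3 * t)) ?mulr_gt0// mulr1.
  rewrite -[X in X * `|_|](gtr0_norm (_ : 0 < 3 * t)) ?mulr_gt0// -normrM mulrBr.
  move: h2 h3; move: (\sum_j _) (3 * t * _) (3 * t * _) => q p1 p2.
  rewrite !ler_norml ltr_norml => /andP[z1 z2] /andP[z3 z4]; apply/andP; split; lra.
have iB : lintble (\1_B : 'rV[R]_n -> R).
  by apply: lintble_indic; [exact: measurable_cbox|rewrite lB ltry].
have NS : N%:R * fine (leb_outer S) <= (4 * s) ^+ n.
  have <- : lint (\1_B : 'rV[R]_n -> R) = (4 * s) ^+ n.
    by rewrite lint_indic ?lB//; exact: measurable_cbox.
  have <- : lint (fun y => \sum_(k < N) F k y) = N%:R * fine (leb_outer S).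
    rewrite lint_sum; last by move=> k; exact: (iF k).1.
    by rewrite (eq_bigr (fun=> fine (leb_outer S))) ?sumr_const ?card_ord ?mulr_natl// => k _; exact: (iF k).2.
  by apply: le_lint iB Fle; exact: lintble_sum _ (fun k => (iF k).1).
have S0 : (0 <= leb_outer S)%E by exact: (outer_measure_ge0 (lebesgue_outer R n)).
have fS : leb_outer S \is a fin_num by rewrite ge0_fin_numE.
rewrite -/S -(fineK fS) lee_fin.
have f0 : 0 <= fine (leb_outer S) by exact: fine_ge0.
have h : s / (6 * t) <= N%:R.
  have -> : s / (6 * t) = s / (3 * t) / 2 by field; rewrite gt_eqF.
  move: N1 x1 N3; move: (s / _) => q; lra.
have := le_trans (ler_wpM2r f0 h) NS.
have p : 0 < s / (6 * t) by rewrite divr_gt0// mulr_gt0.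
rewrite mulrC -ler_pdivlMr// => /le_trans; apply.
by rewrite mulrC invf_div.
Qed.

Lemma leb_outer_translate (A : set 'rV[R]_n) z : leb_outer [set y | A (y - z)] = leb_outer A.
Proof.
rewrite -(leb_outer_sperm 1%g (fun=> false) (- z) A); congr leb_outer.
apply/seteqP; split => y /=; rewrite (_ : sperm _ _ _ _ = y - z)//;
  by apply/rowP => k; rewrite !mxE perm1 mul1r.
Qed.

Lemma leb_slab z w i s t : w 0 i = 1 -> 0 < t -> 3 * t <= s ->
  (leb_outer (slab z w s t) <= (6 * t / s * (4 * s) ^+ n)%:E)%E.
Proof.
move=> wi t0 ts; rewrite (_ : slab z w s t = [set y | slab 0 w s t (y - z)]).
  by rewrite leb_outer_translate; exact: leb_slab0 wi t0 ts.
by apply/seteqP; split => y; rewrite slab_shift.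
Qed.

Lemma taylor2 f D x z : (forall y, differentiable f y) ->
  (forall i x y, `|partial i f x - partial i f y| <= D * `|x - y|) ->
  `|f x - f z - \sum_i (x - z) 0 i * partial i f z| <= n%:R * D * `|x - z| ^+ 2.
Proof.
move=> df HD; have [s /andP[s0 s1]] := mvt_line z (x - z) df ler01.
rewrite scale1r mul1r [z + (x - z)]addrC subrK => ->; rewrite deriveE// diffE_row//.
rewrite -sumrB; apply: le_trans (ler_norm_sum _ _ _) _.
apply: le_trans (_ : \sum_(i < n) D * `|x - z| ^+ 2 <= _).
  apply: ler_sum => i _; rewrite [X in X - _]mulrC -mulrBr normrM expr2 mulrA mulrC.
  apply: ler_pM => //; last exact: coord_le_norm.
  apply: le_trans (HD _ _ _) _; rewrite addrC addKr normrZ (ger0_norm s0).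
  have D0 : 0 <= D * `|x - z| by apply: le_trans (HD i x z).
  by rewrite mulrCA; apply: ler_piMl.
by rewrite sumr_const card_ord -[leLHS]mulr_natl mulrA.
Qed.

(** A left null vector divided by its largest entry; the entry 1 provides the direction in which the
    slab can be shifted. *)
Lemma sing_row (A : 'M[R]_n) : \det A = 0 -> exists w i,
  [/\ w 0 i = 1, forall j, `|w 0 j| <= 1 & w *m A = 0].
Proof.
move=> /eqP/det0P[v v0 vA].
have [j0 vj0] : exists j, v 0 j != 0.
  apply: contrapT => /forallNP H; move/eqP: v0; apply; apply/rowP => j; rewrite mxE.
  by apply/eqP; rewrite -[_ == _]negbK; apply/negP; exact: H.
have [i _ Hi] := @arg_maxP _ R _ j0 xpredT (fun j => `|v 0 j|) isT.
have vi : v 0 i != 0 by rewrite -normr_gt0; apply: lt_le_trans (Hi j0 isT); rewrite normr_gt0.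
exists ((v 0 i)^-1 *: v), i; split; first by rewrite mxE mulVf.
  by move=> j; rewrite mxE normrM normfV mulrC ler_pdivrMr ?normr_gt0// mul1r; exact: Hi.
by rewrite -scalemxAl vA scaler0.
Qed.

Definition gcube C d (N : nat) (g : {ffun 'I_n -> 'I_N.+1}) : set 'rV[R]_n :=
  [set x | forall i, (g i)%:R * d <= x 0 i + C <= ((g i)%:R + 1) * d].

Lemma gcube_diam C d N (g : {ffun 'I_n -> 'I_N.+1}) x z : 0 <= d ->
  gcube C d g x -> gcube C d g z -> `|x - z| <= d.
Proof.
move=> d0 gx gz; apply: norm_row_le => // i; rewrite !mxE.
have := gx i; have := gz i; rewrite !mulrDl mul1r; move: (_ * d) => q.
by move=> /andP[h1 h2] /andP[h3 h4]; rewrite ler_norml; apply/andP; split; lra.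
Qed.

Lemma gcube_cover C (N : nat) x : 0 < C -> `|x| <= C ->
  exists g : {ffun 'I_n -> 'I_N.+1}, gcube C (2 * C / N.+1%:R) g x.
Proof.
move=> C0 xC; set d := _ / _; have d0 : 0 < d by rewrite divr_gt0// mulr_gt0.
pose T i := Num.truncn ((x 0 i + C) / d).
(* Without the minimum, the right end point of the range would fall into a cube beyond the grid. *)
exists [ffun i => inord (minn (T i) N)] => i.
rewrite ffunE inordK ?ltnS ?geq_minr//.
have /andP[x0 x1] : 0 <= x 0 i + C <= 2 * C.
  by have := le_trans (coord_le_norm x i) xC; rewrite ler_norml => /andP[? ?]; apply/andP; split; lra.
have q0 : 0 <= (x 0 i + C) / d by rewrite divr_ge0// ltW.
apply/andP; split.
  rewrite -ler_pdivlMr//; apply: le_trans (_ : (T i)%:R <= _); first by rewrite ler_nat geq_minl.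
  by rewrite truncn_le.
rewrite -ler_pdivrMr//; have [TN|NT] := leqP (T i) N.
  by rewrite natr1; apply: ltW; exact: truncnS_gt.
rewrite natr1 ler_pdivrMr// /d mulrCA divff ?mulr1// pnatr_eq0//.
Qed.

(** A grid of about d^(-n) cubes of side d covers the domain. The image of one containing a critical
    point has volume O(d^(n+1)): its size is O(d), and along a left null vector of the differential
    its thickness is O(d^2) by Taylor. The total is O(d). *)
Lemma sard u K C : compact K -> 0 < C -> (forall m, C2 (u m)) ->
  (forall m x, ~ K x -> u m x = 0) ->
  null [set y | exists x, [/\ `|x| <= C, \det (jac u x) = 0 & y = rowf u x]].
Proof.
move=> cK C0 cu u0; set Z := [set y | _].
have cK' : closed K by apply: compact_closed => //; exact: norm_hausdorff.
have /choice[L0 HL0] m : exists L, 0 < L /\ forall x y, `|u m x - u m y| <= L * `|x - y|.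
  by have [L L0 HL] := lipschitz_compact cK (C2_C1 (cu m)) (u0 m); exists L.
have /choice[D0 HD0] (mi : 'I_n * 'I_n) : exists D, 0 < D /\
    forall x y, `|partial mi.2 (u mi.1) x - partial mi.2 (u mi.1) y| <= D * `|x - y|.
  have [|D D0 HD] := lipschitz_compact cK ((cu mi.1).2 mi.2); last by exists D.
  by move=> y; exact: (partial_out mi.2 cK' (u0 mi.1)).
pose L := 1 + \sum_m L0 m; pose D1 := \sum_mi D0 mi; pose D := n.+1%:R * (n%:R * (1 + D1)).
have L_gt0 : 0 < L by rewrite ltr_pwDl// sumr_ge0// => m _; exact: ltW (HL0 m).1.
have HL m x y : `|u m x - u m y| <= L * `|x - y|.
  apply: le_trans ((HL0 m).2 x y) _; rewrite ler_wpM2r// /L (bigD1 m)//= addrCA lerDl addr_ge0//.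
  by rewrite sumr_ge0// => k _; exact: ltW (HL0 k).1.
have HD m i x y : `|partial i (u m) x - partial i (u m) y| <= (1 + D1) * `|x - y|.
  apply: le_trans ((HD0 (m, i)).2 x y) _; rewrite ler_wpM2r// /D1 (bigD1 (m, i))//= addrCA lerDl addr_ge0//.
  by rewrite sumr_ge0// => k _; exact: ltW (HD0 k).1.
have D10 : 0 < 1 + D1 by rewrite ltr_pwDl// sumr_ge0// => m _; exact: ltW (HD0 m).1.
pose Cst := 6 * (1 + D) / L * (4 * L * (2 * C)) ^+ n.
have D_ge0 : 0 <= D by rewrite mulr_ge0 ?mulr_ge0 ?ler0n ?(ltW D10).
have Cst0 : 0 <= Cst.
  by rewrite mulr_ge0 ?divr_ge0 ?exprn_ge0 ?mulr_ge0 ?(ltW L_gt0) ?(ltW C0)// addr_ge0.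
(* An image cube with a critical point lies in a slab of thickness d^2. *)
have cubeP N (g : {ffun 'I_n -> 'I_N.+1}) d : 0 < d -> 3 * (1 + D) * d <= L ->
  (leb_outer [set y | exists x, [/\ gcube C d g x, \det (jac u x) = 0%R & y = rowf u x]]
    <= (6 * (1 + D) * d / L * (4 * (L * d)) ^+ n)%:E)%E.
  move=> d0 dL; set E := [set y | _].
  have [[z [gz Jz]]|nz] := pselect (exists z, gcube C d g z /\ \det (jac u z) = 0); last first.
    rewrite (_ : E = set0) ?(outer_measure0 (lebesgue_outer R n)); last first.
      by apply/seteqP; split => // y [x [gx Jx _]]; apply: nz; exists x.
    by rewrite lee_fin mulr_ge0 ?divr_ge0 ?exprn_ge0 ?mulr_ge0 ?(ltW L_gt0) ?(ltW d0) ?addr_ge0.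
  have [w [i [wi w1 wA]]] := sing_row Jz.
  (* The slab bound is used with size L d, from the Lipschitz constant, and thickness (1 + D) d^2,
     from the second-order remainder. *)
  have -> : 6 * (1 + D) * d / L = 6 * ((1 + D) * d ^+ 2) / (L * d) by field; rewrite !gt_eqF.
  have t0 : 0 < (1 + D) * d ^+ 2 by rewrite mulr_gt0 ?exprn_gt0// ltr_pwDl.
  have ts : 3 * ((1 + D) * d ^+ 2) <= L * d by rewrite expr2 !mulrA ler_pM2r.
  apply: le_trans (leb_slab (rowf u z) wi t0 ts).
  apply: (le_outer_measure (lebesgue_outer R n)) => y [x [gx Jx ->]].
  have xz : `|x - z| <= d by exact: gcube_diam (ltW d0) gx gz.
  split => [j|]; first by rewrite !mxE; apply: le_trans (HL _ _ _) _; rewrite ler_pM2l.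
  have -> : \sum_j w 0 j * (rowf u x 0 j - rowf u z 0 j) =
            \sum_j w 0 j * (u j x - u j z - \sum_k (x - z) 0 k * partial k (u j) z).
    under [RHS]eq_bigr do rewrite mulrBr.
    rewrite sumrB [X in _ - X](_ : _ = 0) ?subr0; first by apply: eq_bigr => j _; rewrite !mxE.
    under eq_bigr do rewrite mulr_sumr; rewrite exchange_big/= big1// => k _.
    under eq_bigr do rewrite mulrCA; rewrite -mulr_sumr.
    have e : (w *m jac u z) 0 k = 0 by rewrite wA mxE.
    rewrite [X in _ * X](_ : _ = 0) ?mulr0//; apply: etrans _ e.
    by rewrite [RHS]mxE; apply: eq_bigr => j _; rewrite jacE.
  apply: le_trans (ler_norm_sum _ _ _) _.
  apply: le_trans (_ : \sum_(j < n) n%:R * (1 + D1) * d ^+ 2 <= _).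
    apply: ler_sum => j _; rewrite normrM; apply: le_trans (ler_piMl _ (w1 j)) _ => //.
    apply: le_trans (taylor2 _ _ (cu j).1 (HD j)) _.
    by rewrite ler_wpM2l ?mulr_ge0 ?(ltW D10)// lerXn2r ?nnegrE// ltW.
  rewrite sumr_const card_ord -[X in X <= _]mulr_natl mulrA ler_wpM2r ?exprn_ge0 ?(ltW d0)//.
  apply: le_trans (_ : D <= _); last by rewrite lerDr.
  by rewrite /D ler_wpM2r ?mulr_ge0 ?(ltW D10)// ler_nat.
have ZN N : 3 * (1 + D) * (2 * C / N.+1%:R) <= L -> (leb_outer Z <= (Cst * (2 * C / N.+1%:R))%:E)%E.
  set d := 2 * C / _ => dL; have d0 : 0 < d by rewrite divr_gt0// mulr_gt0.
  apply: le_trans (_ : leb_outer (\big[setU/set0]_(g <- enum {ffun 'I_n -> 'I_N.+1})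
     [set y | exists x, [/\ gcube C d g x, \det (jac u x) = 0%R & y = rowf u x]]) <= _)%E.
    apply: (le_outer_measure (lebesgue_outer R n)) => y [x [xC Jx ->]].
    have [g gx] := gcube_cover N C0 xC.
    rewrite -bigcup_seq; exists g; first by rewrite /= mem_enum.
    by exists x.
  apply: le_trans (leb_outer_sum _ (fun g => cubeP N g d d0 dL)) _.
  rewrite lee_fin -cardE card_ffun !card_ord natrX /Cst.
  have -> : 4 * L * (2 * C) = N.+1%:R * (4 * (L * d)).
    have N0 : (N.+1%:R : R) != 0 by rewrite pnatr_eq0.
    by rewrite /d; move: (N.+1%:R : R) N0 => q q0; field.
  rewrite [(N.+1%:R * _) ^+ _]exprMn le_eqVlt; apply/orP; left; apply/eqP.
  have L_n0 : L != 0 by rewrite gt_eqF.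
  by move: (_ ^+ n) ((4 * _) ^+ n) => q r; field.
apply/eqP; rewrite eq_le (outer_measure_ge0 (lebesgue_outer R n)) andbT.
apply/lee_addgt0Pr => e e0; rewrite add0e.
pose c := Num.min (L / (3 * (1 + D))) (e / (1 + Cst)).
have D1p : 0 < 1 + D by rewrite ltr_pwDl.
have C1p : 0 < 1 + Cst by rewrite ltr_pwDl.
have c0 : 0 < c by rewrite lt_min !divr_gt0// mulr_gt0.
pose N := Num.truncn (2 * C / c).
have Nc : 2 * C / N.+1%:R <= c.
  rewrite ler_pdivrMr// [c * _]mulrC -ler_pdivrMr//; apply: ltW; exact: truncnS_gt.
move: (Nc); rewrite le_min => /andP[h1 h2].
apply: le_trans (ZN N _) _; first by rewrite mulrC -ler_pdivlMr// mulr_gt0.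
rewrite lee_fin; apply: le_trans (ler_wpM2l Cst0 h2) _.
by rewrite mulrCA ler_piMr ?(ltW e0)// ler_pdivrMr// mul1r lerDr.
Qed.

End sard.

(** * The Euclidean norm and the Brouwer degree *)

Section brouwer.
Context {R : realType} {n : nat}.
Implicit Types (x y z a b p q : 'rV[R]_n) (V K S : set 'rV[R]_n) (s t r C c d e : R) (g : 'rV[R]_n -> R).
Implicit Types (i j l m : 'I_n) (h k : 'rV[R]_n -> 'rV[R]_n).

Lemma enorm_ge0 x : 0 <= enorm x.
Proof. exact: sqrtr_ge0. Qed.

Lemma sqr_enorm x : enorm x ^+ 2 = \sum_i x 0 i ^+ 2.
Proof. by rewrite sqr_sqrtr// sumr_ge0// => i _; exact: sqr_ge0. Qed.

Lemma enorm_le x c : 0 <= c -> (enorm x <= c) = (\sum_i x 0 i ^+ 2 <= c ^+ 2).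
Proof. by move=> c0; rewrite -sqr_enorm ler_sqr ?nnegrE ?enorm_ge0. Qed.

Lemma coord_le_enorm x i : `|x 0 i| <= enorm x.
Proof.
rewrite -ler_sqr ?nnegrE ?enorm_ge0// sqr_enorm real_normK ?num_real//.
by rewrite (bigD1 i)//= lerDl sumr_ge0// => j _; exact: sqr_ge0.
Qed.

Lemma norm_le_enorm x : `|x| <= enorm x.
Proof. by apply: norm_row_le => [|i]; [exact: enorm_ge0|exact: coord_le_enorm]. Qed.

Lemma enorm_le_norm x : enorm x <= n%:R * `|x|.
Proof.
rewrite enorm_le ?mulr_ge0// exprMn; apply: le_trans (_ : \sum_(i < n) `|x| ^+ 2 <= _).
  by apply: ler_sum => i _; rewrite -[leLHS]real_normK ?num_real// lerXn2r ?nnegrE// coord_le_norm.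
rewrite sumr_const card_ord -[leLHS]mulr_natl ler_wpM2r ?exprn_ge0//.
by rewrite -natrX ler_nat; case: n => // N; rewrite expnS expn1 leq_pmulr.
Qed.

Lemma enorm0 : enorm (0 : 'rV[R]_n) = 0.
Proof. by apply/eqP; rewrite eq_le enorm_ge0 (le_trans (enorm_le_norm 0))// normr0 mulr0. Qed.

Lemma enorm0_eq x : enorm x = 0 -> x = 0.
Proof. by move=> x0; apply/normr0_eq0/eqP; rewrite eq_le normr_ge0 -x0 norm_le_enorm. Qed.

Lemma enormN x : enorm (- x) = enorm x.
Proof. by rewrite /enorm; congr Num.sqrt; apply: eq_bigr => i _; rewrite mxE sqrrN. Qed.

Lemma enormB x y : enorm (x - y) = enorm (y - x).
Proof. by rewrite -enormN opprB. Qed.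

Lemma enormZ t x : enorm (t *: x) = `|t| * enorm x.
Proof.
rewrite /enorm (_ : \sum_i _ = t ^+ 2 * \sum_i x 0 i ^+ 2).
  by rewrite sqrtrM ?sqr_ge0// sqrtr_sqr.
by rewrite mulr_sumr; apply: eq_bigr => i _; rewrite mxE exprMn.
Qed.

Lemma cauchy_schwarz x y : \sum_i x 0 i * y 0 i <= enorm x * enorm y.
Proof.
have [x0|x0] := eqVneq (enorm x) 0.
  by rewrite x0 mul0r big1// => i _; rewrite (enorm0_eq x0) mxE mul0r.
have [y0|y0] := eqVneq (enorm y) 0.
  by rewrite y0 mulr0 big1// => i _; rewrite (enorm0_eq y0) mxE mulr0.
have xp : 0 < enorm x by rewrite lt_neqAle eq_sym x0 enorm_ge0.
have yp : 0 < enorm y by rewrite lt_neqAle eq_sym y0 enorm_ge0.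
rewrite -(ler_pM2l (_ : 0 < 2)) // mulr_sumr.
(* The weights balance the inequality 2ab <= a^2 + b^2 so that both sums become |x| |y|. *)
apply: le_trans (_ : \sum_i (enorm y / enorm x * x 0 i ^+ 2 + enorm x / enorm y * y 0 i ^+ 2) <= _).
  apply: ler_sum => i _; rewrite -(ler_pM2r (mulr_gt0 xp yp)) -subr_ge0.
  have -> : (enorm y / enorm x * x 0 i ^+ 2 + enorm x / enorm y * y 0 i ^+ 2) * (enorm x * enorm y) -
     2 * (x 0 i * y 0 i) * (enorm x * enorm y) = (enorm y * x 0 i - enorm x * y 0 i) ^+ 2.
    by field; rewrite ?x0 ?y0.
  exact: sqr_ge0.
rewrite big_split/= -!mulr_sumr -!sqr_enorm le_eqVlt; apply/orP; left; apply/eqP.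
by field; rewrite ?x0 ?y0.
Qed.

Lemma enormD x y : enorm (x + y) <= enorm x + enorm y.
Proof.
rewrite enorm_le ?addr_ge0 ?enorm_ge0//.
have -> : \sum_i (x + y) 0 i ^+ 2 = enorm x ^+ 2 + 2 * (\sum_i x 0 i * y 0 i) + enorm y ^+ 2.
  rewrite !sqr_enorm mulr_sumr -!big_split/=; apply: eq_bigr => i _; rewrite mxE; ring.
by rewrite sqrrD lerD2r lerD2l -[leRHS]mulr_natl ler_pM2l// cauchy_schwarz.
Qed.

Lemma enorm_triangle x y z : enorm (x - z) <= enorm (x - y) + enorm (y - z).
Proof. by rewrite -[x - z](subrKA y); exact: enormD. Qed.

Lemma ler_enorm_sub x y : `|enorm x - enorm y| <= enorm (x - y).
Proof.
rewrite ler_norml; have := enormD (x - y) y; have := enormD (y - x) x.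
rewrite !subrK enormB => h1 h2; apply/andP; split; lra.
Qed.

Lemma continuous_enorm : continuous (@enorm R n).
Proof.
move=> x A /nbhs_ballP[e /= e0 HA]; apply/nbhs_ballP; exists (e / (n%:R + 1)).
  by rewrite /= divr_gt0// ltr_wpDl.
move=> y; rewrite -ball_normE /ball_/= ltr_pdivlMr ?ltr_wpDl// => xy.
apply: HA; rewrite -ball_normE /ball_/=.
apply: le_lt_trans (ler_enorm_sub _ _) _; apply: le_lt_trans (enorm_le_norm _) _.
by apply: le_lt_trans xy; rewrite mulrC ler_wpM2l// lerDl.
Qed.

Definition coordf k : 'I_n -> 'rV[R]_n -> R := fun m x => k x 0 m.

Lemma rowf_coordf k x : rowf (coordf k) x = k x.
Proof. by apply/rowP => m; rewrite mxE. Qed.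

Lemma partial_coordf k i x m : differentiable k x -> (partial i k x) 0 m = partial i (coordf k m) x.
Proof.
move=> dk; rewrite /partial derive_mx ?mxE//.
by apply: diff_derivable.
Qed.

(** The Jacobian matrix acts on row vectors from the right, while [jac] has the gradients as
    rows. *)
Lemma jacobian_coordf k x : differentiable k x -> 'J k x = (jac (coordf k) x)^T.
Proof.
move=> dk; apply/matrixP => i m; rewrite [RHS]mxE jacE -partial_coordf// /partial deriveEjacobian//.
by rewrite -rowE [RHS]mxE.
Qed.

Lemma det_jacobian k x : differentiable k x -> \det ('J k x) = \det (jac (coordf k) x).
Proof. by move=> dk; rewrite jacobian_coordf// det_tr. Qed.

Lemma differentiable_coordf k x m : differentiable k x -> differentiable (coordf k m) x.
Proof.
move=> dk; apply: (differentiable_comp (g := fun y : 'rV[R]_n => y 0 m)) => //.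
exact: differentiable_coord.
Qed.

Lemma row_differentiable k x : (forall m, differentiable (coordf k m) x) -> differentiable k x.
Proof.
move=> dk; rewrite (_ : k = fun y => \sum_m coordf k m y *: delta_mx 0 m); last first.
  by apply/funext => y; rewrite {1}[k y]row_sum_delta.
elim: (index_enum _) => [|m q IH].
  by rewrite (_ : (fun y => _) = fun=> 0); [exact: differentiable_cst|apply/funext => y; rewrite big_nil].
rewrite (_ : (fun y => _) = fun y => coordf k m y *: delta_mx 0 m + \sum_(m <- q) coordf k m y *: delta_mx 0 m); last first.
  by apply/funext => y; rewrite big_cons.
apply: differentiableD => //; apply: differentiableZl; exact: dk.
Qed.

Lemma foldr_partial_coordf k (s : seq 'I_n) m : smooth_on setT k ->
  (fun x => (foldr (@partial R n _) k s x) 0 m) = foldr (@partial R n _) (coordf k m) s.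
Proof.
move=> sk; elim: s => [//|i s IH] /=; rewrite -IH; apply/funext => x.
by rewrite -/(coordf _ m) -partial_coordf//; exact: sk.
Qed.

Lemma smooth_coordf k m : smooth_on setT k -> smooth_on setT (coordf k m).
Proof.
move=> sk s x _; rewrite -foldr_partial_coordf//.
by apply: differentiable_coordf; exact: sk.
Qed.

Lemma smooth_row k : (forall m, smooth_on setT (coordf k m)) -> smooth_on setT k.
Proof.
move=> sk; suff H (s : seq 'I_n) : (forall x, differentiable (foldr (@partial R n _) k s) x) /\
    forall m, (fun x => (foldr (@partial R n _) k s x) 0 m) = foldr (@partial R n _) (coordf k m) s.
  by move=> s x _; exact: (H s).1.
elim: s => [|i s [IH1 IH2]] /=.
  by split => // x; apply: row_differentiable => m; exact: (sk m [::]).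
have e m : (fun x => partial i (foldr (@partial R n _) k s) x 0 m) =
    foldr (@partial R n _) (coordf k m) (i :: s).
  by rewrite /= -IH2; apply/funext => x; exact: partial_coordf.
split => // x; apply: row_differentiable => m; rewrite /coordf e; exact: sk.
Qed.

Lemma smooth_translate k a : smooth_on setT k -> smooth_on setT (fun x => k x - a).
Proof.
move=> sk s x _; case/lastP: s => [|s i] /=.
  by apply: differentiableB; [exact: (sk [::])|exact: differentiable_cst].
have e : partial i (fun x => k x - a) = partial i k.
  by apply/funext => y; rewrite /partial /derive; under [in LHS]eq_fun do rewrite /= opprB addrA subrK.
by rewrite foldr_rcons e -foldr_rcons; exact: sk.
Qed.

Lemma sgr_sgz (t : R) : Num.sg t = (sgz t)%:~R.
Proof. by rewrite sgrEz. Qed.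

Lemma set_dist_le p A q : A q -> (set_dist p A <= (enorm (p - q))%:E)%E.
Proof. by move=> Aq; apply: ereal_inf_lbound; exists q. Qed.

Lemma set_dist_ge p A c : (forall q, A q -> c <= enorm (p - q)) -> (c%:E <= set_dist p A)%E.
Proof. by move=> H; apply: le_ereal_inf_tmp => _ [q Aq <-]; rewrite lee_fin; exact: H. Qed.

Lemma closure_bnd V x : open V -> closure V x -> V x \/ bnd V x.
Proof.
move=> oV cx; have [Vx|Vx] := pselect (V x); [by left|right].
by rewrite /bnd ((interior_id V).1 oV).
Qed.

Lemma bnd_closure V x : bnd V x -> closure V x.
Proof. by case. Qed.

Lemma bnd_open V x : open V -> bnd V x -> ~ V x.
Proof. by move=> oV; rewrite /bnd ((interior_id V).1 oV) => -[]. Qed.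

Lemma regular_sum V k p : open V -> bounded_set V -> smooth_on setT k ->
  (forall x, bnd V x -> k x != p) ->
  (forall x, V x -> k x = p -> \det ('J k x) != 0) ->
  exists2 s0 : R, 0 < s0 & forall s, 0 < s -> s < s0 ->
    pull V (kern s) (transl (coordf k) p) =
    (\sum_(x \in V `&` k @^-1` [set p]) sgz (\det ('J k x)))%:~R * lint (@kern R n s).
Proof.
move=> oV bV sk kb kr; pose u := transl (coordf k) p.
have dk x : differentiable k x by exact: (sk [::]).
have cu m : C2 (coordf k m) by exact/smooth_C2/smooth_coordf.
have cu' m : C2 (u m) by exact: C2_transl.
have u0 x : (forall m, u m x = 0) <-> k x = p.
  split => [H|e m]; last by rewrite /u /transl /coordf e subrr.
  by apply/rowP => m; apply/eqP; rewrite -subr_eq0; apply/eqP; exact: H.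
have ju x : \det (jac u x) = \det ('J k x) by rewrite det_jacobian// jac_transl.
have Vz x : closure V x -> k x = p -> V x.
  move=> cx kx; have [//|bx] := closure_bnd oV cx.
  by have := kb x bx; rewrite kx eqxx.
have [Z uZ HZ] : exists2 Z : seq 'rV[R]_n, uniq Z &
    forall x, (x \in Z) <-> closure V x /\ forall m, u m x = 0.
  apply: finite_zeros => // x cx /u0 kx; rewrite unitmxE unitfE ju.
  by apply: kr => //; exact: Vz.
have [s0 s00 Hs] : exists2 s0 : R, 0 < s0 & forall s, 0 < s -> s < s0 ->
    pull V (kern s) u = (\sum_(z <- Z) Num.sg (\det (jac u z))) * lint (@kern R n s).
  apply: pull_regular => // [z /HZ[cz uz]|x cx ux]; last by apply/HZ.
  have kz := (u0 z).1 uz; split => //; first exact: Vz.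
  by rewrite unitmxE unitfE ju; apply: kr => //; exact: Vz.
exists s0 => // s sp ss0; rewrite (Hs s sp ss0); congr (_ * _).
have -> : V `&` k @^-1` [set p] = [set` Z].
  apply/seteqP; split => [x [Vx kx]|x /HZ[cx /u0 kx]]; last by split => //; exact: Vz.
  by apply/HZ; split; [exact: subset_closure|exact/u0].
rewrite -fsbig_seq// rmorph_sum/=; apply: eq_bigr => z _.
by rewrite ju sgr_sgz.
Qed.

Lemma conv_lt (t q1 q2 q3 : R) : 0 <= t -> t <= 1 -> q3 < q2 -> q1 < q2 -> (1 - t) * q3 + t * q1 < q2.
Proof.
rewrite le_eqVlt => /predU1P[<- *|t0 t1 h3 h1]; first by rewrite subr0 mul1r mul0r addr0.
have : t * q1 < t * q2 by rewrite ltr_pM2l.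
have : (1 - t) * q3 <= (1 - t) * q2 by rewrite ler_wpM2l ?subr_ge0// ltW.
lra.
Qed.

(** The distance 3 c between [h] on the boundary and [S] is shared out: c for the distance from [k]
    to [h], c for a perturbation that makes [p] a regular value, and the rest keeps boundary values
    off [S]. *)
Lemma brouwer_degree_integral V h k c K S g p : open V -> bounded_set V ->
  smooth_on setT k -> compact K -> (forall x, ~ K x -> k x = 0) ->
  0 < c -> (forall x, closure V x -> enorm (k x - h x) <= c) ->
  C1 g -> compact S -> connected S -> (forall y, ~ S y -> g y = 0) -> S p ->
  (forall x y, bnd V x -> S y -> 3 * c <= enorm (h x - y)) ->
  (brouwer_degree V h p)%:~R * lint g = pull V g (coordf k).
Proof.
move=> oV bV sk cK k0 c0 kh cg cS nS g0 Sp hS.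
(* The set from which [brouwer_degree] picks. Each of its members satisfies the formula, because any
   admissible [k'] is joined to [k] by a segment avoiding [p] on the boundary; so the choice made by
   [xget] does not matter once the set is inhabited. *)
pose ok (d : int) := exists k' : 'rV[R]_n -> 'rV[R]_n,
    [/\ smooth_on setT k',
        (forall x, closure V x -> ((enorm (k' x - h x))%:E < set_dist p (h @` bnd V))%E),
        (forall x, V x -> k' x = p -> \det ('J k' x) != 0) &
        d = \sum_(x \in V `&` k' @^-1` [set p]) sgz (\det ('J k' x))].
have cu m : C2 (coordf k m) by exact/smooth_C2/smooth_coordf.
have okP (d : int) : ok d -> d%:~R * lint g = pull V g (coordf k).
  move=> [k' [sk' k'h k'r ->]].
  have bad x t : bnd V x -> 0 <= t <= 1 -> (1 - t) *: (k' x - p) + t *: (k x - p) != 0.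
    move=> Bx /andP[t0 t1]; apply/eqP => e0.
    have cx := bnd_closure Bx.
    have h1 : enorm (k' x - h x) < enorm (p - h x).
      by rewrite -lte_fin; apply: lt_le_trans (k'h x cx) _; apply: set_dist_le; exists x.
    have h2 : enorm (k x - h x) < enorm (p - h x).
      apply: le_lt_trans (kh x cx) _; rewrite enormB; apply: lt_le_trans (hS x p Bx Sp).
      by rewrite -{1}[c]mul1r ltr_pM2r// ltr1n.
    have e1 : p - h x = (1 - t) *: (k' x - h x) + t *: (k x - h x).
      apply/eqP; rewrite -subr_eq0 -oppr_eq0 -e0; apply/eqP/rowP => m; rewrite !mxE; ring.
    have : enorm (p - h x) < enorm (p - h x).
      rewrite {1}e1; apply: le_lt_trans (enormD _ _) _; rewrite !enormZ !ger0_norm ?subr_ge0//.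
      move: h1 h2; move: (enorm _) (enorm _) (enorm _) => q1 q2 q3 h1 h2.
      exact: conv_lt.
    by rewrite ltxx.
  have k'b x : bnd V x -> k' x != p.
    move=> Bx; have := bad x 0 Bx; rewrite lexx ler01 => /(_ isT).
    by rewrite subr0 scale1r scale0r addr0 subr_eq0.
  have [s1 s10 H1] := regular_sum oV bV sk' k'b k'r.
  have cu' m : C2 (coordf k' m) by exact/smooth_C2/smooth_coordf.
  have [|s2 s20 H2] := @pull_homotopy_ex R n V (transl (coordf k') p) (transl (coordf k) p) oV bV
    (fun m => C2_transl p (cu' m)) (fun m => C2_transl p (cu m)) _.
    move=> x t Bx tI; apply: contrapT => /forallNP H; have /negP := bad x t Bx tI; apply.
    apply/eqP/rowP => m; rewrite !mxE; apply/eqP; rewrite -[_ == _]negbK; apply/negP; exact: H.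
  have n0 : 0 < (n%:R + 1 : R) by rewrite ltr_wpDl.
  (* The Euclidean distance 2 c becomes a bound on one coordinate; the denominator n + 1 makes the
     comparison strict. *)
  apply/esym; apply: (@pull_degree R n V (coordf k) S g (2 * c / (n%:R + 1)) _ (Num.min s1 s2) p) => //.
  - by rewrite divr_gt0 ?mulr_gt0.
  - move=> x y Bx Sy; apply: contrapT => /forallNP H.
    have : enorm (k x - y) < 2 * c.
      apply: le_lt_trans (enorm_le_norm _) _.
      apply: le_lt_trans (_ : n%:R * (2 * c / (n%:R + 1)) < _).
        rewrite ler_wpM2l//; apply: norm_row_le; first by rewrite divr_ge0 ?mulr_ge0 ?ltW.
        by move=> m; rewrite !mxE leNgt; apply/negP => hm; apply: (H m); exact: ltW.
      by rewrite mulrA ltr_pdivrMr// mulrC ltr_pM2l ?mulr_gt0// ltrDl.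
    have := kh x (bnd_closure Bx); have := hS x y Bx Sy; have := enorm_triangle (h x) (k x) y.
    by rewrite [enorm (h x - k x)]enormB; lra.
  - by rewrite lt_min s10.
  - move=> s sp; rewrite lt_min => /andP[ss1 ss2].
    by rewrite -(H2 s sp ss2) (H1 s sp ss1).
apply: okP; apply: xgetPex.
have [C C0 VC] := cbox_bounded bV.
have [C' C'0 KC'] : exists2 C : R, 0 < C & forall x, closure V x -> `|x| <= C.
  exists C => // x cx; apply/(cbox_norm _ (ltW C0)).
  have cc : closed (cbox (const_mx (- C) : 'rV[R]_n) (const_mx C)) by exact: closed_cbox.
  by have /closure_id -> := cc; exact: closureS cx.
have N := sard (u := coordf k) cK C'0 cu.
set Z := [set y | _] in N.
have {}N : null Z by apply: N => m x Kx; rewrite /coordf k0// mxE.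
(* The set of critical values is null, so it cannot fill a cube around [p]; with this half side
   every point of the cube is within Euclidean distance c of [p]. *)
pose r := c / (n%:R + 1).
have r0 : 0 < r by rewrite divr_gt0// ltr_wpDl.
have [y [yZ yp]] : exists y, ~ Z y /\ `|y - p| <= r.
  apply: contrapT => /forallNP H.
  have : null (cbox (p - const_mx r) (p + const_mx r)).
    apply: nullS N => y yb; apply: contrapT => yZ; apply: (H y); split => //.
    apply: norm_row_le; first exact: ltW.
    by move=> i; have := yb i; rewrite !mxE ler_distl.
  rewrite /null leb_outer_cbox => [|i]; last by rewrite !mxE; lra.
  by move=> [] /eqP; rewrite gt_eqF// prodr_gt0// => i _; rewrite !mxE; lra.
(* Translation carries the regular value [y] of [k] to [p]. *)
pose a := y - p; pose k' x := k x - a.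
have ck' : coordf k' = transl (coordf k) a.
  by apply/funext => m; apply/funext => x; rewrite /coordf /transl /k' !mxE.
have sk' : smooth_on setT k' by exact: smooth_translate.
have dJ x : \det ('J k' x) = \det (jac (coordf k) x).
  by rewrite det_jacobian ?ck' ?jac_transl//; exact: (sk' [::]).
exists (\sum_(x \in V `&` k' @^-1` [set p]) sgz (\det ('J k' x))); exists k'; split => // x.
- move=> cx; apply: lt_le_trans (_ : (3 * c)%:E <= _)%E; last first.
    by apply: set_dist_ge => _ [q Bq <-]; rewrite enormB; exact: hS.
  rewrite lte_fin (_ : k' x - h x = (k x - h x) - a); last by rewrite /k' addrAC.
  apply: le_lt_trans (enormD _ _) _; rewrite enormN.
  have : enorm a <= c.
    apply: le_trans (enorm_le_norm _) _; apply: le_trans (ler_wpM2l (ler0n _ _) yp) _.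
    by rewrite /r mulrA ler_pdivrMr ?ltr_wpDl// mulrC ler_wpM2l ?(ltW c0)// lerDl.
  have := kh x cx; move: (enorm _) (enorm _) => q1 q2; lra.
- move=> Vx kx; apply/eqP => e0; apply: yZ; exists x; split.
  + by apply: KC'; exact: subset_closure.
  + by rewrite -dJ.
  + by rewrite rowf_coordf -[y](subrK p) -/a -kx /k' subrKC.
Qed.

End brouwer.

(** * Mollification and weak derivatives *)

Import HBNNSimple.

(** * Density of compactly supported Lipschitz functions in L^1 *)

Section density.
Context {R : realType} {n : nat}.
Implicit Types (x y z : 'rV[R]_n) (A K U : set 'rV[R]_n) (s t r C c d e : R) (f g h F G : 'rV[R]_n -> R).

Local Notation M := (caratheodory_type (lebesgue_outer R n)).

Definition dst A x : R := fine (set_dist x A).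

Lemma set_distE A x : A !=set0 -> set_dist x A = (dst A x)%:E.
Proof.
move=> [a Aa]; rewrite /dst fineK// ge0_fin_numE; last by apply: set_dist_ge => q _; exact: enorm_ge0.
by apply: le_lt_trans (set_dist_le _ Aa) _; rewrite ltry.
Qed.

Lemma dst_ge0 A x : 0 <= dst A x.
Proof. by apply: fine_ge0; apply: set_dist_ge => q _; exact: enorm_ge0. Qed.

Lemma dst_le A x a : A a -> dst A x <= enorm (x - a).
Proof. by move=> Aa; rewrite -lee_fin -set_distE; [exact: set_dist_le|exists a]. Qed.

Lemma dst_ge A x c : A !=set0 -> (forall a, A a -> c <= enorm (x - a)) -> c <= dst A x.
Proof. by move=> A0 H; rewrite -lee_fin -set_distE//; exact: set_dist_ge. Qed.

Lemma dst_lip1 A x y : A !=set0 -> dst A x <= enorm (x - y) + dst A y.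
Proof.
move=> A0; rewrite addrC -lerBlDr; apply: dst_ge => // a Aa.
by rewrite lerBlDr addrC; apply: le_trans (dst_le _ Aa) (enorm_triangle _ _ _).
Qed.

Lemma dst_lip A x y : A !=set0 -> `|dst A x - dst A y| <= enorm (x - y).
Proof.
move=> A0; rewrite ler_distl; have := dst_lip1 x y A0; have := dst_lip1 y x A0.
by rewrite enormB => h1 h2; apply/andP; split; [rewrite lerBlDl|rewrite addrC].
Qed.

Lemma continuous_dst A : A !=set0 -> continuous (dst A).
Proof.
move=> A0 x B /nbhs_ballP[e /= e0 HB]; apply/nbhs_ballP; exists (e / (n%:R + 1)).
  by rewrite /= divr_gt0// ltr_wpDl.
move=> y; rewrite -ball_normE /ball_/= ltr_pdivlMr ?ltr_wpDl// => xy.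
apply: HB; rewrite -ball_normE /ball_/=.
apply: le_lt_trans (dst_lip x y A0) _; apply: le_lt_trans (enorm_le_norm _) _.
by apply: le_lt_trans xy; rewrite mulrC ler_wpM2l// lerDl.
Qed.

Lemma dst_attained A x e : A !=set0 -> dst A x < e -> exists2 a, A a & enorm (x - a) < e.
Proof.
move=> A0 H; apply: contrapT => /forall2NP N; move: H; apply/negP; rewrite -leNgt.
by apply: dst_ge => // a Aa; rewrite leNgt; apply/negP; have [] := N a.
Qed.

Lemma dst_eq0 A x : A !=set0 -> closed A -> dst A x = 0 -> A x.
Proof.
move=> A0 cA d0; apply: cA => B /nbhs_ballP[e /= e0 HB].
have [|a Aa ae] := @dst_attained A x e A0; first by rewrite d0.
exists a; split => //; apply: HB; rewrite -ball_normE /ball_/=.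
exact: le_lt_trans (norm_le_enorm _) ae.
Qed.

(** Lipschitz rather than merely continuous, so that mollification at scale s is off by at most L
    s. *)
Definition Cc h := (exists2 L, 0 <= L & forall x y, `|h x - h y| <= L * `|x - y|) /\
  exists2 C, 0 <= C & forall x, C < `|x| -> h x = 0.

Lemma lipschitz_continuous h (L : R) : 0 <= L -> (forall x y, `|h x - h y| <= L * `|x - y|) -> continuous h.
Proof.
move=> L0 hL x B /nbhs_ballP[e /= e0 HB]; apply/nbhs_ballP; exists (e / (L + 1)).
  by rewrite /= divr_gt0// ltr_wpDl.
move=> y; rewrite -ball_normE /ball_/= ltr_pdivlMr ?ltr_wpDl// => xy.
apply: HB; rewrite -ball_normE /ball_/=; apply: le_lt_trans (hL _ _) _.
by apply: le_lt_trans xy; rewrite mulrC ler_wpM2l// lerDl.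
Qed.

Lemma Cc_continuous h : Cc h -> continuous h.
Proof. by move=> [[L L0 hL] _]; exact: lipschitz_continuous hL. Qed.

(** Membership in the L^1 closure of [Cc]. *)
Definition dens F := forall e, 0 < e -> exists2 h, Cc h & lint (fun x => `|F x - h x|) <= e.

Lemma lintble_Cc h : Cc h -> lintble h.
Proof.
move=> hc; have ch := Cc_continuous hc; case: hc => _ [C _ hC].
apply: (lintble_continuous (a := const_mx (- C)) (b := const_mx C)) => // x xC.
apply: hC; rewrite ltNge; apply/negP => h1; apply: xC => i; rewrite !mxE -ler_norml.
exact: le_trans (coord_le_norm _ _) h1.
Qed.

Lemma lint_dist3 F G h : lintble F -> lintble G -> lintble h ->
  lint (fun x => `|F x - h x|) <= lint (fun x => `|F x - G x|) + lint (fun x => `|G x - h x|).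
Proof.
move=> iF iG ih; rewrite -(lintD (lintble_norm (lintbleB iF iG)) (lintble_norm (lintbleB iG ih))).
apply: le_lint; first exact: lintble_norm (lintbleB iF ih).
  exact: lintbleD (lintble_norm (lintbleB iF iG)) (lintble_norm (lintbleB iG ih)).
by move=> x; exact: ler_distD.
Qed.

Lemma dens_lim F : lintble F ->
  (forall e, 0 < e -> exists G, [/\ lintble G, dens G & lint (fun x => `|F x - G x|) <= e]) -> dens F.
Proof.
move=> iF H e e0; have e20 : 0 < e / 2 by rewrite divr_gt0.
have [G [iG dG FG]] := H _ e20; have [h ch Gh] := dG _ e20; exists h => //.
by apply: le_trans (lint_dist3 iF iG (lintble_Cc ch)) _; rewrite [e]splitr lerD.
Qed.

Lemma CcD f g : Cc f -> Cc g -> Cc (fun x => f x + g x).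
Proof.
move=> [[L L0 fL] [C C0 fC]] [[L' L'0 gL] [D D0 gD]]; split.
  exists (L + L'); first exact: addr_ge0.
  by move=> x y; rewrite opprD addrACA mulrDl; apply: le_trans (ler_normD _ _) (lerD _ _).
exists (Num.max C D); first by rewrite le_max C0.
by move=> x; rewrite gt_max => /andP[/fC -> /gD ->]; rewrite addr0.
Qed.

Lemma CcZ c f : Cc f -> Cc (fun x => c * f x).
Proof.
move=> [[L L0 fL] [C C0 fC]]; split.
  exists (`|c| * L); first exact: mulr_ge0.
  by move=> x y; rewrite -mulrBr normrM -mulrA ler_wpM2l.
by exists C => // x /fC ->; rewrite mulr0.
Qed.

Lemma densD F G : lintble F -> lintble G -> dens F -> dens G -> dens (fun x => F x + G x).
Proof.
move=> iF iG dF dG e e0; have e20 : 0 < e / 2 by rewrite divr_gt0.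
have [f cf Ff] := dF _ e20; have [g cg Gg] := dG _ e20.
have if_ := lintble_Cc cf; have ig := lintble_Cc cg.
exists (fun x => f x + g x); first exact: CcD.
apply: le_trans (_ : lint (fun x => `|F x - f x| + `|G x - g x|) <= _).
  apply: le_lint; first exact: lintble_norm (lintbleB (lintbleD iF iG) (lintbleD if_ ig)).
    exact: lintbleD (lintble_norm (lintbleB iF if_)) (lintble_norm (lintbleB iG ig)).
  by move=> x; rewrite opprD addrACA; exact: ler_normD.
rewrite (lintD (lintble_norm (lintbleB iF if_)) (lintble_norm (lintbleB iG ig))).
by rewrite [e]splitr lerD.
Qed.

Lemma densZ c F : lintble F -> dens F -> dens (fun x => c * F x).
Proof.
move=> iF dF e e0; have c0 : 0 < 1 + `|c| by rewrite ltr_pwDl.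
have [f cf Ff] := dF _ (divr_gt0 e0 c0); have if_ := lintble_Cc cf.
exists (fun x => c * f x); first exact: CcZ.
rewrite (_ : (fun x => _) = fun x => `|c| * `|F x - f x|); last first.
  by apply/funext => x; rewrite -mulrBr normrM.
rewrite (lintZ _ (lintble_norm (lintbleB iF if_))).
apply: le_trans (ler_wpM2l (normr_ge0 c) Ff) _.
by rewrite mulrCA ler_piMr ?(ltW e0)// ler_pdivrMr// mul1r lerDr.
Qed.

Lemma dens0 : dens (fun=> 0).
Proof.
move=> e e0; exists (fun=> 0).
  by split; exists 0 => // x y; rewrite subrr normr0 mul0r.
rewrite (_ : (fun x => _) = fun=> 0); first by rewrite lint0 ltW.
by apply/funext => x; rewrite subrr normr0.
Qed.

Lemma dens_sum (I : Type) (q : seq I) (f : I -> 'rV[R]_n -> R) :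
  (forall k, lintble (f k) /\ dens (f k)) -> dens (fun x => \sum_(k <- q) f k x).
Proof.
move=> H; elim: q => [|k q IH].
  by under eq_fun do rewrite big_nil; exact: dens0.
under eq_fun do rewrite big_cons; apply: densD (H k).1 _ (H k).2 IH.
by apply: lintble_sum => l; exact: (H l).1.
Qed.

Lemma lint_dist_cvg N (F_ : nat -> 'rV[R]_n -> R) F g : null N -> lintble g -> (forall k, lmeas (F_ k)) ->
  (forall k x, ~ N x -> `|F_ k x| <= g x) -> (forall x, ~ N x -> F_ k x @[k --> \oo] --> F x) ->
  [/\ lintble F, forall k, lintble (F_ k) & lint (fun x => `|F x - F_ k x|) @[k --> \oo] --> 0].
Proof.
move=> N0 ig mF Fg FF.
have [iF iFk _] := dominated_lint N0 mF ig Fg FF.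
have Fg' x : ~ N x -> `|F x| <= g x.
  move=> Nx; have cF : `|F_ k x| @[k --> \oo] --> `|F x| by apply: cvg_norm; exact: FF.
  have cg : (g x : R) @[_ --> \oo] --> g x by exact: cvg_cst.
  by apply: ler_cvg_to cF cg _; near=> k; exact: Fg.
split => //.
have mD k : lmeas (fun x => `|F x - F_ k x|).
  exact: lintble_meas (lintble_norm (lintbleB iF (iFk k))).
have Db k x : ~ N x -> `| `|F x - F_ k x| | <= 2 * g x.
  move=> Nx; rewrite normr_id; apply: le_trans (ler_normB _ _) _.
  by rewrite mulrDl mul1r lerD// ?Fg'// Fg.
have D0 x : ~ N x -> `|F x - F_ k x| @[k --> \oo] --> 0.
  move=> Nx; rewrite -(normr0 R) -(subrr (F x)); apply: cvg_norm.
  by apply: cvgB; [exact: cvg_cst|exact: FF].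
have [_ _] := dominated_lint N0 mD (lintbleZ 2 ig) Db D0.
by rewrite lint0.
Unshelve. all: by end_near. Qed.

Lemma dens_dominated (F_ : nat -> 'rV[R]_n -> R) F g : lintble g -> (forall k, lmeas (F_ k)) ->
  (forall k x, `|F_ k x| <= g x) -> (forall x, F_ k x @[k --> \oo] --> F x) ->
  (forall k, dens (F_ k)) -> lintble F /\ dens F.
Proof.
move=> ig mF Fg FF dF.
have [iF iFk c0] := lint_dist_cvg (@null0 R n) ig mF (fun k x _ => Fg k x) (fun x _ => FF x).
split => //; apply: dens_lim iF _ => e e0.
move/cvgrPdist_le : c0 => /(_ _ e0) [k _ /(_ k (leqnn _)) /=].
rewrite sub0r normrN => /(le_trans (ler_norm _)) h.
by exists (F_ k); split.
Qed.

Lemma dens_compact K : compact K -> lintble (\1_K) /\ dens (\1_K).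
Proof.
move=> cK; have [K0|/set0P K0] := eqVneq K set0.
  rewrite K0 indic0; split; [exact: lintble0|exact: dens0].
have cK' : closed K by apply: compact_closed => //; exact: norm_hausdorff.
(* Truncated multiples of the distance, which decrease to the indicator of [K]. *)
pose h (j : nat) x : R := Num.max 0 (1 - j.+1%:R * dst K x).
have [C C0 KC] := compact_cbox_sub cK.
have lh j x y : `|h j x - h j y| <= j.+1%:R * n%:R * `|x - y|.
  have m1 (p q : R) : `|Num.max 0 p - Num.max 0 q| <= `|p - q|.
    have [p0|p0] := leP p 0; have [q0|q0] := leP q 0; rewrite ?subrr ?normr0 ?normr_ge0//.
      by rewrite sub0r normrN (gtr0_norm q0) distrC; apply: le_trans (ler_norm (q - p)); lra.
    by rewrite subr0 (gtr0_norm p0); apply: le_trans (ler_norm (p - q)); lra.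
  apply: le_trans (m1 _ _) _.
  rewrite (_ : _ - _ = j.+1%:R * (dst K y - dst K x)); last ring.
  rewrite normrM normr_nat -mulrA ler_wpM2l//; apply: le_trans (dst_lip y x K0) _.
  by rewrite enormB; exact: enorm_le_norm.
have ch j : continuous (h j) by apply: lipschitz_continuous (lh j); exact: mulr_ge0.
have h01 j x : 0 <= h j x <= 1.
  rewrite /h le_max lexx/= ge_max ler01/= gerDl oppr_le0 mulr_ge0// dst_ge0//.
have hout j x : C + 1 < `|x| -> h j x = 0.
  move=> xC; rewrite /h; apply/max_idPl; rewrite subr_le0.
  have d1 : 1 <= dst K x.
    apply: dst_ge => // a Ka; apply: le_trans (norm_le_enorm _).
    have := lerB_dist x a; have := (cbox_norm _ (ltW C0)).1 (KC a Ka); move: xC; lra.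
  by apply: le_trans d1 _; rewrite ler_peMl ?dst_ge0// ler1n.
have ib : lintble (\1_(cbox (const_mx (- (C + 1)) : 'rV[R]_n) (const_mx (C + 1)))).
  apply: lintble_indic; first exact: measurable_cbox.
  by rewrite leb_outer_cbox ?ltry// => i; rewrite !mxE; lra.
have C10 : 0 <= C + 1 by rewrite addr_ge0// ltW.
apply: (dens_dominated (F_ := h) ib).
- by move=> j; exact: continuous_lmeas.
- move=> j x; rewrite indicE; case: (pselect (`|x| <= C + 1)) => xC.
    by rewrite mem_set ?ger0_norm; [case/andP: (h01 j x)|case/andP: (h01 j x)|exact/cbox_norm].
  by rewrite hout ?normr0// ltNge; exact/negP.
- move=> x; rewrite indicE; case: (pselect (K x)) => Kx.
    rewrite mem_set//; apply: cvg_near_cst; near=> j; rewrite /h.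
    have -> : dst K x = 0 by apply/eqP; rewrite eq_le dst_ge0 (le_trans (dst_le _ Kx))// subrr enorm0.
    by rewrite mulr0 subr0; apply/max_idPr.
  have d0 : 0 < dst K x.
    by rewrite lt_neqAle dst_ge0 andbT eq_sym; apply/eqP => /(dst_eq0 K0 cK').
  rewrite memNset//; apply: cvg_near_cst; near=> j; rewrite /h; apply/max_idPl.
  rewrite subr_le0 -ler_pdivrMr// div1r; near: j; exists (Num.truncn (dst K x)^-1) => // j /= jt.
  apply: ltW; apply: lt_le_trans (truncnS_gt _) _; by rewrite ler_nat ltnS.
- move=> j e e0; exists (h j); first by split; [exists (j.+1%:R * n%:R); [exact: mulr_ge0|exact: lh]|exists (C + 1); [|exact: hout]].
  rewrite (_ : (fun x => _) = fun=> 0); first by rewrite lint0 ltW.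
  by apply/funext => x; rewrite subrr normr0.
Unshelve. all: by end_near. Qed.

Lemma lint_indic_dist A U e : measurable (A : set M) -> measurable (U : set M) -> A `<=` U -> 0 < e ->
  (leb_outer A < +oo)%E -> (leb_outer U <= leb_outer A + e%:E)%E ->
  lint (fun x => `|\1_A x - \1_U x|) <= e.
Proof.
move=> mA mU AU e0 Aoo UA.
have fA : leb_outer A \is a fin_num by rewrite ge0_fin_numE// (outer_measure_ge0 (lebesgue_outer R n)).
have Uoo : (leb_outer U < +oo)%E by apply: le_lt_trans UA _; rewrite -(fineK fA) -EFinD ltry.
have fU : leb_outer U \is a fin_num by rewrite ge0_fin_numE// (outer_measure_ge0 (lebesgue_outer R n)).
rewrite (_ : (fun x => _) = fun x => \1_U x - \1_A x); last first.
  apply/funext => x; rewrite distrC ger0_norm// subr_ge0 !indicE.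
  by case: (pselect (A x)) => Ax; [rewrite !mem_set//; exact: AU|rewrite (memNset Ax)].
rewrite lintB ?lint_indic//; try exact: lintble_indic.
by rewrite lerBlDl -lee_fin EFinD !fineK.
Qed.

(** A nearly optimal covering by boxes has a union that exceeds [A] by little; that union is the
    limit of finite unions of boxes, which are compact. *)
Lemma dens_measurable A : measurable (A : set M) -> (leb_outer A < +oo)%E -> dens (\1_A).
Proof.
move=> mA Aoo; apply: dens_lim (lintble_indic mA Aoo) _ => e e0.
have fA : leb_outer A \is a fin_num by rewrite ge0_fin_numE// (outer_measure_ge0 (lebesgue_outer R n)).
have [_ [F [_ AF] <-]] := lb_ereal_inf_adherent e0 fA.
rewrite -[ereal_inf _]/(leb_outer A) => Fe.
have Foo : (\sum_(0 <= k <oo) box_vol (F k) < +oo)%E.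
  by apply: lt_trans Fe _; rewrite -(fineK fA) -EFinD ltry.
have Fk k : F k = set0 \/ exists a b, F k = cbox a b.
  have : (box_vol (F k) < +oo)%E.
    apply: le_lt_trans Foo; rewrite (@nneseriesD1 _ _ k)// => [|*]; last exact: box_vol_ge0.
    by rewrite leeDl// nneseries_ge0// => *; exact: box_vol_ge0.
  rewrite /box_vol; case: ifPn => [/eqP|_ h]; first by left.
  right; apply: contrapT => N; move: h; rewrite (_ : [set _ | _ in _] = set0) ?ereal_inf0 ?ltxx//.
  by apply/seteqP; split => // r [[a b] [_ e'] _]; apply: N; exists a, b.
have cF k : compact (F k).
  by have [->|[a [b ->]]] := Fk k; [exact: compact0|exact: compact_cbox].
have clF k : closed (F k) by apply: compact_closed => //; exact: norm_hausdorff.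
pose U := \bigcup_k F k; pose V N := \big[setU/set0]_(k < N) F k.
have mF k : measurable (F k : set M) by exact: closed_lmeasurable.
have mU : measurable (U : set M) by exact: bigcup_measurable.
have UA : (leb_outer U <= leb_outer A + e%:E)%E.
  apply: le_trans (ltW Fe); apply: le_trans (outer_measure_sigma_subadditive (lebesgue_outer R n) F) _.
  apply: lee_nneseries => [k _|k _]; first by move=> _; exact: (outer_measure_ge0 (lebesgue_outer R n)).
  apply: ereal_inf_lbound; exists (fun j => if j == 0%N then F k else set0).
    by split => // x Fx; exists 0%N.
  rewrite nneseries_recl//; last by move=> j _; exact: box_vol_ge0.
  by rewrite eqxx eseries0 ?adde0// => -[|j]//= _ _; rewrite box_vol0.
have AU : A `<=` U by [].
have Uoo : (leb_outer U < +oo)%E by apply: le_lt_trans UA _; rewrite -(fineK fA) -EFinD ltry.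
have cV N : compact (V N).
  rewrite /V; elim: N => [|N IH]; first by rewrite big_ord0; exact: compact0.
  by rewrite big_ord_recr/=; exact: compactU.
have VU N : V N `<=` U by rewrite /V -bigcup_mkord => x [k _ Fx]; exists k.
have clV N : closed (V N) by apply: compact_closed => //; exact: norm_hausdorff.
have [iU dU] : lintble (\1_U) /\ dens (\1_U).
  apply: (dens_dominated (F_ := fun N => \1_(V N)) (lintble_indic mU Uoo)).
  - by move=> N; exact/lmeas_indic/closed_lmeasurable.
  - move=> N x; rewrite !indicE; case: (pselect (V N x)) => Vx.
      by rewrite !mem_set ?normr1//; exact: VU Vx.
    by rewrite memNset// normr0.
  - move=> x; rewrite indicE; case: (pselect (U x)) => Ux; apply: cvg_near_cst.
      case: (Ux) => k _ Fx; exists k.+1 => // N /= kN; rewrite indicE !mem_set//.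
      by rewrite /V -bigcup_mkord; exists k.
    by near=> N; rewrite indicE !memNset// => /VU.
  - by move=> N; exact: (dens_compact (cV N)).2.
exists (\1_U); split => //; exact: lint_indic_dist.
Unshelve. all: by end_near. Qed.

Lemma dens_ge0 F : lintble F -> (forall x, 0 <= F x) -> dens F.
Proof.
move=> iF F0.
have mF : measurable_fun [set: M] (fun x : M => (F x)%:E) by exact/measurable_EFinP/lintble_meas.
have F0' x : [set: M] x -> (0 <= (F x)%:E)%E by rewrite lee_fin.
pose S k : {nnsfun M >-> R} := nnsfun_approx measurableT mF k.
have SF (x : M) : S k x @[k --> \oo] --> F x.
  have := @cvg_approx _ M R setT (fun x : M => (F x)%:E) x F0' I (ltry _).
  by under eq_fun do rewrite -(nnsfun_approxE measurableT mF).
have Sle k x : S k x <= F x.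
  have nd := @nd_nnsfun_approx _ M R setT measurableT _ mF.
  have c2 : (S k x : R) @[_ --> \oo] --> S k x by exact: cvg_cst.
  apply: ler_cvg_to c2 (SF x) _; near=> l.
  have kl : (k <= l)%N by near: l; exists k.
  by have /lefP/(_ x) := nd k l kl.
have SF' k x : `|S k x| <= F x by rewrite ger0_norm//; exact: fun_ge0.
apply: (dens_dominated (F_ := fun k x => S k x) iF _ SF' SF _).2 => [k|k].
  by apply: measurable_funPT.
have e x : S k x = \sum_(y <- finmap.enum_fset (fset_set (range (S k)))) y * \1_(S k @^-1` [set y]) x.
  by rewrite -fsbig_finite//; exact: fimfunE.
under eq_fun do rewrite e.
suff H (y : R) : lintble (fun x => y * \1_(S k @^-1` [set y]) x) /\ dens (fun x => y * \1_(S k @^-1` [set y]) x).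
  by apply: dens_sum.
have my : measurable (S k @^-1` [set y] : set M) by exact: measurable_sfunP.
have [y0|y0] := eqVneq y 0.
  rewrite y0 (_ : (fun x => _) = fun=> 0); last by apply/funext => x; rewrite mul0r.
  by split; [exact: lintble0|exact: dens0].
have iy : lintble (fun x => y * \1_(S k @^-1` [set y]) x).
  apply: (le_lintble _ _ iF); first exact: lmeasZ (lmeas_indic my).
  move=> x; rewrite indicE; case: (pselect ((S k @^-1` [set y]) x)) => Sx.
    by rewrite mem_set// mulr1 -Sx.
  by rewrite memNset// mulr0 normr0.
have iA : lintble (\1_(S k @^-1` [set y])).
  have := lintbleZ y^-1 iy; rewrite (_ : (fun x => _) = \1_(S k @^-1` [set y]))//.
  by apply/funext => x; rewrite mulKf.
split => //; apply: (densZ _ iA); apply: (dens_measurable my).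
have := lintE iA; rewrite integral_indic// setIT => e1.
by rewrite -[X in (X < _)%E]e1 ltry.
Unshelve. all: by end_near. Qed.

Lemma dens_lintble F : lintble F -> dens F.
Proof.
move=> iF; have inF := lintble_norm iF.
have d1 : dens (fun x => `|F x| + F x).
  by apply: dens_ge0 (lintbleD inF iF) _ => x; rewrite -lerBlDr sub0r -normrN ler_norm.
have d2 : dens (fun x => `|F x| - F x).
  by apply: dens_ge0 (lintbleB inF iF) _ => x; rewrite subr_ge0 ler_norm.
rewrite (_ : F = fun x => 2^-1 * (`|F x| + F x) + (- 2^-1) * (`|F x| - F x)).
  apply: densD (lintbleZ _ (lintbleD inF iF)) (lintbleZ _ (lintbleB inF iF)) _ _.
    exact: densZ (lintbleD inF iF) d1.
  exact: densZ (lintbleB inF iF) d2.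
by apply/funext => x; lra.
Qed.

End density.

(** * Convolution with the normalized kernels *)

Section convolution.
Context {R : realType} {n : nat}.
Implicit Types (x y z : 'rV[R]_n) (s t r C c d e : R) (f g h F G : 'rV[R]_n -> R) (i j m : 'I_n).

Local Notation M := (caratheodory_type (lebesgue_outer R n)).

Definition ker s y : R := kern s y / lint (@kern R n s).

Definition conv G F x : R := lint (fun y => F y * G (x - y)).

Lemma ker_ge0 s y : 0 < s -> 0 <= ker s y.
Proof. by move=> s0; rewrite divr_ge0 ?kern_ge0// ltW// lint_kern_gt0. Qed.

Lemma ker_out s z : 0 < s -> s < `|z| -> ker s z = 0.
Proof.
by move=> s0; rewrite -[z in `|z|]subr0 -[z in ker _ z]subr0 /ker => h; rewrite kern_shift_out// mul0r.
Qed.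

Lemma kerE s : ker s = (fun y => (lint (@kern R n s))^-1 * kern s y).
Proof. by apply/funext => y; rewrite mulrC. Qed.

Lemma lintble_ker s : 0 < s -> lintble (ker s).
Proof. by move=> s0; rewrite kerE; exact: (lintbleZ _ (lintble_kern s0)). Qed.

Lemma lint_ker s : 0 < s -> lint (ker s) = 1.
Proof.
move=> s0; rewrite kerE (lintZ _ (lintble_kern s0)) mulVf// gt_eqF//; exact: (lint_kern_gt0 s0).
Qed.

Lemma lint_ker_shift s z : 0 < s ->
  [/\ lintble (fun y => ker s (z - y)), lint (fun y => ker s (z - y)) = 1,
      lintble (fun y => ker s (y - z)) & lint (fun y => ker s (y - z)) = 1].
Proof.
move=> s0; have ik := lintble_ker s0; have [h1 h2] := lint_reflect z ik.
have [h3 h4] := lint_translate (- z) ik; have e := lint_ker s0.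
by split; [exact: h1|exact: etrans h2 e|exact: h3|exact: etrans h4 e].
Qed.

Lemma continuous_ker s : continuous (ker s).
Proof. by rewrite kerE; apply: continuous_mulf; [exact: continuous_cstf|exact: continuous_kern]. Qed.

Lemma ker_bounded s : 0 < s -> exists2 B, 0 < B & forall y, `|ker s y| <= B.
Proof.
move=> s0; have [B B0 HB] := @kern_bounded R n s s0; have k0 := @lint_kern_gt0 R n s s0.
exists (B / lint (@kern R n s)); first exact: divr_gt0.
by move=> y; rewrite normrM normfV (gtr0_norm k0) ler_pM2r ?invr_gt0.
Qed.

Lemma conv_lintble G F x B : continuous G -> (forall y, `|G y| <= B) -> lintble F ->
  lintble (fun y => F y * G (x - y)).
Proof.
move=> cG GB iF; apply: (le_lintble (g := fun y => B * `|F y|)); last exact: (lintbleZ _ (lintble_norm iF)).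
  apply: lmeasM; first exact: lintble_meas iF.
  apply: continuous_lmeas => y; apply: (continuous_comp (f := fun y => x - y)); last exact: cG.
  by apply: continuousB; [exact: cst_continuous|exact: cvg_id].
by move=> y; rewrite normrM mulrC ler_wpM2r.
Qed.

Lemma conv_ker_lintble s F x : 0 < s -> lintble F -> lintble (fun y => F y * ker s (x - y)).
Proof. by move=> s0 iF; have [B B0 HB] := ker_bounded s0; exact: (conv_lintble x (@continuous_ker s) HB iF). Qed.

Lemma jmeas_ker s : jmeas (fun y x => ker s (x - y)).
Proof.
have mk : jmeas (fun y x => kern s (x - y)).
  apply: (@jmeas_prod _ _ _ _ (fun m y x => bump ((x - y) 0 m / s))) => m.
  apply: (jmeas_comp (u := fun t => bump (t / s)) (F := fun y x => (x - y) 0 m)).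
    move=> t; apply: (continuous_comp (f := fun t => t / s)); last exact: (diffn_continuous (diffn_bump 0)).
    by apply: continuousM; [exact: cvg_id|exact: cst_continuous].
  rewrite (_ : (fun y x => _) = fun y x => x 0 m - y 0 m); last first.
    by apply/funext => y; apply/funext => x; rewrite !mxE.
  by apply: jmeasB; [apply: jmeas_snd|apply: jmeas_fst]; apply: continuous_lmeas; exact: coord_continuous.
rewrite (_ : (fun y x => _) = fun y x => (lint (@kern R n s))^-1 * kern s (x - y)); last first.
  by apply/funext => y; apply/funext => x; rewrite kerE.
have mc : jmeas (fun _ _ : 'rV[R]_n => (lint (@kern R n s))^-1).
  exact: (@jmeas_fst R n (fun=> (lint (@kern R n s))^-1) (continuous_lmeas (@continuous_cstf R n _))).
exact: (jmeasM mc mk).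
Qed.

(** By Tonelli, since every translate of the kernel has mass 1. *)
Lemma young s F : 0 < s -> lintble F ->
  lintble (conv (ker s) F) /\ lint (fun x => `|conv (ker s) F x|) <= lint (fun x => `|F x|).
Proof.
move=> s0 iF; pose H y x := F y * ker s (x - y).
have mH : jmeas H by exact: jmeasM (jmeas_fst (lintble_meas iF)) (jmeas_ker s).
have i1 y : lintble (H y) by have [_ _ h _] := lint_ker_shift y s0; exact: (lintbleZ (F y) h).
have i2 x : lintble (H ^~ x) by exact: conv_ker_lintble.
have e1 y : lint (fun x => `|H y x|) = `|F y|.
  have [_ _ h e] := lint_ker_shift y s0.
  rewrite -[RHS]mulr1 -e -(lintZ _ h); congr lint; apply/funext => x.
  by rewrite normrM [`|ker _ _|]ger0_norm// ker_ge0.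
have E1 := funext e1.
have iN : lintble (fun y => lint (fun x => `|H y x|)) by rewrite E1; exact: lintble_norm.
have [j1 j2 _] := lint_fubini mH i1 i2 iN.
have [j3 j4] := lint_tonelli (jmeas_norm mH) (fun y x => normr_ge0 _) (fun y => lintble_norm (i1 y))
  (fun x => lintble_norm (i2 x)) iN.
have ic : lintble (conv (ker s) F) by exact: j2.
have e4 := etrans (esym j4) (congr1 lint E1).
split; first exact: ic.
apply: (@le_trans _ _ (lint (fun x => lint (fun y => `|H y x|)))); last by move: e4 => ->.
apply: (le_lint (lintble_norm ic) j3) => x; exact: (le_norm_lint (i2 x)).
Qed.

Lemma convB s F G x : 0 < s -> lintble F -> lintble G ->
  conv (ker s) (fun y => F y - G y) x = conv (ker s) F x - conv (ker s) G x.
Proof.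
move=> s0 iF iG; rewrite /conv -(lintB (conv_ker_lintble x s0 iF) (conv_ker_lintble x s0 iG)).
by congr lint; apply/funext => y; rewrite mulrBl.
Qed.

Lemma conv_close s f E L z : 0 < s -> lmeas f -> (forall y, `|f y| <= E) -> 0 <= L ->
  (forall x y, `|f x - f y| <= L * `|x - y|) -> `|conv (ker s) f z - f z| <= L * s.
Proof.
move=> s0 mf fE L0 fL; have k0 := @lint_kern_gt0 R n s s0.
have ik := lintble_kern_mul z s0 mf fE.
have -> : conv (ker s) f z = (lint (@kern R n s))^-1 * lint (fun y => f y * kern s (z - y)).
  by rewrite -(lintZ _ ik) /conv; congr lint; apply/funext => y; rewrite /ker mulrA mulrC.
rewrite -(ler_pM2r k0) -[X in `|_| * X](gtr0_norm k0) -normrM mulrBl mulrAC mulVf ?gt_eqF// mul1r.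
exact: kern_mul_close fE L0 fL.
Qed.

Lemma conv_out s f z C : 0 < s -> (forall x, C < `|x| -> f x = 0) -> C + s < `|z| -> conv (ker s) f z = 0.
Proof.
move=> s0 fC zC; rewrite /conv (_ : (fun y => _) = fun=> 0) ?lint0//; apply/funext => y.
have [h|h] := leP `|z - y| s; last by rewrite ker_out// mulr0.
by rewrite fC ?mul0r//; have := lerB_dist z y; move: zC h; lra.
Qed.

(** For a Lipschitz [h] with bounded support the error is at most L s on a fixed box and 0
    elsewhere. The rest is density, used twice: once for F - h and once, through [young], for its
    convolution. *)
Lemma conv_cvg F : lintble F -> forall e, 0 < e -> exists2 s0, 0 < s0 & forall s, 0 < s -> s < s0 ->
  lint (fun x => `|conv (ker s) F x - F x|) <= e.
Proof.
move=> iF e e0; have e40 : 0 < e / 4 by rewrite divr_gt0.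
have [h hc Fh] := dens_lintble iF e40.
have ih := lintble_Cc hc; have ch := Cc_continuous hc.
case: (hc) => [[L L0 hL] [C C0 hC]].
have C10 : 0 <= C + 1 by rewrite addr_ge0.
pose B := cbox (const_mx (- (C + 1)) : 'rV[R]_n) (const_mx (C + 1)).
have vB : leb_outer B = ((2 * (C + 1)) ^+ n)%:E.
  rewrite leb_outer_cbox => [|i]; last by rewrite !mxE; lra.
  congr (_%:E); rewrite (eq_bigr (fun=> 2 * (C + 1))) ?prodr_const ?card_ord// => i _.
  by rewrite !mxE; ring.
have iB : lintble (\1_B) by apply: lintble_indic; [exact: measurable_cbox|rewrite vB ltry].
have lB : lint (\1_B) = (2 * (C + 1)) ^+ n by rewrite lint_indic ?vB//; exact: measurable_cbox.
pose v : R := (2 * (C + 1)) ^+ n; have v0 : 0 <= v by rewrite exprn_ge0// mulr_ge0.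
have p0 : 0 < L * v + 1 by rewrite ltr_wpDl// mulr_ge0.
exists (Num.min 1 (e / 2 / (L * v + 1))); first by rewrite lt_min ltr01 !divr_gt0.
move=> s sp; rewrite lt_min => /andP[s1 se].
have [D D0 HD] := compact_fun_bound (@compact_cbox R n (const_mx (- C)) (const_mx C)) ch.
have hb y : `|h y| <= D.
  have [yC|yC] := leP `|y| C; first by apply: HD; exact/cbox_norm.
  by rewrite hC// normr0 ltW.
have mh := lintble_meas ih.
have ich := (young sp ih).1; have icF := (young sp iF).1; have iFh := lintbleB iF ih.
have h1 : lint (fun x => `|conv (ker s) h x - h x|) <= e / 2.
  apply: le_trans (_ : lint (fun x => L * s * \1_B x) <= _).
    apply: le_lint (lintble_norm (lintbleB ich ih)) (lintbleZ _ iB) _ => x.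
    rewrite indicE; case: (pselect (`|x| <= C + 1)) => xC.
      rewrite mem_set ?mulr1; last exact/cbox_norm.
      exact: conv_close hb L0 hL.
    have xC' : C + 1 < `|x| by rewrite ltNge; exact/negP.
    rewrite hC ?(conv_out sp hC) ?subrr ?normr0 ?mulr_ge0 ?(ltW sp)//; move: xC'; lra.
  rewrite (lintZ _ iB) lB -/v mulrAC; apply: le_trans (ler_wpM2l (mulr_ge0 L0 v0) (ltW se)) _.
  by rewrite mulrCA ler_piMr ?divr_ge0 ?(ltW e0)// ler_pdivrMr// mul1r lerDl.
have h2 : lint (fun x => `|conv (ker s) F x - conv (ker s) h x|) <= e / 4.
  apply: le_trans Fh; apply: le_trans (young sp iFh).2.
  rewrite le_eqVlt; apply/orP; left; apply/eqP; congr lint; apply/funext => x.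
  by rewrite convB.
have h3 : lint (fun x => `|h x - F x|) <= e / 4.
  by apply: le_trans Fh; under eq_fun do rewrite distrC.
apply: le_trans (lint_dist3 icF ich iF) _.
apply: le_trans (lerD h2 (le_trans (lint_dist3 ich ih iF) (lerD h1 h3))) _; lra.
Qed.

Lemma partial_reflect G z i y : differentiable G (z - y) ->
  differentiable (fun y => G (z - y)) y /\ partial i (fun y => G (z - y)) y = - partial i G (z - y).
Proof.
move=> dG; have d1 : differentiable (fun y => z - y) y by apply: differentiableB => //; exact: differentiable_cst.
have d : differentiable (fun y => G (z - y)) y by exact: (differentiable_comp d1 dG).
split => //; rewrite (_ : partial i _ y = 'D_(- delta_mx 0 i) G (z - y)).
  by rewrite deriveE// linearN/= partialE.
have e : (fun h : R => h^-1 *: (((fun y => G (z - y)) \o shift y) (h *: delta_mx 0 i) - G (z - y))) =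
  (fun h : R => h^-1 *: ((G \o shift (z - y)) (h *: - delta_mx 0 i) - G (z - y))).
  by apply/funext => h /=; rewrite scalerN opprD addrCA.
by rewrite /partial /derive e.
Qed.

Definition dotl (a w : 'rV[R]_n) : R := \sum_j a 0 j * w 0 j.

Lemma dotl_is_linear (a : 'rV[R]_n) : linear (dotl a).
Proof.
move=> c x y; rewrite /dotl scaler_sumr -big_split/=; apply: eq_bigr => j _.
by rewrite !mxE mulrDr mulrCA.
Qed.

HB.instance Definition _ (a : 'rV[R]_n) := GRing.isLinear.Build R 'rV[R]_n R _ (dotl a) (dotl_is_linear a).

(** The partial derivatives of [G] are Lipschitz, so its Taylor remainder is uniformly quadratic;
    integrated against [F], it bounds the remainder of the convolution directly. *)
Lemma conv_differentiable G F C x : lintble F -> C2 G -> (forall y, C < `|y| -> G y = 0) ->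
  differentiable (conv G F) x /\ forall i, partial i (conv G F) x = conv (partial i G) F x.
Proof.
move=> iF cG GC; pose K := cbox (const_mx (- C) : 'rV[R]_n) (const_mx C).
have cK : compact K by exact: compact_cbox.
have GK y : ~ K y -> G y = 0.
  move=> Ky; apply: GC; rewrite ltNge; apply/negP => h; apply: Ky => i; rewrite !mxE -ler_norml.
  exact: le_trans (coord_le_norm _ _) h.
have clK : closed K by exact: closed_cbox.
have pK i y : ~ K y -> partial i G y = 0 by exact: (partial_out i clK GK).
have bd (H : 'rV[R]_n -> R) : continuous H -> (forall y, ~ K y -> H y = 0) -> exists B, forall y, `|H y| <= B.
  move=> cH HK; have [B B0 HB] := compact_fun_bound cK cH; exists B => y.
  by have [/HB//|/HK ->] := pselect (K y); rewrite normr0 ltW.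
have [B HB] := bd G (C1_continuous (C2_C1 cG)) GK.
have iG y : lintble (fun z => F z * G (y - z)).
  exact: (conv_lintble y (C1_continuous (C2_C1 cG)) HB iF).
have iP i y : lintble (fun z => F z * partial i G (y - z)).
  have [B' HB'] := bd _ (C1_continuous (cG.2 i)) (pK i).
  exact: (conv_lintble y (C1_continuous (cG.2 i)) HB' iF).
have /choice[D0 HD0] i : exists D, 0 < D /\ forall x y, `|partial i G x - partial i G y| <= D * `|x - y|.
  by have [D D0 HD] := lipschitz_compact cK (cG.2 i) (pK i); exists D.
pose D := \sum_i D0 i.
have HD i y z : `|partial i G y - partial i G z| <= D * `|y - z|.
  apply: le_trans ((HD0 i).2 y z) _; rewrite ler_wpM2r// /D (bigD1 i)//= lerDl sumr_ge0// => k _.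
  exact: ltW (HD0 k).1.
have D_ge0 : 0 <= D by rewrite sumr_ge0// => k _; exact: ltW (HD0 k).1.
pose T := n%:R * D * lint (fun z => `|F z|).
have T0 : 0 <= T by rewrite !mulr_ge0// lint_ge0.
pose grad : 'rV[R]_n := \row_i conv (partial i G) F x.
have taylor (w : 'rV[R]_n) : `|conv G F (w + x) - conv G F x - dotl grad w| <= T * `|w| ^+ 2.
  have iS : lintble (fun z => F z * \sum_i w 0 i * partial i G (x - z)).
    under eq_fun do rewrite mulr_sumr; apply: lintble_sum => i.
    under eq_fun do rewrite mulrCA; exact: lintbleZ _ (iP i x).
  have e : dotl grad w = lint (fun z => F z * \sum_i w 0 i * partial i G (x - z)).
    rewrite /dotl (_ : (fun z => F z * _) = fun z => \sum_i w 0 i * (F z * partial i G (x - z))); last first.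
      by apply/funext => z; rewrite mulr_sumr; apply: eq_bigr => i _; rewrite mulrCA.
    rewrite lint_sum; last by move=> i; exact: (lintbleZ _ (iP i x)).
    by apply: eq_bigr => i _; rewrite mxE mulrC; apply/esym; exact: (lintZ _ (iP i x)).
  rewrite e /conv -(lintB (iG _) (iG _)) -(lintB (lintbleB (iG _) (iG _)) iS).
  have -> : T * `|w| ^+ 2 = lint (fun z => n%:R * D * `|w| ^+ 2 * `|F z|).
    by apply/esym; apply: etrans (lintZ _ (lintble_norm iF)) _; rewrite /T mulrAC.
  apply: norm_lint_le; last exact: (lintbleZ _ (lintble_norm iF)).
    exact: lintble_meas (lintbleB (lintbleB (iG _) (iG _)) iS).
  move=> z; rewrite -!mulrBr normrM mulrC ler_wpM2r//.
  have := taylor2 (w + x - z) (x - z) cG.1 HD.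
  by rewrite opprB addrA subrK addrK.
have [e e0|d1 d2] := @differentiable_eps R _ _ (conv G F) x (dotl grad) (@lip_coord_continuous R n grad) _.
  have p0 : 0 < T + 1 by rewrite ltr_wpDl.
  near=> w; apply: le_trans (taylor w) _; rewrite expr2 mulrA ler_wpM2r//.
  apply: le_trans (_ : (T + 1) * `|w| <= _); first by rewrite ler_wpM2r// lerDl.
  rewrite mulrC -ler_pdivlMr//; near: w; apply/nbhs_ballP; exists (e / (T + 1)); first exact: divr_gt0.
  by move=> w; rewrite -ball_normE /ball_/= sub0r normrN => /ltW.
split => // i; rewrite partialE//.
have -> : 'd (conv G F) x (delta_mx 0 i) = \sum_j grad 0 j * (delta_mx 0 i : 'rV[R]_n) 0 j by rewrite d2.
rewrite (bigD1 i)//= big1 ?addr0.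
  by rewrite !mxE !eqxx mulr1.
by move=> k /negbTE ki; rewrite [X in _ * X]mxE ki andbF mulr0.
Unshelve. all: by end_near. Qed.

Lemma conv_foldr G F C (q : seq 'I_n) : lintble F -> smooth_on setT G -> (forall y, C < `|y| -> G y = 0) ->
  foldr (@partial R n _) (conv G F) q = conv (foldr (@partial R n _) G q) F /\
  forall y, C < `|y| -> foldr (@partial R n _) G q y = 0.
Proof.
move=> iF sG GC; elim: q => [//|i q [IH1 IH2]] /=.
have sq : smooth_on setT (foldr (@partial R n _) G q).
  by move=> r y _; rewrite -foldr_cat; exact: sG.
split.
  by rewrite IH1; apply/funext => x; exact: (conv_differentiable x iF (smooth_C2 sq) IH2).2.
have cK : closed [set y : 'rV[R]_n | `|y| <= C].
  by apply: (@closed_comp _ _ (fun y : 'rV[R]_n => `|y|) [set t | t <= C]); [move=> *; exact: norm_continuous|exact: closed_le].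
move=> y yC; apply: (partial_out i cK) => [z zC|yC'].
  by apply: IH2; rewrite ltNge; exact/negP.
by move: yC; rewrite ltNge yC'.
Qed.

Lemma conv_smooth G F C : lintble F -> smooth_on setT G -> (forall y, C < `|y| -> G y = 0) ->
  smooth_on setT (conv G F).
Proof.
move=> iF sG GC q x _; have [-> h] := conv_foldr q iF sG GC.
apply: (conv_differentiable x iF _ h).1; apply: smooth_C2.
by move=> r y _; rewrite -foldr_cat; exact: sG.
Qed.

(** A partial derivative of a product of functions of separate coordinates is again such a product,
    with one factor differentiated; smoothness follows by induction on the list of derivatives. *)
Lemma smooth_prod (u : 'I_n -> R -> R) : (forall m k, diffn k (u m)) ->
  smooth_on setT (fun y : 'rV[R]_n => \prod_m u m (y 0 m)).
Proof.
move=> du q x _; suff [v dv ->] : exists2 v : 'I_n -> R -> R, (forall m k, diffn k (v m)) &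
    foldr (@partial R n _) (fun y : 'rV[R]_n => \prod_m u m (y 0 m)) q = fun y => \prod_m v m (y 0 m).
  have := (C1_prod (index_enum 'I_n) (F := fun m (y : 'rV[R]_n) => v m (y 0 m)) _).1 x; apply => m.
  exact: C1_comp (dv m 1%N) (C2_C1 (@C2_coord R n m)).
elim: q => [|i q [v dv IH]] /=; first by exists u.
exists (fun m => if m == i then derive1 (v m) else v m).
  by move=> m k; case: eqP => // _; have [] := dv m k.+1.
rewrite IH; apply/funext => y.
have dvm m : differentiable (fun y : 'rV[R]_n => v m (y 0 m)) y /\
    partial i (fun y : 'rV[R]_n => v m (y 0 m)) y = derive1 (v m) (y 0 m) * (m == i)%:R.
  rewrite -(@partial_coord R n m i y); apply: partial_comp; last exact: differentiable_coord.
  by have [] := dv m 1%N.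
have [_ ->] := partial_prod i (index_enum_uniq _) (fun m => (dvm m).1).
rewrite (bigD1 i)//= (dvm i).2 eqxx mulr1 [X in _ + X]big1 ?addr0; last first.
  by move=> l /negbTE li; rewrite (dvm l).2 li mulr0 mul0r.
rewrite [RHS](bigD1 i)//= eqxx; congr (_ * _).
by apply: eq_bigr => m /negbTE ->.
Qed.

Lemma smooth_scale c f : smooth_on setT f -> smooth_on setT (fun y => c * f y).
Proof.
move=> sf; suff H q : foldr (@partial R n _) (fun y => c * f y) q = fun y => c * foldr (@partial R n _) f q y.
  by move=> q x _; rewrite H; apply: differentiableM; [exact: differentiable_cst|exact: sf].
elim: q => //= i q ->; apply/funext => y; rewrite partialM; [|exact: differentiable_cst|exact: sf].
by rewrite partial_cst mul0r add0r.
Qed.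

Lemma diffn_affine k (a b : R) : diffn k (fun t => a * t + b).
Proof. by apply: diffnD; [apply: diffnM; [exact: diffn_cst|exact: diffn_id]|exact: diffn_cst]. Qed.

Lemma smooth_ker s : smooth_on setT (ker s).
Proof.
rewrite kerE; apply: smooth_scale; apply: (smooth_prod (u := fun _ t => bump (t / s))) => m k.
apply: (diffn_comp (u := bump)); first exact: diffn_bump.
by apply: diffnM; [exact: diffn_id|exact: diffn_cst].
Qed.

Lemma smooth_ker_reflect s z : smooth_on setT (fun y => ker s (z - y)).
Proof.
have -> : (fun y => ker s (z - y)) = fun y => (lint (@kern R n s))^-1 * \prod_m bump ((z 0 m - y 0 m) / s).
  by apply/funext => y; rewrite kerE; congr (_ * _); apply: eq_bigr => m _; rewrite !mxE.
apply: smooth_scale; apply: (smooth_prod (u := fun m t => bump ((z 0 m - t) / s))) => m k.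
apply: (diffn_comp (u := bump)); first exact: diffn_bump.
apply: diffnM; last exact: diffn_cst.
have := diffn_affine k (-1) (z 0 m); congr (diffn _ _); apply/funext => t; ring.
Qed.

End convolution.

(** * Mollified weak derivatives and uniqueness of weak derivatives *)

Section weak_derivatives.
Context {R : realType} {n : nat}.
Implicit Types (x y z a b : 'rV[R]_n) (s t r C c d e : R) (f g F G u v w : 'rV[R]_n -> R) (i j m : 'I_n).
Implicit Types (O K : set 'rV[R]_n).

Local Notation M := (caratheodory_type (lebesgue_outer R n)).

Lemma Rintegral_lint O f : (\int[leb R n]_(x in O) (f x))%R = lint (fun x => \1_O x * f x).
Proof.
rewrite Rintegral_mkcond; congr lint; apply/funext => x.
by rewrite /patch indicE; case: ifP => _; rewrite ?mul1r ?mul0r.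
Qed.

Lemma patchE O f : patch (fun=> 0) O f = fun x => \1_O x * f x.
Proof. by apply/funext => x; rewrite /patch indicE; case: ifP => _; rewrite ?mul1r ?mul0r. Qed.

Lemma loc_lintble O K u : loc_integrable O u -> compact K -> K `<=` O -> lintble (fun x => \1_K x * u x).
Proof.
move=> lu cK KO; have mK : measurable (K : set M).
  by apply: closed_lmeasurable; apply: compact_closed => //; exact: norm_hausdorff.
have := (@integrable_mkcond _ M R (leb R n) K (fun x : M => (u x)%:E) mK).1 (lu K cK KO).
rewrite (_ : _ \_ _ = (fun x : M => ((\1_K x * u x)%R)%:E))//; apply/funext => x.
by rewrite /patch indicE; case: ifP => _; rewrite ?mul1r ?mul0r.
Qed.

Lemma test_ker O s x : 0 < s -> (forall y, `|y - x| <= s -> O y) -> test_fun O (fun y => ker s (x - y)).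
Proof.
move=> s0 H; have S : supp (fun y => ker s (x - y)) `<=` [set y | `|y - x| <= s].
  have cS : closed [set y : 'rV[R]_n | `|y - x| <= s].
    apply: (@closed_comp _ _ (fun y : 'rV[R]_n => `|y - x|) [set t | t <= s]); last exact: closed_le.
    move=> y _; apply: (@continuous_comp _ _ _ (fun y => y - x) (fun x => `|x|)).
      by apply: continuousB; [exact: cvg_id|exact: cst_continuous].
    exact: norm_continuous.
  rewrite [X in _ `<=` X]((closure_id _).1 cS); apply: closureS => y /= ky; rewrite leNgt; apply/negP => h; move/eqP: ky; apply.
  by apply: ker_out => //; rewrite distrC.
split; first exact: smooth_ker_reflect.
  apply: subclosed_compact (@closed_closure _ _) (@compact_cbox R n (x - const_mx s) (x + const_mx s)) _.
  move=> y /S /= yx i; rewrite !mxE -ler_distl; have := coord_le_norm (y - x) i.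
  by rewrite !mxE => /le_trans; apply.
by move=> y /S /H.
Qed.

(** The reflected kernel y |-> [ker s] (x - y) is an admissible test function as soon as the cube
    around [x] lies in [O]; the sign from the reflection cancels that of the integration by
    parts. *)
Lemma conv_weak O i u v s x : weak_partial O i u v ->
  lintble (fun y => \1_O y * u y) -> lintble (fun y => \1_O y * v y) -> 0 < s ->
  (forall y, `|y - x| <= s -> O y) ->
  partial i (conv (ker s) (fun y => \1_O y * u y)) x = conv (ker s) (fun y => \1_O y * v y) x.
Proof.
move=> [_ _ H] iu iv s0 Ox.
have sk := @smooth_ker R n s.
have dk y : differentiable (ker s) y by exact: (sk [::]).
rewrite ((conv_differentiable x iu (smooth_C2 sk) (fun y => @ker_out R n s y s0)).2 i).
have := H _ (test_ker s0 Ox); rewrite !Rintegral_lint => E.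
have -> : conv (ker s) (fun y => \1_O y * v y) x = lint (fun y => \1_O y * (v y * ker s (x - y))).
  by rewrite /conv; congr lint; apply/funext => y; exact/esym/mulrA.
rewrite -[RHS]opprK -E -mulN1r.
have c1 : continuous (partial i (ker s)) by exact: (C2_C1 (smooth_C2 sk)).2.
have [B HB] : exists B, forall y, `|partial i (@ker R n s) y| <= B.
  have cK : closed [set y : 'rV[R]_n | `|y| <= s].
    by apply: (@closed_comp _ _ (fun y : 'rV[R]_n => `|y|) [set t | t <= s]); [move=> *; exact: norm_continuous|exact: closed_le].
  have [B B0 HB] := compact_fun_bound (@compact_cbox R n (const_mx (- s)) (const_mx s)) c1.
  exists B => y; have [ys|ys] := leP `|y| s; first by apply: HB; apply/cbox_norm => //; exact: ltW.
  rewrite (partial_out i cK _ (x := y)) ?normr0 ?(ltW B0)//; last by apply/negP; rewrite -ltNge.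
  by move=> z /= zs; apply: ker_out => //; rewrite ltNge; exact/negP.
have ip := conv_lintble x c1 HB iu.
rewrite -(lintZ (-1)).
  congr lint; apply/funext => y; rewrite (partial_reflect i (dk (x - y))).2 mulN1r -mulrN.
  by rewrite [u y * - _]mulrN opprK mulrA.
have -> : (fun y => \1_O y * (u y * partial i (fun y => ker s (x - y)) y)) =
   (fun y => (-1) * (\1_O y * u y * partial i (ker s) (x - y))).
  by apply/funext => y; rewrite (partial_reflect i (dk (x - y))).2 mulN1r !mulrN mulrA.
exact: lintbleZ ip.
Qed.

Lemma cbox_enlarge O a b : open O -> cbox a b `<=` O -> (forall i, a 0 i <= b 0 i) ->
  exists2 r, 0 < r & cbox (a - const_mx r) (b + const_mx r) `<=` O.
Proof.
move=> oO abO ab; have [N0|/set0P N0] := eqVneq (~` O) set0.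
  by exists 1 => // x _; apply: contrapT => Ox; have : (~` O) x by []; rewrite N0.
have aK : cbox a b !=set0 by exists a => i; rewrite lexx ab.
have [c /set_mem Kc cmin] := EVT_min_rV aK (@compact_cbox R n a b) (continuous_subspaceT (continuous_dst N0)).
have m0 : 0 < dst (~` O) c.
  rewrite lt_neqAle dst_ge0 andbT eq_sym; apply/eqP => /(dst_eq0 N0); apply; last exact: abO.
  by rewrite closedC.
exists (dst (~` O) c / (n%:R + 1)); first by rewrite divr_gt0// ltr_wpDl.
set r := _ / _ => x xr; apply: contrapT => Ox.
(* The nearest point of the original box, obtained by clamping each coordinate. *)
pose z : 'rV[R]_n := \row_i Num.max (a 0 i) (Num.min (b 0 i) (x 0 i)).
have Kz : cbox a b z by move=> i; rewrite mxE le_max lexx/= ge_max ab ge_min lexx.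
have r0 : 0 <= r by rewrite divr_ge0 ?dst_ge0// addr_ge0.
have xz : `|x - z| <= r.
  apply: norm_row_le => // i; have := xr i; have := ab i; rewrite !mxE => h1 /andP[h2 h3].
  case: (leP (b 0 i) (x 0 i)) => c1; case: (leP (a 0 i) _) => c2; rewrite ler_norml; apply/andP; split; move: c1 c2; lra.
have := cmin z; rewrite inE => /(_ Kz); apply/negP; rewrite -ltNge.
apply: le_lt_trans (dst_le z Ox) _; apply: le_lt_trans (enorm_le_norm _) _.
apply: le_lt_trans (_ : n%:R * r < _); first by rewrite ler_wpM2l// distrC.
by rewrite mulrA ltr_pdivrMr ?ltr_wpDl// mulrC ltr_pM2l// ltrDl.
Qed.

Lemma null_countable (I : countType) (A : I -> set 'rV[R]_n) : (forall k, null (A k)) -> null (\bigcup_k A k).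
Proof.
move=> A0; pose B k := if unpickle k is Some q then A q else set0.
apply: (@nullS _ _ _ (\bigcup_k B k)) => [x [q _ Ax]|].
  by exists (pickle q) => //; rewrite /B pickleK.
by apply: null_bigcup => k; rewrite /B; case: (unpickle k) => [q|]; [exact: A0|exact: null0].
Qed.

(** On each of countably many boxes filling [O], the mollifications of v - w vanish for small
    scales, while they converge to v - w in L^1. This identifies the prescribed weak gradient with
    the L^(n-1) derivatives given by the Sobolev hypothesis. *)
Lemma weak_partial_unique O i u v w : open O -> weak_partial O i u v -> weak_partial O i u w ->
  null (O `&` [set x | v x != w x]).
Proof.
move=> oO [lu lv Hv] [_ lw Hw].
have [F [OF HF]] := open_bigcup_cbox oO.
apply: (@nullS _ _ _ (\bigcup_q (F q `&` [set x | v x != w x]))).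
  by move=> x [Ox vw]; move: Ox; rewrite OF => -[q _ Fx]; exists q.
apply: null_countable => q.
have [->|[a [b Fab]]] := HF q; first by rewrite set0I; exact: null0.
have FO : F q `<=` O by move=> x Fx; rewrite OF; exists q.
rewrite Fab in FO *; case: (pselect (forall i, a 0 i <= b 0 i)) => [ab|/existsNP[l abl]]; last first.
  rewrite (_ : cbox a b = set0) ?set0I; first exact: null0.
  apply/seteqP; split => // x /(_ l) /andP[h1 h2]; apply: abl; exact: le_trans h1 h2.
have [r r0 rO] := cbox_enlarge oO FO ab.
set K := cbox (a - _) _ in rO.
have cK : compact K by exact: compact_cbox.
pose W x := \1_K x * (v x - w x).
have iv := loc_lintble lv cK rO; have iw := loc_lintble lw cK rO.
have iW : lintble W.
  by rewrite /W (_ : (fun x => _) = fun x => \1_K x * v x - \1_K x * w x);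
    [exact: lintbleB|apply/funext => x; rewrite mulrBr].
have cW s x : 0 < s -> s < r -> cbox a b x -> conv (ker s) W x = 0.
  move=> s0 sr xab; have xK y : `|y - x| <= s -> K y.
    move=> yx l; have := xab l; have := le_trans (coord_le_norm (y - x) l) yx; rewrite !mxE ler_norml.
    by move=> /andP[h1 h2] /andP[h3 h4]; apply/andP; split; move: sr; lra.
  have tO := test_ker s0 (fun y h => rO y (xK y h)).
  have E : forall u, (fun y => \1_O y * (u y * ker s (x - y))) = (fun y => \1_K y * u y * ker s (x - y)).
    move=> u'; apply/funext => y; have [yx|yx] := leP `|y - x| s; last by rewrite ker_out ?mulr0// distrC.
    by rewrite !indicE !mem_set ?mul1r//; [exact: xK|exact/rO/xK].
  have e : lint (fun y => \1_K y * v y * ker s (x - y)) = lint (fun y => \1_K y * w y * ker s (x - y)).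
    by apply: oppr_inj; rewrite -!E -!Rintegral_lint -Hv// -Hw.
  have -> : W = fun y => \1_K y * v y - \1_K y * w y by apply/funext => y; rewrite /W mulrBr.
  by rewrite (convB x s0 iv iw) /conv e subrr.
have mB : measurable (cbox a b : set M) by exact: measurable_cbox.
pose Z x := \1_(cbox a b) x * `|W x|.
have iZ : lintble Z.
  apply: (le_lintble (lmeasM (lmeas_indic mB) (lintble_meas (lintble_norm iW))) _ (lintble_norm iW)) => x.
  by rewrite /Z indicE; case: (_ \in _); rewrite ?mul1r ?mul0r ?normr_id ?normr0.
have Z0 x : 0 <= Z x by rewrite mulr_ge0// indic_ge0.
have lZ : lint Z = 0.
  apply/eqP; rewrite eq_le (lint_ge0 Z0) andbT; apply/ler_addgt0Pr => e e0; rewrite add0r.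
  have [s0 s00 Hs] := conv_cvg iW e0.
  pose s := Num.min s0 r / 2; have m0 : 0 < Num.min s0 r by rewrite lt_min s00.
  have sp : 0 < s by rewrite divr_gt0.
  have : s < Num.min s0 r by rewrite ltr_pdivrMr// ltr_pMr// ltrDl.
  rewrite lt_min => /andP[ss0 sr]; apply: le_trans (Hs s sp ss0).
  apply: (le_lint iZ (lintble_norm (lintbleB (young sp iW).1 iW))) => x.
  rewrite /Z indicE; case: (pselect (cbox a b x)) => xab; last by rewrite memNset// mul0r.
  by rewrite mem_set// mul1r cW// sub0r normrN.
apply: (nullS _ (lint0_ae Z0 iZ lZ)) => x [xab vw] /=.
have Kx : K x.
  by move=> l; have := xab l; rewrite !mxE => /andP[h1 h2]; apply/andP; split; move: r0; lra.
by rewrite /Z /W !indicE !mem_set// !mul1r normr_eq0 subr_eq0.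
Qed.

End weak_derivatives.

(** * Convergence of the integrals of mollified Jacobians *)

Section jacobian_limit.
Context {R : realType} {n : nat}.
Implicit Types (x y z : 'rV[R]_n) (s t r C c e : R) (f g F G H : 'rV[R]_n -> R) (i j m l : 'I_n).
Implicit Types (O K : set 'rV[R]_n).

Local Notation M := (caratheodory_type (lebesgue_outer R n)).

(** 4^-(k+1): multiplied by the weight 2^(k+1) it is still summable, with sum 1. *)
Definition quarter (k : nat) : R := (2 ^+ k.+1)^-1 ^+ 2.

Lemma quarter_gt0 k : 0 < quarter k.
Proof. by rewrite exprn_gt0// invr_gt0 exprn_gt0. Qed.

(* With the weights 2^(k+1), the series of the differences is integrable and
   both dominates them and forces them to 0 where it is finite. *)
Lemma summable_ae (G_ : nat -> 'rV[R]_n -> R) G : lintble G -> (forall k, lintble (G_ k)) ->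
  (forall k, lint (fun x => `|G_ k x - G x|) <= quarter k) ->
  exists N S, [/\ null N, lintble S & forall x, ~ N x ->
    (forall k, `|G_ k x - G x| <= S x) /\ G_ k x @[k --> \oo] --> G x].
Proof.
move=> iG iGk Gq.
pose h k (x : M) : R := 2 ^+ k.+1 * `|G_ k x - G x|.
have h0 k x : 0 <= h k x by rewrite mulr_ge0// exprn_ge0.
have ih k : lintble (h k) := lintbleZ _ (lintble_norm (lintbleB (iGk k) iG)).
have mh k : measurable_fun [set: M] (fun x => (h k x)%:E) by exact/measurable_EFinP/lintble_meas.
pose T (x : M) := (\sum_(0 <= k <oo) (h k x)%:E)%E.
have T0 x : (0 <= T x)%E by apply: nneseries_ge0 => k _ _; rewrite lee_fin.
have mT : measurable_fun [set: M] T.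
  by apply: ge0_emeasurable_sum => // k x _ _; rewrite lee_fin.
have iT : (\int[leb R n]_(x in [set: M]) T x <= 1%:E)%E.
  rewrite /T (integral_nneseries _ measurableT mh); last by move=> k x _; rewrite lee_fin.
  apply: le_trans (epsilon_trick0 xpredT ler01).
  apply: lee_nneseries => [k _ _|k _]; first by apply: integral_ge0 => x _; rewrite lee_fin.
  rewrite -(lintE (ih k)) lee_fin (lintZ _ (lintble_norm (lintbleB (iGk k) iG))).
  apply: le_trans (ler_wpM2l (exprn_ge0 _ _) (Gq k)) _ => //.
  by rewrite /quarter expr2 mulrA mulfV ?mul1r ?natrX ?div1r// expf_neq0.
have intT : (leb R n).-integrable [set: M] T.
  apply/integrableP; split => //; rewrite (eq_integral T); last by move=> x _; rewrite gee0_abs.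
  by apply: le_lt_trans iT _; rewrite ltry.
have [N [mN N0 HN]] := integrable_ae measurableT intT.
exists N, (fun x => fine (T x)); split => //.
- apply: (@le_integrable _ M R (leb R n) setT measurableT (fun x : M => (fine (T x))%:E) T _ _ intT).
    by apply/measurable_EFinP; apply: measurableT_comp.
  move=> x _; rewrite (gee0_abs (T0 x)); move: (T0 x); case: (T x) => [r| |]//= r0; last by rewrite leey.
  by rewrite lee_fin ger0_norm// -lee_fin.
- move=> x Nx; have Tx : T x \is a fin_num.
    by apply: contrapT => H; apply: Nx; apply: HN => /= H'; apply: H; exact: H'.
  have hT k : h k x <= fine (T x).
    rewrite -lee_fin fineK// /T (@nneseriesD1 _ _ k)// => [|*]; last by rewrite lee_fin.
    by rewrite leeDl// nneseries_ge0// => *; rewrite lee_fin.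
  have p1 k : (1 : R) <= 2 ^+ k.+1 by rewrite exprn_ege1// ler1n.
  split => [k|].
    by apply: le_trans (hT k); rewrite /h ler_peMl.
  apply/subr_cvg0; apply/norm_cvg0P.
  apply: (@squeeze_cvgr _ _ _ _ (fun=> 0) (fun k => fine (T x) * (2^-1) ^+ k)).
  + near=> k; rewrite normr_ge0/= exprVn ler_pdivlMr ?exprn_gt0//.
    apply: le_trans (hT k); rewrite /h mulrC ler_wpM2r// exprS ler_peMl// ?ler1n ?exprn_ge0//.
  + exact: cvg_cst.
  + rewrite -[X in _ --> X](mulr0 (fine (T x))); apply: cvgMr; apply: cvg_expr.
    by rewrite gtr0_norm ?invr_gt0// invf_lt1// ltr1n.
Unshelve. all: by end_near. Qed.

Lemma cvg_bigsum (I : Type) (q : seq I) (P : pred I) (a_ : I -> nat -> R) (a : I -> R) :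
  (forall k, a_ k p @[p --> \oo] --> a k) ->
  (\sum_(k <- q | P k) a_ k p) @[p --> \oo] --> \sum_(k <- q | P k) a k.
Proof.
move=> H; elim: q => [|k q IH].
  by rewrite big_nil; under eq_fun do rewrite big_nil; exact: cvg_cst.
rewrite big_cons; under eq_fun do rewrite big_cons; case: ifP => // _.
exact: cvgD (H k) IH.
Qed.

Lemma cvg_bigprod (I : Type) (q : seq I) (P : pred I) (a_ : I -> nat -> R) (a : I -> R) :
  (forall k, a_ k p @[p --> \oo] --> a k) ->
  (\prod_(k <- q | P k) a_ k p) @[p --> \oo] --> \prod_(k <- q | P k) a k.
Proof.
move=> H; elim: q => [|k q IH].
  by rewrite big_nil; under eq_fun do rewrite big_nil; exact: cvg_cst.
rewrite big_cons; under eq_fun do rewrite big_cons; case: ifP => // _.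
exact: cvgM (H k) IH.
Qed.

Lemma cvg_det (A_ : nat -> 'M[R]_n) (A : 'M[R]_n) :
  (forall i j, A_ p i j @[p --> \oo] --> A i j) -> \det (A_ p) @[p --> \oo] --> \det A.
Proof.
move=> H; apply: cvg_bigsum => s; apply: cvgM; first exact: cvg_cst.
by apply: cvg_bigprod => i; exact: H.
Qed.

Lemma cvg_row (y_ : nat -> 'rV[R]_n) (y : 'rV[R]_n) :
  (forall m, y_ p 0 m @[p --> \oo] --> y 0 m) -> y_ p @[p --> \oo] --> y.
Proof.
move=> H; apply/cvgrPdist_le => e e0.
have : \forall p \near \oo, forall m, `|y 0 m - y_ p 0 m| <= e.
  by apply: filter_forall => m; have /cvgrPdist_le/(_ e e0) := H m.
apply: filterS => p hp; apply: norm_row_le => [|m]; first exact: ltW.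
by rewrite !mxE.
Qed.

(** Every factor is at most the largest one, whose power is one of the summands. *)
Lemma prod_le_sum_pow (I : finType) (P : pred I) (a : I -> R) : (forall k, 0 <= a k) -> (0 < #|P|)%N ->
  \prod_(k | P k) a k <= \sum_(k | P k) a k ^+ #|P|.
Proof.
move=> a0 P0; have /card_gt0P[k0 Pk0] := P0.
have [k Pk Hk] := @arg_maxP _ R I k0 P a Pk0.
apply: le_trans (_ : \prod_(l | P l) a k <= _).
  by apply: ler_prod => l Pl; rewrite a0/=; exact: (Hk l Pl).
rewrite prodr_const (bigD1 k)//= lerDl sumr_ge0// => l _; exact: exprn_ge0.
Qed.

(** Each Leibniz term has exactly one factor from column [l], bounded by C, and n - 1 others. This
    is where the exponent n - 1 and the bounded last derivative fit together. *)
Lemma det_bound (A : 'M[R]_n) l C : 0 <= C -> (1 < n)%N -> (forall m, `|A m l| <= C) ->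
  `|\det A| <= (n`!)%:R * C * \sum_m \sum_i `|A m i| ^+ n.-1.
Proof.
move=> C0 n1 AC; rewrite /determinant; apply: le_trans (ler_norm_sum _ _ _) _.
apply: le_trans (_ : \sum_(s : 'S_n) C * \sum_m \sum_i `|A m i| ^+ n.-1 <= _); last first.
  rewrite sumr_const (_ : #|_| = n`!); first by rewrite -[leLHS]mulr_natl mulrA.
  by rewrite -[RHS]card_Sn; apply: eq_card => s; rewrite !inE.
apply: ler_sum => s _; rewrite normrM normrX normrN1 expr1n mul1r normr_prod.
pose m0 := perm_inv s l.
rewrite (bigD1 m0)//= permKV; apply: ler_pM => //; first by rewrite prodr_ge0.
have cP : #|[pred m | m != m0]| = n.-1.
  exact: etrans (cardC1 m0) (congr1 predn (card_ord n)).
apply: le_trans (prod_le_sum_pow (P := [pred m | m != m0]) (fun m => normr_ge0 _) _) _.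
  by rewrite cP; case: n n1 => [|[|k]].
rewrite cP [leRHS](bigID [pred m | m != m0])/= ler_wpDr//.
  by rewrite sumr_ge0// => m _; rewrite sumr_ge0// => i _; exact: exprn_ge0.
apply: ler_sum => m _; rewrite (bigD1 (s m))//= lerDl sumr_ge0// => i _; exact: exprn_ge0.
Qed.

(** A power lies above its tangent line at [a]; this is the supporting line in Jensen's
    inequality. *)
Lemma bernoulli_pow (a t : R) k : 0 <= a -> 0 <= t -> a ^+ k.+1 + k.+1%:R * a ^+ k * (t - a) <= t ^+ k.+1.
Proof.
move=> a0 t0; elim: k => [|k IH]; first by rewrite !expr1 expr0 !mul1r addrC subrK.
rewrite -subr_ge0.
have -> : t ^+ k.+2 - (a ^+ k.+2 + k.+2%:R * a ^+ k.+1 * (t - a)) =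
   t * (t ^+ k.+1 - (a ^+ k.+1 + k.+1%:R * a ^+ k * (t - a))) + k.+1%:R * a ^+ k * (t - a) ^+ 2.
  by rewrite [t ^+ k.+2]exprS [a ^+ k.+2]exprS [a ^+ k.+1]exprS -[k.+2%:R]natr1; ring.
by rewrite addr_ge0// mulr_ge0 ?subr_ge0 ?sqr_ge0// mulr_ge0// exprn_ge0.
Qed.

Lemma jensen_conv s F k x : 0 < s -> lintble F -> lintble (fun y => `|F y| ^+ k.+1) ->
  `|conv (ker s) F x| ^+ k.+1 <= conv (ker s) (fun y => `|F y| ^+ k.+1) x.
Proof.
move=> s0 iF iP; have ic := conv_ker_lintble x s0 iF.
have inF := lintble_norm iF.
have icn := conv_ker_lintble x s0 inF; have icp := conv_ker_lintble x s0 iP.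
have [ik lk _ _] := lint_ker_shift x s0.
(* The tangent is taken at the mean of |F|, so that the linear term integrates to 0. *)
pose a := conv (ker s) (fun y => `|F y|) x.
have a0 : 0 <= a by apply: lint_ge0 => y; rewrite mulr_ge0// ker_ge0.
have ca : `|conv (ker s) F x| <= a.
  apply: (norm_lint_le (lintble_meas ic) _ icn) => y.
  by rewrite normrM [`|ker _ _|]ger0_norm// ker_ge0.
apply: le_trans (_ : a ^+ k.+1 <= _); first by rewrite lerXn2r.
have -> : a ^+ k.+1 = lint (fun y => a ^+ k.+1 * ker s (x - y) + (k.+1%:R * a ^+ k) * (`|F y| * ker s (x - y) - a * ker s (x - y))).
  have i1 := lintbleZ (a ^+ k.+1) ik; have i2 := lintbleB icn (lintbleZ a ik).
  rewrite (lintD i1 (lintbleZ _ i2)) (lintZ _ ik) (lintZ _ i2) (lintB icn (lintbleZ a ik)) (lintZ _ ik) lk.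
  by rewrite -/a !mulr1 subrr mulr0 addr0.
apply: (le_lint _ icp).
  exact: (lintbleD (lintbleZ _ ik) (lintbleZ _ (lintbleB icn (lintbleZ a ik)))).
move=> y; apply: le_trans (_ : (a ^+ k.+1 + k.+1%:R * a ^+ k * (`|F y| - a)) * ker s (x - y) <= _).
  by rewrite le_eqVlt; apply/orP; left; apply/eqP; ring.
by rewrite ler_wpM2r ?ker_ge0//; exact: bernoulli_pow.
Qed.

Lemma conv_ae N F G s x : null N -> (forall y, ~ N y -> F y = G y) -> lmeas F -> 0 < s ->
  conv (ker s) F x = conv (ker s) G x.
Proof.
move=> N0 FG mF s0; apply: (ae_lint N0) => [y Ny|]; first by rewrite FG.
apply: lmeasM mF _; have [h _ _ _] := lint_ker_shift x s0; exact: lintble_meas h.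
Qed.

Lemma conv_bound N F C s x : null N -> (forall y, ~ N y -> `|F y| <= C) -> lintble F -> 0 < s ->
  0 <= C -> `|conv (ker s) F x| <= C.
Proof.
move=> N0 FC iF s0 C0; pose G y := F y * \1_(~` N) y.
have FG y : ~ N y -> F y = G y by move=> Ny; rewrite /G indicE mem_set// mulr1.
rewrite (conv_ae x N0 FG (lintble_meas iF) s0).
have iG := ae_lintble N0 FG iF.
have [ik lk _ _] := lint_ker_shift x s0.
have -> : C = lint (fun y => C * ker s (x - y)) by rewrite (lintZ _ ik) lk mulr1.
apply: (norm_lint_le (lintble_meas (conv_ker_lintble x s0 iG)) _ (lintbleZ _ ik)) => y.
rewrite normrM [`|ker _ _|]ger0_norm ?ker_ge0// ler_wpM2r ?ker_ge0// /G indicE.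
case: (pselect (N y)) => Ny; first by rewrite memNset ?mulr0 ?normr0//; exact.
by rewrite mem_set// mulr1 FC.
Qed.

(** The rates [quarter k] upgrade L^1 convergence along the sequence to almost everywhere
    convergence with an integrable bound [S] on the error. By Jensen the powers of the mollified
    derivatives are at most the mollified powers, hence at most H + S, and dominated convergence
    applies. *)
Lemma pull_limit O (f : 'I_n -> 'rV[R]_n -> R) (D : 'I_n -> 'I_n -> 'rV[R]_n -> R) l g (C E : R)
   (N0 : set 'rV[R]_n) (V_ : nat -> set 'rV[R]_n) (s_ : nat -> R) :
  let F m x := \1_O x * f m x in
  let DO m i x := \1_O x * D m i x in
  let H m i x := `|DO m i x| ^+ n.-1 in
  (1 < n)%N -> (forall m, lintble (F m)) -> (forall m i, lintble (DO m i)) -> (forall m i, lintble (H m i)) ->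
  null N0 -> 0 <= C -> (forall m x, ~ N0 x -> `|DO m l x| <= C) ->
  (forall k, open (V_ k)) -> (forall k, V_ k `<=` O) ->
  (forall x, O x -> exists p, forall k, (p <= k)%N -> V_ k x) ->
  (forall k, 0 < s_ k) ->
  (forall k x m i, V_ k x -> partial i (conv (ker (s_ k)) (F m)) x = conv (ker (s_ k)) (DO m i) x) ->
  (forall k m, lint (fun x => `|conv (ker (s_ k)) (F m) x - F m x|) <= quarter k) ->
  (forall k m i, lint (fun x => `|conv (ker (s_ k)) (DO m i) x - DO m i x|) <= quarter k) ->
  (forall k m i, lint (fun x => `|conv (ker (s_ k)) (H m i) x - H m i x|) <= quarter k) ->
  continuous g -> (forall y, `|g y| <= E) ->
  pull (V_ k) g (fun m => conv (ker (s_ k)) (F m)) @[k --> \oo] -->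
  lint (fun x => \1_O x * (g (\row_m f m x) * \det (\matrix_(m, i) D m i x))).
Proof.
move=> F DO H n1 iF iD iH N00 C0 DC oV VO Vev sp pV qF qD qH cg gE.
have E0 : 0 <= E by exact: le_trans (normr_ge0 _) (gE 0).
have ic k G := fun iG => (@young R n (s_ k) G (sp k) iG).1.
have /choice[NF HF] m : exists N, null N /\ forall x, ~ N x ->
    conv (ker (s_ k)) (F m) x @[k --> \oo] --> F m x.
  have [N [S [Nn _ NS]]] := summable_ae (iF m) (fun k => ic k _ (iF m)) (fun k => qF k m).
  by exists N; split => // x Nx; exact: (NS x Nx).2.
have /choice[ND HD] (mi : 'I_n * 'I_n) : exists N, null N /\ forall x, ~ N x ->
    conv (ker (s_ k)) (DO mi.1 mi.2) x @[k --> \oo] --> DO mi.1 mi.2 x.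
  have [N [S [Nn _ NS]]] := summable_ae (iD mi.1 mi.2) (fun k => ic k _ (iD mi.1 mi.2)) (fun k => qD k mi.1 mi.2).
  by exists N; split => // x Nx; exact: (NS x Nx).2.
have /choice[NH /choice[S HS]] (mi : 'I_n * 'I_n) :=
  summable_ae (iH mi.1 mi.2) (fun k => ic k _ (iH mi.1 mi.2)) (fun k => qH k mi.1 mi.2).
pose N := N0 `|` (\bigcup_m NF m `|` (\bigcup_mi ND mi `|` \bigcup_mi NH mi)).
have Nn : null N.
  apply: nullU => //; apply: nullU; first by apply: null_countable => m; exact: (HF m).1.
  by apply: nullU; apply: null_countable => mi; [exact: (HD mi).1|have [] := HS mi].
have NNF m x : ~ N x -> ~ NF m x by move=> Nx Nm; apply: Nx; right; left; exists m.
have NND mi x : ~ N x -> ~ ND mi x by move=> Nx Nm; apply: Nx; right; right; left; exists mi.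
have NNH mi x : ~ N x -> ~ NH mi x by move=> Nx Nm; apply: Nx; right; right; right; exists mi.
pose A k x : 'M[R]_n := \matrix_(m, i) conv (ker (s_ k)) (DO m i) x.
pose u k m := conv (ker (s_ k)) (F m).
have cu k m : C2 (u k m).
  apply: smooth_C2; apply: (conv_smooth (C := s_ k) (iF m) (@smooth_ker R n (s_ k))) => y.
  exact: ker_out.
pose I k x := \1_(V_ k) x * (g (rowf (u k) x) * \det (jac (u k) x)).
have IE k x : I k x = \1_(V_ k) x * (g (rowf (u k) x) * \det (A k x)).
  rewrite /I; case: (pselect (V_ k x)) => Vx; last by rewrite indicE memNset// !mul0r.
  by congr (_ * (_ * \det _)); apply/matrixP => m i; rewrite jacE mxE; exact: pV.
have mI k : lmeas (I k).
  apply: lmeasM; first exact/lmeas_indic/open_lmeasurable.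
  apply: continuous_lmeas; apply: continuous_mulf.
    move=> x; apply: continuous_comp; last exact: cg.
    by apply: continuous_rowf => m; exact: C1_continuous (C2_C1 (cu k m)).
  by apply: continuous_jac => m; exact: C2_C1.
pose T := (n`!)%:R * C : R.
have T0 : 0 <= T by rewrite mulr_ge0.
(* The dominating function: the sup bound of [g] times [det_bound], with the mollified powers
   replaced by their fixed bound. *)
pose d x := E * (T * \sum_m \sum_i (H m i x + S (m, i) x)).
have iS mi : lintble (S mi) by have [] := HS mi.
have id : lintble d.
  apply: (lintbleZ E); apply: (lintbleZ T); apply: lintble_sum => m; apply: lintble_sum => i.
  exact: lintbleD (iH m i) (iS (m, i)).
have nS : n.-1 = n.-2.+1 by case: (n) n1 => [|[|]].
have Id k x : ~ N x -> `|I k x| <= d x.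
  move=> Nx; rewrite IE normrM normrM.
  have h1 : `|\1_(V_ k) x : R| <= 1 by rewrite indicE; case: (_ \in _); rewrite ?normr1 ?normr0.
  apply: le_trans (ler_piMl _ h1) _; first by rewrite mulr_ge0.
  rewrite /d; apply: ler_pM => //.
  have Al m : `|A k x m l| <= C.
    by rewrite mxE; apply: conv_bound N00 (DC m) (iD m l) (sp k) C0.
  apply: le_trans (det_bound C0 n1 Al) _; rewrite ler_wpM2l//.
  apply: ler_sum => m _; apply: ler_sum => i _; rewrite mxE.
  have iP : lintble (fun y => `|DO m i y| ^+ n.-2.+1) by rewrite -nS; exact: iH.
  have := jensen_conv x (sp k) (iD m i) iP; rewrite -nS => /le_trans; apply.
  have [_ _ /(_ x (NNH _ _ Nx))[/(_ k)]] := HS (m, i) => h _.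
  by rewrite -lerBlDl; apply: le_trans (ler_norm _) h.
have Ic x : ~ N x -> I k x @[k --> \oo] --> \1_O x * (g (\row_m f m x) * \det (\matrix_(m, i) D m i x)).
  move=> Nx; case: (pselect (O x)) => Ox; last first.
    rewrite indicE memNset// mul0r; apply: cvg_near_cst; near=> k.
    by rewrite /I indicE memNset ?mul0r// => /VO.
  rewrite indicE mem_set// mul1r.
  have [p Hp] := Vev x Ox.
  have cg' : g (rowf (u k) x) @[k --> \oo] --> g (\row_m f m x).
    apply: (cvg_comp (fun k => rowf (u k) x) g _ (cg _)); apply: cvg_row => m.
    have := (HF m).2 x (NNF _ _ Nx); rewrite /F indicE mem_set// mul1r mxE.
    by under [X in _ -> X @ _ --> _]eq_fun do rewrite mxE.
  have cA : \det (A k x) @[k --> \oo] --> \det (\matrix_(m, i) D m i x).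
    apply: cvg_det => m i; rewrite mxE.
    have := (HD (m, i)).2 x (NND _ _ Nx); rewrite /DO indicE mem_set// mul1r /=.
    rewrite (_ : (fun p => A p x m i) = fun k => conv (ker (s_ k)) (DO m i) x)//.
    by apply/funext => q; rewrite mxE.
  apply: cvg_trans (cvgM cg' cA); apply: near_eq_cvg; near=> k.
  rewrite IE indicE mem_set ?mul1r//; apply: Hp; near: k; exact: nbhs_infty_ge.
by have [_ _] := dominated_lint Nn mI id Id Ic.
Unshelve. all: by end_near. Qed.

End jacobian_limit.

(** * Geometry of the boundary *)

Section charts.
Context {R : realType} {n : nat}.
Implicit Types (x y z a v w : 'rV[R]_n) (U V G : set 'rV[R]_n) (s t r C c e : R).
Implicit Types (i j l m : 'I_n) (f h q : 'rV[R]_n -> R) (k : 'rV[R]_n -> 'rV[R]_n).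

Lemma mvt_segment f x v : (forall s, 0 <= s <= 1 -> differentiable f (x + s *: v)) ->
  exists2 s : R, 0 <= s <= 1 & f (x + v) - f x = \sum_i partial i f (x + s *: v) * v 0 i.
Proof.
move=> df.
have [||s sI e] := @MVT_segment R (fun s : R => f (x + s *: v)) (fun s => 'D_v f (x + s *: v)) 0 1 ler01.
- move=> s; rewrite in_itv/= => /andP[s0 s1]; apply: is_derive_line; apply: df.
  by rewrite !ltW.
- apply: continuous_in_subspaceT => s; rewrite inE/= in_itv/= => sI.
  apply/differentiable_continuous/derivable1_diffP.
  by have [] := is_derive_line (df s sI).
rewrite in_itv/= in sI; exists s => //; move: e; rewrite scale1r scale0r addr0 subr0 mulr1 => ->.
by rewrite deriveE ?diffE_row//; exact: df.
Qed.

Lemma smooth_coordf_on U k m : open U -> smooth_on U k ->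
  smooth_on U (coordf k m) /\ forall x i, U x -> partial i (coordf k m) x = (partial i k x) 0 m.
Proof.
move=> oU sk.
have nU x : U x -> \near x, U x by move=> Ux; apply: open_nbhs_nbhs; split.
suff H (s : seq 'I_n) x : U x -> foldr (@partial R n _) (coordf k m) s x = (foldr (@partial R n _) k s x) 0 m.
  split => [s x Ux|x i Ux]; last exact: (H [:: i] x Ux).
  apply: near_eq_differentiable (differentiable_coordf m (sk s x Ux)).
  by apply: filterS (nU x Ux) => y Uy; rewrite (H s y Uy).
elim: s x => [//|i s IH] x Ux /=.
rewrite (partial_coordf i m (sk s x Ux)); apply: near_eq_derive.
by apply: filterS (nU x Ux) => y Uy; rewrite (IH y Uy).
Qed.

Definition sqdist a : 'rV[R]_n -> R := fun y => \sum_m (y 0 m - a 0 m) ^+ 2.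

Lemma sqdistE a y : sqdist a y = enorm (y - a) ^+ 2.
Proof. by rewrite sqr_enorm; apply: eq_bigr => m _; rewrite !mxE. Qed.

Lemma partial_sqdist a i y : differentiable (sqdist a) y /\ partial i (sqdist a) y = 2 * (y 0 i - a 0 i).
Proof.
have c1 m : C2 (fun y : 'rV[R]_n => y 0 m - a 0 m) by apply: C2B; [exact: C2_coord|exact: C2_cst].
have c2 m : C2 (fun y : 'rV[R]_n => (y 0 m - a 0 m) ^+ 2) := C2M (c1 m) (c1 m).
split; first exact: (C2_sum (index_enum 'I_n) c2).1.
rewrite /sqdist partial_sum// (bigD1 i)//= big1 ?addr0 => [|m mi].
  rewrite (partialM i ((c1 i).1 y) ((c1 i).1 y)) !(partialD i ((C2_coord i).1 y) (differentiable_cst _ _)).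
  by rewrite partial_coord eqxx partial_cst addr0 mul1r mulr1 mulrDl mul1r.
rewrite (partialM i ((c1 m).1 y) ((c1 m).1 y)) !(partialD i ((C2_coord m).1 y) (differentiable_cst _ _)).
by rewrite partial_coord (negbTE mi) partial_cst addr0 mul0r mulr0 addr0.
Qed.

Lemma derive_local_min f x v : differentiable f x ->
  (exists2 e, 0 < e & forall t, `|t| < e -> differentiable f (x + t *: v) /\ f x <= f (x + t *: v)) ->
  'd f x v = 0.
Proof.
move=> df [e e0 H]; rewrite -deriveE//.
have d t : t \in `](- e), e[ -> is_derive t 1 (fun s : R => f (x + s *: v)) ('D_v f (x + t *: v)).
  by rewrite in_itv/= -ltr_norml => te; apply: is_derive_line; exact: (H t te).1.
have e00 : - e <= e by lra.
have := @derive1_at_min R (fun s : R => f (x + s *: v)) (- e) e 0 e00 _ _ _.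
case.
- by move=> t /d [].
- by rewrite in_itv/= oppr_lt0 e0.
- by move=> t; rewrite in_itv/= -ltr_norml scale0r addr0 => te; exact: (H t te).2.
move=> _; have [_] : is_derive (0 : R) 1 (fun s : R => f (x + s *: v)) ('D_v f (x + 0 *: v)).
  by apply: d; rewrite in_itv/= oppr_lt0 e0.
by rewrite scale0r addr0 => -> .
Qed.

Definition grad h x : 'rV[R]_n := \row_i partial i h x.

Lemma diff_cancel (F K : 'rV[R]_n -> 'rV[R]_n) x y v : F x = y -> differentiable F x -> differentiable K y ->
  (\near x, K (F x) = x) -> 'd K y ('d F x v) = v.
Proof.
move=> <- dF dK e; have dKF : differentiable (K \o F) x by exact: differentiable_comp.
have e1 : 'D_v (K \o F) x = 'd K (F x) ('d F x v).
  by rewrite deriveE// [X in X _ = _](diff_comp dF dK).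
have e2 : 'D_v (K \o F) x = 'D_v id x := near_eq_derive v e.
have e3 : 'D_v id x = v := derive_id x v.
exact: (etrans (esym e1) (etrans e2 e3)).
Qed.

Lemma dotlDl a v w : dotl (a + v) w = dotl a w + dotl v w.
Proof. by rewrite /dotl -big_split; apply: eq_bigr => i _; rewrite mxE mulrDl. Qed.

Lemma dotlZl t a w : dotl (t *: a) w = t * dotl a w.
Proof. by rewrite /dotl mulr_sumr; apply: eq_bigr => i _; rewrite mxE mulrA. Qed.

Lemma dotl_sumr (I : Type) (q : seq I) a (c : I -> R) (P : I -> 'rV[R]_n) :
  dotl a (\sum_(k <- q) c k *: P k) = \sum_(k <- q) c k * dotl a (P k).
Proof.
rewrite /dotl; under [RHS]eq_bigr do rewrite mulr_sumr.
rewrite exchange_big/=; apply: eq_bigr => i _; rewrite summxE mulr_sumr.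
by apply: eq_bigr => k _; rewrite mxE mulrCA.
Qed.

Lemma dotl_delta a m : dotl a (delta_mx 0 m) = a 0 m.
Proof.
rewrite /dotl (bigD1 m)//= mxE !eqxx mulr1 big1 ?addr0// => i /negbTE im.
by rewrite mxE im andbF mulr0.
Qed.

(** A local defining function with nonzero gradient. The last clause is the Lagrange multiplier rule
    for the distance to [G]: the vector to a nearest point is normal. *)
Definition chart_at G y0 h U := [/\ open U, U y0, smooth_on U h,
    forall x, U x -> (G x <-> h x = 0) /\ exists i, partial i h x != 0 &
    forall x y, U y -> G y -> (forall z, G z -> enorm (x - y) <= enorm (x - z)) ->
      exists t, x - y = t *: grad h y].

(** [h] is the last coordinate of the straightening map. At a nearest point the squared distance is
    stationary along the curves of the chart inside [G], so x - y is orthogonal to all tangent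
    vectors, and the gradient of [h] spans their orthogonal complement. *)
Lemma chart_function G y0 : (2 <= n)%N -> smooth_hypersurface G -> G y0 ->
  exists h U, chart_at G y0 h U.
Proof.
move=> n2 sG Gy0; have [U [V [Phi [Psi [[oU oV Uy0] [sPhi sPsi] UV VU GU]]]]] := sG y0 Gy0.
have n0 : (n.-1 < n)%N by case: (n) n2.
pose l : 'I_n := Ordinal n0.
have lP i : i.+1 = n <-> i = l.
  split => [e|->]; last by rewrite /= prednK//; apply: leq_trans n2.
  by apply: val_inj => /=; exact: (congr1 predn e).
pose h := coordf Phi l.
have [sh hP] := smooth_coordf_on l oU sPhi.
have dh x : U x -> differentiable h x by exact: (sh [::]).
have dPhi x : U x -> differentiable Phi x by exact: (sPhi [::]).
have dPsi z : V z -> differentiable Psi z by exact: (sPsi [::]).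
have GE x : U x -> (G x <-> h x = 0).
  move=> Ux; rewrite GU//; split => [H|H i /lP ->]; last exact: H.
  by apply: H; apply/lP.
have nU x : U x -> \near x, U x by move=> Ux; apply: open_nbhs_nbhs; split.
have nV z : V z -> \near z, V z by move=> Vz; apply: open_nbhs_nbhs; split.
have inv1 x : U x -> forall v, 'd Psi (Phi x) ('d Phi x v) = v.
  move=> Ux v; apply: (diff_cancel _ (erefl _) (dPhi x Ux) (dPsi _ (UV x Ux).1)).
  by apply: filterS (nU x Ux) => y Uy; exact: (UV y Uy).2.
have inv2 x : U x -> forall v, 'd Phi x ('d Psi (Phi x) v) = v.
  move=> Ux v; have [Vx Ex] := UV x Ux; apply: (diff_cancel _ Ex (dPsi _ Vx) (dPhi x Ux)).
  by apply: filterS (nV _ Vx) => z Vz; exact: (VU z Vz).2.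
have hdiff x v : U x -> 'd h x v = ('d Phi x v) 0 l.
  move=> Ux; rewrite -deriveE; last exact: dh.
  rewrite -deriveE; last exact: dPhi.
  by rewrite derive_mx ?mxE//; apply: diff_derivable; exact: dPhi.
exists h, U; split => // [x Ux|x y Uy Gy ymin].
  split; first exact: GE.
  apply: contrapT => /forallNP H.
  have : 'd h x ('d Psi (Phi x) (delta_mx 0 l)) = 1 by rewrite hdiff// inv2// mxE !eqxx.
  rewrite diffE_row ?big1; [|by move=> i _; have /negP := H i; rewrite negbK => /eqP ->; rewrite mul0r|exact: dh].
  by move/esym/eqP; rewrite oner_eq0.
have [Vy Ey] := UV y Uy.
(* A basis at [y] adapted to [G]: tangent for j different from [l], transversal for [l], where the
   gradient of [h] pairs to 1. *)
pose P j : 'rV[R]_n := 'd Psi (Phi y) (delta_mx 0 j).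
have hP' j : dotl (grad h y) (P j) = (l == j)%:R.
  rewrite /dotl (_ : \sum_j0 _ = 'd h y (P j)).
    by rewrite hdiff// inv2// mxE eqxx.
  by rewrite diffE_row; [apply: eq_bigr => i _; rewrite mxE|exact: dh].
have minP j : j != l -> dotl (x - y) (P j) = 0.
  move=> jl; have dq z : differentiable (sqdist x) z by exact: (partial_sqdist x l z).1.
  have dqP z : V z -> differentiable (sqdist x \o Psi) z.
    by move=> Vz; apply: differentiable_comp; [exact: dPsi|exact: dq].
  have : 'd (sqdist x \o Psi) (Phi y) (delta_mx 0 j) = 0.
    apply: derive_local_min; first exact: dqP.
    have /nbhs_ballP[e /= e0 He] := nV _ Vy; exists e => // t te.
    have Vt : V (Phi y + t *: delta_mx 0 j).
      apply: He; rewrite -ball_normE /ball_/= opprD addNKr normrN normrZ.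
      by apply: le_lt_trans te; rewrite ler_piMr// normrv_delta.
    split; first exact: dqP.
    have [Ut Et] := VU _ Vt; rewrite /= !sqdistE Ey lerXn2r ?nnegrE ?enorm_ge0//.
    rewrite enormB [X in _ <= X]enormB; apply: ymin; apply/(GE _ Ut).
    rewrite /h /coordf Et !mxE eqxx/= [l == j]eq_sym (negbTE jl) mulr0 addr0.
    by have := (GE y Uy).1 Gy.
  rewrite [X in X _ = _](diff_comp (dPsi _ Vy) (dq _))/= -/(P j) Ey diffE_row; last exact: dq.
  rewrite (eq_bigr (fun i => - 2 * ((x - y) 0 i * P j 0 i))) => [|i _].
    by rewrite -mulr_sumr => /eqP; rewrite mulf_eq0 oppr_eq0 pnatr_eq0/= => /eqP.
  by rewrite (partial_sqdist x i y).2 !mxE; ring.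
pose t := dotl (x - y) (P l).
exists t; apply/eqP; rewrite -subr_eq0; apply/eqP/rowP => m.
rewrite [RHS]mxE -dotl_delta.
pose c j := ('d Phi y (delta_mx 0 m)) 0 j.
have -> : delta_mx 0 m = \sum_j c j *: P j.
  rewrite -{1}(inv1 y Uy (delta_mx 0 m)) [X in 'd Psi _ X]row_sum_delta linear_sum.
  by apply: eq_bigr => j _; exact: linearZ.
rewrite dotl_sumr big1// => j _; rewrite dotlDl -scaleNr dotlZl hP'.
have [->|jl] := eqVneq j l; first by rewrite mulr1 subrr mulr0.
by rewrite minP// mulr0 addr0 mulr0.
Qed.

End charts.

(** * The domain lies on one side of its boundary; exterior cubes *)

Section one_sided.
Context {R : realType} {n : nat}.
Implicit Types (x y z a v w : 'rV[R]_n) (U V G B : set 'rV[R]_n) (s t r C c e : R).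
Implicit Types (i j l m : 'I_n) (f h k : 'rV[R]_n -> R).

Lemma near_ball_ex (Q : 'rV[R]_n -> Prop) x : (\near x, Q x) -> exists2 r, 0 < r & forall y, `|x - y| < r -> Q y.
Proof.
by move=> /nbhs_ballP[r /= r0 H]; exists r => // y xy; apply: H; rewrite -ball_normE.
Qed.

Lemma smooth_on_continuous U h x : smooth_on U h -> U x ->
  {for x, continuous h} /\ forall i, {for x, continuous (partial i h)}.
Proof.
move=> sh Ux; split; first exact: differentiable_continuous (sh [::] x Ux).
by move=> i; exact: differentiable_continuous (sh [:: i] x Ux).
Qed.

Lemma increasing_along U h x i : open U -> U x -> smooth_on U h -> 0 < partial i h x ->
  exists2 r, 0 < r & (forall y, `|x - y| < r -> U y) /\
    forall y t, `|x - y| < r -> 0 < t -> `|x - (y + t *: delta_mx 0 i)| < r -> h y < h (y + t *: delta_mx 0 i).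
Proof.
move=> oU Ux sh hp; have [_ /(_ i) cp] := smooth_on_continuous sh Ux.
have np : \near x, 0 < partial i h x.
  have := cp; move/cvgrPdist_lt => /(_ _ hp); apply: filterS => y /=; rewrite ltr_distl; lra.
have nU : \near x, U x by apply: open_nbhs_nbhs; split.
have [r r0 H] := near_ball_ex (filterI nU np); exists r => //.
split => [y /H[]//|y t xy t0 xt].
have seg s : 0 <= s <= 1 -> `|x - (y + s *: (t *: delta_mx 0 i))| < r.
  move=> /andP[s0 s1].
  have -> : x - (y + s *: (t *: delta_mx 0 i)) = (1 - s) *: (x - y) + s *: (x - (y + t *: delta_mx 0 i)).
    by apply/rowP => m; rewrite !mxE; ring.
  apply: le_lt_trans (ler_normD _ _) _; rewrite !normrZ !ger0_norm ?subr_ge0//.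
  exact: conv_lt.
have [s sI e] := mvt_segment (f := h) (x := y) (v := t *: delta_mx 0 i)
  (fun s sI => sh [::] _ (H _ (seg s sI)).1).
rewrite -subr_gt0 e (bigD1 i)//= big1 ?addr0 => [|m /negbTE mi]; last by rewrite !mxE mi andbF !mulr0.
by rewrite !mxE !eqxx/= mulr1 mulr_gt0//; exact: (H _ (seg s sI)).2.
Qed.

Lemma sgr_segment f x v : (forall t, 0 <= t <= 1 -> {for x + t *: v, continuous f} /\ f (x + t *: v) != 0) ->
  Num.sg (f x) = Num.sg (f (x + v)).
Proof.
move=> H; pose p t := f (x + t *: v).
have cp : {within `[0, 1], continuous p}.
  apply: continuous_in_subspaceT => t; rewrite inE/= in_itv/= => tI.
  apply: (continuous_comp (f := fun t : R => x + t *: v)); last exact: (H t tI).1.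
  apply: continuousD; first exact: cst_continuous.
  by apply: continuousZl; exact: cvg_id.
have p0 : p 0 = f x by rewrite /p scale0r addr0.
have p1 : p 1 = f (x + v) by rewrite /p scale1r.
have n0 t : t \in `[0, 1] -> p t != 0 by rewrite in_itv/= => /H[].
have z0 : p 0 != 0 by apply: n0; rewrite in_itv/= lexx ler01.
have z1 : p 1 != 0 by apply: n0; rewrite in_itv/= lexx ler01.
rewrite -p0 -p1; case: (ltrgtP (p 0) 0) z0 => // h0 _; case: (ltrgtP (p 1) 0) z1 => // h1 _.
- by rewrite !ltr0_sg.
- have [|c /n0 cI c0] := @IVT R p 0 1 0 ler01 cp; last by rewrite c0 eqxx in cI.
  by rewrite ge_min le_max (ltW h0) (ltW h1) orbT.
- have [|c /n0 cI c0] := @IVT R p 0 1 0 ler01 cp; last by rewrite c0 eqxx in cI.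
  by rewrite ge_min le_max (ltW h0) (ltW h1) orbT.
- by rewrite !gtr0_sg.
Qed.

Lemma sgr_near f x : {for x, continuous f} -> f x != 0 -> \forall y \near x, Num.sg (f y) = Num.sg (f x).
Proof.
move=> cf fx; have p : 0 < `|f x| by rewrite normr_gt0.
have := cf; move/cvgrPdist_lt => /(_ _ p); apply: filterS => y /=.
case: (ltrgtP (f x) 0) fx => // h _; rewrite ltr_distl.
  by rewrite (ltr0_norm h) opprK => /andP[h1 h2]; rewrite !ltr0_sg//; lra.
by rewrite (gtr0_norm h) => /andP[h1 h2]; rewrite !gtr0_sg//; lra.
Qed.

Definition pm1 s := s = 1 \/ s = -1.

(** Two defining functions agree near [x] up to one global sign. [h] increases in direction [i], so
    every nearby point on a given side can be pushed away from [G] along that direction without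
    crossing it, to a place where the sign of [k] is constant. *)
Lemma sign_compat_pos G x h k U V i : open U -> open V -> U x -> V x -> G x ->
  smooth_on U h -> smooth_on V k ->
  (forall y, U y -> (G y <-> h y = 0)) -> (forall y, V y -> (G y <-> k y = 0)) ->
  0 < partial i h x -> (exists j, partial j k x != 0) ->
  exists2 s, pm1 s & exists2 r, 0 < r & forall y, `|x - y| < r -> Num.sg (k y) = s * Num.sg (h y).
Proof.
move=> oU oV Ux Vx Gx sh sk hG kG hp [j kp].
have [r1 r10 [U1 H1]] := increasing_along oU Ux sh hp.
have nV : \near x, V x by apply: open_nbhs_nbhs; split.
have [r2 r20 V2] := near_ball_ex nV.
pose rho := Num.min r1 r2 / 4.
have m0 : 0 < Num.min r1 r2 by rewrite lt_min r10.
have rho0 : 0 < rho by rewrite divr_gt0.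
have [rr1 rr2] : 4 * rho <= r1 /\ 4 * rho <= r2.
  by rewrite /rho mulrCA divff ?mulr1 ?pnatr_eq0//; split; rewrite ge_min lexx ?orbT.
have de t : 0 <= t <= rho -> `|t *: (delta_mx 0 i : 'rV[R]_n)| <= rho.
  move=> /andP[t0 t1]; rewrite normrZ ger0_norm//; apply: le_trans t1.
  by rewrite ler_piMr// normrv_delta.
have inr y t : `|x - y| < 2 * rho -> 0 <= t <= rho ->
    `|x - (y + t *: delta_mx 0 i)| < 4 * rho /\ `|x - (y - t *: delta_mx 0 i)| < 4 * rho.
  move=> xy /de tr; rewrite !opprD !addrA opprK; split.
    by apply: le_lt_trans (ler_normB _ _) _; move: xy tr; lra.
  by apply: le_lt_trans (ler_normD _ _) _; move: xy tr; lra.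
have hx0 : h x = 0 by apply/hG.
have xx : `|x - x| < 2 * rho by rewrite subrr normr0 mulr_gt0.
have rI : 0 <= rho <= rho by rewrite lexx ltW.
have [xp xm] := inr x rho xx rI.
set ei := rho *: delta_mx 0 i in xp xm.
have hpos : 0 < h (x + ei).
  by rewrite -hx0; apply: H1 => //; [rewrite subrr normr0|exact: lt_le_trans xp rr1].
have hneg : h (x - ei) < 0.
  rewrite -hx0 -{2}[x](subrK ei); apply: H1 => //; first exact: lt_le_trans xm rr1.
  by rewrite subrK subrr normr0.
have Up := U1 _ (lt_le_trans xp rr1); have Um := U1 _ (lt_le_trans xm rr1).
have Vp := V2 _ (lt_le_trans xp rr2); have Vm := V2 _ (lt_le_trans xm rr2).
have kp0 : k (x + ei) != 0 by apply/eqP => /(kG _ Vp)/(hG _ Up) e; move: hpos; rewrite e ltxx.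
have km0 : k (x - ei) != 0 by apply/eqP => /(kG _ Vm)/(hG _ Um) e; move: hneg; rewrite e ltxx.
have [rp rp0 Hp] := near_ball_ex (sgr_near (smooth_on_continuous sk Vp).1 kp0).
have [rm rm0 Hm] := near_ball_ex (sgr_near (smooth_on_continuous sk Vm).1 km0).
pose r := Num.min (2 * rho) (Num.min rp rm).
have r0 : 0 < r by rewrite !lt_min mulr_gt0// rp0.
have above y : `|x - y| < r -> 0 < h y -> Num.sg (k y) = Num.sg (k (x + ei)).
  rewrite !lt_min => /and3P[xy xp' _] hy.
  rewrite -(Hp (y + ei)); last by rewrite opprD addrACA subrr addr0.
  apply: sgr_segment => t /andP[t0 t1].
  have tI : 0 <= t * rho <= rho by rewrite mulr_ge0 ?(ltW rho0)//= ler_piMl// ltW.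
  have [z1 _] := inr y (t * rho) xy tI; rewrite -scalerA -/ei in z1.
  have Uz := U1 _ (lt_le_trans z1 rr1); have Vz := V2 _ (lt_le_trans z1 rr2).
  split; first exact: (smooth_on_continuous sk Vz).1.
  apply/eqP => /(kG _ Vz)/(hG _ Uz) e.
  have [t00|t0'] := eqVneq t 0; first by move: e; rewrite t00 scale0r addr0 => e; move: hy; rewrite e ltxx.
  have := H1 y (t * rho); rewrite -scalerA -/ei e => h2.
  suff : h y < 0 by move/(lt_trans hy); rewrite ltxx.
  apply: h2; [|by rewrite mulr_gt0// lt_neqAle eq_sym t0'|exact: lt_le_trans z1 rr1].
  by apply: lt_le_trans rr1; apply: lt_trans xy _; rewrite ltr_pM2r// ltr_nat.
have below y : `|x - y| < r -> h y < 0 -> Num.sg (k y) = Num.sg (k (x - ei)).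
  rewrite !lt_min => /and3P[xy _ xm'] hy.
  rewrite -(Hm (y - ei)); last by rewrite opprB addrA subrK.
  apply: sgr_segment => t /andP[t0 t1].
  have tI : 0 <= t * rho <= rho by rewrite mulr_ge0 ?(ltW rho0)//= ler_piMl// ltW.
  have [_ z1] := inr y (t * rho) xy tI; rewrite -scalerA -/ei -scalerN in z1.
  have Uz := U1 _ (lt_le_trans z1 rr1); have Vz := V2 _ (lt_le_trans z1 rr2).
  split; first exact: (smooth_on_continuous sk Vz).1.
  apply/eqP => /(kG _ Vz)/(hG _ Uz) e.
  have [t00|t0'] := eqVneq t 0; first by move: e; rewrite t00 scale0r addr0 => e; move: hy; rewrite e ltxx.
  have := H1 (y + t *: - ei) (t * rho); rewrite -scalerA -/ei e scalerN subrK => h2.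
  suff : 0 < h y by move=> /(lt_trans hy); rewrite ltxx.
  rewrite scalerN in z1; apply: h2; [exact: lt_le_trans z1 rr1|by rewrite mulr_gt0// lt_neqAle eq_sym t0'|].
  by apply: lt_le_trans rr1; apply: lt_trans xy _; rewrite ltr_pM2r// ltr_nat.
have kx0 : k x = 0 by apply/kG.
have zero y : `|x - y| < r -> h y = 0 -> k y = 0.
  rewrite !lt_min => /and3P[xy _ _] hy.
  have xy4 : `|x - y| < 4 * rho by apply: lt_trans xy _; rewrite ltr_pM2r// ltr_nat.
  by apply/(kG _ (V2 _ (lt_le_trans xy4 rr2)))/(hG _ (U1 _ (lt_le_trans xy4 rr1))).
(* If [k] had the same sign on both sides, then k or -k would have a local minimum at [x], against
   its nonzero gradient. *)
have sp : Num.sg (k (x + ei)) != Num.sg (k (x - ei)).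
  apply/eqP => e; pose s := Num.sg (k (x + ei)).
  have kmin y : `|x - y| < r -> 0 <= s * k y.
    move=> xy; case: (ltrgtP (h y) 0) => hy; last by rewrite (zero y xy hy) mulr0.
      by rewrite /s e -(below y xy hy) -normrEsg.
    by rewrite /s -(above y xy hy) -normrEsg.
  have s0 : s != 0 by rewrite sgr_eq0.
  have dk : differentiable k x by exact: (sk [::]).
  have dsk y : V y -> differentiable (fun y => s * k y) y.
    by move=> Vy; apply: differentiableM; [exact: differentiable_cst|exact: (sk [::])].
  have : 'd (fun y => s * k y) x (delta_mx 0 j) = 0.
    apply: derive_local_min; first exact: dsk.
    exists r => // t tr.
    have xt : `|x - (x + t *: delta_mx 0 j)| < r.
      rewrite opprD addNKr normrN normrZ; apply: le_lt_trans tr; by rewrite ler_piMr// normrv_delta.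
    split; last by rewrite kx0 mulr0; exact: kmin.
    apply: dsk; apply: V2; apply: lt_le_trans rr2; apply: lt_trans xt _.
    by rewrite /r gt_min ltr_pM2r// ltr_nat.
  rewrite -partialE; last exact: dsk.
  rewrite partialM; [|exact: differentiable_cst|exact: dk].
  by rewrite partial_cst mul0r add0r => /eqP; rewrite mulf_eq0 (negbTE s0) (negbTE kp).
have [s ps [e1 e2]] : exists2 s, pm1 s & Num.sg (k (x + ei)) = s /\ Num.sg (k (x - ei)) = - s.
  move: sp; case: (ltrgtP (k (x + ei)) 0) kp0 => // h1 _; case: (ltrgtP (k (x - ei)) 0) km0 => // h2 _.
  - by rewrite !ltr0_sg// eqxx.
  - by exists (-1); [right|rewrite ltr0_sg// gtr0_sg// opprK].
  - by exists 1; [left|split; [rewrite gtr0_sg|rewrite ltr0_sg]].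
  - by rewrite !gtr0_sg// eqxx.
exists s => //; exists r => // y xy; case: (ltrgtP (h y) 0) => hy.
- by rewrite (below y xy hy) e2 (ltr0_sg hy) mulrN1.
- by rewrite (above y xy hy) e1 (gtr0_sg hy) mulr1.
- by rewrite (zero y xy hy) hy sgr0 mulr0.
Qed.

Lemma partialN i h x : differentiable h x -> partial i (fun y => - h y) x = - partial i h x.
Proof.
move=> dh; have -> : (fun y => - h y) = fun y => (-1) * h y by apply/funext => y; rewrite mulN1r.
by rewrite partialM; [rewrite partial_cst mul0r add0r mulN1r|exact: differentiable_cst|].
Qed.

Lemma smooth_onN U h : open U -> smooth_on U h -> smooth_on U (fun y => - h y).
Proof.
move=> oU sh; have nU x : U x -> \near x, U x by move=> Ux; apply: open_nbhs_nbhs; split.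
suff H (q : seq 'I_n) x : U x ->
    foldr (@partial R n _) (fun y => - h y) q x = - foldr (@partial R n _) h q x.
  move=> q x Ux; apply: (@near_eq_differentiable _ _ _ (fun y => - foldr (@partial R n _) h q y)).
    by apply: filterS (nU x Ux) => y Uy; rewrite H.
  by apply: differentiableN; exact: sh.
elim: q x => [//|i q IH] x Ux /=.
rewrite -(partialN i (sh q x Ux)); apply: near_eq_derive.
by apply: filterS (nU x Ux) => y Uy; exact: IH.
Qed.

Lemma sign_compat G x h k U V : open U -> open V -> U x -> V x -> G x ->
  smooth_on U h -> smooth_on V k ->
  (forall y, U y -> (G y <-> h y = 0)) -> (forall y, V y -> (G y <-> k y = 0)) ->
  (exists i, partial i h x != 0) -> (exists j, partial j k x != 0) ->
  exists2 s, pm1 s & exists2 r, 0 < r & forall y, `|x - y| < r -> Num.sg (k y) = s * Num.sg (h y).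
Proof.
move=> oU oV Ux Vx Gx sh sk hG kG [i hi] kj.
have dh : differentiable h x by exact: (sh [::]).
case: (ltrgtP (partial i h x) 0) hi => // hp _; last first.
  exact: sign_compat_pos oU oV Ux Vx Gx sh sk hG kG hp kj.
have hNG y : U y -> (G y <-> - h y = 0).
  by move=> Uy; rewrite hG//; split => /eqP; rewrite ?oppr_eq0 => /eqP //; move=> ->; rewrite oppr0.
have hNp : 0 < partial i (fun y => - h y) x by rewrite partialN// oppr_gt0.
have [s ps [r r0 H]] := sign_compat_pos oU oV Ux Vx Gx (smooth_onN oU sh) sk hNG kG hNp kj.
exists (- s); first by case: ps => ->; [right|left; rewrite opprK].
by exists r => // y xy; rewrite H// sgrN mulrN mulNr.
Qed.

Context (G : set 'rV[R]_n) (hf : 'rV[R]_n -> 'rV[R]_n -> R) (Uf : 'rV[R]_n -> set 'rV[R]_n).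
Context (chart : forall y, G y -> chart_at G y (hf y) (Uf y)) (closedG : closed G).
Context (thinG : forall x r, 0 < r -> exists2 z, ~ G z & `|x - z| < r).

Definition side x y : R := if `[< G x >] then Num.sg (hf x y) else 1.

(* The functions on B that change sign across G and only there. *)
Definition flip B (chi : 'rV[R]_n -> R) := forall x, B x -> exists2 s, pm1 s &
  exists2 r, 0 < r & forall y, `|x - y| < r -> ~ G y -> chi y = s * side x y.

Lemma pm1M s t : pm1 s -> pm1 t -> pm1 (s * t).
Proof. by move=> [->|->] [->|->]; rewrite ?mul1r ?mulr1 ?mulN1r ?opprK; [left|right|right|left]. Qed.

Lemma pm1_sqr s : pm1 s -> s * s = 1.
Proof. by move=> [->|->]; rewrite ?mulr1// mulN1r opprK. Qed.

Lemma pm1_sg t : t != 0 -> pm1 (Num.sg t).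
Proof. by case: (ltrgtP t 0) => // h _; [right; rewrite ltr0_sg|left; rewrite gtr0_sg]. Qed.

Lemma side_pm1 x : exists2 r, 0 < r & forall y, `|x - y| < r -> ~ G y -> pm1 (side x y).
Proof.
rewrite /side; case: asboolP => Gx; last by exists 1 => // *; left.
have [oU Ux _ hG _] := chart Gx.
have [|r r0 Hr] := @near_ball_ex (Uf x) x; first by apply: open_nbhs_nbhs; split.
exists r => // y xy Gy; apply: pm1_sg; apply/eqP => h0; apply: Gy.
by apply/(hG _ (Hr y xy)).1.
Qed.

Definition convex_set B := forall x y, B x -> B y -> forall t, 0 <= t <= 1 -> B (x + t *: (y - x)).

Lemma locally_cst_segment B (D : 'rV[R]_n -> R) : convex_set B ->
  (forall x, B x -> exists2 r, 0 < r & forall y, B y -> `|x - y| < r -> D x = D y) ->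
  forall x y, B x -> B y -> D x = D y.
Proof.
move=> cB HD x y Bx By; pose p t := x + t *: (y - x).
pose S := `[0, 1]%classic `&` [set t : R | D (p t) = D x].
have Bp t : (0 <= t <= 1) -> B (p t) by exact: cB.
have loc t : 0 <= t <= 1 -> exists2 e, 0 < e & forall t', 0 <= t' <= 1 -> `|t - t'| < e -> D (p t) = D (p t').
  move=> tI; have [r r0 Hr] := HD _ (Bp t tI).
  exists (r / (`|y - x| + 1)); first by rewrite divr_gt0// ltr_wpDl.
  move=> t' tI' tt; apply: Hr; first exact: Bp.
  rewrite /p opprD addrACA subrr add0r -scalerBl normrZ.
  apply: le_lt_trans (_ : `|t - t'| * (`|y - x| + 1) < _); first by rewrite ler_wpM2l// lerDl.
  by rewrite -ltr_pdivlMr// ltr_wpDl.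
have SE : S = `[0, 1]%classic.
  apply: segment_connected.
  - by exists 0; split; [rewrite /= in_itv/= lexx ler01|rewrite /= /p scale0r addr0].
  - exists (\bigcup_(t in S) [set t' | exists2 e, 0 < e & (forall u, 0 <= u <= 1 -> `|t - u| < e -> D (p t) = D (p u)) /\ `|t - t'| < e]).
      apply: bigcup_open => t _; rewrite openE => t' [e e0 [He tt]].
      apply/nbhs_ballP; exists (e - `|t - t'|); first by rewrite /= subr_gt0.
      move=> u; rewrite /ball/= => tu; exists e => //; split => //.
      apply: le_lt_trans (ler_distD t' _ _) _; rewrite -ltrBDl; exact: tu.
    apply/seteqP; split => [t [tI Dt]|t [tI [t' [tI' Dt'] [e e0 [He tt]]]]].
      have := tI; rewrite /= in_itv/= => tJ; have [e e0 He] := loc t tJ.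
      by split => //; exists t => //; exists e => //; split => //; rewrite subrr normr0.
    by split => //; rewrite -Dt'; apply/esym; apply: He => //; move: tI; rewrite /= in_itv.
  - exists (~` \bigcup_(t in `[0, 1]%classic `\` S) [set t' | exists2 e, 0 < e & (forall u, 0 <= u <= 1 -> `|t - u| < e -> D (p t) = D (p u)) /\ `|t - t'| < e]).
      rewrite closedC; apply: bigcup_open => t _; rewrite openE => t' [e e0 [He tt]].
      apply/nbhs_ballP; exists (e - `|t - t'|); first by rewrite /= subr_gt0.
      move=> u; rewrite /ball/= => tu; exists e => //; split => //.
      apply: le_lt_trans (ler_distD t' _ _) _; rewrite -ltrBDl; exact: tu.
    apply/seteqP; split => [t [tI Dt]|t [tI nt]].
      split => // -[t' [tI' nS] [e e0 [He tt]]]; apply: nS; split => //=.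
      by rewrite -Dt; apply: He => //; move: tI; rewrite /= in_itv.
    split => //; apply: contrapT => nD; apply: nt.
    have := tI; rewrite /= in_itv/= => tJ; have [e e0 He] := loc t tJ.
    by exists t; [split => // -[]|exists e => //; split => //; rewrite subrr normr0].
have : S 1 by rewrite SE /= in_itv/= lexx ler01.
by move=> [_ /=]; rewrite /p scale1r subrKC => ->.
Qed.

(** Both functions flip across [G], so their quotient does not and is locally constant. Its values
    at nearby points are compared at a point off [G], which exists because [G] has empty
    interior. *)
Lemma flip_unique B chi tau : convex_set B -> flip B chi -> flip B tau ->
  exists2 s, pm1 s & forall x, B x -> ~ G x -> chi x = s * tau x.
Proof.
move=> cB fc ft.
have [[b Bb]|nB] := pselect (B !=set0); last first.
  by exists 1; [left|move=> x Bx; case: nB; exists x].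
have /choice[c Hc] x : exists c, B x -> pm1 c /\ exists2 r, 0 < r & forall y, `|x - y| < r -> ~ G y -> chi y = c * tau y /\ pm1 (tau y).
  have [Bx|nBx] := pselect (B x); last by exists 1.
  have [s ps [r1 r10 H1]] := fc x Bx; have [t pt [r2 r20 H2]] := ft x Bx.
  have [r3 r30 H3] := side_pm1 x.
  exists (s * t) => _; split; first exact: pm1M.
  exists (Num.min r1 (Num.min r2 r3)); first by rewrite !lt_min r10 r20.
  move=> y; rewrite !lt_min => /and3P[y1 y2 y3] Gy.
  rewrite H1// H2// mulrA -[s * t * t]mulrA (pm1_sqr pt) mulr1; split => //.
  exact: pm1M pt (H3 y y3 Gy).
exists (c b); first exact: (Hc b Bb).1.
move=> x Bx Gx; have [pc [r r0 Hr]] := Hc x Bx.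
rewrite (Hr x _ Gx).1 ?subrr ?normr0//; congr (_ * _).
apply: (locally_cst_segment cB _ Bx Bb) => z Bz.
have [pz [rz rz0 Hz]] := Hc z Bz; exists rz => // y By zy.
have [py [ry ry0 Hy]] := Hc y By.
have m0 : 0 < Num.min ry (rz - `|z - y|) by rewrite lt_min ry0 subr_gt0.
have [w Gw] := thinG y m0; rewrite lt_min ltrBrDl => /andP[wy wz].
have zw : `|z - w| < rz by apply: le_lt_trans (ler_distD y _ _) _.
have [e1 tw] := Hz w zw Gw; have [e2 _] := Hy w wy Gw.
have t0 : tau w != 0 by case: tw => ->; rewrite ?oppr_eq0 oner_eq0.
by apply: (mulIf t0); rewrite -e1 -e2.
Qed.

(** On the convex overlap the two functions differ by one sign, which is absorbed into the second
    one. *)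
Lemma flip_glue A B : open A -> open B -> convex_set (A `&` B) ->
  (exists chi, flip A chi) -> (exists chi, flip B chi) -> exists chi, flip (A `|` B) chi.
Proof.
move=> oA oB cAB [chi fA] [tau fB].
have [s ps H] : exists2 s, pm1 s & forall x, (A `&` B) x -> ~ G x -> chi x = s * tau x.
  by apply: flip_unique => // x [Ax Bx]; [exact: fA|exact: fB].
exists (fun x => if `[< A x >] then chi x else s * tau x) => x.
have [Ax _|nAx [//|Bx]] := pselect (A x).
  have [t pt [r r0 Hr]] := fA x Ax; exists t => //.
  have [|r' r'0 Hr'] := @near_ball_ex A x; first by apply: open_nbhs_nbhs; split.
  exists (Num.min r r'); first by rewrite lt_min r0.
  by move=> y; rewrite lt_min => /andP[y1 y2] Gy; rewrite asboolT; [exact: Hr|exact: Hr'].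
have [t pt [r r0 Hr]] := fB x Bx; exists (s * t); first exact: pm1M.
have [|r' r'0 Hr'] := @near_ball_ex B x; first by apply: open_nbhs_nbhs; split.
exists (Num.min r r'); first by rewrite lt_min r0.
move=> y; rewrite lt_min => /andP[y1 y2] Gy; rewrite -mulrA -(Hr y y1 Gy).
by case: asboolP => // Ay; apply: H => //; split => //; exact: Hr'.
Qed.

Lemma flip_local x0 : exists2 r, 0 < r & flip (ball x0 r) (side x0).
Proof.
have [Gx0|Gx0] := pselect (G x0); last first.
  have oG : open (~` G) by rewrite openC.
  have [|r r0 Hr] := @near_ball_ex (~` G) x0; first by apply: open_nbhs_nbhs; split.
  exists r => // x; rewrite -ball_normE /ball_/= => /Hr Gx; exists 1; first by left.
  exists 1 => // y _ Gy; rewrite mul1r /side asboolF// asboolF//.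
have [oU Ux sh hG nx0] := chart Gx0.
have [|r r0 Hr] := @near_ball_ex (Uf x0) x0; first by apply: open_nbhs_nbhs; split.
exists r => // x; rewrite -ball_normE /ball_/= => /Hr Uxx.
have e y : side x0 y = Num.sg (hf x0 y) by rewrite /side asboolT.
have [Gx|Gx] := pselect (G x).
  have [oU' Ux' sh' hG' nx] := chart Gx.
  have [s ps [r' r'0 H]] := sign_compat oU' oU Ux' Uxx Gx sh' sh (fun y Uy => (hG' y Uy).1)
    (fun y Uy => (hG y Uy).1) (hG' x Ux').2 (hG x Uxx).2.
  by exists s => //; exists r' => // y xy Gy; rewrite e H// /side asboolT.
have h0 : hf x0 x != 0 by apply/eqP => /(hG x Uxx).1.
exists (Num.sg (hf x0 x)); first exact: pm1_sg.
have [r' r'0 H] := near_ball_ex (sgr_near (smooth_on_continuous sh Uxx).1 h0).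
by exists r' => // y xy Gy; rewrite e H// /side asboolF// mulr1.
Qed.

Lemma flip_sub A B chi : A `<=` B -> flip B chi -> flip A chi.
Proof. by move=> AB fB x /AB; exact: fB. Qed.

(** A Lebesgue number for the local sign functions; far from [G] the constant 1 serves. *)
Lemma flip_uniform : compact G -> exists2 d, 0 < d & forall x, exists chi, flip (ball x d) chi.
Proof.
move=> cG; have [C C0 GC] := compact_cbox_sub cG.
pose K := cbox (const_mx (- (C + 1)) : 'rV[R]_n) (const_mx (C + 1)).
have cK : compact K by exact: compact_cbox.
have /choice[rho Hrho] x : exists r, 0 < r /\ flip (ball x r) (side x).
  by have [r r0 H] := flip_local x; exists r.
move: (cK); rewrite compact_cover => /(_ _ K (fun z => ball z (rho z / 2))).
case=> [z _|z Kz|D DK KD]; first exact: ball_open.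
  by exists z => //; apply: ballxx; rewrite divr_gt0// (Hrho z).1.
have [d0 d00 Hd] : exists2 d0, 0 < d0 & forall z, z \in finmap.enum_fset D -> forall d, 0 < d -> d < d0 -> d <= rho z / 2.
  apply: seq_small => z _; exists (rho z / 2); first by rewrite divr_gt0// (Hrho z).1.
  by move=> d _ /ltW.
pose d := Num.min 1 (d0 / 2).
have dp : 0 < d by rewrite lt_min ltr01 divr_gt0.
have dd0 : d < d0 by rewrite gt_min ltr_pdivrMr// ltr_pMr// ltrDl ltr01 orbT.
exists d => // x; have [Kx|Kx] := pselect (K x).
  have [z zD] := KD x Kx; rewrite -ball_normE /ball_/= => zx; exists (side z).
  apply: flip_sub (Hrho z).2 => y; rewrite -!ball_normE /ball_/= => xy.
  apply: le_lt_trans (ler_distD x _ _) _; have := Hd z zD d dp dd0; move: zx xy; lra.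
exists (fun=> 1) => y; rewrite -ball_normE /ball_/= => xy; exists 1; first by left.
exists 1 => // w _ _; rewrite mul1r /side asboolF// => Gy; apply: Kx.
have C1 : 0 <= C + 1 by rewrite addr_ge0// ltW.
apply/(cbox_norm _ C1); have := (cbox_norm _ (ltW C0)).1 (GC y Gy).
have d1 : d <= 1 by rewrite ge_min lexx.
have := ler_distD y x 0; rewrite !subr0; move: xy; lra.
Qed.

Lemma norm_row_lt x C : 0 < C -> (forall i, `|x 0 i| < C) -> `|x| < C.
Proof.
move=> C0 H; rewrite [ltLHS]/Num.norm /= mx_normrE; apply/bigmax_ltP; split => // -[a i] _ /=.
by rewrite (ord1 a).
Qed.

Definition ob x (rho : 'I_n -> R) : set 'rV[R]_n := [set y | forall i, `|y 0 i - x 0 i| < rho i].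

Lemma open_ob x rho : open (ob x rho).
Proof.
rewrite openE => y H.
have Hi i : nbhs y [set z : 'rV[R]_n | `|z 0 i - x 0 i| < rho i].
  apply/nbhs_ballP; exists (rho i - `|y 0 i - x 0 i|); first by rewrite /= subr_gt0; exact: H.
  move=> z; rewrite -ball_normE /ball_/= => yz.
  have := le_lt_trans (coord_le_norm _ i) yz; rewrite !mxE => h.
  have := ler_distD (y 0 i) (z 0 i) (x 0 i); rewrite [`|z 0 i - y 0 i|]distrC; move: h; lra.
have : nbhs y [set z : 'rV[R]_n | forall i, `|z 0 i - x 0 i| < rho i] by exact: filter_forall Hi.
by [].
Qed.

Lemma convex_ob x rho : convex_set (ob x rho).
Proof.
move=> y z Hy Hz t /andP[t0 t1] i.
have -> : (y + t *: (z - y)) 0 i - x 0 i = (1 - t) * (y 0 i - x 0 i) + t * (z 0 i - x 0 i).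
  by rewrite !mxE; ring.
apply: le_lt_trans (ler_normD _ _) _; rewrite !normrM [`|1 - t|]ger0_norm ?subr_ge0// [`|t|]ger0_norm//.
exact: (conv_lt t0 t1 (Hy i) (Hz i)).
Qed.

Definition flips (rho : 'I_n -> R) := (forall i, 0 < rho i) /\ forall x, exists chi, flip (ob x rho) chi.

(** Two copies of the box shifted by half a radius to either side cover the longer box, and their
    overlap is convex as an intersection of boxes. *)
Lemma flips_grow1 rho i : flips rho -> flips (fun j => if j == i then 3 / 2 * rho i else rho j).
Proof.
move=> [rho0 H]; split=> [j|x]; first by case: eqP => // _; rewrite mulr_gt0// divr_gt0.
pose v : 'rV[R]_n := (rho i / 2) *: delta_mx 0 i.
have vE j : v 0 j = (rho i / 2) * (j == i)%:R by rewrite !mxE eqxx.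
have [|chi Hc] := flip_glue (open_ob (x := x - v) (rho := rho)) (open_ob (x := x + v) (rho := rho)) _ (H _) (H _).
  move=> y z [y1 y2] [z1 z2] t tI; split; exact: convex_ob tI.
exists chi; apply: flip_sub Hc => y Hy.
have r0 := rho0 i; have yi := Hy i; rewrite eqxx in yi.
have [h|h] := leP (y 0 i) (x 0 i).
  left => j; have := Hy j; have [->|ji] := eqVneq j i => [_|h2].
    rewrite mxE [(- v) 0 i]mxE vE eqxx mulr1; move: yi; rewrite !ltr_norml => /andP[h1 _]; apply/andP; split; lra.
  by rewrite mxE [(- v) 0 j]mxE vE (negbTE ji) mulr0 subr0.
right => j; have := Hy j; have [->|ji] := eqVneq j i => [_|h2].
  rewrite mxE vE eqxx mulr1; move: yi; rewrite !ltr_norml => /andP[_ h1]; apply/andP; split; lra.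
by rewrite mxE vE (negbTE ji) mulr0 addr0.
Qed.

Lemma flips_grow (q : seq 'I_n) rho : flips rho -> flips (fun j => (3 / 2) ^+ count_mem j q * rho j).
Proof.
move=> H; elim: q => [|i q IH].
  by rewrite (_ : (fun j => _) = rho)//; apply/funext => j; rewrite mul1r.
have := flips_grow1 i IH; congr flips; apply/funext => j /=.
by have [->|ji] := eqVneq i j; rewrite ?eqxx ?exprS ?mulrA// eq_sym (negbTE ji).
Qed.

Lemma flip_big C : compact G -> exists chi, flip [set y | `|y| < C] chi.
Proof.
move=> cG; have [d d0 Hd] := flip_uniform cG.
have S0 : flips (fun=> d).
  split=> // x; have [chi Hc] := Hd x; exists chi; apply: flip_sub Hc => y Hy.
  rewrite -ball_normE /ball_/= distrC; apply: norm_row_lt => // i.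
  by rewrite !mxE; exact: Hy.
have SN N : flips (fun=> (3 / 2) ^+ N * d).
  elim: N => [|N IH]; first by rewrite (_ : (fun=> _) = fun=> d)//; apply/funext => j; rewrite mul1r.
  have := flips_grow (enum 'I_n) IH; congr flips; apply/funext => j.
  by rewrite count_uniq_mem ?enum_uniq// mem_enum expr1 mulrA exprS.
(* By Bernoulli, (3/2)^(N+1) is at least 1 + (N+1)/2, which exceeds C / d. *)
pose N := Num.truncn (2 * (C / d)).
have [chi Hc] := (SN N.+1).2 0; exists chi; apply: flip_sub Hc => y /= yC i.
rewrite mxE subr0; apply: le_lt_trans (coord_le_norm y i) _; apply: lt_le_trans yC _.
rewrite -ler_pdivrMr//.
have := @bernoulli_pow R 1 (3 / 2) N ler01 _; rewrite !expr1n mulr1.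
have h1 : 2 * (C / d) < N.+1%:R by exact: truncnS_gt.
have h2 : (0 : R) <= 3 / 2 by rewrite divr_ge0.
move=> /(_ h2); move: h1; move: (N.+1%:R) (C / d) (_ ^+ _) => p q r; lra.
Qed.

(* On a large box there is a locally constant function off G that changes sign
   across G; on O it is constant, hence it determines the sign of hf y on O. *)
Lemma connected_one_sided (O : set 'rV[R]_n) : compact G -> connected O -> bounded_set O -> open O ->
  (forall x, O x -> ~ G x) -> forall y, G y ->
  exists2 s, pm1 s & exists2 r, 0 < r & forall z, `|y - z| < r -> O z -> Num.sg (hf y z) = s.
Proof.
move=> cG cO bO oO OG y Gy.
have [C1 C10 OC] := cbox_bounded bO; have [C2 C20 GC] := compact_cbox_sub cG.
pose C := C1 + C2 + 1.
have [chi Hc] := flip_big C cG.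
have inC x : O x \/ G x -> `|x| < C.
  move=> H; apply: (@le_lt_trans _ _ (C1 + C2)); last by rewrite /C ltrDl.
  case: H => [/OC/(cbox_norm _ (ltW C10))|/GC/(cbox_norm _ (ltW C20))] h; apply: le_trans h _.
    by rewrite lerDl ltW.
  by rewrite lerDr ltW.
have [[b Ob]|nO] := pselect (O !=set0); last first.
  by exists 1; [left|exists 1 => // z _ Oz; case: nO; exists z].
pose B := O `&` [set x | chi x = chi b].
have chiE x : O x -> exists2 r, 0 < r & forall z, `|x - z| < r -> O z -> chi z = chi x.
  move=> Ox; have [s ps [r r0 Hr]] := Hc x (inC x (or_introl Ox)).
  have Gx := OG x Ox; exists r => // z xz Oz.
  rewrite (Hr z xz (OG z Oz)) (Hr x _ Gx) ?subrr ?normr0//; congr (_ * _).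
  by rewrite /side !asboolF.
have BO : B = O.
  apply: cO.
  - by exists b.
  - exists (\bigcup_(x in B) [set z | exists2 r, 0 < r & (forall z, `|x - z| < r -> O z -> chi z = chi x) /\ `|x - z| < r]).
      apply: bigcup_open => x _; rewrite openE => z [e e0 [He xz]].
      apply/nbhs_ballP; exists (e - `|x - z|); first by rewrite /= subr_gt0.
      move=> w; rewrite -ball_normE /ball_/= => zw; exists e => //; split => //.
      by apply: le_lt_trans (ler_distD z _ _) _; rewrite -ltrBDl.
    apply/seteqP; split => [x [Ox cx]|x [Ox [z [Oz cz] [e e0 [He zx]]]]].
      by have [e e0 He] := chiE x Ox; split => //; exists x => //; exists e => //; split => //; rewrite subrr normr0.
    by split => //=; rewrite (He x zx Ox).
  - exists (~` \bigcup_(x in O `\` B) [set z | exists2 r, 0 < r & (forall z, `|x - z| < r -> O z -> chi z = chi x) /\ `|x - z| < r]).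
      rewrite closedC; apply: bigcup_open => x _; rewrite openE => z [e e0 [He xz]].
      apply/nbhs_ballP; exists (e - `|x - z|); first by rewrite /= subr_gt0.
      move=> w; rewrite -ball_normE /ball_/= => zw; exists e => //; split => //.
      by apply: le_lt_trans (ler_distD z _ _) _; rewrite -ltrBDl.
    apply/seteqP; split => [x [Ox cx]|x [Ox nx]].
      split => // -[z [Oz nB] [e e0 [He zx]]]; apply: nB; split => //=.
      by rewrite -cx (He x zx Ox).
    split => //; apply: contrapT => nD; apply: nx.
    have [e e0 He] := chiE x Ox.
    by exists x; [split => // -[]|exists e => //; split => //; rewrite subrr normr0].
have chib z : O z -> chi z = chi b by rewrite -BO => -[].
have [s ps [r r0 Hr]] := Hc y (inC y (or_intror Gy)).
have [s' ps' [r' r'0 Hr']] := Hc b (inC b (or_introl Ob)).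
exists (s * chi b).
  apply: pm1M => //; rewrite (Hr' b _ (OG b Ob)) ?subrr ?normr0// /side asboolF ?mulr1//; exact: OG.
exists r => // z yz Oz; have := Hr z yz (OG z Oz).
by rewrite /side asboolT// chib// => ->; rewrite mulrA (pm1_sqr ps) mul1r.
Qed.

Lemma neg_aux (a r q1 q2 : R) : 0 < a * r -> q1 <= a * r / 16 -> a / 2 * (r / 2) <= q2 -> q1 - q2 < 0.
Proof. by rewrite mulrACA; move: (a * r) => q; lra. Qed.

(* Near y the complement of O contains a cube below the graph, at distance r/2. *)
Lemma exterior_cube_local (O : set 'rV[R]_n) y0 s : G y0 -> pm1 s ->
  (exists2 r, 0 < r & forall z, `|y0 - z| < r -> O z -> Num.sg (hf y0 z) = s) ->
  exists2 k : R, 0 < k & exists2 r0, 0 < r0 & forall y r, G y -> `|y0 - y| < r0 -> 0 < r -> r < r0 ->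
    exists c : 'rV[R]_n, cbox (c - const_mx (k * r)) (c + const_mx (k * r)) `<=` eball y r `\` O.
Proof.
move=> Gy0 ps [r1 r10 H1].
have [oU Uy0 sh hG _] := chart Gy0.
have [_ [i hi]] := hG y0 Uy0.
set h := hf y0 in sh hG hi H1.
have [_ cp] := smooth_on_continuous sh Uy0.
pose p := partial i h y0; pose a := `|p|; have a0 : 0 < a by rewrite normr_gt0.
pose L := 1 + \sum_j `|partial j h y0|.
have Lj j : `|partial j h y0| + 1 <= L.
  by rewrite /L addrC lerD2l (bigD1 j)//= lerDl sumr_ge0.
have L0 : 0 < L by rewrite ltr_pwDl// sumr_ge0.
have nb : \forall z \near y0, Uf y0 z /\ ((forall j, `|partial j h z| <= L) /\ `|p - partial i h z| < a / 2).
  apply: filterI; first by apply: open_nbhs_nbhs; split.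
  apply: filterI.
    have Hj j : nbhs y0 [set z : 'rV[R]_n | `|partial j h z| <= L].
      by have := cp j; move/cvgrPdist_lt => /(_ 1 ltr01); apply: filterS => z /= hz;
      have := Lj j; have := ler_distD (partial j h y0) (partial j h z) 0; rewrite !subr0 distrC; move: hz; lra.
    exact: filter_forall Hj.
  by have := cp i; move/cvgrPdist_lt => /(_ (a / 2)); apply; rewrite divr_gt0.
have [r2 r20 H2] := near_ball_ex nb.
pose N := n%:R + 1 : R; have N0 : 0 < N by rewrite ltr_wpDl.
(* The first bound keeps the cube within r/4 of its center. The second bounds the variation of [h]
   on it by a r / 16, less than the change a r / 4 gained by moving r/2 in direction [i]. *)
pose k := Num.min (1 / (4 * N)) (a / (16 * N * L)).
have k0 : 0 < k by rewrite lt_min !divr_gt0// !mulr_gt0.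
have k1 : k * (4 * N) <= 1 by rewrite -ler_pdivlMr ?mulr_gt0// ge_min lexx.
have k2 : k * (16 * N * L) <= a by rewrite -ler_pdivlMr ?mulr_gt0// ge_min lexx orbT.
have N1 : 1 <= N by rewrite /N lerDr.
have k14 : k <= 1 / 4.
  apply: le_trans (_ : k * N <= _); first by rewrite ler_peMr// ltW.
  by move: k1; rewrite mulrCA; move: (k * N) => q; lra.
pose r0 := Num.min r1 r2 / 2.
have m0 : 0 < Num.min r1 r2 by rewrite lt_min r10.
exists k => //; exists r0 => [|y r Gy yy rp rr]; first exact: divr_gt0.
have [rr1 rr2] : 2 * r0 <= r1 /\ 2 * r0 <= r2.
  by rewrite /r0 mulrCA divff ?mulr1 ?pnatr_eq0//; split; rewrite ge_min lexx ?orbT.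
(* Going from [y] in direction -t e_i decreases s h, that is, it leads away from the side occupied
   by [O]. *)
have [t tE] : exists t, t = s * Num.sg p by exists (s * Num.sg p).
have pt : pm1 t by rewrite tE; apply: pm1M ps (pm1_sg hi).
have t1 : `|t| = 1 by case: pt => ->; rewrite ?normrN normr1.
have [c cE] : exists c : 'rV[R]_n, c = y - (t * (r / 2)) *: delta_mx 0 i by eexists.
exists c => z zc.
have zw j : `|z 0 j - c 0 j| <= k * r.
  by have := zc j; rewrite !mxE ler_distl.
have kr : k * r <= r / 4.
  by rewrite -[r / 4]mulrC ler_wpM2r ?(ltW rp)// -div1r.
have vj j : z 0 j - y 0 j = (z 0 j - c 0 j) - t * (r / 2) * (j == i)%:R.
  by rewrite cE !mxE eqxx/=; ring.
have zy : `|z - y| <= 3 / 4 * r.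
  apply: norm_row_le => [|j]; first by rewrite mulr_ge0// ltW.
  rewrite !mxE vj; apply: le_trans (ler_normB _ _) _.
  have h1 : `|t * (r / 2) * (j == i)%:R| <= r / 2.
    have rh0 : 0 <= r / 2 by rewrite divr_ge0// ltW.
    by rewrite normrM [`|t * _|]normrM t1 mul1r normr_nat (ger0_norm rh0); case: (j == i); rewrite ?mulr1 ?mulr0.
  by have := zw j; move: kr h1; lra.
have Bz q : 0 <= q <= 1 -> `|y0 - (y + q *: (z - y))| < 2 * r0.
  move=> /andP[q0 q1]; rewrite opprD addrA; apply: le_lt_trans (ler_normB _ _) _.
  rewrite normrZ ger0_norm//.
  have := ler_piMl (normr_ge0 (z - y)) q1; move: zy yy rr rp; lra.
split.
  rewrite /eball /=; have -> : z - y = (z - c) - (t * (r / 2)) *: delta_mx 0 i by rewrite cE opprB addrA addrAC addrK.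
  apply: le_lt_trans (enormD _ _) _; rewrite enormN enormZ.
  have -> : enorm (delta_mx 0 i : 'rV[R]_n) = 1.
    rewrite /enorm (bigD1 i)//= mxE !eqxx big1 ?addr0 ?expr1n ?sqrtr1// => j /negbTE ji.
    by rewrite mxE ji andbF expr0n.
  rewrite mulr1 normrM t1 mul1r ger0_norm ?divr_ge0 ?(ltW rp)//.
  have : enorm (z - c) <= r / 4.
    apply: le_trans (enorm_le_norm _) _.
    apply: le_trans (_ : N * (k * r) <= _).
      by apply: ler_pM => //; [rewrite lerDl|apply: norm_row_le => [|j]; [rewrite mulr_ge0// ltW|rewrite !mxE; exact: zw]].
    by rewrite mulrA -[r / 4]mulrC ler_wpM2r ?(ltW rp)// mulrC; move: k1; rewrite mulrCA; move: (k * N) => q; lra.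
  lra.
move=> Oz.
have z1 : `|y0 - z| < 2 * r0 by have := Bz 1; rewrite lexx ler01 scale1r subrKC; exact.
have sz := H1 z (lt_le_trans z1 rr1) Oz.
have hy : h y = 0.
  apply/(hG y _).1 => //; apply: (H2 y _).1; apply: lt_le_trans rr2; apply: lt_trans yy _.
  by rewrite ltr_pMl ?ltr1n// divr_gt0.
have [q qI e] := mvt_segment (f := h) (x := y) (v := z - y)
  (fun q qI => sh [::] _ (H2 _ (lt_le_trans (Bz q qI) rr2)).1).
rewrite subrKC hy subr0 in e; set xi := y + q *: (z - y) in e.
have [_ [Lb ib]] := H2 _ (lt_le_trans (Bz q qI) rr2); rewrite -/xi in Lb ib.
have es : s * h z = \sum_j s * partial j h xi * (z 0 j - c 0 j) - (Num.sg p * partial i h xi) * (r / 2).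
  rewrite e mulr_sumr.
  have -> : (Num.sg p * partial i h xi) * (r / 2) = \sum_j s * partial j h xi * (t * (r / 2) * (j == i)%:R).
    rewrite (bigD1 i)//= eqxx big1 ?addr0; last by move=> j /negbTE ->; rewrite !mulr0.
    by rewrite tE mulr1 -[LHS]mul1r -(pm1_sqr ps); ring.
  rewrite -sumrB; apply: eq_bigr => j _; rewrite !mxE vj; ring.
have b1 : \sum_j s * partial j h xi * (z 0 j - c 0 j) <= a * r / 16.
  apply: le_trans (_ : \sum_(j < n) L * (k * r) <= _).
    apply: ler_sum => j _; apply: le_trans (ler_norm _) _; rewrite !normrM.
    have -> : `|s| = 1 by case: ps => ->; rewrite ?normrN normr1.
    by rewrite mul1r; apply: ler_pM.
  rewrite sumr_const card_ord -[leLHS]mulr_natl.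
  apply: le_trans (_ : N * (L * (k * r)) <= _).
    by rewrite ler_wpM2r ?mulr_ge0 ?(ltW L0) ?(ltW k0) ?(ltW rp)// lerDl.
  have := ler_wpM2r (ltW rp) k2; have -> : k * (16 * N * L) * r = 16 * (N * (L * (k * r))) by ring.
  by move: (a * r) (N * _) => q1 q2; lra.
have b2 : a / 2 <= Num.sg p * partial i h xi.
  have -> : Num.sg p * partial i h xi = a - Num.sg p * (p - partial i h xi).
    by rewrite mulrBr -/a /a normrEsg; ring.
  rewrite lerBrDr -lerBrDl; apply: le_trans (ler_norm _) _; rewrite normrM.
  have -> : `|Num.sg p| = 1 by case: (pm1_sg hi) => ->; rewrite ?normrN normr1.
  by rewrite mul1r; move: ib; lra.
have b3 : a / 2 * (r / 2) <= Num.sg p * partial i h xi * (r / 2) by rewrite ler_wpM2r// divr_ge0// ltW.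
have neg : s * h z < 0.
  rewrite es; have : 0 < a * r by rewrite mulr_gt0.
  move=> ar; exact: (neg_aux ar b1 b3).
move: neg; rewrite -sz -normrEsg ltNge normr_ge0//.
Qed.

(** Compactness of [G] makes the local constants uniform; this is the fixed portion of each boundary
    ball that lies outside [O]. *)
Lemma exterior_cube (O : set 'rV[R]_n) : compact G -> connected O -> bounded_set O -> open O ->
  (forall x, O x -> ~ G x) ->
  exists2 k : R, 0 < k & exists2 r0, 0 < r0 & forall y r, G y -> 0 < r -> r < r0 ->
    exists c : 'rV[R]_n, cbox (c - const_mx (k * r)) (c + const_mx (k * r)) `<=` eball y r `\` O.
Proof.
move=> cG cO bO oO OG.
have /choice[kr Hkr] y0 : exists kr : R * R, [/\ 0 < kr.1, 0 < kr.2 &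
    G y0 -> forall y r, G y -> `|y0 - y| < kr.2 -> 0 < r -> r < kr.2 ->
    exists c : 'rV[R]_n, cbox (c - const_mx (kr.1 * r)) (c + const_mx (kr.1 * r)) `<=` eball y r `\` O].
  have [Gy|Gy] := pselect (G y0); last by exists (1, 1).
  have [s ps Hs] := connected_one_sided cG cO bO oO OG Gy.
  by have [k k0 [r0 r00 H]] := exterior_cube_local Gy ps Hs; exists (k, r0).
move: (cG); rewrite compact_cover => /(_ _ G (fun z => ball z (kr z).2)).
case=> [z _|z Gz|D DG GD]; first exact: ball_open.
  by exists z => //; apply: ballxx; have [] := Hkr z.
have [d0 d00 Hd] : exists2 d0, 0 < d0 & forall z, z \in finmap.enum_fset D -> forall d, 0 < d -> d < d0 ->
    d <= (kr z).1 /\ d <= (kr z).2.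
  apply: seq_small => z _; have [k0 r0 _] := Hkr z.
  exists (Num.min (kr z).1 (kr z).2); first by rewrite lt_min k0.
  by move=> d _; rewrite lt_min => /andP[/ltW ? /ltW ?].
pose d := d0 / 2; have dp : 0 < d by rewrite divr_gt0.
have dd : d < d0 by rewrite ltr_pdivrMr// ltr_pMr// ltrDl.
exists d => //; exists d => // y r Gy rp rd.
have [z zD zy] := GD y Gy; move: zy; rewrite -ball_normE /ball_/= => zy.
have [h1 h2] := Hd z zD d dp dd; have [k0 _ Hz] := Hkr z.
have Gz : G z by have := DG z zD; rewrite inE.
have [c Hc] := Hz Gz y r Gy zy rp (lt_le_trans rd h2).
exists c => x xc; apply: Hc => i; have := xc i; rewrite !mxE.
by have := ler_wpM2r (ltW rp) h1; move: (d * r) (_ * r) => p q; move=> pq /andP[? ?]; apply/andP; split; lra.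
Qed.

End one_sided.

(** * Preimages of null sets under the nearest-point projection *)

Section projection_null.
Context {R : realType} {n : nat}.
Implicit Types (x y z v w : 'rV[R]_n) (U V G N T : set 'rV[R]_n) (s t r C c d e : R).
Implicit Types (i j l m : 'I_n) (f h : 'rV[R]_n -> R) (P : 'rV[R]_n -> 'rV[R]_n).

(** Positivity allows d^(n-1) to be bounded by the Hausdorff gauge. *)
Lemma unit_ball_vol_gt0 k : 0 < unit_ball_vol R k.
Proof.
pose r : R := 1 / (k%:R + 1); have k1 : 0 < k%:R + 1 :> R by rewrite ltr_wpDl.
have r0 : 0 < r by rewrite divr_gt0.
have s1 : cbox (const_mx (- r)) (const_mx r) `<=` eball (0 : 'rV[R]_k) 1.
  move=> x /(cbox_norm _ (ltW r0)) xr; rewrite /eball /= subr0.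
  apply: le_lt_trans (enorm_le_norm _) _; apply: le_lt_trans (ler_wpM2l (ler0n _ _) xr) _.
  by rewrite /r mulrA mulr1 ltr_pdivrMr// mul1r ltrDl.
have s2 : eball (0 : 'rV[R]_k) 1 `<=` cbox (const_mx (- 1)) (const_mx 1).
  move=> x; rewrite /eball /= subr0 => x1; apply/cbox_norm => //.
  exact: le_trans (norm_le_enorm x) (ltW x1).
rewrite /unit_ball_vol fine_gt0//; apply/andP; split.
  apply: lt_le_trans (le_outer_measure (lebesgue_outer R k) _ _ s1).
  rewrite /= leb_outer_cbox => [|i]; last by rewrite !mxE; lra.
  by rewrite lte_fin prodr_gt0// => i _; rewrite !mxE; lra.
apply: le_lt_trans (le_outer_measure (lebesgue_outer R k) _ _ s2) _.
by rewrite /= leb_outer_cbox ?ltry// => i; rewrite !mxE; lra.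
Qed.

Lemma exp_addr_le (a b : R) k : 0 <= a -> 0 <= b -> (a + b) ^+ k <= 2 ^+ k * (a ^+ k + b ^+ k).
Proof.
move=> a0 b0; have [ab|ab] := leP a b.
  apply: le_trans (_ : (2 * b) ^+ k <= _); first by rewrite lerXn2r ?nnegrE ?addr_ge0 ?mulr_ge0//; lra.
  by rewrite exprMn ler_wpM2l ?exprn_ge0// lerDr exprn_ge0.
apply: le_trans (_ : (2 * a) ^+ k <= _); first by rewrite lerXn2r ?nnegrE ?addr_ge0 ?mulr_ge0//; lra.
by rewrite exprMn ler_wpM2l ?exprn_ge0// lerDl exprn_ge0.
Qed.

(* Such a tube is covered by about tau / d cubes of side d. *)
Lemma leb_tube y v (K tau d : R) (A : set 'rV[R]_n) : 0 < n%:R :> R -> 0 <= K -> 0 <= tau -> 0 < d -> d <= 2 ->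
  (forall x, A x -> exists2 t, `|t| <= tau & `|x - y - t *: v| <= K * d) ->
  (leb_outer A <= ((2 * tau + 2) * (2 * (K + `|v|)) ^+ n * d ^+ n.-1)%:E)%E.
Proof.
move=> n0 K0 tau0 d0 d2 HA; pose N := (Num.truncn (2 * tau / d)).+1.
pose c (j : 'I_N) : 'rV[R]_n := y + (- tau + j%:R * d) *: v.
pose r := (K + `|v|) * d; have r0 : 0 <= r by rewrite mulr_ge0 ?addr_ge0// ltW.
pose B (j : 'I_N) := cbox (c j - const_mx r) (c j + const_mx r).
have vB (j : 'I_N) : (leb_outer (B j) <= ((2 * r) ^+ n)%:E)%E.
  rewrite leb_outer_cbox => [|i]; last by rewrite !mxE; lra.
  rewrite (eq_bigr (fun=> 2 * r)) ?prodr_const ?card_ord// => i _; rewrite !mxE; ring.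
have AB : A `<=` \big[setU/set0]_(j <- enum 'I_N) B j.
  move=> x /HA[t tt xt]; rewrite -bigcup_seq.
  have q0 : 0 <= (t + tau) / d by rewrite divr_ge0 ?(ltW d0)//; move: tt; rewrite ler_norml => /andP[]; lra.
  have qN : (Num.truncn ((t + tau) / d) < N)%N.
    rewrite ltnS; apply: le_truncn; rewrite ler_pM2r ?invr_gt0//.
    by move: tt; rewrite ler_norml => /andP[]; lra.
  exists (Ordinal qN); first by rewrite /= mem_enum.
  have /andP[h1 h2] := truncn_itv q0.
  set q := Num.truncn _ in h1 h2 qN *.
  have tq : `|t - (- tau + q%:R * d)| <= d.
    rewrite ler_pdivlMr// in h1; rewrite ltr_pdivrMr// -natr1 mulrDl mul1r in h2.
    by rewrite ler_norml; move: h1 h2; move: (q%:R * d) => p h1 h2; apply/andP; split; lra.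
  have xc : `|x - c (Ordinal qN)| <= r.
    have -> : x - c (Ordinal qN) = (x - y - t *: v) + (t - (- tau + q%:R * d)) *: v.
      by apply/rowP => i; rewrite !mxE /=; ring.
    apply: le_trans (ler_normD _ _) _; rewrite normrZ /r mulrDl; apply: lerD => //.
    by rewrite mulrC ler_wpM2l.
  move=> i; have := le_trans (coord_le_norm _ i) xc; rewrite !mxE ler_norml => /andP[p1 p2].
  by apply/andP; split; lra.
apply: le_trans (le_outer_measure (lebesgue_outer R n) _ _ AB) _.
apply: le_trans (leb_outer_sum (enum 'I_N) vB) _.
rewrite lee_fin size_enum_ord /N -natr1.
have nE : n = n.-1.+1 by rewrite prednK// -(@ltr0n R).
have h : (Num.truncn (2 * tau / d))%:R + 1 <= (2 * tau + 2) / d :> R.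
  have q0 : 0 <= 2 * tau / d by rewrite divr_ge0 ?mulr_ge0// ltW.
  rewrite [leRHS]mulrDl; apply: lerD; first by rewrite truncn_le.
  by rewrite ler_pdivlMr// mul1r.
apply: le_trans (ler_wpM2r (exprn_ge0 _ _) h) _; first by rewrite mulr_ge0.
have dn : d ^+ n = d * d ^+ n.-1 by rewrite -exprS -nE.
have d_n0 : d != 0 by rewrite gt_eqF.
rewrite /r mulrA exprMn dn le_eqVlt; apply/orP; left; apply/eqP.
by move: (_ ^+ n) (d ^+ _) => p q; field.
Qed.

Lemma ediam_ge (E : set 'rV[R]_n) x y : E x -> E y -> ((enorm (x - y))%:E <= ediam E)%E.
Proof. by move=> Ex Ey; apply: ereal_sup_ubound; exists (x, y). Qed.

(** Points that project into a piece of diameter d lie on normals whose directions vary by O(d),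
    hence in a tube of fixed length and width O(d) around one of them. Its volume is O(d^(n-1)), so
    a Hausdorff covering of [N] of small total gauge yields a small total volume. *)
Lemma null_projection_local G T P y0 h U : (1 < n)%N -> chart_at G y0 h U ->
  (forall x, T x -> G (P x) /\ forall z, G z -> enorm (x - P x) <= enorm (x - z)) ->
  exists2 r, 0 < r & forall N, N `<=` G -> haus_outer n.-1 N = 0%E ->
    null [set x | [/\ T x, N (P x), `|x - P x| <= 1 & `|y0 - P x| < r]].
Proof.
move=> n1 [oU Uy0 sh hG nrm] TP.
have n0 : 0 < n%:R :> R by rewrite ltr0n; apply: ltnW.
have [_ [i hi]] := hG y0 Uy0.
have [_ cp] := smooth_on_continuous sh Uy0.
have cpp j l : {for y0, continuous (partial l (partial j h))}.
  exact: differentiable_continuous (sh [:: l; j] y0 Uy0).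
pose a := `|partial i h y0|; have a0 : 0 < a by rewrite normr_gt0.
pose L1 := 1 + \sum_j `|partial j h y0|.
pose L2 := 1 + \sum_(jl : 'I_n * 'I_n) `|partial jl.2 (partial jl.1 h) y0|.
have L1j j : `|partial j h y0| + 1 <= L1.
  by rewrite /L1 addrC lerD2l (bigD1 j)//= lerDl sumr_ge0.
have L2j j l : `|partial l (partial j h) y0| + 1 <= L2.
  by rewrite /L2 addrC lerD2l (bigD1 (j, l))//= lerDl sumr_ge0.
have L1p : 0 < L1 by rewrite ltr_pwDl// sumr_ge0.
have L2p : 0 < L2 by rewrite ltr_pwDl// sumr_ge0.
have bnd1 f C : {for y0, continuous f} -> `|f y0| + 1 <= C -> nbhs y0 [set z : 'rV[R]_n | `|f z| <= C].
  move=> cf fC; have := cf; move/cvgrPdist_lt => /(_ 1 ltr01); apply: filterS => z /= hz.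
  have := ler_distD (f y0) (f z) 0; rewrite !subr0 distrC; move: hz fC; lra.
have N1 : nbhs y0 [set z : 'rV[R]_n | forall j, `|partial j h z| <= L1].
  exact: filter_forall (fun j => bnd1 _ _ (cp j) (L1j j)).
have N2 : nbhs y0 [set z : 'rV[R]_n | forall jl : 'I_n * 'I_n, `|partial jl.2 (partial jl.1 h) z| <= L2].
  exact: filter_forall (fun jl : 'I_n * 'I_n => bnd1 _ _ (cpp jl.1 jl.2) (L2j jl.1 jl.2)).
have N3 : nbhs y0 [set z : 'rV[R]_n | a / 2 <= `|partial i h z|].
  have := cp i; move/cvgrPdist_lt => /(_ (a / 2)) H.
  have := H (divr_gt0 a0 (ltr0Sn _ _)); apply: filterS => z /= hz.
  have := ler_distD (partial i h z) (partial i h y0) 0; rewrite !subr0 -/a; move: hz; lra.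
have N4 : nbhs y0 U by apply: open_nbhs_nbhs; split.
have [r r0 Hr] := near_ball_ex (filterI N4 (filterI N1 (filterI N2 N3))).
exists r => // N NG N0.
(* Points at distance at most 1 from [G] have normal parameter at most 2 / a, since the i-th
   component of the gradient is at least a / 2. *)
pose tau := 2 / a; have tau0 : 0 < tau by rewrite divr_gt0.
have gradL y z : `|y0 - y| < r -> `|y0 - z| < r -> `|grad h y - grad h z| <= n%:R * L2 * `|y - z|.
  move=> yr zr; apply: norm_row_le => [|j]; first by rewrite !mulr_ge0// ltW.
  have seg s : 0 <= s <= 1 -> `|y0 - (z + s *: (y - z))| < r.
    move=> /andP[s0 s1].
    have -> : y0 - (z + s *: (y - z)) = (1 - s) *: (y0 - z) + s *: (y0 - y).
      by apply/rowP => m; rewrite !mxE; ring.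
    apply: le_lt_trans (ler_normD _ _) _; rewrite !normrZ !ger0_norm ?subr_ge0//.
    exact: conv_lt.
  have [s sI e] := mvt_segment (f := partial j h) (x := z) (v := y - z)
    (fun s sI => sh [:: j] _ (Hr _ (seg s sI)).1).
  rewrite subrKC in e; rewrite !mxE e; apply: le_trans (ler_norm_sum _ _ _) _.
  apply: le_trans (_ : \sum_(l < n) L2 * `|y - z| <= _).
    apply: ler_sum => l _; rewrite normrM; apply: ler_pM => //; last exact: coord_le_norm.
    by have [_ [_ [/(_ (j, l))]]] := Hr _ (seg s sI).
  by rewrite sumr_const card_ord -[leLHS]mulr_natl mulrA.
have tP x : T x -> N (P x) -> `|x - P x| <= 1 -> `|y0 - P x| < r ->
    exists2 t, `|t| <= tau & x - P x = t *: grad h (P x).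
  move=> Tx NP x1 yr; have [Uy [_ [_ hy]]] := Hr _ yr; have [Gy miny] := TP x Tx.
  have [t tE] := nrm x (P x) Uy Gy miny; exists t => //.
  have := le_trans (coord_le_norm (x - P x) i) x1; rewrite tE !mxE normrM => h1.
  rewrite /tau ler_pdivlMr//.
  have : `|t| * (a / 2) <= 1 by apply: le_trans h1; rewrite ler_wpM2l.
  by rewrite mulrA; move: (`|t| * a) => q; lra.
pose S E := [set x | [/\ T x, N (P x), `|x - P x| <= 1 & `|y0 - P x| < r] /\ E (P x)].
pose K := 1 + tau * (n%:R * L2); have K0 : 0 <= K by rewrite addr_ge0// (mulr_ge0 (ltW tau0) (mulr_ge0 (ler0n _ _) (ltW L2p))).
pose Q := (2 * tau + 2) * (2 * (K + L1)) ^+ n.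
have t2 : 0 <= 2 * tau + 2 by rewrite addr_ge0// mulr_ge0// ltW.
have Q0 : 0 <= Q by rewrite mulr_ge0// exprn_ge0// mulr_ge0// addr_ge0// ltW.
(* The slack [e] keeps the side of the covering cubes positive for pieces of diameter 0. *)
have tube (E : set 'rV[R]_n) (d e : R) : (forall y z, E y -> E z -> enorm (y - z) <= d) -> 0 <= d -> d <= 1 -> 0 < e -> e <= 1 ->
    (leb_outer (S E) <= (Q * (d + e) ^+ n.-1)%:E)%E.
  move=> Ed d0 d1 e0 e1.
  have [[x1 [[Tx1 Nx1 x11 yr1] Ex1]]|nS] := pselect (S E !=set0); last first.
    have SE0 : S E = set0 by apply/seteqP; split => // x Sx; apply: nS; exists x.
    rewrite SE0 (outer_measure0 (lebesgue_outer R n)) lee_fin.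
    exact: (mulr_ge0 Q0 (exprn_ge0 _ (addr_ge0 d0 (ltW e0)))).
  have de0 : 0 < d + e by rewrite ltr_wpDl.
  have de2 : d + e <= 2 by move: d1 e1; lra.
  have [_ [v1 _]] := Hr _ yr1.
  have v1' : `|grad h (P x1)| <= L1 by apply: norm_row_le => [|j]; [exact: ltW|rewrite mxE; exact: v1].
  apply: le_trans (leb_tube (y := P x1) (v := grad h (P x1)) n0 K0 (ltW tau0) de0 de2 _) _.
    move=> x [[Tx Nx x1' yr] Ex]; have [t tt tE] := tP x Tx Nx x1' yr; exists t => //.
    have -> : x - P x1 - t *: grad h (P x1) = (P x - P x1) + t *: (grad h (P x) - grad h (P x1)).
      rewrite scalerBr -tE; move: (t *: grad h (P x1)) (P x1) (P x) => w w1 w2.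
      by apply/rowP => m; rewrite !mxE; ring.
    apply: le_trans (ler_normD _ _) _; rewrite normrZ.
    have h1 : `|P x - P x1| <= d + e.
      by apply: le_trans (norm_le_enorm _) _; apply: le_trans (Ed _ _ Ex Ex1) _; rewrite lerDl ltW.
    rewrite /K mulrDl mul1r; apply: lerD => //; rewrite -mulrA; apply: ler_pM => //.
    apply: le_trans (gradL _ _ yr yr1) _; rewrite ler_wpM2l// mulr_ge0//; exact: ltW.
  have p1 : 0 <= 2 * (K + `|grad h (P x1)|) by exact: mulr_ge0 (ler0n _ 2) (addr_ge0 K0 (normr_ge0 _)).
  have p2 : 0 <= 2 * (K + L1) by exact: mulr_ge0 (ler0n _ 2) (addr_ge0 K0 (ltW L1p)).
  have p12 : 2 * (K + `|grad h (P x1)|) <= 2 * (K + L1) by rewrite ler_pM2l// lerD2l.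
  rewrite lee_fin /Q; apply: ler_wpM2r; first exact: (exprn_ge0 _ (ltW de0)).
  by apply: (ler_wpM2l t2); apply: lerXn2r.
pose ub := unit_ball_vol R n.-1; have ub0 : 0 < ub by exact: unit_ball_vol_gt0.
(* [B] absorbs the splitting of (d + e)^(n-1); [A] converts d^(n-1) into the gauge ub (d/2)^(n-1),
   the summand 1 making it positive. *)
pose B := Q * 2 ^+ n.-1; pose A := B * 2 ^+ n.-1 / ub + 1.
have B0 : 0 <= B by rewrite mulr_ge0// exprn_ge0.
have A1 : 0 <= B * 2 ^+ n.-1 / ub by exact: divr_ge0 (mulr_ge0 B0 (exprn_ge0 _ (ler0n _ 2))) (ltW ub0).
have Ap : 0 < A by rewrite ltr_wpDl.
have A0 := ltW Ap.
apply/eqP; rewrite eq_le (outer_measure_ge0 (lebesgue_outer R n)) andbT.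
apply/lee_addgt0Pr => e' e'0; rewrite add0e.
(* The gauges sum to at most e and the slacks e / 2^(k+1) sum to e, for a total of (A + B) e. *)
pose e := Num.min 1 (e' / (A + B + 1)).
have AB0 : 0 < A + B + 1 by rewrite ltr_wpDl// addr_ge0.
have e0 : 0 < e by rewrite lt_min ltr01 divr_gt0.
have e1 : e <= 1 by rewrite ge_min lexx.
have eE : (A + B) * e <= e'.
  apply: le_trans (_ : (A + B) * (e' / (A + B + 1)) <= _); first by rewrite ler_wpM2l ?addr_ge0// ge_min lexx orbT.
  by rewrite mulrCA ler_piMr ?(ltW e'0)// ler_pdivrMr// mul1r lerDl.
have N1' : mu_ext (hausdorff_gauge n.-1 (1 : R)) N = 0%E.
  apply/eqP; rewrite eq_le (mu_ext_ge0 (@hausdorff_gauge_ge0 R n n.-1 1)) andbT -N0.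
  by apply: ereal_sup_ubound; exists 1 => //=.
have fN : mu_ext (hausdorff_gauge n.-1 (1 : R)) N \is a fin_num by rewrite N1'.
have [_ [E [_ NE] <-]] := lb_ereal_inf_adherent e0 fN.
move=> Ee0.
have Ee : (\sum_(0 <= k <oo) hausdorff_gauge n.-1 (1 : R) (E k) < e%:E)%E.
  by apply: (lt_le_trans Ee0); rewrite [X in (X + _ <= _)%E](_ : _ = 0%E) ?add0e//; exact: N1'.
apply: le_trans (_ : leb_outer (\bigcup_k S (E k)) <= _)%E.
  apply: (le_outer_measure (lebesgue_outer R n)) => x [Tx Nx x1 yr].
  by have [k _ Ek] := NE _ Nx; exists k.
apply: le_trans (outer_measure_sigma_subadditive (lebesgue_outer R n) _) _.
apply: le_trans (_ : (\sum_(0 <= k <oo) (A%:E * hausdorff_gauge n.-1 1 (E k) + (B * e / (2 ^ k.+1)%:R)%:E)) <= _)%E.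
  apply: lee_nneseries => [k _ _|k _]; first exact: (outer_measure_ge0 (lebesgue_outer R n)).
  have ek0 : 0 < e / (2 ^ k.+1)%:R by rewrite divr_gt0// ltr0n expn_gt0.
  have ek1 : e / (2 ^ k.+1)%:R <= 1.
    by rewrite ler_pdivrMr ?ltr0n ?expn_gt0// mul1r; apply: le_trans e1 _; rewrite ler1n expn_gt0.
  rewrite /hausdorff_gauge; case: ifPn => [/eqP Ek|/set0P[z Ez]].
    rewrite (_ : S (E k) = set0); last by apply/seteqP; split => // x [_]; rewrite Ek.
    rewrite [X in (X <= _)%E](outer_measure0 (lebesgue_outer R n)) mule0 add0e lee_fin -mulrA mulr_ge0//.
    exact: ltW.
  case: ifPn => [ed|_]; last first.
    by rewrite mulry gtr0_sg// mul1e addye// leey.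
  have ed0 : (0 <= ediam (E k))%E.
    by apply: le_trans (ediam_ge Ez Ez); rewrite lee_fin enorm_ge0.
  have fe : ediam (E k) \is a fin_num by rewrite ge0_fin_numE//; apply: le_lt_trans ed _; rewrite ltry.
  set d := fine (ediam (E k)).
  have d0 : 0 <= d by exact: fine_ge0.
  have d1 : d <= 1 by rewrite -lee_fin /d fineK.
  have Ed x y : E k x -> E k y -> enorm (x - y) <= d.
    by move=> Ex Ey; rewrite -lee_fin /d fineK//; exact: ediam_ge.
  apply: le_trans (tube _ _ _ Ed d0 d1 ek0 ek1) _.
  rewrite -EFinM -EFinD lee_fin -/ub.
  apply: le_trans (ler_wpM2l Q0 (exp_addr_le _ d0 (ltW ek0))) _.
  rewrite mulrA -/B mulrDr; apply: lerD.
    apply: le_trans (_ : B * 2 ^+ n.-1 / ub * (ub * (d / 2) ^+ n.-1) <= _); last first.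
      by rewrite ler_wpM2r ?mulr_ge0 ?exprn_ge0 ?divr_ge0 ?(ltW ub0)// /A lerDl.
    rewrite expr_div_n le_eqVlt; apply/orP; left; apply/eqP.
    have u0 : ub != 0 by rewrite gt_eqF.
    have p0 : 2 ^+ n.-1 != 0 :> R by rewrite expf_neq0.
    by move: (2 ^+ n.-1) p0 (d ^+ _) => q q0 p; field; rewrite ?u0 ?q0.
  rewrite -mulrA ler_wpM2l//.
  have -> : n.-1 = n.-2.+1 by case: (n) n1 => [|[|]].
  by rewrite exprS ler_piMr ?(ltW ek0)// exprn_ile1// ltW.
apply: le_trans (epsilon_trick xpredT _ _) _.
- by move=> k; rewrite mule_ge0 ?lee_fin//; exact: hausdorff_gauge_ge0.
- by rewrite mulr_ge0// ltW.
rewrite nneseriesZl; last by move=> k _; exact: hausdorff_gauge_ge0.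
apply: le_trans (_ : A%:E * e%:E + (B * e)%:E <= _)%E; last by rewrite -EFinM -EFinD lee_fin -mulrDl.
by rewrite leeD2r// lee_wpmul2l ?lee_fin// ltW.
Qed.

Lemma null_projection G T P (hf : 'rV[R]_n -> 'rV[R]_n -> R) (Uf : 'rV[R]_n -> set 'rV[R]_n) N :
  (1 < n)%N -> (forall y, G y -> chart_at G y (hf y) (Uf y)) -> compact G ->
  (forall x, T x -> G (P x) /\ forall z, G z -> enorm (x - P x) <= enorm (x - z)) ->
  N `<=` G -> haus_outer n.-1 N = 0%E ->
  null [set x | [/\ T x, N (P x) & `|x - P x| <= 1]].
Proof.
move=> n1 chart cG TP NG N0.
have /choice[rho Hrho] y : exists r, 0 < r /\ (G y -> null [set x | [/\ T x, N (P x), `|x - P x| <= 1 & `|y - P x| < r]]).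
  have [Gy|Gy] := pselect (G y); last by exists 1.
  by have [r r0 H] := null_projection_local n1 (chart y Gy) TP; exists r; split => // _; exact: H.
move: (cG); rewrite compact_cover => /(_ _ G (fun z => ball z (rho z))).
case=> [z _|z Gz|D DG GD]; first exact: ball_open.
  by exists z => //; apply: ballxx; exact: (Hrho z).1.
pose A z := [set x | [/\ T x, N (P x), `|x - P x| <= 1 & `|z - P x| < rho z]].
pose q := finmap.enum_fset D.
apply: (@nullS _ _ _ (\bigcup_k (if (k < size q)%N then A (nth 0 q k) else set0))).
  move=> x [Tx Nx x1]; have [z zD] := GD _ (NG _ Nx); rewrite -ball_normE /ball_/= => zx.
  by exists (index z q) => //; rewrite index_mem ifT// nth_index.
apply: null_bigcup => k; case: ifP => kq; last exact: null0.
by apply: (Hrho _).2; have := DG (nth 0 q k) (mem_nth 0 kq); rewrite inE.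
Qed.

End projection_null.

(** * Vanishing mean oscillation *)

Section oscillation_estimates.
Context {R : realType} {n : nat}.
Implicit Types (x y z q : 'rV[R]_n) (A B O K : set 'rV[R]_n) (s t r C c d e : R) (u v : 'rV[R]_n -> R).
Implicit Types (f h w : 'rV[R]_n -> 'rV[R]_n) (i j m : 'I_n).
Local Notation M := (caratheodory_type (lebesgue_outer R n)).

(** The kernel is bounded independently of [s], while its mass is at least a constant times s^n: on
    the cube [s/4, s/2]^n every bump factor is at least its minimum over [1/4, 1/2]. *)
Lemma ker_sup : exists2 C, 0 < C & forall s y, 0 < s -> ker s y * s ^+ n <= C.
Proof.
have [b b0 Hb] : exists2 b : R, 0 < b & forall t : R, 4^-1 <= t <= 2^-1 -> b <= bump t.
  have l42 : (4^-1 : R) <= 2^-1 by lra.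
  have [] := @EVT_min R bump 4^-1 2^-1 l42.
    by apply: continuous_subspaceT => t; exact: (diffn_continuous (k := 1) (diffn_bump 1)).
  move=> c cI Hc; exists (bump c) => //.
  by apply: bump_gt0; move: cI; rewrite in_itv/= => /andP[h1 h2]; [apply: lt_le_trans h1|apply: le_lt_trans h2 _]; lra.
have [K K0 HK] := @kern_bounded R n 1 ltr01.
exists (K / (b / 4) ^+ n); first by rewrite divr_gt0// exprn_gt0// divr_gt0.
move=> s y s0.
have kK : kern s y <= K.
  have -> : kern s y = kern 1 (s^-1 *: y).
    by apply: eq_bigr => m _; rewrite mxE divr1 mulrC.
  exact: le_trans (ler_norm _) (HK _).
have s42 : s / 4 <= s / 2 by lra.
have bx m : (const_mx (s / 4) : 'rV[R]_n) 0 m <= (const_mx (s / 2) : 'rV[R]_n) 0 m by rewrite !mxE.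
have lk : (b * s / 4) ^+ n <= lint (@kern R n s).
  pose B := cbox (const_mx (s / 4) : 'rV[R]_n) (const_mx (s / 2)).
  have iB : lintble (\1_B) by apply: lintble_indic (measurable_cbox _ _) _; rewrite leb_outer_cbox// ltry.
  have -> : (b * s / 4) ^+ n = b ^+ n * lint (\1_B).
    rewrite lint_indic; last exact: measurable_cbox.
    rewrite leb_outer_cbox//= (eq_bigr (fun=> s / 4)) ?prodr_const ?card_ord; last by move=> m _; rewrite !mxE; field.
    by rewrite -exprMn mulrA.
  rewrite -(lintZ _ iB); apply: (le_lint (lintbleZ _ iB) (lintble_kern s0)) => z.
  have [zB|zB] := pselect (B z); last first.
    by rewrite indicE memNset// mulr0 kern_ge0.
  rewrite indicE mem_set// mulr1 -[X in b ^+ X](card_ord n) -prodr_const; apply: ler_prod => m _.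
  have := zB m; rewrite !mxE => /andP[h1 h2]; rewrite (ltW b0) Hb// ler_pdivlMr// ler_pdivrMr// ![_ * s]mulrC.
  by rewrite h1 h2.
have k0 := @lint_kern_gt0 R n s s0.
have bs0 : 0 < (b * s / 4) ^+ n by rewrite exprn_gt0// divr_gt0// mulr_gt0.
have b40 : 0 < (b / 4) ^+ n by rewrite exprn_gt0// divr_gt0.
rewrite /ker mulrAC ler_pdivrMr// mulrAC ler_pdivlMr// -mulrA -exprMn.
have -> : s * (b / 4) = b * s / 4 by field.
by apply: ler_pM => //; [exact: kern_ge0|exact: ltW].
Qed.

Lemma compact_unif h K e : compact K -> {within K, continuous h} -> 0 < e ->
  exists2 r, 0 < r & forall x y, K x -> K y -> `|x - y| < r -> `|h x - h y| < e.
Proof.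
move=> cK ch e0; have e20 : 0 < e / 2 by rewrite divr_gt0.
have /choice[r Hr] x : exists r, 0 < r /\ (K x -> forall y, K y -> `|x - y| < r + r -> `|h x - h y| < e / 2).
  have [Kx|Kx] := pselect (K x); last by exists 1.
  have [r r0 H] : exists2 r, 0 < r & forall y, K y -> `|x - y| < r -> `|h x - h y| < e / 2.
    have : \forall y \near within K (nbhs x), `|h x - h y| < e / 2.
      by have := (subspace_continuousP K h).1 ch x Kx; move/cvgrPdist_lt => /(_ _ e20).
    rewrite near_withinE => /near_ball_ex[r r0 H]; exists r => // y Ky xy.
    exact: H.
  exists (r / 2); split; first by rewrite divr_gt0.
  by move=> _ y Ky; rewrite -splitr; exact: H.
move: (cK); rewrite compact_cover => /(_ _ K (fun z => ball z (r z))).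
case=> [z _|z Kz|D DK KD]; first exact: ball_open.
  by exists z => //; apply: ballxx; exact: (Hr z).1.
have [rm2 rm20 Hrm] : exists2 r0, 0 < r0 & forall z, z \in finmap.enum_fset D -> forall t, 0 < t -> t < r0 -> t <= r z.
  by apply: seq_small => z _; exists (r z); [exact: (Hr z).1|move=> t _ /ltW].
have [rm rmE] : exists rm, rm = rm2 / 2 by exists (rm2 / 2).
have rm0 : 0 < rm by rewrite rmE divr_gt0.
have rm1 : rm < rm2 by rewrite rmE; lra.
exists rm => // x y Kx Ky xy.
have [z zD] := KD _ Kx; rewrite -ball_normE /ball_/= => zx.
have Kz : K z by have := DK z zD; rewrite inE.
have rmz : rm <= r z by exact: Hrm z zD _ rm0 rm1.
have h1 := (Hr z).2 Kz x Kx (lt_trans zx _).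
have h2 : `|h z - h y| < e / 2.
  apply: (Hr z).2 => //; rewrite -(subrKA x) ; apply: le_lt_trans (ler_normD _ _) _.
  by rewrite ltrD// (lt_le_trans xy).
rewrite -(subrKA (h z)); apply: le_lt_trans (ler_normD _ _) _; rewrite [e]splitr distrC ltrD//.
by apply: h1; rewrite ltrDl; exact: (Hr z).1.
Qed.


Lemma open_eball x r : open (eball x r).
Proof.
rewrite (_ : eball x r = (fun y => enorm (y - x)) @^-1` [set t | t < r]); last by [].
apply: open_comp; last exact: open_lt.
move=> y _; apply: (continuous_comp (f := fun y => y - x)); last exact: continuous_enorm.
by apply: continuousB; [exact: cvg_id|exact: cst_continuous].
Qed.

Lemma cbox_eball x r : 0 < r -> cbox (x - const_mx (r / n.+1%:R)) (x + const_mx (r / n.+1%:R)) `<=` eball x r.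
Proof.
move=> r0 y yB; rewrite /eball/=; apply: le_lt_trans (enorm_le_norm _) _.
have r1 : 0 <= r / n.+1%:R by rewrite divr_ge0// ltW.
have h : `|y - x| <= r / n.+1%:R.
  apply: norm_row_le => // i; have := yB i; rewrite !mxE ler_norml => /andP[h1 h2].
  by move: (r / _) h1 h2 => a h1 h2; apply/andP; split; lra.
apply: le_lt_trans (ler_wpM2l (ler0n _ _) h) _.
by rewrite mulrCA gtr_pMr// ltr_pdivrMr ?ltr0Sn// mul1r ltr_nat.
Qed.

Lemma eball_cbox x r : eball x r `<=` cbox (x - const_mx r) (x + const_mx r).
Proof.
move=> y yB i; have := le_lt_trans (coord_le_enorm (y - x) i) yB.
by rewrite !mxE ltr_norml => /andP[h1 h2]; apply/andP; split; lra.
Qed.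

Lemma vol_cube x r : 0 <= r -> lintble (\1_(cbox (x - const_mx r) (x + const_mx r))) /\
  lint (\1_(cbox (x - const_mx r) (x + const_mx r))) = (2 * r) ^+ n.
Proof.
move=> r0; have E : leb_outer (cbox (x - const_mx r) (x + const_mx r)) = ((2 * r) ^+ n)%:E.
  rewrite leb_outer_cbox => [|i]; last by rewrite !mxE; lra.
  by rewrite (eq_bigr (fun=> 2 * r)) ?prodr_const ?card_ord// => i _; rewrite !mxE; ring.
split; first by apply: lintble_indic (measurable_cbox _ _) _; rewrite E ltry.
by rewrite lint_indic ?E//; exact: measurable_cbox.
Qed.

Lemma lintble_eball x r : 0 <= r -> lintble (\1_(eball x r)).
Proof.
move=> r0; apply: (le_lintble _ _ (vol_cube x r0).1).
  exact: lmeas_indic (open_lmeasurable (@open_eball x r)).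
move=> y; rewrite !indicE ger0_norm// ler_nat.
case: (boolP (y \in eball x r)) => // /set_mem yB; rewrite mem_set//; exact: eball_cbox.
Qed.

Lemma vol_eball_ge x r : 0 < r -> (2 * (r / n.+1%:R)) ^+ n <= lint (\1_(eball x r)).
Proof.
move=> r0; have r1 : 0 <= r / n.+1%:R by rewrite divr_ge0// ltW.
have [i1 <-] := vol_cube x r1; apply: (le_lint i1 (lintble_eball x (ltW r0))) => y.
rewrite !indicE ler_nat; case: (boolP (y \in cbox _ _)) => // /set_mem yB; rewrite mem_set//.
exact: cbox_eball.
Qed.

Lemma vol_eball_gt0 x r : 0 < r -> 0 < lint (\1_(eball x r)).
Proof. by move=> r0; apply: lt_le_trans (vol_eball_ge x r0); rewrite exprn_gt0// mulr_gt0// divr_gt0. Qed.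

Lemma vol_eball_le x r : 0 <= r -> lint (\1_(eball x r)) <= (2 * r) ^+ n.
Proof.
move=> r0; have [i1 <-] := vol_cube x r0; apply: (le_lint (lintble_eball x r0) i1) => y.
rewrite !indicE ler_nat; case: (boolP (y \in eball _ _)) => // /set_mem yB; rewrite mem_set//.
exact: eball_cbox.
Qed.

(** Off the boundary the indicator of [O] is locally constant. *)
Lemma convex_sub O B x : open O -> convex_set B -> (forall z, B z -> ~ bnd O z) -> B x -> O x -> B `<=` O.
Proof.
move=> oO cvB nb xB Ox y yB; have /(_ (\1_O)) H := @locally_cst_segment R n B _ cvB.
have /eqP : \1_O x = \1_O y :> R.
  apply: H xB yB => z zB; have [Oz|nOz] := pselect (O z).
    have [d d0 Hd] : exists2 d, 0 < d & forall z', `|z - z'| < d -> O z'.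
      by apply: near_ball_ex; exact: open_nbhs_nbhs.
    by exists d => // z' _ zw; rewrite !indicE !mem_set//; exact: Hd.
  have [d d0 Hd] : exists2 d, 0 < d & forall z', `|z - z'| < d -> (~` closure O) z'.
    apply: near_ball_ex; apply: open_nbhs_nbhs; split; first exact/closed_openC/closed_closure.
    by move=> cz; have [//|] := closure_bnd oO cz; exact: nb.
  by exists d => // z' _ zw; rewrite !indicE !memNset// => /subset_closure; exact: Hd.
rewrite !indicE (mem_set Ox); case: (boolP (y \in O)) => [/set_mem//|_].
by rewrite oner_eq0.
Qed.

Lemma inner_sub O x r : open O -> bnd O !=set0 -> O x -> r <= dst (bnd O) x -> eball x r `<=` O.
Proof.
move=> oO bO Ox rd y yB.
have cvB : convex_set (eball x r).
  move=> a b aB bB t /andP[t0 t1]; rewrite /eball/=.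
  have -> : a + t *: (b - a) - x = (1 - t) *: (a - x) + t *: (b - x).
    by apply/rowP => m; rewrite !mxE; ring.
  apply: le_lt_trans (enormD _ _) _; rewrite !enormZ !ger0_norm ?subr_ge0//.
  have := aB; have := bB; rewrite /eball/= => h1 h2.
  exact: (conv_lt t0 t1 h2 h1).
have xB : eball x r x.
  by rewrite /eball/= subrr enorm0; apply: le_lt_trans yB; exact: enorm_ge0.
apply: (convex_sub oO cvB _ xB Ox yB) => z zB Hz.
by have := lt_le_trans zB rd; apply/negP; rewrite -leNgt enormB; exact: dst_le.
Qed.

Lemma bnd_neq0 O x : (0 < n)%N -> open O -> bounded_set O -> O x -> bnd O !=set0.
Proof.
move=> n0 oO bO Ox; apply: contrapT => /set0P/negP/negPn/eqP nb.
have [C C0 HC] := cbox_bounded bO.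
have : O (const_mx (C + 1)).
  by apply: (@convex_sub O setT x oO) => // z _; rewrite nb.
by move/HC => /(_ (Ordinal n0)); rewrite !mxE => /andP[_]; lra.
Qed.

Lemma lintble_sub O B u : measurable (B : set M) -> B `<=` O -> lintble (fun y => \1_O y * u y) ->
  lintble (fun y => \1_B y * u y).
Proof.
move=> mB BO iu; apply: (le_lintble _ _ (lintble_norm iu)).
  apply: (ae_lmeas null0 _ (lmeasM (lmeas_indic mB) (lintble_meas iu))) => y _; rewrite mulrA; congr (_ * _).
  rewrite !indicE; case: (boolP (y \in B)) => [/set_mem /BO yB|_]; last by rewrite mul0r.
  by rewrite mem_set ?mulr1.
move=> y; rewrite !indicE; case: (boolP (y \in B)) => [/set_mem /BO yB|_]; last by rewrite mul0r normr0.
by rewrite mem_set.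
Qed.

Lemma inner_lintble O x r u : open O -> bnd O !=set0 -> O x -> r < dst (bnd O) x -> loc_integrable O u ->
  lintble (fun y => \1_(eball x r) y * u y).
Proof.
move=> oO bO Ox rd lu; pose K := [set y | enorm (y - x) <= r].
have clK : closed K.
  rewrite (_ : K = (fun y => enorm (y - x)) @^-1` [set t | t <= r]); last by [].
  apply: closed_comp; last exact: closed_le.
  move=> y _; apply: (continuous_comp (f := fun y => y - x)); last exact: continuous_enorm.
  by apply: continuousB; [exact: cvg_id|exact: cst_continuous].
have KB : K `<=` cbox (x - const_mx r) (x + const_mx r).
  move=> y yB i; have := le_trans (coord_le_enorm (y - x) i) yB.
  by rewrite !mxE ler_norml => /andP[h1 h2]; apply/andP; split; lra.
have cK : compact K by exact: subclosed_compact clK (@compact_cbox R n _ _) KB.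
have KO : K `<=` O by move=> y Ky; apply: (inner_sub oO bO Ox (lexx _)); exact: le_lt_trans Ky rd.
have iK := loc_lintble lu cK KO.
apply: (lintble_sub _ _ iK) => [|y /ltW//].
exact: open_lmeasurable (@open_eball x r).
Qed.

Lemma mean_lint B f m : measurable (B : set M) ->
  mean (leb R n) B f 0 m = (lint (\1_B))^-1 * lint (fun y => \1_B y * f y 0 m).
Proof. by move=> mB; rewrite mxE Rintegral_lint lint_indic. Qed.

Lemma enorm_scale (b : bool) x : b%:R * enorm x = enorm (b%:R *: x) :> R.
Proof. by rewrite enormZ ger0_norm// ler0n. Qed.

Lemma lintble_enorm f : (forall m, lintble (fun y => f y 0 m)) -> lintble (fun y => enorm (f y)).
Proof.
move=> iF; apply: (le_lintble (g := fun y => \sum_m `|f y 0 m|)).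
- by apply: lmeas_comp_row => [|m]; [exact: continuous_enorm|exact: lintble_meas (iF m)].
- move=> y; rewrite ger0_norm ?enorm_ge0// -(@ler_pXn2r _ 2)// ?nnegrE ?enorm_ge0 ?sumr_ge0//.
  rewrite sqr_enorm expr2 mulr_suml; apply: ler_sum => m _; rewrite -real_normK ?num_real// expr2.
  by rewrite ler_wpM2l// (bigD1 m)//= lerDl sumr_ge0.
by apply: lintble_sum => m; exact: lintble_norm.
Qed.

Lemma lintble_dist B f q : measurable (B : set M) -> lintble (\1_B) -> (forall m, lintble (fun y => \1_B y * f y 0 m)) ->
  lintble (fun y => \1_B y * enorm (f y - q)).
Proof.
move=> mB iB iF.
rewrite (_ : (fun y => _) = fun y => enorm (\1_B y *: (f y - q))); last first.
  by apply/funext => y; rewrite !indicE enorm_scale.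
apply: lintble_enorm => m.
rewrite (_ : (fun y => _) = fun y => \1_B y * f y 0 m - q 0 m * \1_B y); last first.
  by apply/funext => y; rewrite !mxE; ring.
exact: lintbleB (iF m) (lintbleZ _ iB).
Qed.

Lemma bmo_inner O f x r e : open O -> bnd O !=set0 -> O x -> 0 < r -> r < dst (bnd O) x ->
  (forall m, lintble (fun y => \1_(eball x r) y * f y 0 m)) -> (bmo_norm O f < e%:E)%E ->
  lint (fun y => \1_(eball x r) y * enorm (f y - mean (leb R n) (eball x r) f)) <= e * lint (\1_(eball x r)).
Proof.
move=> oO bO Ox r0 rd iF He; set B := eball x r; set q := mean _ _ _.
have mB : measurable (B : set M) by apply: open_lmeasurable; exact: open_eball.
have iB := lintble_eball x (ltW r0).
have v0 := vol_eball_gt0 x r0.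
have id_ := lintble_dist q mB iB iF.
have : (mean_dist (leb R n) B f q <= e%:E)%E.
  apply: le_trans (ltW He); apply: ereal_sup_ubound; exists B => //.
  by exists x, r; split => //; rewrite set_distE// lte_fin.
rewrite /mean_dist (_ : (\int[leb R n]_(y in B) _)%E = (lint (fun y => \1_B y * enorm (f y - q)))%:E); last first.
  rewrite (lintE id_) integral_mkcond; apply: eq_integral => y _; rewrite /patch indicE.
  by case: ifP => _; rewrite ?mul1r// mul0r.
rewrite -EFinM lee_fin (_ : fine (leb R n B) = lint (\1_B)); last by rewrite lint_indic.
by rewrite mulrC ler_pdivrMr.
Qed.

End oscillation_estimates.

(** * Mollifications compared with means over balls *)

Section mollified_means.
Context {R : realType} {n : nat}.
Implicit Types (x y z q : 'rV[R]_n) (A B O K : set 'rV[R]_n) (s t r C c d e : R) (u v : 'rV[R]_n -> R).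
Implicit Types (f h w : 'rV[R]_n -> 'rV[R]_n) (i j m : 'I_n).
Local Notation M := (caratheodory_type (lebesgue_outer R n)).

Lemma lmeas_open_continuous B u : open B -> (forall x, B x -> {for x, continuous u}) ->
  lmeas (fun y => \1_B y * u y).
Proof.
move=> oB cu; apply: (measurability (@RGenOpens.G R)); first exact: RGenOpens.measurableE.
move=> _ [_ [a [b ->]] <-]; rewrite setTI.
have oV : open [set x | B x /\ `]a, b[%classic (u x)].
  rewrite openE => x [Bx Vx]; rewrite /interior/=.
  have h1 : nbhs x (u @^-1` `]a, b[%classic) by apply: (cu x Bx); apply: open_nbhs_nbhs; split => //; exact: interval_open.
  have h2 : nbhs x B by exact: (open_nbhs_nbhs (conj oB Bx)).
  by apply: filterS2 h1 h2 => y.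
have mB := open_lmeasurable oB.
have [V0|V0] := pselect (`]a, b[%classic (0 : R)).
  rewrite (_ : _ @^-1` _ = [set x | B x /\ `]a, b[%classic (u x)] `|` ~` B).
    by apply: measurableU; [exact: open_lmeasurable oV|exact: measurableC].
  apply/seteqP; split => x; rewrite /preimage/= indicE.
    by case: (boolP (x \in B)) => [/set_mem xB|/negP xB _]; [rewrite mul1r; left|right => xB'; apply: xB; exact: mem_set].
  case=> [[Bx ux]|Bx]; first by rewrite mem_set// mul1r.
  by rewrite memNset// mul0r.
rewrite (_ : _ @^-1` _ = [set x | B x /\ `]a, b[%classic (u x)]); first exact: open_lmeasurable oV.
apply/seteqP; split => x; rewrite /preimage/= indicE.
  by case: (boolP (x \in B)) => [/set_mem xB|/negP xB]; [rewrite mul1r|rewrite mul0r => /V0].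
by case=> Bx ux; rewrite mem_set// mul1r.
Qed.

Lemma meanD B f h : measurable (B : set M) -> (forall m, lintble (fun y => \1_B y * f y 0 m)) ->
  (forall m, lintble (fun y => \1_B y * h y 0 m)) ->
  mean (leb R n) B (fun y => f y - h y) = mean (leb R n) B f - mean (leb R n) B h.
Proof.
move=> mB iF ih; apply/rowP => m; rewrite [RHS]mxE [X in _ = _ + X]mxE !mean_lint// -mulrBr; congr (_ * _).
rewrite -(lintB (iF m) (ih m)); congr lint; apply/funext => y; by rewrite !mxE mulrBr.
Qed.

(** [f] is close in the BMO seminorm to some [h] continuous on the compact closure; uniform
    continuity makes the oscillation of [h] small on small balls. *)
Lemma vmo_osc O f e : open O -> bounded_set O -> bnd O !=set0 -> VMO O f -> 0 < e ->
  exists2 r0, 0 < r0 & forall x r, O x -> 0 < r -> r < r0 -> r < dst (bnd O) x ->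
  lint (fun y => \1_(eball x r) y * enorm (f y - mean (leb R n) (eball x r) f)) <= e * lint (\1_(eball x r)).
Proof.
(* One [a] pays for the seminorm of f - h, and 2 n a for h minus its mean, n being the cost of
   passing from the sup norm to the Euclidean norm. *)
move=> oO bO nO [[lf _] vf] e0; pose a : R := e / (2 * n%:R + 1).
have n0 : 0 < 2 * n%:R + 1 :> R by rewrite ltr_wpDl// mulr_ge0.
have a0 : 0 < a by rewrite divr_gt0.
have [h ch Hh] := vf a a0.
have cK : compact (closure O) by exact: compact_closure.
have [r0 r00 Hr] := compact_unif cK ch a0.
exists r0 => // x r Ox rp rr0 rd.
set B := eball x r; have mB : measurable (B : set M) by apply: open_lmeasurable; exact: open_eball.
have oB : open B by exact: open_eball.
have iB := lintble_eball x (ltW rp); have v0 := vol_eball_gt0 x rp.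
have BO : B `<=` O by exact: inner_sub oO nO Ox (ltW rd).
have hB y : B y -> `|h y - h x| < a.
  move=> By; apply: Hr; [by apply: subset_closure; exact: BO|exact: subset_closure|].
  by apply: le_lt_trans (norm_le_enorm _) (lt_trans By rr0).
have hc y : B y -> {for y, continuous h}.
  move=> By; have := (subspace_continuousP (closure O) h).1 ch y (subset_closure (BO _ By)).
  move=> H U /H H2.
  have h2 : nbhs y B by exact: (open_nbhs_nbhs (conj oB By)).
  have H3 : nbhs y [set z | closure O z -> U (h z)] by exact: H2.
  have : nbhs y (h @^-1` U) by apply: filterS2 H3 h2 => z Hz /BO /subset_closure; exact: Hz.
  by [].
have ih m : lintble (fun y => \1_B y * h y 0 m).
  apply: (le_lintble (g := fun y => (`|h x 0 m| + a) * \1_B y)); last exact: lintbleZ _ iB.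
    apply: lmeas_open_continuous => // y By.
    by apply: (@continuous_comp _ _ _ h (fun z : 'rV[R]_n => z 0 m)); [exact: hc|exact: coord_continuous].
  move=> y; rewrite indicE; case: (boolP (y \in B)) => [/set_mem yB|_]; last by rewrite mul0r mulr0 normr0.
  rewrite mul1r mulr1; have := le_lt_trans (coord_le_norm (h y - h x) m) (hB y yB); rewrite !mxE.
  move: (h y 0 m) (h x 0 m) => p q H.
  by rewrite -(subrK q p) addrC; apply: le_trans (ler_normD _ _) _; rewrite lerD2l ltW.
have if_ m : lintble (fun y => \1_B y * f y 0 m) by exact: inner_lintble oO nO Ox rd (lf m).
have iu m : lintble (fun y => \1_B y * (f y - h y) 0 m).
  rewrite (_ : (fun y => _) = fun y => \1_B y * f y 0 m - \1_B y * h y 0 m); first exact: lintbleB.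
  by apply/funext => y; rewrite !mxE mulrBr.
have Hu := bmo_inner oO nO Ox rp rd iu Hh.
set p := mean _ _ _; pose q := mean (leb R n) B h.
have hx m : `|h x 0 m - q 0 m| <= a.
  rewrite /q mean_lint// -/B.
  have -> : h x 0 m = (lint (\1_B))^-1 * lint (fun y => h x 0 m * \1_B y).
    by rewrite (lintZ (h x 0 m) iB) mulrCA mulVf ?gt_eqF// mulr1.
  rewrite -mulrBr normrM ger0_norm ?invr_ge0 ?(ltW v0)// mulrC ler_pdivrMr//.
  rewrite -(lintB (lintbleZ _ iB) (ih m)) -(lintZ a iB).
  apply: norm_lint_le; [exact: lintble_meas (lintbleB (lintbleZ _ iB) (ih m))| |exact: lintbleZ _ iB].
  move=> y; rewrite indicE; case: (boolP (y \in B)) => [/set_mem yB|_]; last by rewrite mul0r !mulr0 subrr normr0.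
  rewrite mul1r !mulr1 distrC; have := le_lt_trans (coord_le_norm (h y - h x) m) (hB y yB); rewrite !mxE.
  exact: ltW.
have -> : p = mean (leb R n) B (fun y => f y - h y) + q by rewrite (meanD mB if_ ih) subrK.
set p' := mean _ _ _.
have hq y : B y -> enorm (h y - q) <= 2 * n%:R * a.
  move=> By; apply: le_trans (enorm_le_norm _) _; rewrite (_ : 2 * n%:R * a = n%:R * (2 * a)); last by ring.
  rewrite ler_wpM2l//.
  apply: norm_row_le; first by rewrite mulr_ge0// ltW.
  move=> m; have := ltW (le_lt_trans (coord_le_norm (h y - h x) m) (hB y By)); rewrite [(h y - h x) 0 m]mxE [(- h x) 0 m]mxE => h1.
  rewrite [(h y - q) 0 m]mxE [(- q) 0 m]mxE.
  by rewrite -(subrKA (h x 0 m)) [2]/(1 + 1) mulrDl mul1r; apply: le_trans (ler_normD _ _) (lerD h1 (hx m)).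
have iu' := lintble_dist p' mB iB iu.
have idf := lintble_dist (p' + q) mB iB if_.
have -> : e * lint (\1_B) = a * lint (\1_B) + 2 * n%:R * a * lint (\1_B).
  by rewrite -mulrDl; congr (_ * _); rewrite /a; field; rewrite gt_eqF.
apply: (@le_trans _ _ (lint (fun y => \1_B y * enorm (f y - h y - p') + 2 * n%:R * a * \1_B y))); last first.
  by rewrite (lintD iu' (lintbleZ _ iB)) (lintZ (2 * n%:R * a) iB) lerD2r.
apply: (le_lint idf (lintbleD iu' (lintbleZ _ iB))) => y.
rewrite indicE; case: (boolP (y \in B)) => [/set_mem yB|_]; last by rewrite !mul0r !mulr0 addr0.
rewrite !mul1r mulr1.
have -> : f y - (p' + q) = (f y - h y - p') + (h y - q) by apply/rowP => m; rewrite !mxE; ring.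
by apply: le_trans (enormD _ _) _; rewrite lerD2l; exact: hq.
Qed.

(* The oscillation is controlled on balls of radius less than the distance to
   the boundary; means over balls of that radius are limits of such means. *)
Definition inner_radius e (k : nat) : R := e * (1 - k.+3%:R^-1).

(** Starting the sequence at 1/3 keeps every radius above e / 2, so the smaller balls still contain
    the support of the kernel. *)
Lemma inner_radiusP e k : 0 < e -> e / 2 < inner_radius e k < e.
Proof.
move=> e0; rewrite /inner_radius.
have h1 : k.+3%:R^-1 < 2^-1 :> R by rewrite ltf_pV2 ?posrE ?ltr0Sn// ltr_nat.
have h2 : 0 < k.+3%:R^-1 :> R by rewrite invr_gt0 ltr0Sn.
by rewrite ltr_pM2l// gtr_pMr//; move: (_^-1) h1 h2 => a h1 h2; apply/andP; split; lra.
Qed.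

Lemma inner_radius_lint e x u : 0 < e -> lintble (fun y => \1_(eball x e) y * u y) ->
  lint (fun y => \1_(eball x (inner_radius e k)) y * u y) @[k --> \oo] --> lint (fun y => \1_(eball x e) y * u y).
Proof.
move=> e0 iu.
have sub k y : eball x (inner_radius e k) y -> eball x e y.
  by move=> h; apply: lt_trans h _; have /andP[] := inner_radiusP k e0.
have [] // := @dominated_lint R n set0 (fun k y => \1_(eball x (inner_radius e k)) y * u y)
  (fun y => \1_(eball x e) y * u y) (fun y => `|\1_(eball x e) y * u y|) null0.
- move=> k; exact: (lintble_meas (lintble_sub (open_lmeasurable (@open_eball R n x _)) (sub k) iu)).
- exact: lintble_norm.
- move=> k y _; rewrite !normrM ler_wpM2r// !indicE !ger0_norm// ler_nat.
  by case: (boolP (y \in eball x (inner_radius e k))) => // /set_mem /sub yB; rewrite mem_set.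
move=> y _; have [yB|yB] := pselect (eball x e y); last first.
  rewrite (_ : (fun k => _) = fun=> \1_(eball x e) y * u y); first exact: cvg_cst.
  apply/funext => k; rewrite !indicE [in RHS]memNset// memNset//; exact: contra_not (@sub k y) yB.
have [p Hp] : exists p, forall k, (p <= k)%N -> eball x (inner_radius e k) y.
  pose d := 1 - enorm (y - x) / e; have d0 : 0 < d by rewrite subr_gt0 ltr_pdivrMr// mul1r.
  have [p _ Hp] := near_infty_natSinv_lt (PosNum d0).
  exists p => k pk; rewrite /eball/= /inner_radius mulrC -ltr_pdivrMr//.
  have h : k.+3%:R^-1 < d.
    apply: le_lt_trans (Hp k pk); rewrite lef_pV2 ?posrE ?ltr0Sn// ler_nat; exact: leqW.
  by rewrite ltrBrDl -ltrBrDr.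
apply: cvg_near_cst; exists p => // k /= pk.
by rewrite !indicE !mem_set//; exact: Hp.
Qed.

Lemma inner_radius_mean e x f m : 0 < e -> lintble (fun y => \1_(eball x e) y * f y 0 m) ->
  mean (leb R n) (eball x (inner_radius e k)) f 0 m @[k --> \oo] --> mean (leb R n) (eball x e) f 0 m.
Proof.
move=> e0 iF; have mB r : measurable (eball x r : set M) by apply: open_lmeasurable; exact: open_eball.
rewrite mean_lint//; under eq_fun do rewrite mean_lint//.
apply: cvgM; last exact: inner_radius_lint.
apply: cvgV; first by rewrite gt_eqF// vol_eball_gt0.
have iB : lintble (fun y => \1_(eball x e) y * (fun=> 1 : R) y).
  by under eq_fun do rewrite mulr1; exact: lintble_eball (ltW e0).
have E r : \1_(eball x r) = (fun y => \1_(eball x r) y * (fun=> 1 : R) y) by apply/funext => y; rewrite mulr1.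
by under eq_fun do rewrite E; rewrite E; exact: inner_radius_lint.
Qed.

(** At scale s = r / (2 (n + 1)) the kernel at x lives within Euclidean distance n s < r / 2, inside
    every ball B_t(x) with r / 2 < t < r, and is at most C s^(-n). So the mollification differs from
    the mean over B_t(x) by a multiple of the mean oscillation; then t tends to r. *)
Lemma mollify_mean O f e : open O -> bounded_set O -> bnd O !=set0 -> VMO O f ->
  (forall m, lintble (fun y => \1_O y * f y 0 m)) -> 0 < e ->
  exists2 r0, 0 < r0 & forall x r m, O x -> 0 < r -> r < r0 -> r <= dst (bnd O) x ->
  `|conv (ker (r / (2 * n.+1%:R))) (fun y => \1_O y * f y 0 m) x - mean (leb R n) (eball x r) f 0 m| <= e.
Proof.
move=> oO bO nO vf iF e0; have [C C0 HC] := @ker_sup R n.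
(* The value of C s^(-n) (2 r)^n at r = 2 (n + 1) s. *)
pose a := C * (4 * n.+1%:R) ^+ n; have a0 : 0 < a by rewrite mulr_gt0// exprn_gt0// mulr_gt0.
have [r0 r00 Hr] := vmo_osc oO bO nO vf (divr_gt0 e0 a0).
exists r0 => // x r m Ox rp rr0 rd.
set s := r / _; have s0 : 0 < s by rewrite divr_gt0// mulr_gt0.
set c := conv _ _ _.
have step k : `|c - mean (leb R n) (eball x (inner_radius r k)) f 0 m| <= e.
  have /andP[k1 k2] := inner_radiusP k rp; move: (inner_radius r k) k1 k2 => t t1 t2.
  have t0 : 0 < t by apply: lt_trans t1; rewrite divr_gt0.
  have td := lt_le_trans t2 rd.
  have HH := Hr x t Ox t0 (lt_trans t2 rr0) td.
  set B := eball x t in HH *; set p := mean _ _ _ in HH *.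
  have BO : B `<=` O by exact: inner_sub oO nO Ox (ltW td).
  have mB : measurable (B : set M) by apply: open_lmeasurable; exact: open_eball.
  have iB := lintble_eball x (ltW t0).
  have ifB m' : lintble (fun y => \1_B y * f y 0 m') by exact: inner_lintble oO nO Ox td (vf.1.1 m').
  have [k1 k2 _ _] := lint_ker_shift x s0.
  have ic := conv_ker_lintble x s0 (iF m).
  have -> : c - p 0 m = lint (fun y => (\1_O y * f y 0 m) * ker s (x - y) - p 0 m * ker s (x - y)).
    by rewrite (lintB ic (lintbleZ _ k1)) (lintZ (p 0 m) k1) k2 mulr1.
  have id_ := lintble_dist p mB iB ifB.
  have sn0 : 0 < s ^+ n by rewrite exprn_gt0.
  apply: (@le_trans _ _ (lint (fun y => C / s ^+ n * (\1_B y * enorm (f y - p))))).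
    apply: norm_lint_le; [exact: lintble_meas (lintbleB ic (lintbleZ _ k1))| |exact: lintbleZ _ id_].
    move=> y; rewrite -mulrBl normrM.
    have kC : `|ker s (x - y)| <= C / s ^+ n by rewrite ger0_norm ?ker_ge0// ler_pdivlMr// HC.
    have [h|h] := leP `|x - y| s; last first.
      rewrite ker_out// normr0 mulr0 mulr_ge0 ?divr_ge0 ?(ltW C0) ?(ltW sn0)//.
      by rewrite mulr_ge0// ?enorm_ge0 ?indicE.
    have yB : B y.
      rewrite /B /eball/= enormB; apply: le_lt_trans (enorm_le_norm _) _.
      apply: le_lt_trans (ler_wpM2l (ler0n _ _) h) _; apply: le_lt_trans t1.
      have -> : n%:R * s = n%:R / n.+1%:R * (r / 2) by rewrite /s; field; rewrite nat1r pnatr_eq0.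
      by rewrite ler_piMl ?divr_ge0 ?(ltW rp)// ler_pdivrMr ?ltr0Sn// mul1r ler_nat.
    rewrite !indicE !mem_set//; last exact: BO.
    rewrite !mul1r mulrC; apply: ler_pM => //; apply: le_trans (coord_le_enorm _ m).
    by rewrite !mxE.
  rewrite (lintZ (C / s ^+ n) id_).
  apply: le_trans (ler_wpM2l (divr_ge0 (ltW C0) (ltW sn0)) HH) _.
  apply: le_trans (_ : C / s ^+ n * (e / a * (2 * r) ^+ n) <= _).
    rewrite ler_wpM2l ?(divr_ge0 (ltW C0) (ltW sn0))// ler_wpM2l ?(ltW (divr_gt0 e0 a0))//.
    apply: le_trans (vol_eball_le _ (ltW t0)) _; apply: lerXn2r; rewrite ?nnegrE ?mulr_ge0 ?(ltW t0) ?(ltW rp)//.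
    by rewrite ler_pM2l// ltW.
  have -> : (2 * r) ^+ n = (4 * n.+1%:R) ^+ n * s ^+ n.
    by rewrite -exprMn; congr (_ ^+ _); rewrite /s; field; rewrite nat1r pnatr_eq0.
  rewrite le_eqVlt; apply/orP; left; apply/eqP; rewrite /a.
  have q0 : (4 * n.+1%:R) ^+ n != 0 :> R by rewrite gt_eqF// exprn_gt0// mulr_gt0.
  move: (s ^+ n) sn0 ((4 * n.+1%:R) ^+ n) q0 => q1 h1 q2 h2; field.
  by rewrite h2 !gt_eqF.
have ie : lintble (fun y => \1_(eball x r) y * f y 0 m).
  apply: (lintble_sub _ _ (iF m)); last exact: inner_sub oO nO Ox rd.
  exact: open_lmeasurable (@open_eball R n x r).
have cv := inner_radius_mean rp ie.
have cv2 : `|c - mean (leb R n) (eball x (inner_radius r k)) f 0 m| @[k --> \oo] --> `|c - mean (leb R n) (eball x r) f 0 m|.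
  by apply: cvg_norm; apply: cvgB; [exact: cvg_cst|exact: cv].
rewrite -(cvg_lim (@Rhausdorff R) cv2); apply: limr_le; first by apply/cvg_ex; eexists; exact: cv2.
by near=> k; exact: step.
Unshelve. all: by end_near.
Qed.

End mollified_means.

(** * Means near the boundary stay away from the support of the density *)

Section boundary_values.
Context {R : realType} {n : nat}.
Implicit Types (x y z q : 'rV[R]_n) (A B O K G N : set 'rV[R]_n) (s t r C c d e : R) (u v : 'rV[R]_n -> R).
Implicit Types (f h w phi : 'rV[R]_n -> 'rV[R]_n) (i j m : 'I_n).
Local Notation M := (caratheodory_type (lebesgue_outer R n)).

Lemma le_lint_ae N u v : null N -> lintble u -> lintble v -> (forall x, ~ N x -> u x <= v x) -> lint u <= lint v.
Proof.
move=> N0 iu iv uv; pose v' x := if `[< N x >] then u x else v x.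
have E x : ~ N x -> v x = v' x by move=> nx; rewrite /v'; case: asboolP.
rewrite (ae_lint N0 E (lintble_meas iv)); apply: (le_lint iu (ae_lintble N0 E iv)) => x.
by rewrite /v'; case: asboolP => // /uv.
Qed.

(** Each point of [K] has a ball whose preimage is null for the surface measure; finitely many of
    half the radius cover [K], and the spare half gives the uniform gap [d] outside a null set. *)
Lemma essR_gap G phi K : compact K -> K `<=` ~` closure (essR G phi) ->
  exists2 d, 0 < d & exists N, [/\ N `<=` G, haus_outer n.-1 N = 0%E &
    forall y q, G y -> ~ N y -> K q -> d <= enorm (phi y - q)].
Proof.
move=> cK KE.
have /choice[r Hr] q : exists r, 0 < r /\ (K q -> haus_outer n.-1 (G `&` phi @^-1` (ball q (r + r))) = 0%E).
  have [Kq|] := pselect (K q); last by exists 1.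
  have : ~ essR G phi q by move/subset_closure; exact: KE.
  move=> /existsNP[S /not_implyP[oS /not_implyP[Sq H]]].
  have [r r0 Hr] : exists2 r, 0 < r & forall y, `|q - y| < r -> S y.
    by apply: near_ball_ex; exact: open_nbhs_nbhs.
  exists (r / 2); split; first by rewrite divr_gt0.
  move=> _; apply/eqP; rewrite eq_le haus_outer_ge0 andbT -splitr.
  apply: (@le_trans _ _ (haus_outer n.-1 (G `&` phi @^-1` S))); last by rewrite leNgt; apply/negP.
  apply: le_haus_outer => y [Gy]; rewrite /preimage/= -ball_normE /ball_/= => h; split => //; exact: Hr.
move: (cK); rewrite compact_cover => /(_ _ K (fun z => ball z (r z))).
case=> [z _|z Kz|D DK KD]; first exact: ball_open.
  by exists z => //; apply: ballxx; exact: (Hr z).1.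
have [d2 d20 Hd] : exists2 r0, 0 < r0 & forall z, z \in finmap.enum_fset D -> forall t, 0 < t -> t < r0 -> t <= r z.
  by apply: seq_small => z _; exists (r z); [exact: (Hr z).1|move=> t _ /ltW].
have [d dE] : exists d, d = d2 / 2 by exists (d2 / 2).
have d0 : 0 < d by rewrite dE divr_gt0.
have d1 : d < d2 by rewrite dE; lra.
exists d => //; exists [set y | G y /\ exists2 q, K q & enorm (phi y - q) < d].
split; [by move=> y []| |]; last first.
  by move=> y q Gy Ny Kq; rewrite leNgt; apply/negP => h; apply: Ny; split => //; exists q.
pose s := finmap.enum_fset D.
pose A k := if (k < size s)%N then G `&` phi @^-1` (ball (nth 0 s k) (r (nth 0 s k) + r (nth 0 s k))) else set0.
have A0 k : haus_outer n.-1 (A k) = 0%E.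
  rewrite /A; case: ifP => ks; last exact: haus_outer0.
  by apply: (Hr _).2; have := DK (nth 0 s k) (mem_nth 0 ks); rewrite inE.
apply/eqP; rewrite eq_le haus_outer_ge0 andbT.
apply: le_trans (_ : haus_outer n.-1 (\bigcup_k A k) <= _)%E.
  apply: le_haus_outer => y [Gy [q Kq yq]]; have [z zD] := KD _ Kq; rewrite -ball_normE /ball_/= => zq.
  exists (index z s) => //; rewrite /A index_mem ifT// nth_index//; split => //.
  rewrite /preimage/= -ball_normE /ball_/= -(subrKA q); apply: le_lt_trans (ler_normD _ _) _; rewrite ltrD//.
  rewrite distrC; apply: le_lt_trans (norm_le_enorm _) _; apply: lt_le_trans yq _; exact: Hd.
apply: le_trans (@haus_outer_sigma_subadditive R n n.-1 A) _.
by rewrite eseries0// => k _ _; exact: A0.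
Qed.

Lemma closed_enorm_le C : closed [set x : 'rV[R]_n | enorm x <= C].
Proof.
rewrite (_ : [set x | _] = @enorm R n @^-1` [set t | t <= C]); last by [].
by apply: closed_comp; [move=> y _; exact: continuous_enorm|exact: closed_le].
Qed.

Lemma compact_bnd O : bounded_set O -> compact (bnd O).
Proof.
move=> bO; apply: (subclosed_compact _ (compact_closure bO)); last by move=> x [].
by apply: closedI; [exact: closed_closure|exact/open_closedC/open_interior].
Qed.

Lemma bnd_thin O : open O -> forall x r, 0 < r -> exists2 z, ~ bnd O z & `|x - z| < r.
Proof.
move=> oO x r r0; have [Gx|Gx] := pselect (bnd O x); last by exists x => //; rewrite subrr normr0.
have [z []] := bnd_closure Gx (nbhsx_ballx x r r0) => Oz; rewrite -ball_normE /ball_/= => xz.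
by exists z => //; move/(bnd_open oO).
Qed.

(* On a ball of radius 4e centered on the boundary, the zero extension W of
   f - psi (phi o P) vanishes on a fixed portion, so its small oscillation makes
   it small in mean; and W = f - phi o P on B_e(x), where phi o P avoids K. *)
Lemma trace_far Omega T P psi phi f K : (2 <= n)%N -> open Omega -> bounded_set Omega -> connected Omega ->
  bnd Omega !=set0 -> smooth_hypersurface (bnd Omega) -> tubular_nbhs Omega T P -> trace_cutoff Omega T psi ->
  VMO_trace Omega P psi phi f -> (forall m, lintble (fun y => \1_Omega y * f y 0 m)) ->
  compact K -> K `<=` ~` closure (essR (bnd Omega) phi) ->
  exists2 c, 0 < c & exists2 e0, 0 < e0 & forall e x q, 0 < e -> e < e0 -> Omega x -> dst (bnd Omega) x = e ->
    K q -> c <= enorm (mean (leb R n) (eball x e) f - q).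
Proof.
move=> n2 oO bO cO nG smG [oT GT TP _ _] [_ _ [U [[oU UO [s s0 sU]] _ UT psi1]]] [vf [_ vw]] iF cK KE.
set G := bnd Omega in nG smG GT TP sU KE *.
have n0 : (0 < n)%N by exact: leq_trans n2.
have cG : compact G by exact: compact_bnd.
have clG : closed G by apply: compact_closed => //; exact: norm_hausdorff.
have /choice[hf Hhf] y : exists hU : ('rV[R]_n -> R) * set 'rV[R]_n, G y -> chart_at G y hU.1 hU.2.
  have [Gy|Gy] := pselect (G y); last by exists (fun=> 0, set0).
  by have [h [U' H]] := chart_function n2 smG Gy; exists (h, U').
have [d d0 [N [NG N0 Hd]]] := essR_gap cK KE.
have TPn x : T x -> G (P x) /\ forall z, G z -> enorm (x - P x) <= enorm (x - z).
  move=> Tx; have [Gx H] := TP x Tx; split => // z Gz; have [->//|zP] := eqVneq z (P x).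
  by apply: ltW; apply: H => //; exact/eqP.
have Z0 := null_projection n2 Hhf cG TPn NG N0.
have [k k0 [r0 r00 Hext]] := exterior_cube Hhf clG (bnd_thin oO) cG cO bO oO (fun y Oy Gy => bnd_open oO Gy Oy).
have [C C0 HC] := cbox_bounded bO.
have OC x : Omega x -> enorm x <= n%:R * C.
  move=> /HC xC; apply: le_trans (enorm_le_norm _) _; rewrite ler_wpM2l//.
  by apply: norm_row_le => [|i]; [exact: ltW|have := xC i; rewrite !mxE ler_norml].
have GC x : G x -> enorm x <= n%:R * C.
  move=> /bnd_closure cx; have cl := @closed_enorm_le (n%:R * C); apply: cl.
  exact: closure_subset cx.
pose R0 := n%:R * C + 2; pose Q := eball (0 : 'rV[R]_n) R0.
have R00 : 0 < R0 by rewrite ltr_wpDl// mulr_ge0// ltW.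
have QO : Omega `<=` Q by move=> x /OC h; rewrite /Q /eball/= subr0; apply: le_lt_trans h _; rewrite ltrDl.
have {vw} := vw _ _ QO; set W := patch _ _ _ => vw.
have oQ : open Q by exact: open_eball.
have bQ : bounded_set Q.
  have [C' [C'r HC']] := @bounded_cbox R n (0 - const_mx R0) (0 + const_mx R0).
  by exists C'; split => // c c0 x /eball_cbox Qx; exact: (HC' c).
have nQ : bnd Q !=set0.
  by apply: (@bnd_neq0 R n Q 0 n0 oQ bQ); rewrite /Q /eball/= subrr enorm0.
have GQ y : G y -> 2 <= dst (bnd Q) y.
  move=> /GC yC; apply: dst_ge => // a /(bnd_open oQ); rewrite /Q /eball/= subr0 => /negP; rewrite -leNgt => aR.
  have := ler_enorm_sub a y; rewrite enormB => h; have := le_trans (ler_norm _) h.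
  by move: aR yC; rewrite /R0; lra.
have k40 : 0 < k ^+ n by rewrite exprn_gt0.
(* The factor 1 + k^(-n) bounds [W] in mean by its oscillation; the other one compares the volumes
   of the ball of radius 4 e and of a ball of radius above e / 2. *)
pose C3 := (1 + (k ^+ n)^-1) * (8 * n.+1%:R) ^+ n.
have C30 : 0 < C3 by rewrite mulr_gt0 ?addr_gt0 ?invr_gt0// exprn_gt0// mulr_gt0.
(* With this value the errors coming from [W] and from [f], C3 eta + eta, add up to d / 2. *)
have [eta etaE] : exists eta, eta = d / (2 * (C3 + 1)) by eexists.
have eta0 : 0 < eta by rewrite etaE divr_gt0// mulr_gt0// addr_gt0.
have [r1 r10 Hf] := vmo_osc oO bO nG vf eta0.
have [r2 r20 HW] := vmo_osc oQ bQ nQ vw eta0.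
exists (d / 2); first by rewrite divr_gt0.
(* The ball of radius 4 e must admit an exterior cube and a small oscillation of [W]; 2 e < s keeps
   B_e(x) where [psi] is 1, and 2 e < 1 keeps its points within distance 1 of their projections, as
   [null_projection] asks. *)
pose e0 := Num.min (Num.min (r0 / 4) r1) (Num.min (r2 / 4) (Num.min (s / 2) 2^-1)).
exists e0; first by rewrite !lt_min r10 !divr_gt0// invr_gt0 ltr0n.
move=> e x q ep; rewrite !lt_min => /andP[/andP[er0 er1] /andP[er2 /andP[es e1]]] Ox xe Kq.
have UT' y : Omega y -> dst G y < s -> U y /\ T y.
  move=> Oy ys; have Uy : U y by apply: sU; split => //; rewrite set_distE// lte_fin.
  by split => //; apply: UT; exact: subset_closure.
have es2 : e < s by move: es; lra.
have [Ux Tx] : U x /\ T x by apply: UT'; rewrite // xe.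
have [Gy0 Py0] := TPn x Tx; set y0 := P x in Gy0 Py0.
have xy0 : enorm (x - y0) = e.
  by apply/eqP; rewrite eq_le -{2}xe dst_le// andbT -xe; apply: dst_ge.
have e4 : 0 < 4 * e by rewrite mulr_gt0.
have Qy0 : Q y0 by rewrite /Q /eball/= subr0; apply: le_lt_trans (GC _ Gy0) _; rewrite ltrDl.
have e4Q : 4 * e < dst (bnd Q) y0 by apply: lt_le_trans (GQ _ Gy0); move: e1; lra.
have e4r2 : 4 * e < r2 by move: er2; lra.
have e4r0 : 4 * e < r0 by move: er0; lra.
have e2s : 2 * e < s by move: es; lra.
have e21 : 2 * e < 1 by move: e1; lra.
have e24 : 2 * e < 4 * e by move: ep; lra.
have := HW y0 (4 * e) Qy0 e4 e4r2 e4Q; set B4 := eball y0 (4 * e); set W4 := mean _ _ _ => oscW.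
have [c Hc] := Hext y0 (4 * e) Gy0 e4 e4r0.
have iW m : lintble (fun y => \1_B4 y * W y 0 m) by exact: inner_lintble oQ nQ Qy0 e4Q (vw.1.1 m).
have mB4 : measurable (B4 : set M) by apply: open_lmeasurable; exact: open_eball.
have iB4 := lintble_eball y0 (ltW e4); rewrite -/B4 in iB4.
have idW p := lintble_dist p mB4 iB4 iW.
have v4 : lint (\1_B4) <= (8 * e) ^+ n.
  by apply: le_trans (vol_eball_le y0 (ltW e4)) _; rewrite mulrA -natrM.
have k4e : 0 <= k * (4 * e) by rewrite mulr_ge0// ltW.
have [icu vcu] := vol_cube c k4e.
(* On the exterior cube [W] is 0, so there its deviation from the mean is the mean itself. *)
have hW4 : enorm W4 <= eta / k ^+ n.
  have h1 : enorm W4 * (2 * (k * (4 * e))) ^+ n <= eta * (8 * e) ^+ n.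
    rewrite -vcu -(lintZ (enorm W4) icu).
    apply: le_trans (le_trans oscW (ler_wpM2l (ltW eta0) v4)).
    apply: (le_lint (lintbleZ _ icu) (idW W4)) => y; rewrite indicE.
    case: (boolP (y \in cbox _ _)) => [/set_mem /Hc[yB nOy]|_]; last first.
      by rewrite mulr0 mulr_ge0 ?enorm_ge0// indicE.
    have -> : W y = 0 by rewrite /W /patch memNset.
    by rewrite mulr1 indicE mem_set// mul1r sub0r enormN.
  have E : (2 * (k * (4 * e))) ^+ n = k ^+ n * (8 * e) ^+ n by rewrite -exprMn; congr (_ ^+ _); ring.
  have e8 : 0 < (8 * e) ^+ n by rewrite exprn_gt0// mulr_gt0.
  by rewrite ler_pdivlMr// -(ler_pM2r e8) -mulrA -E.
have HW4 : lint (fun y => \1_B4 y * enorm (W y - 0)) <= eta * (1 + (k ^+ n)^-1) * (8 * e) ^+ n.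
  apply: le_trans (_ : lint (fun y => \1_B4 y * enorm (W y - W4) + enorm W4 * \1_B4 y) <= _).
    apply: (le_lint (idW 0) (lintbleD (idW W4) (lintbleZ _ iB4))) => y; rewrite subr0 [enorm W4 * _]mulrC -mulrDr ler_wpM2l ?indicE//.
    by rewrite -{1}(subrK W4 (W y)); exact: enormD.
  rewrite (lintD (idW W4) (lintbleZ _ iB4)) (lintZ (enorm W4) iB4).
  apply: le_trans (lerD oscW (ler_wpM2r (ltW (vol_eball_gt0 y0 e4)) hW4)) _.
  rewrite -mulrDl -[X in X + _](mulr1 eta) -mulrDr; apply: ler_wpM2l v4.
  by rewrite mulr_ge0 ?(ltW eta0)// addr_ge0// invr_ge0 ltW.
have dd : d - d / 2 = d / 2 by field.
have stepk (j : nat) : d / 2 <= enorm (mean (leb R n) (eball x (inner_radius e j)) f - q).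
  have /andP[t1 t2] := inner_radiusP j ep; move: (inner_radius e j) t1 t2 => t t1 t2.
  have t0 : 0 < t by apply: lt_trans t1; rewrite divr_gt0.
  have td : t < dst G x by rewrite xe.
  have := Hf x t Ox t0 (lt_trans t2 er1) td; set B := eball x t; set p := mean _ _ _ => oscf.
  have mB : measurable (B : set M) by apply: open_lmeasurable; exact: open_eball.
  have iB := lintble_eball x (ltW t0); rewrite -/B in iB.
  have vB : 0 < lint (\1_B) by exact: vol_eball_gt0.
  have BO : B `<=` Omega by exact: inner_sub oO nG Ox (ltW td).
  have By0 y : B y -> enorm (y - y0) < 2 * e.
    move=> yB; apply: le_lt_trans (enorm_triangle _ x _) _; rewrite xy0 mulr2n mulrDl mul1r ltrD2r.
    exact: lt_trans yB t2.
  have BB4 : B `<=` B4 by move=> y /By0 h; exact: lt_trans h e24.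
  have iWB m : lintble (fun y => \1_B y * W y 0 m) by exact: lintble_sub mB BB4 (iW m).
  have ifB m : lintble (fun y => \1_B y * f y 0 m) by exact: lintble_sub mB BO (iF m).
  have idWB := lintble_dist 0 mB iB iWB.
  have idf := lintble_dist p mB iB ifB.
  have oscW' : lint (fun y => \1_B y * enorm (W y - 0)) <= C3 * eta * lint (\1_B).
    apply: le_trans (_ : lint (fun y => \1_B4 y * enorm (W y - 0)) <= _).
      apply: (le_lint idWB (idW 0)) => y; rewrite ler_wpM2r ?enorm_ge0// !indicE ler_nat.
      by case: (boolP (y \in B)) => // /set_mem /BB4 yB; rewrite mem_set.
    apply: le_trans HW4 _; rewrite [C3 * eta]mulrC /C3 mulrA -[X in _ <= X]mulrA.
    apply: ler_wpM2l; first by rewrite mulr_ge0 ?(ltW eta0)// addr_ge0// invr_ge0 ltW.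
    apply: le_trans (_ : (8 * n.+1%:R) ^+ n * (2 * (t / n.+1%:R)) ^+ n <= _); last first.
      by rewrite ler_wpM2l ?exprn_ge0 ?mulr_ge0//; exact: vol_eball_ge.
    rewrite -exprMn; apply: lerXn2r; rewrite ?nnegrE ?mulr_ge0 ?divr_ge0 ?(ltW ep) ?(ltW t0)//.
    have -> : 8 * n.+1%:R * (2 * (t / n.+1%:R)) = 16 * t by field; rewrite nat1r pnatr_eq0.
    have -> : 8 * e = 16 * (e / 2) by field.
    by rewrite ler_pM2l// ltW.
  (* Integrates the triangle inequality for phi (P y) - q through f y and the mean p, at almost
     every point of the ball. *)
  have main : d * lint (\1_B) <= (C3 * eta + eta + enorm (p - q)) * lint (\1_B).
    apply: le_trans (_ : lint (fun y => \1_B y * enorm (W y - 0) + (\1_B y * enorm (f y - p) + enorm (p - q) * \1_B y)) <= _).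
      rewrite -(lintZ d iB); apply: (le_lint_ae Z0 (lintbleZ _ iB) (lintbleD idWB (lintbleD idf (lintbleZ _ iB)))) => y nZ.
      rewrite indicE; case: (boolP (y \in B)) => [/set_mem yB|_]; last by rewrite !mul0r !mulr0 !addr0.
      rewrite !mulr1 !mul1r subr0.
      have Oy := BO y yB.
      have dy : dst G y < s by apply: le_lt_trans (dst_le _ Gy0) _; exact: lt_trans (By0 y yB) e2s.
      have [Uy Ty] := UT' y Oy dy; have [GPy HPy] := TPn y Ty.
      have nN : ~ N (P y).
        move=> NP; apply: nZ; split => //; apply: le_trans (norm_le_enorm _) _.
        apply: le_trans (HPy _ Gy0) _; apply: ltW; exact: lt_trans (By0 y yB) e21.
      have := Hd (P y) q GPy nN Kq.
      have -> : W y = f y - phi (P y) by rewrite /W patchT ?mem_set// psi1// scale1r.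
      have -> : phi (P y) - q = - (f y - phi (P y)) + ((f y - p) + (p - q)).
        by apply/rowP => m; rewrite !mxE; ring.
      move=> h; apply: le_trans h _; apply: le_trans (enormD _ _) _; rewrite enormN lerD2l; exact: enormD.
    rewrite (lintD idWB (lintbleD idf (lintbleZ _ iB))) (lintD idf (lintbleZ _ iB)) (lintZ (enorm (p - q)) iB).
    by rewrite -addrA !mulrDl !lerD.
  move: main; rewrite ler_pM2r// => main.
  have E : C3 * eta + eta = d / 2 by rewrite etaE; field; rewrite gt_eqF// addr_gt0.
  by move: main; rewrite E -lerBlDl dd.
have iFe m : lintble (fun y => \1_(eball x e) y * f y 0 m).
  apply: (lintble_sub _ _ (iF m)); first exact: open_lmeasurable (@open_eball R n x e).
  by apply: inner_sub oO nG Ox _; rewrite xe.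
have cv : mean (leb R n) (eball x (inner_radius e j)) f @[j --> \oo] --> mean (leb R n) (eball x e) f.
  by apply: cvg_row => m; exact: inner_radius_mean ep (iFe m).
have cv2 : enorm (mean (leb R n) (eball x (inner_radius e j)) f - q) @[j --> \oo] -->
    enorm (mean (leb R n) (eball x e) f - q).
  have cvq : mean (leb R n) (eball x (inner_radius e j)) f - q @[j --> \oo] --> mean (leb R n) (eball x e) f - q.
    by apply: cvgB; [exact: cv|exact: cvg_cst].
  exact: (cvg_comp _ _ cvq (@continuous_enorm R n _)).
rewrite -(cvg_lim (@Rhausdorff R) cv2); apply: limr_ge; first by apply/cvg_ex; eexists; exact: cv2.
exact: nearW stepk.
Qed.

End boundary_values.

(** * Passage to the limit *)

Section assembly.
Context {R : realType} {n : nat}.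
Implicit Types (x y z q : 'rV[R]_n) (A B O K G N : set 'rV[R]_n) (s t r C c d e : R) (u v : 'rV[R]_n -> R).
Implicit Types (f h w : 'rV[R]_n -> 'rV[R]_n) (i j m : 'I_n).

Lemma ae_null (Q : 'rV[R]_n -> Prop) : {ae leb R n, forall x, Q x} -> null [set x | ~ Q x].
Proof. by move=> [A [mA A0 AQ]]; apply: nullS AQ _. Qed.

Lemma Lp_on_lmeas O (q : \bar R) u : Lp_on O q u -> lmeas (fun x => \1_O x * u x).
Proof.
rewrite /Lp_on -patchE => /andP[/= mu_ _]; exact: (set_mem mu_).
Qed.

Lemma Lp_on_pow O u k : (0 < k)%N -> Lp_on O (k%:R)%:E u -> lintble (fun x => `|\1_O x * u x| ^+ k).
Proof.
move=> k0; rewrite /Lp_on => /Lfun_integrable H; have : (1 : R) <= k%:R by rewrite ler1n.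
move=> /H; rewrite patchE; congr (_.-integrable _ _).
by apply/funext => x; rewrite powR_mulrn.
Qed.

Lemma Lp_on_lintble O u k : open O -> bounded_set O -> (0 < k)%N -> Lp_on O (k%:R)%:E u -> lintble (fun x => \1_O x * u x).
Proof.
move=> oO bO k0 Lu; have iP := Lp_on_pow k0 Lu.
have iO : lintble (\1_O).
  have [C C0 HC] := cbox_bounded bO.
  apply: (lintble_bounded (a := const_mx (- C)) (b := const_mx C) (C := 1)).
  - exact: lmeas_indic (open_lmeasurable oO).
  - by move=> x; rewrite indicE ger0_norm// lern1 leq_b1.
  by move=> x nx; rewrite indicE memNset// => /HC.
apply: (le_lintble (Lp_on_lmeas Lu) _ (lintbleD iO iP)) => x.
rewrite indicE; case: (x \in O); last by rewrite mul0r normr0 add0r exprn_ge0.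
rewrite mul1r; set a := `|_|; have a0 : 0 <= a by exact: normr_ge0.
have [a1|a1] := leP a 1; first by rewrite ler_wpDr// exprn_ge0.
by apply: ler_wpDl => //; rewrite -{1}(expr1 a); apply: ler_weXn2l => //; exact: ltW.
Qed.

Lemma Lp_on_bounded O u : Lp_on O +oo%E u -> exists2 C, 0 <= C & null [set x | ~ (`|\1_O x * u x| <= C)].
Proof.
rewrite /Lp_on patchE => /andP[_ /= H]; have {H} := set_mem H.
(* In the default case of the sup norm the whole space has measure 0, and every set is null. *)
rewrite /= /finite_norm unlock /Lnorm; case: ifP => [_|T0 _]; last first.
  exists 0 => //; apply: (@nullS _ _ _ setT) => //; apply/eqP; rewrite eq_le (outer_measure_ge0 (lebesgue_outer R n)) andbT.
  by rewrite leNgt; apply/negP => h; move: T0; rewrite h.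
move=> /ess_supr_bounded[C HC].
exists `|C| => //; apply: (nullS _ (ae_null HC)) => x /=; apply: contra_not => h.
by apply: le_trans h (ler_norm _).
Qed.

Lemma open_shrink O e : open O -> bnd O !=set0 -> open (shrink O e).
Proof.
move=> oO nO; rewrite (_ : shrink O e = O `&` (dst (bnd O) @^-1` [set t | e < t])).
  by apply: openI => //; apply: open_comp; [move=> x _; exact: continuous_dst|exact: open_gt].
by apply/seteqP; split => x; rewrite /shrink/= set_distE// lte_fin.
Qed.

Lemma closure_shrink O e x : open O -> 0 < e -> bnd O !=set0 -> closure (shrink O e) x -> O x /\ e <= dst (bnd O) x.
Proof.
move=> oO e0 nO cx.
have ed : e <= dst (bnd O) x.
  have cl : closed [set y | e <= dst (bnd O) y].
    rewrite (_ : [set y | _] = dst (bnd O) @^-1` [set t | e <= t]); last by [].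
    by apply: closed_comp; [move=> y _; exact: continuous_dst|exact: closed_ge].
  apply: cl; apply: closure_subset cx => y [Oy]; rewrite set_distE// lte_fin; exact: ltW.
split => //; have : closure O x by apply: closure_subset cx => y [].
move=> /(closure_bnd oO)[//|bx]; have := dst_le x bx; rewrite subrr enorm0 => h.
by have := lt_le_trans e0 (le_trans ed h); rewrite ltxx.
Qed.

Lemma bnd_shrink O e x : open O -> 0 < e -> bnd O !=set0 -> bnd (shrink O e) x -> O x /\ dst (bnd O) x = e.
Proof.
move=> oO e0 nO bx; have [Ox ed] := closure_shrink oO e0 nO (bnd_closure bx); split => //.
apply/eqP; rewrite eq_le ed andbT leNgt; apply/negP => h.
apply: (bnd_open (@open_shrink O e oO nO) bx); rewrite /shrink/=; split => //; rewrite set_distE// lte_fin.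
Qed.

Lemma bounded_sub A B : A `<=` B -> bounded_set B -> bounded_set A.
Proof. by move=> AB [C [C0 HC]]; exists C; split => // c c0 x /AB; exact: HC. Qed.

(* If I = 0 then L = 0 as well, and D need not converge. *)
Lemma lim_step (D L_ : R -> R) (I L : R) :
  (exists2 e0, 0 < e0 & forall e, 0 < e -> e < e0 -> D e * I = L_ e) ->
  (forall a, 0 < a -> exists2 e0, 0 < e0 & forall e, 0 < e -> e < e0 -> `|L_ e - L| <= a) ->
  L = lim (D e @[e --> 0^'+]) * I.
Proof.
move=> [e0 e00 HD] HL; have [I0|I0] := eqVneq I 0.
  rewrite I0 mulr0; apply/eqP; rewrite -normr_le0; apply/ler_addgt0Pr => a a0; rewrite add0r.
  have [e1 e10 He] := HL a a0; pose e := Num.min e0 e1 / 2.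
  have m0 : 0 < Num.min e0 e1 by rewrite lt_min e00.
  have e'0 : 0 < e by rewrite divr_gt0.
  have : e < Num.min e0 e1 by rewrite /e; lra.
  by rewrite lt_min => /andP[h1 h2]; have := He e e'0 h2; rewrite -HD// I0 mulr0 sub0r normrN.
suff cv : D e @[e --> 0^'+] --> L / I by rewrite (cvg_lim (@Rhausdorff R) cv) divfK.
apply/cvgrPdist_le => a a0; have aI : 0 < a * `|I| by rewrite mulr_gt0// normr_gt0.
have [e1 e10 He] := HL _ aI.
near=> e.
have ep : 0 < e by near: e; exact: nbhs_right_gt.
have h1 : e < e0 by near: e; exact: nbhs_right_lt.
have h2 : e < e1 by near: e; exact: nbhs_right_lt.
have := He e ep h2; rewrite -HD// distrC -[X in `|X - _|](divfK I0) -mulrBl normrM.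
by rewrite ler_pM2r// normr_gt0.
Unshelve. all: by end_near.
Qed.


Lemma coordB (a b : 'rV[R]_n) m : (a - b) 0 m = a 0 m - b 0 m.
Proof. by rewrite !mxE. Qed.

Lemma smooth_row_conv (s : R) (F : 'I_n -> 'rV[R]_n -> R) : 0 < s -> (forall m, lintble (F m)) ->
  smooth_on setT (fun x => \row_m conv (ker s) (F m) x).
Proof.
move=> s0 iF; apply: smooth_row => m; rewrite (_ : coordf _ m = conv (ker s) (F m)).
  by apply: (conv_smooth (iF m) (smooth_ker s)) => y; exact: ker_out.
by apply/funext => x; rewrite /coordf mxE.
Qed.

(** On the boundary of the shrunken domain the distance is exactly e, so [far] applies there; the
    tolerance in [close], divided by n + 1, gives Euclidean closeness c / 3 and thus the budget of
    [brouwer_degree_integral]. *)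
Lemma degree_pull Omega f g p (c e : R) (k : R -> 'rV[R]_n -> 'rV[R]_n) :
  (forall e x, k e x = \row_m conv (ker (e / (2 * n.+1%:R))) (fun y => \1_Omega y * f y 0 m) x) ->
  open Omega -> bounded_set Omega -> bnd Omega !=set0 -> (forall m, lintble (fun y => \1_Omega y * f y 0 m)) ->
  smooth_on setT g -> compact (supp g) -> connected (supp g) -> supp g p -> 0 < c -> 0 < e ->
  (forall x m, Omega x -> e <= dst (bnd Omega) x ->
    `|k e x 0 m - mean (leb R n) (eball x e) f 0 m| <= c / (3 * (n%:R + 1))) ->
  (forall x q, Omega x -> dst (bnd Omega) x = e -> supp g q -> c <= enorm (mean (leb R n) (eball x e) f - q)) ->
  (brouwer_degree (shrink Omega e) (fun x => mean (leb R n) (eball x e) f) p)%:~R * lint g =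
  pull (shrink Omega e) g (coordf (k e)).
Proof.
move=> kE oO bO nO iF sg cg cog gp c0 e0 close far.
have s0 : 0 < e / (2 * n.+1%:R) by rewrite divr_gt0// mulr_gt0.
have [C C0 HC] := cbox_bounded bO.
have n10 : 0 < n%:R + 1 :> R by rewrite ltr_wpDl.
have c30 : 0 < c / 3 by rewrite divr_gt0.
apply: (@brouwer_degree_integral R n _ _ (k e) (c / 3) (cbox (const_mx (- (C + e / (2 * n.+1%:R)))) (const_mx (C + e / (2 * n.+1%:R)))) (supp g)) => //.
- exact: open_shrink.
- by apply: bounded_sub bO => x [].
- by rewrite (funext (kE e)); exact: smooth_row_conv.
- exact: compact_cbox.
- move=> x xK; rewrite kE; apply/rowP => m; rewrite !mxE; apply: (conv_out (C := C)) => //.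
    move=> y yC; rewrite indicE memNset ?mul0r// => /HC yB.
    have : `|y| <= C by apply: norm_row_le => [|i]; [exact: ltW|have := yB i; rewrite !mxE ler_norml].
    by move/(lt_le_trans yC); rewrite ltxx.
  rewrite ltNge; apply/negP => h; apply: xK => i; rewrite !mxE -ler_norml.
  exact: le_trans (coord_le_norm _ _) h.
- move=> x /(closure_shrink oO e0 nO)[Ox ed]; apply: le_trans (enorm_le_norm _) _.
  have h : `|k e x - mean (leb R n) (eball x e) f| <= c / (3 * (n%:R + 1)).
    apply: norm_row_le => [|m]; first by rewrite ltW// divr_gt0// mulr_gt0.
    by rewrite coordB; exact: close.
  apply: le_trans (ler_wpM2l (ler0n _ n) h) _.
  rewrite [X in _ <= X](_ : _ = (n%:R + 1) * (c / (3 * (n%:R + 1)))); last by field; rewrite gt_eqF.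
  by rewrite ler_wpM2r ?lerDl// ltW// divr_gt0// mulr_gt0.
- by have [dg cgp] := smooth_C2 sg; split => // i; exact: C1_continuous.
- by move=> y gy; apply/eqP; apply: contra_notT gy; exact: (@subset_closure _ [set x | g x != 0]).
move=> x y /(bnd_shrink oO e0 nO)[Ox xe] Sy.
by rewrite mulrCA divff ?mulr1; [exact: far|rewrite pnatr_eq0].
Qed.

(** [pull_limit] handles sequences with prescribed rates, so the limit over all small e is proved by
    contradiction: a failure would give a sequence of bad radii, which can be taken to decrease as
    fast as desired. *)
Lemma pull_shrink_limit Omega f (Df : 'rV[R]_n -> 'M[R]_n) (l : 'I_n) g (a : R) (k : R -> 'rV[R]_n -> 'rV[R]_n) :
  (forall e x, k e x = \row_m conv (ker (e / (2 * n.+1%:R))) (fun y => \1_Omega y * f y 0 m) x) ->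
  (2 <= n)%N -> open Omega -> bounded_set Omega -> bnd Omega !=set0 ->
  sobolev1 Omega (n.-1)%:R%:E f -> weak_gradient Omega f Df ->
  (forall k, Lp_on Omega +oo%E (fun x => Df x k l)) ->
  smooth_on setT g -> compact (supp g) -> 0 < a ->
  exists2 e0, 0 < e0 & forall e, 0 < e -> e < e0 ->
  `|pull (shrink Omega e) g (coordf (k e)) - lint (fun x => \1_Omega x * (g (f x) * \det (Df x)))| <= a.
Proof.
move=> kE n2 oO bO nO sf gf linf sg cg a0.
have n10 : (0 < n.-1)%N by case: (n) n2 => [|[]].
pose F m x := \1_Omega x * f x 0 m.
pose DO m i x := \1_Omega x * Df x m i.
pose H m i x := `|DO m i x| ^+ n.-1.
have iF m : lintble (F m) by exact: Lp_on_lintble oO bO n10 (sf m).1.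
have HD m i : lintble (DO m i) /\ lintble (H m i).
  have [v wv Lv] := (sf m).2 i.
  have N0 := weak_partial_unique oO wv (gf m i).
  have E x : ~ (Omega `&` [set x | v x != Df x m i]) x -> \1_Omega x * v x = DO m i x.
    rewrite /DO indicE; case: (boolP (x \in Omega)) => [/set_mem Ox nx|_ _]; last by rewrite !mul0r.
    by congr (_ * _); apply/eqP; apply: contra_notT nx => h; split.
  split; first exact: ae_lintble N0 E (Lp_on_lintble oO bO n10 Lv).
  by apply: (ae_lintble N0 _ (Lp_on_pow n10 Lv)) => x /E; rewrite /H => ->.
have /choice[C_ HC] m : exists C, 0 <= C /\ null [set x | ~ (`|DO m l x| <= C)].
  by have [C C0 HC] := Lp_on_bounded (linf m); exists C.
pose C := \sum_m C_ m; have C0 : 0 <= C by apply: sumr_ge0 => m _; exact: (HC m).1.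
pose N := \bigcup_(m : 'I_n) [set x | ~ (`|DO m l x| <= C_ m)].
have N0 : null N by apply: null_countable => m; exact: (HC m).2.
have HN m x : ~ N x -> `|DO m l x| <= C.
  move=> nx; apply: (@le_trans _ _ (C_ m)); first by apply: contrapT => h; apply: nx; exists m.
  by rewrite /C (bigD1 m)//= lerDl sumr_ge0// => j _; exact: (HC j).1.
have cgc : continuous g by exact: C1_continuous (conj (smooth_C2 sg).1 (fun i => C1_continuous ((smooth_C2 sg).2 i))).
have [E E0 HE] := compact_fun_bound cg cgc.
have gE y : `|g y| <= E.
  have [Sy|Sy] := pselect (supp g y); first exact: HE.
  suff -> : g y = 0 by rewrite normr0 ltW.
  by apply/eqP; apply: contra_notT Sy; exact: (@subset_closure _ [set x | g x != 0]).
pose sc e : R := e / (2 * n.+1%:R).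
have sc0 e : 0 < e -> 0 < sc e by move=> e0; rewrite divr_gt0// mulr_gt0.
have scle e : 0 < e -> sc e <= e by move=> e0; rewrite /sc ler_pdivrMr ?mulr_gt0// ler_peMr ?(ltW e0)// -natrM ler1n.
have smallF (G : 'rV[R]_n -> R) b : lintble G -> 0 < b -> exists2 e0, 0 < e0 & forall e, 0 < e -> e < e0 ->
    lint (fun x => `|conv (ker (sc e)) G x - G x|) <= b.
  move=> iG b0; have [s0 s00 Hs] := conv_cvg iG b0; exists s0; [exact: s00|move=> e ep es].
  by apply: Hs; [exact: sc0|exact: le_lt_trans (scle _ ep) es].
have /choice[th Hth] (j : nat) : exists t, 0 < t /\ forall e, 0 < e -> e < t ->
    [/\ forall m, lint (fun x => `|conv (ker (sc e)) (F m) x - F m x|) <= quarter j,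
        forall m i, lint (fun x => `|conv (ker (sc e)) (DO m i) x - DO m i x|) <= quarter j &
        forall m i, lint (fun x => `|conv (ker (sc e)) (H m i) x - H m i x|) <= quarter j].
  pose Q (mi : 'I_n * 'I_n) e := [/\ lint (fun x => `|conv (ker (sc e)) (F mi.1) x - F mi.1 x|) <= quarter j,
    lint (fun x => `|conv (ker (sc e)) (DO mi.1 mi.2) x - DO mi.1 mi.2 x|) <= quarter j &
    lint (fun x => `|conv (ker (sc e)) (H mi.1 mi.2) x - H mi.1 mi.2 x|) <= quarter j].
  have [mi _|t t0 Ht] := @seq_small R _ (enum [set: 'I_n * 'I_n]%SET) Q.
    have [e1 e10 h1] := smallF _ _ (iF mi.1) (quarter_gt0 j).
    have [e2 e20 h2] := smallF _ _ (HD mi.1 mi.2).1 (quarter_gt0 j).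
    have [e3 e30 h3] := smallF _ _ (HD mi.1 mi.2).2 (quarter_gt0 j).
    exists (Num.min e1 (Num.min e2 e3)); first by rewrite !lt_min e10 e20.
    by move=> e ep; rewrite !lt_min => /andP[? /andP[? ?]]; split; [exact: h1|exact: h2|exact: h3].
  exists t; split => // e ep et.
  have HH m i : Q (m, i) e by apply: Ht => //; rewrite mem_enum inE.
  by split => [m|m i|m i]; [have [] := HH m l|have [] := HH m i|have [] := HH m i].
set L := lint _.
apply: contrapT => /forall2NP NH.
(* Being below [th j] ensures the rates [quarter j]; being below 1/(j+1) makes the shrunken domains
   eventually contain each point of Omega. *)
have /choice[e_ He] (j : nat) : exists e, [/\ 0 < e, e < th j, e < j.+1%:R^-1 &
    ~ `|pull (shrink Omega e) g (coordf (k e)) - L| <= a].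
  have t0 : 0 < Num.min (th j) j.+1%:R^-1 by rewrite lt_min (Hth j).1 invr_gt0 ltr0Sn.
  have [//|/existsNP[e /not_implyP[ep /not_implyP[]]]] := NH (Num.min (th j) j.+1%:R^-1).
  by rewrite lt_min => /andP[h1 h2] h3; exists e.
have cv : pull (shrink Omega (e_ j)) g (fun m => conv (ker (sc (e_ j))) (F m)) @[j --> \oo] --> L.
  rewrite /L (_ : (fun x => _) = (fun x => \1_Omega x * (g (\row_m f x 0 m) * \det (\matrix_(m, i) Df x m i)))); last first.
    apply/funext => x.
    have -> : \row_m f x 0 m = f x by apply/rowP => m; rewrite mxE.
    by have -> : \matrix_(m, i) Df x m i = Df x by apply/matrixP => m i; rewrite mxE.
  apply: (@pull_limit R n Omega (fun m x => f x 0 m) (fun m i x => Df x m i) l g C E N) => //.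
  - by move=> m i; exact: (HD m i).1.
  - by move=> m i; exact: (HD m i).2.
  - by move=> j; exact: open_shrink.
  - by move=> j x [].
  - move=> x Ox; have d0 : 0 < dst (bnd Omega) x.
      rewrite lt_neqAle dst_ge0 andbT eq_sym; apply/eqP => d0.
      apply: (bnd_open oO _ Ox); apply: dst_eq0 d0 => //.
      by apply: compact_closed; [exact: norm_hausdorff|exact: compact_bnd].
    have [p _ Hp] := near_infty_natSinv_lt (PosNum d0).
    exists p => j pj; split => //; rewrite set_distE// lte_fin.
    by have [_ _ h _] := He j; apply: lt_trans h (Hp j pj).
  - by move=> j; have [h _ _ _] := He j; exact: sc0.
  - move=> j x m i [Ox]; rewrite set_distE// lte_fin => xd; have [ep _ _ _] := He j.
    apply: (conv_weak (gf m i) (iF m) (HD m i).1 (sc0 _ ep)).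
    move=> y xy; apply: (inner_sub oO nO Ox (lexx _)); apply: le_lt_trans xd.
    apply: le_trans (enorm_le_norm _) _; apply: le_trans (ler_wpM2l (ler0n _ n) xy) _.
    rewrite /sc mulrCA ler_piMr ?(ltW ep)// ler_pdivrMr ?mulr_gt0// mul1r -natrM ler_nat.
    by rewrite mul2n -addnn; exact: leq_trans (leqnSn n) (leq_addr _ _).
  - by move=> j m; have [e0 e1 _ _] := He j; have [h _ _] := (Hth j).2 _ e0 e1; exact: h.
  - by move=> j m i; have [e0 e1 _ _] := He j; have [_ h _] := (Hth j).2 _ e0 e1; exact: h.
  - by move=> j m i; have [e0 e1 _ _] := He j; have [_ _ h] := (Hth j).2 _ e0 e1; exact: h.
move/cvgrPdist_le : cv => /(_ _ a0)[p _ Hp].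
have [_ _ _] := He p; apply; have := Hp p (leqnn p); rewrite distrC.
suff -> : coordf (k (e_ p)) = (fun m => conv (ker (sc (e_ p))) (F m)) by [].
by apply/funext => m; apply/funext => x; rewrite /coordf kE mxE.
Qed.

End assembly.

(** Both the default value of [xget] and the empty sum of signs are 0. *)
Lemma brouwer_degree_set0 (R : realType) (n : nat) (h : 'rV[R]_n -> 'rV[R]_n) p : brouwer_degree set0 h p = 0.
Proof.
rewrite /brouwer_degree; case: xgetP => // d _ [k [_ _ _ ->]].
by rewrite set0I fsbig_set0.
Qed.

Theorem theorem4p20 (R : realType) (n : nat) (hn : (2 <= n)%N)
  (Omega : set 'rV[R]_n)
  (Omega_open : open Omega) (Omega_bounded : bounded_set Omega)
  (Omega_connected : connected Omega)
  (Gamma_smooth : smooth_hypersurface (bnd Omega))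
  (phi : 'rV[R]_n -> 'rV[R]_n) (phi_VMO : VMO_surface (bnd Omega) phi)
  (T : set 'rV[R]_n) (P : 'rV[R]_n -> 'rV[R]_n) (psi : 'rV[R]_n -> R)
  (T_tubular : tubular_nbhs Omega T P) (psi_cutoff : trace_cutoff Omega T psi)
  (f : 'rV[R]_n -> 'rV[R]_n)
  (f_VMO : VMO_trace Omega P psi phi f)
  (f_sobolev : sobolev1 Omega (n.-1)%:R%:E f)
  (Df : 'rV[R]_n -> 'M[R]_n) (f_grad : weak_gradient Omega f Df)
  (f_Linf : forall k i : 'I_n, i.+1 = n ->
     Lp_on Omega +oo%E (fun x => Df x k i))
  (g : 'rV[R]_n -> R) (g_smooth : smooth_on setT g)
  (g_compact : compact (supp g)) (g_connected : connected (supp g))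
  (g_essR : supp g `<=` ~` closure (essR (bnd Omega) phi))
  (p : 'rV[R]_n) (hp : supp g p) :
  (\int[leb R n]_(x in Omega) (g (f x) * \det (Df x)))%R =
  vmo_degree f Omega p * (\int[leb R n]_z (g z))%R.
Proof.
rewrite !Rintegral_lint (_ : (fun z => \1_setT z * g z) = g); last first.
  by apply/funext => z; rewrite indicT mul1r.
rewrite /vmo_degree; have [Om0|/set0P[x0 Ox0]] := eqVneq Omega set0.
  (* The empty domain satisfies the hypotheses and has empty boundary; there both sides are 0. *)
  have sh e : shrink Omega e = set0 by rewrite Om0; apply/seteqP; split => // x [].
  rewrite (_ : (fun x => _) = fun=> 0) ?lint0; last by apply/funext => x; rewrite Om0 indic0 mul0r.
  under eq_fun do rewrite sh brouwer_degree_set0.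
  by rewrite lim_cst ?mul0r//; exact: Rhausdorff.
have n0 : (0 < n)%N by exact: leq_trans hn.
have nO : bnd Omega !=set0 by exact: bnd_neq0 n0 Omega_open Omega_bounded Ox0.
have n1 : (0 < n.-1)%N by case: (n) hn => [|[]].
have lt_n1 : (n.-1 < n)%N by rewrite prednK.
pose l := Ordinal lt_n1; have lE : l.+1 = n by rewrite /= prednK.
pose k e x : 'rV[R]_n := \row_m conv (ker (e / (2 * n.+1%:R))) (fun y => \1_Omega y * f y 0 m) x.
have kE e x : k e x = \row_m conv (ker (e / (2 * n.+1%:R))) (fun y => \1_Omega y * f y 0 m) x by [].
have iF m : lintble (fun y => \1_Omega y * f y 0 m) by exact: Lp_on_lintble Omega_open Omega_bounded n1 (f_sobolev m).1.
apply: (lim_step (L_ := fun e => pull (shrink Omega e) g (coordf (k e)))); last first.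
  move=> a a0; exact: (@pull_shrink_limit R n Omega f Df l g a k kE hn Omega_open Omega_bounded nO f_sobolev f_grad
    (fun i => f_Linf i l lE) g_smooth g_compact a0).
have [c c0 [e1 e10 far]] := trace_far hn Omega_open Omega_bounded Omega_connected nO Gamma_smooth T_tubular
  psi_cutoff f_VMO iF g_compact g_essR.
have n10 : 0 < n%:R + 1 :> R by rewrite ltr_wpDl.
have c30 : 0 < c / (3 * (n%:R + 1)) by rewrite divr_gt0// mulr_gt0.
have [e2 e20 close] := mollify_mean Omega_open Omega_bounded nO f_VMO.1 iF c30.
exists (Num.min e1 e2); first by rewrite lt_min e10.
move=> e e0; rewrite lt_min => /andP[h1 h2].
apply: (degree_pull kE Omega_open Omega_bounded nO iF g_smooth g_compact g_connected hp c0 e0).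
- by move=> x m Ox xe; rewrite kE [X in X - _]mxE; exact: close.
- by move=> x q Ox xe Kq; exact: far h1 Ox xe Kq.
Qed.
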